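(* Consider the uniform partition $0=t_0<t_1<\dots<t_N=T$ with step $\Delta t$, and the AC-ROM (artificial compression reduced order model): given $u_R^0\in X_R$, $p_M^0\in Q_M$, the pairs $(u_R^{n+1},p_M^{n+1})\in X_R\times Q_M$, $n=0,1,2,\dots$, satisfy $$\Big(\frac{u^{n+1}_R - u^{n}_R}{\Delta t}, \varphi \Big) + b^{\ast}(u_R^{n} , u^{n+1}_R ,\varphi) +\nu (\nabla u^{n+1}_R, \nabla \varphi) - (p^{n+1}_M , \nabla \cdot \varphi) =( f^{n+1}, \varphi) \qquad \forall \varphi \in X_R,$$ $$\epsilon \Big(\frac{p_{M}^{n+1} - p_{M}^{n}}{\Delta t}, \psi \Big) + (\nabla \cdot u_R^{n+1}, \psi )= 0 \qquad \forall \psi \in Q_M.$$ Let $(u,p)$ be the Navier-Stokes solution described in the context, and set $e_u^n=u^n-u_R^n$, $e_p^n=p^n-p_M^n$, $\eta^n=u^n-P_Ru^n$, $\kappa^n=p^n-\chi_Mp^n$, $\xi_R^n=u_R^n-P_Ru^n$, $\pi_M^n=p_M^n-\chi_Mp^n$ (so that $e_u^n=\eta^n-\xi_R^n$ and $e_p^n=\kappa^n-\pi_M^n$), and $\alpha=\cos\theta_1$, where $\theta_1$ is the first principal angle between $X_R^{div}$ and $Q_M$. Let $\epsilon=\mathcal{O}(\Delta t)$. Then $$\begin{aligned} &\|e^{N+1}_u\|^2+\epsilon\|e^{N+1}_p\|^2+ \frac{\nu\Delta t}{2}\|\nabla e^{N+1}_u\|^2+\frac{\nu}{2}\|\nabla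 e_u\|_{2,0}^2 +\sum_{n=0}^{N}\Big(\|e^{n+1}_u-e^{n}_u\|^2+\frac{\epsilon}{2}\|e^{n+1}_p-e^{n}_p\|^2\Big)\\ &\leq \|\eta^{N+1}\|^2+\epsilon\|\kappa^{N+1}\|^2+ \frac{\nu\Delta t}{2}\|\nabla \eta^{N+1}\|^2+\frac{\nu}{2}\|\nabla \eta\|_{2,0}^2 +\sum_{n=0}^{N}\Big(\|\eta^{n+1}-\eta^{n}\|^2+\frac{\epsilon}{2}\|\kappa^{n+1}-\kappa^{n}\|^2\Big)\\ &\quad+C\exp\Big(\frac{\widetilde{C}T}{\nu^{3}}\Big)\bigg(\|\xi^{0}_R\|^2+\epsilon\|\pi^{0}_M\|^2+\Delta t\,\nu\|\nabla \xi^{0}_R\|^2 +\Big(\frac{1}{\nu}+\alpha^{2}\Delta t^{-1}\Big)\|\nabla \eta\|_{2,0}^2+\frac{1}{\nu}\|\kappa\|_{2,0}^2\\ &\qquad+\frac{\Delta t^2}{\nu}\|u_{tt}\|_{L^2(0,T;L^2(\Omega))}^2+\frac{\Delta t^2}{\nu}\|\nabla u_t\|_{L^2(0,T;L^2(\Omega))}^2 + \frac{\Delta t^{1/2}}{\nu^{3/2}}\Big(\sum_{n=0}^{N} \| \nabla \eta^{n+1} \|^{4}\Big)^{\frac{1}{2}}\\ &\qquad+\Delta t^3\|p_t\|_{L^2(0,T;L^2(\Omega))}^2+\Delta t\,\|p_t\|_{\infty}^2\bigg), \end{aligned}$$ where $C$ and $\widetilde C$ are generic positive constants, with the powers of $\nu$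 and $\Delta t$ and the factor $\alpha^2$ in the bound written out explicitly as displayed.
   Context: $\Omega\subset\mathbb{R}^d$ is the flow domain; $(\cdot,\cdot)$ and $\|\cdot\|$ are the $L^2(\Omega)$ inner product and norm. $X=[H^1_0(\Omega)]^d$ and $Q=L^2_0(\Omega)$ (mean-zero $L^2$ functions). The skew-symmetric trilinear form is $b^{\ast}(w,u,v)=\frac12(w\cdot\nabla u,v)-\frac12(w\cdot\nabla v,u)$. A superscript $n$ denotes the time step number; $u^n=u(t_n)$, $p^n=p(t_n)$, $f^n=f(t_n)$. Navier-Stokes solution: $\nu$ is the kinematic viscosity, $f$ the body force; $u:(0,T]\to X$, $p:(0,T]\to Q$ satisfy, for almost all $t\in(0,T]$, $$(u_{t},v)+(u\cdot\nabla u,v)+\nu(\nabla u,\nabla v)-(p,\nabla\cdot v)=(f,v)\ \ \forall v\in X,\qquad (\nabla\cdot u,q)=0\ \ \forall q\in Q,\qquad u(x,0)=u^0(x).$$ Standing regularity assumption: $u^0\in X$, $f\in L^2(0,T;L^2(\Omega))$, $u\in L^\infty(0,T;L^2(\Omega))\cap L^4(0,T;H^{s+1}(\Omega))\cap H^1(0,T;H^{s+1}(\Omega))\cap H^2(0,T;L^2(\Omega))$, $p\in L^\infty(0,T;Q\cap H^k(\Omega))$. Norms: $\|\cdot\|_{2,0}$ denotes the $L^2(0,T;L^2(\Omega))$ norm $\big(\int_0^T\|v(\cdot,t)\|^2dt\big)^{1/2}$; for quantities given only at the time levels it is understood as its time-discrete counterpart, i.e. $\|v\|_{2,0}^2$ is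 $\Delta t$ times the sum of $\|v^n\|^2$ over the time levels. $\|p_t\|_\infty=\mathrm{ess\,sup}_{t\in[0,T]}\|p_t(\cdot,t)\|$. Snapshots: $X_h\subset X$, $Q_h\subset Q$ are conforming finite element spaces (Taylor-Hood $P^s$-$P^{s-1}$, $s\ge2$) on a regular triangulation with maximum triangle diameter $h$, with approximation properties $\inf_{v_h\in X_h}\|v-v_h\|\le C(v)h^{s+1}$ and $\inf_{v_h\in X_h}\|\nabla(v-v_h)\|\le C(v)h^s$ for $v\in[H^{s+1}(\Omega)]^d$, and $\inf_{q_h\in Q_h}\|q-q_h\|\le C(q)h^s$ for $q\in H^s(\Omega)$. Velocity snapshots $u_{h,S}^n\in X_h$ and pressure snapshots $p_{h,S}^n\in Q_h$ are taken from the finite element artificial compression scheme, i.e. the same scheme as the AC-ROM with $X_R,Q_M,u_R,p_M$ replaced by $X_h,Q_h,u_h,p_h$. The finite element solution is assumed to satisfy $\sup_n\|u^n-u_h^n\|^2+h^2\|\nabla(u^n-u_h^n)\|^2\le C(\nu,p)(h^{2s+2}+\Delta t^2)$ and $\sup_n\|p^n-p_h^n\|^2\le C(\nu,p)(h^{2\ell}+\Delta t^2)$. POD spaces: $X_R=\mathrm{span}\{\varphi_i\}_{i=1}^R\subset X_h$ and $Q_M=\mathrm{span}\{\psi_i\}_{i=1}^M\subset Q_h$, where $\{\varphi_i\}$ and $\{\psi_i\}$ are $L^2$-orthonormal families minimizing, respectively, $\sum_n\|u_{h,S}^n-\sum_{j=1}^R(u_{h,S}^n,\varphi_j)\varphi_j\|^2$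 and $\sum_n\|p_{h,S}^n-\sum_{j=1}^M(p_{h,S}^n,\psi_j)\psi_j\|^2$. The pair $(X_R,Q_M)$ is not required to satisfy an inf-sup condition. Projections: $P_R:L^2(\Omega)\to X_R$ and $\chi_M:L^2(\Omega)\to Q_M$ are the $L^2$ projections: $(u-P_Ru,\varphi)=0$ for all $\varphi\in X_R$ and $(p-\chi_Mp,\psi)=0$ for all $\psi\in Q_M$. Principal angle: $X_R^{div}=\mathrm{span}\{\nabla\cdot\varphi_i\}_{i=1}^R\subset L^2(\Omega)$ and $$\theta_1=\min\Big\{\arccos\Big(\frac{|(v,\psi)|}{\|v\|\|\psi\|}\Big)\ :\ v\in X_R^{div},\ \psi\in Q_M,\ v\neq0,\ \psi\neq0\Big\},\qquad 0\le\theta_1\le\tfrac{\pi}{2}.$$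
   Formalization: ε = O(Δt) is taken as c1Δt ≤ ε ≤ c2Δt: with only the upper bound the estimate fails as ε → 0. C and C̃ may depend on an upper bound for ν, bounds for the data, c1 and c2; the equations are assumed at the time levels, d is 2 or 3, and t_{N+1} ≤ T. *)

(* Defs.v *)
From HB Require Import structures.
From mathcomp Require Import all_boot all_order all_algebra.
From mathcomp Require Import all_classical all_reals all_analysis ess_sup_inf.
Set Implicit Arguments.
Unset Strict Implicit.
Unset Printing Implicit Defensive.
Import Order.TTheory GRing.Theory Num.Theory.
Import numFieldNormedType.Exports.
Local Open Scope classical_set_scope.
Local Open Scope ring_scope.

(* 'rV[R]_n carries a topology in the library but no measurable structure: it is
   given here the product (= Borel) sigma-algebra generated by the coordinates,
   and n-dimensional Lebesgue measure is built as an iterated product. *)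
Definition rV_display : measure_display. Proof. exact: default_measure_display. Qed.

Section measurable_rV.
Context (R : realType) (n : nat).

Definition rV_coord (i : 'I_n) (x : 'rV[R]_n) : measurableTypeR R := x ord0 i.

Let rV_set0 : g_sigma_preimage rV_coord set0.
Proof. exact: sigma_algebra0. Qed.

Let rV_setC A : g_sigma_preimage rV_coord A -> g_sigma_preimage rV_coord (~` A).
Proof. exact: sigma_algebraC. Qed.

Let rV_bigcup (F : (set 'rV[R]_n)^nat) :
  (forall i, g_sigma_preimage rV_coord (F i)) ->
  g_sigma_preimage rV_coord (\bigcup_i (F i)).
Proof. exact: sigma_algebra_bigcup. Qed.

HB.instance Definition _ := @isMeasurable.Build rV_display
  'rV[R]_n (g_sigma_preimage rV_coord) rV_set0 rV_setC rV_bigcup.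

Lemma measurable_rV_coord (i : 'I_n) : measurable_fun [set: 'rV[R]_n] (rV_coord i).
Proof.
move=> _ Y mY; rewrite setTI; apply: sub_sigma_algebra => /=.
rewrite -bigcup_seq/=; exists i => /=; first by rewrite mem_index_enum.
by exists Y => //; rewrite setTI.
Qed.

Lemma measurable_fun_rV d (T : measurableType d) (f : T -> 'rV[R]_n) :
  (forall i, measurable_fun [set: T] (rV_coord i \o f)) ->
  measurable_fun [set: T] f.
Proof.
move=> mf _ A mA; rewrite setTI.
have : preimage_set_system [set: T] f (g_sigma_preimage rV_coord) (f @^-1` A).
  by exists A => //; rewrite setTI.
rewrite -g_sigma_preimage_comp; apply: smallest_sub.
  exact: sigma_algebra_measurable.
rewrite -bigcup_seq => B [i /= _ [C mC <-]].
by apply: mf.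
Qed.

End measurable_rV.

Section lebesgue_rV.
Context (R : realType).

Section step.
Context (n : nat) (m : {sigma_finite_measure set 'rV[R]_n -> \bar R}).

Definition rV_cons (p : measurableTypeR R * 'rV[R]_n) : 'rV[R]_n.+1 :=
  row_mx (const_mx p.1 : 'rV[R]_1) p.2.

Lemma measurable_rV_cons : measurable_fun setT rV_cons.
Proof.
apply: measurable_fun_rV => i.
case: (@split_ordP 1 n i) => j ->.
- rewrite (_ : _ \o _ = fst); first exact: measurable_fst.
  apply/funext => p; rewrite /comp /rV_coord /rV_cons.
  by rewrite (row_mxEl (const_mx p.1 : 'rV[R]_1)) mxE.
- rewrite (_ : _ \o _ = rV_coord j \o snd).
    by apply: measurableT_comp => //; exact: measurable_rV_coord.
  apply/funext => p; rewrite /comp /rV_coord /rV_cons.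
  by rewrite (row_mxEr (const_mx p.1 : 'rV[R]_1)).
Qed.

Definition lebesgue_rV_step : set 'rV[R]_n.+1 -> \bar R :=
  pushforward ((@lebesgue_measure R) \x m)%E rV_cons.

Let step0 : lebesgue_rV_step set0 = 0%E.
Proof. by rewrite /lebesgue_rV_step /pushforward preimage_set0 measure0. Qed.

Let step_ge0 A : (0 <= lebesgue_rV_step A)%E.
Proof. by rewrite /lebesgue_rV_step /pushforward measure_ge0. Qed.

Let step_sigma_additive : semi_sigma_additive lebesgue_rV_step.
Proof.
move=> F mF tF mUF; rewrite /lebesgue_rV_step /pushforward preimage_bigcup.
have mcons A : measurable A -> measurable (rV_cons @^-1` A).
  by move=> mA; rewrite -[X in measurable X]setTI; exact: measurable_rV_cons.
apply: measure_semi_sigma_additive.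
- by move=> k; exact: mcons.
- apply/trivIsetP => /= i j _ _ ij; rewrite -preimage_setI.
  by move/trivIsetP : tF => /(_ _ _ _ _ ij) ->//; rewrite preimage_set0.
- by rewrite -preimage_bigcup; exact: mcons.
Qed.

HB.instance Definition _ := isMeasure.Build _ _ _ lebesgue_rV_step
  step0 step_ge0 step_sigma_additive.

Let step_sigma_finite : sigma_finite setT lebesgue_rV_step.
Proof.
have [F TF mF] : sigma_finite setT ((@lebesgue_measure R) \x m)%E.
  have /sigma_finiteP[F [TF ndF Foo]] := sigma_finiteT (@lebesgue_measure R).
  have /sigma_finiteP[G [TG ndG Goo]] := sigma_finiteT m.
  exists (fun k => F k `*` G k).
    rewrite -setXTT TF TG predeqE => -[x y]; split.
      move=> [/= [j _ Fjx] [k _ Gky]]; exists (maxn j k) => //; split.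
      - by move: x Fjx; exact/subsetPset/ndF/leq_maxl.
      - by move: y Gky; exact/subsetPset/ndG/leq_maxr.
    by move=> [j _ []/= ? ?]; split; exists j.
  move=> k; have [? ?] := Foo k; have [? ?] := Goo k.
  split; first exact: measurableX.
  by rewrite product_measure1E// lte_mul_pinfty// ge0_fin_numE.
pose g (x : 'rV[R]_(1 + n)) : measurableTypeR R * 'rV[R]_n :=
  (x ord0 ord0, rsubmx x).
have gK p : g (rV_cons p) = p.
  case: p => a v; rewrite /g /rV_cons /= row_mxKr; congr pair.
  have -> : ord0 = lshift n ord0 :> 'I_(1 + n) by apply/val_inj.
  by rewrite (row_mxEl (const_mx a : 'rV[R]_1)) mxE.
have mg : measurable_fun setT (g : 'rV[R]_n.+1 -> _).
  apply/measurable_fun_pairP; split.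
    exact: (@measurable_rV_coord R n.+1 ord0).
  apply: measurable_fun_rV => i.
  rewrite (_ : _ \o _ = @rV_coord R n.+1 (rshift 1 i)).
    exact: measurable_rV_coord.
  by apply/funext => x; rewrite /comp /rV_coord /g /= mxE.
exists (fun k => (g : 'rV[R]_n.+1 -> _) @^-1` F k).
  by rewrite -preimage_bigcup -TF preimage_setT.
move=> k; have [mFk Fk] := mF k; split.
  by rewrite -[X in measurable X]setTI; exact: mg.
rewrite /lebesgue_rV_step /pushforward -comp_preimage.
by rewrite (_ : _ \o _ = id) //; apply/funext => p; exact: gK.
Qed.

HB.instance Definition _ := Measure_isSigmaFinite.Build _ _ _ lebesgue_rV_step
  step_sigma_finite.

End step.

Fixpoint lebesgue_rV (n : nat) : {sigma_finite_measure set 'rV[R]_n -> \bar R} :=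
  match n with
  | 0 => \d_(0 : 'rV[R]_0)
  | n'.+1 => lebesgue_rV_step (lebesgue_rV n')
  end.

End lebesgue_rV.

Section inner_product.
Context (R : realType) (V : lmodType R) (ip : V -> V -> R).

Definition lspan (r : nat) (phi : 'I_r -> V) : set V :=
  [set v | exists c : 'I_r -> R, v = \sum_(i < r) c i *: phi i].

Definition orthonormal_family (r : nat) (phi : 'I_r -> V) : Prop :=
  forall i j, ip (phi i) (phi j) = (i == j)%:R.

(* characterized by orthogonality; it exists for the finite-dimensional W used *)
Definition orth_proj (W : set V) (v : V) : V :=
  xget 0 [set w | W w /\ forall z, W z -> ip (v - w) z = 0].

Definition pod_error (N : nat) (S : {set 'I_N.+1}) (snap : nat -> V)
    (r : nat) (phi : 'I_r -> V) : R :=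
  \sum_(n in S)
    let e := snap n - \sum_(j < r) ip (snap n) (phi j) *: phi j in ip e e.

Definition pod_basis (W : set V) (N : nat) (S : {set 'I_N.+1})
    (snap : nat -> V) (r : nat) (phi : 'I_r -> V) : Prop :=
  [/\ forall i, W (phi i), orthonormal_family phi &
      forall phi' : 'I_r -> V, (forall i, W (phi' i)) ->
        orthonormal_family phi' -> pod_error S snap phi <= pod_error S snap phi'].

End inner_product.

Definition sfield (R : realType) (d : nat) := 'rV[R]_d -> R.
(* velocity fields are indexed by their components *)
Definition vfield (R : realType) (d : nat) := 'I_d -> 'rV[R]_d -> R.

Section sobolev.
Context (R : realType) (d : nat) (Om : set 'rV[R]_d).
Implicit Types (f g q : 'rV[R]_d -> R) (u v w : 'I_d -> 'rV[R]_d -> R).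

Definition flow_domain : Prop :=
  [/\ open Om, bounded_set Om, connected Om & Om !=set0].

Definition L2 f : Prop := measurable_fun Om f /\
  (\int[lebesgue_rV R d]_(x in Om) (f x ^+ 2)%:E < +oo)%E.

Definition ip f g : R := \int[lebesgue_rV R d]_(x in Om) (f x * g x).
Definition L2norm f : R := Num.sqrt (ip f f).

Definition partial (i : 'I_d) f : 'rV[R]_d -> R := 'D_(delta_mx ord0 i) f.

Fixpoint Cn (n : nat) f : Prop :=
  continuous f /\
  match n with
  | 0 => True
  | n'.+1 => forall i,
      (forall x, derivable f x (delta_mx ord0 i)) /\ Cn n' (partial i f)
  end.

Definition test_function f : Prop :=
  (forall n, Cn n f) /\
  exists K, [/\ compact K, K `<=` Om & forall x, ~ K x -> f x = 0].

Definition weak_partial (i : 'I_d) f g : Prop :=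
  L2 g /\ forall phi, test_function phi -> ip f (partial i phi) = - ip g phi.

(* L2 functions are not quotiented, so this is one representative of the class *)
Definition wD (i : 'I_d) f : 'rV[R]_d -> R :=
  xget (fun=> 0) [set g | weak_partial i f g].

Definition wDs (a : seq 'I_d) f : 'rV[R]_d -> R := foldr wD f a.

Fixpoint Hm (m : nat) f : Prop :=
  L2 f /\
  match m with
  | 0 => True
  | m'.+1 => forall i, (exists g, weak_partial i f g) /\ Hm m' (wD i f)
  end.

(* words of derivatives instead of multi-indices: an equivalent norm, and the
   same one for m <= 1 *)
Definition Hnorm (m : nat) f : R :=
  Num.sqrt (\sum_(j < m.+1) \sum_(a : j.-tuple 'I_d) L2norm (wDs a f) ^+ 2).

Definition H10 f : Prop := Hm 1 f /\
  forall e : R, 0 < e ->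
    exists2 phi, test_function phi & Hnorm 1 (f - phi) < e.

Definition Xsp : set ('I_d -> 'rV[R]_d -> R) := [set v | forall j, H10 (v j)].

Definition Qsp : set ('rV[R]_d -> R) :=
  [set q | L2 q /\ \int[lebesgue_rV R d]_(x in Om) q x = 0].

Definition vip u v : R := \sum_(j < d) ip (u j) (v j).
Definition vnorm v : R := Num.sqrt (vip v v).
Definition gradip u v : R :=
  \sum_(i < d) \sum_(j < d) ip (wD i (u j)) (wD i (v j)).
Definition gradnorm v : R := Num.sqrt (gradip v v).

Definition diverg v : 'rV[R]_d -> R := fun x => \sum_(i < d) wD i (v i) x.

Definition convect w u : 'I_d -> 'rV[R]_d -> R :=
  fun j x => \sum_(i < d) w i x * wD i (u j) x.

Definition bstar w u v : R :=
  2^-1 * vip (convect w u) v - 2^-1 * vip (convect w v) u.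

End sobolev.

Section bochner.
Context (R : realType) (d : nat) (Om : set 'rV[R]_d) (T : R).
Implicit Types w wt : R -> 'rV[R]_d -> R.
Local Notation leb := (@lebesgue_measure R).

(* strong measurability of t |-> w t as an H^m-valued function: its weak
   derivatives of order <= m have jointly measurable versions *)
Definition bochner_measurable (m : nat) w : Prop :=
  exists D : seq 'I_d -> measurableTypeR R * 'rV[R]_d -> R,
    (forall a, (size a <= m)%N -> measurable_fun (`]0, T[ `*` Om) (D a)) /\
    {ae leb, forall t, 0 < t < T -> Hm Om m (w t) /\
      forall a, (size a <= m)%N ->
        {ae lebesgue_rV R d, forall x, Om x -> wDs Om a (w t) x = D a (t, x)}}.

Definition Lq_Hm (q m : nat) w : Prop := bochner_measurable m w /\
  (\int[leb]_(t in `]0%R, T[) (Hnorm Om m (w t) ^+ q)%:E < +oo)%E.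

Definition Linf_Hm (m : nat) w : Prop := bochner_measurable m w /\
  exists M : R, {ae leb, forall t, 0 < t < T -> Hnorm Om m (w t) <= M}.

(* wt is the Bochner time derivative of w; as the identity is required for all
   a <= b, w is the continuous representative, so that w(t_n) is meaningful *)
Definition time_derivative w wt : Prop :=
  [/\ forall t, 0 <= t <= T -> L2 Om (w t), Lq_Hm 2 0 wt &
      forall v, L2 Om v -> forall a b, 0 <= a -> a <= b -> b <= T ->
        ip Om (w b) v - ip Om (w a) v = \int[leb]_(t in `[a, b]) ip Om (wt t) v].

(* tnorm2 is the squared norm *)
Definition tnorm2 (g : R -> R) : R := \int[leb]_(t in `]0, T[) g t ^+ 2.
Definition tnormoo (g : R -> R) : R :=
  fine (ess_sup (mrestr leb (measurable_itv `[0, T])) (fun t => `|g t|%:E)).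

End bochner.

Section navier_stokes.
Context (R : realType) (d : nat) (Om : set 'rV[R]_d) (T nu : R).
Implicit Types (u ut utt f : R -> vfield R d) (p pt : R -> sfield R d).

Definition nse_at u ut p f (t : R) : Prop :=
  (forall v, Xsp Om v ->
     vip Om (ut t) v + vip Om (convect Om (u t) (u t)) v
     + nu * gradip Om (u t) v - ip Om (p t) (diverg Om v) = vip Om (f t) v) /\
  (forall q, Qsp Om q -> ip Om (diverg Om (u t)) q = 0).

Record nse_solution (s k : nat) (u0 : vfield R d) u ut utt p pt f : Prop := {
  nse_init : u 0 = u0 ;
  nse_u0 : Xsp Om u0 ;
  nse_uX : forall t, 0 <= t <= T -> Xsp Om (u t) ;
  nse_pQ : forall t, 0 <= t <= T -> Qsp Om (p t) ;
  nse_fL2 : forall t, 0 < t <= T -> forall j, L2 Om (f t j) ;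
  nse_eq : {ae @lebesgue_measure R, forall t, 0 < t <= T -> nse_at u ut p f t} ;
  nse_ut : forall j, time_derivative Om T (u ^~ j) (ut ^~ j) ;
  nse_utt : forall j, time_derivative Om T (ut ^~ j) (utt ^~ j) ;
  nse_pt : time_derivative Om T p pt ;
  nse_f_reg : forall j, Lq_Hm Om T 2 0 (f ^~ j) ;
  nse_u_Loo : forall j, Linf_Hm Om T 0 (u ^~ j) ;
  nse_u_L4 : forall j, Lq_Hm Om T 4 s.+1 (u ^~ j) ;
  nse_u_H1 : forall j, Lq_Hm Om T 2 s.+1 (u ^~ j) /\ Lq_Hm Om T 2 s.+1 (ut ^~ j) ;
  nse_p_Loo : Linf_Hm Om T k p ;
  nse_pt_Loo : Linf_Hm Om T 0 pt }.

End navier_stokes.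

Section schemes.
Context (R : realType) (d : nat) (Om : set 'rV[R]_d).

(* the artificial compression scheme in a pair of spaces (XX, QQ), over the Nt
   steps of the partition; fn n is the force at the n-th time level *)
Definition ac_scheme (XX : set (vfield R d)) (QQ : set (sfield R d))
    (nu dt eps : R) (Nt : nat) (fn : nat -> vfield R d)
    (un : nat -> vfield R d) (pn : nat -> sfield R d) : Prop :=
  (forall n, (n <= Nt)%N -> XX (un n) /\ QQ (pn n)) /\
  forall n, (n < Nt)%N ->
    (forall phi, XX phi ->
       vip Om (dt^-1 *: (un n.+1 - un n)) phi
       + bstar Om (un n) (un n.+1) phi
       + nu * gradip Om (un n.+1) phi
       - ip Om (pn n.+1) (diverg Om phi) = vip Om (fn n.+1) phi) /\
    (forall psi, QQ psi ->
       eps * ip Om (dt^-1 *: (pn n.+1 - pn n)) psi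
       + ip Om (diverg Om (un n.+1)) psi = 0).

Definition principal_angle (V W : set (sfield R d)) (theta : R) : Prop :=
  let angles := [set acos (`|ip Om z.1 z.2| / (L2norm Om z.1 * L2norm Om z.2)) | z in
    [set z : sfield R d * sfield R d | [/\ V z.1, W z.2, L2norm Om z.1 != 0
                                       & L2norm Om z.2 != 0]]] in
  angles theta /\ lbound angles theta.

End schemes.

Section taylor_hood.
Context (R : realType) (d : nat) (Om : set 'rV[R]_d).

Definition enorm (x : 'rV[R]_d) : R := Num.sqrt (\sum_(i < d) x ord0 i ^+ 2).

Definition diam (A : set 'rV[R]_d) : R :=
  sup [set enorm (x - y) | x in A & y in A].

(* convex hull of the vertices a k selected by P *)
Definition face (a : 'I_d.+1 -> 'rV[R]_d) (P : pred 'I_d.+1) : set 'rV[R]_d :=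
  [set x | exists c : 'I_d.+1 -> R,
    [/\ forall k, 0 <= c k, forall k, ~~ P k -> c k = 0, \sum_k c k = 1
      & x = \sum_k c k *: a k]].

Definition cell (a : 'I_d.+1 -> 'rV[R]_d) : set 'rV[R]_d := face a predT.

Definition common_vertex (a b : 'I_d.+1 -> 'rV[R]_d) : pred 'I_d.+1 :=
  fun k => [exists l, a k == b l].

Record regular_triangulation (sigma h : R) (m : nat)
    (tau : 'I_m -> 'I_d.+1 -> 'rV[R]_d) : Prop := {
  tri_nondegenerate : forall i,
    \det (\matrix_(k < d, l < d) (tau i (lift ord0 k) - tau i ord0) ord0 l) != 0 ;
  tri_cover : closure Om = \bigcup_i cell (tau i) ;
  tri_conforming : forall i j, i != j ->
    (exists k, ~~ common_vertex (tau i) (tau j) k) /\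
    cell (tau i) `&` cell (tau j) = face (tau i) (common_vertex (tau i) (tau j)) ;
  tri_shape : forall i, exists z r,
    diam (cell (tau i)) <= sigma * r /\
    [set y | enorm (y - z) <= r] `<=` cell (tau i) ;
  tri_size : (forall i, diam (cell (tau i)) <= h) /\
    exists i, diam (cell (tau i)) = h }.

(* polynomial functions of total degree at most n *)
Definition poly_fun (n : nat) (q : 'rV[R]_d -> R) : Prop :=
  exists c : {ffun 'I_d -> 'I_n.+1} -> R, forall x,
    q x = \sum_(a : {ffun 'I_d -> 'I_n.+1} | (\sum_i a i <= n)%N)
            c a * \prod_i x ord0 i ^+ a i.

Definition cont_Pn (n m : nat) (tau : 'I_m -> 'I_d.+1 -> 'rV[R]_d)
    (f : 'rV[R]_d -> R) : Prop :=
  {within closure Om, continuous f} /\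
  forall i, exists2 q, poly_fun n q & forall x, cell (tau i) x -> f x = q x.

Definition Xh (s m : nat) (tau : 'I_m -> 'I_d.+1 -> 'rV[R]_d)
    : set (vfield R d) :=
  [set v | Xsp Om v /\ forall j, cont_Pn s tau (v j)].

Definition Qh (s m : nat) (tau : 'I_m -> 'I_d.+1 -> 'rV[R]_d)
    : set (sfield R d) :=
  [set q | Qsp Om q /\ cont_Pn s.-1 tau q].

(* The approximated v and q satisfy the essential constraints of X and Q: no
   estimate of this kind can hold for v that does not vanish on the boundary. *)
Definition fe_approximation (s : nat) (Cv : vfield R d -> R)
    (Cq : sfield R d -> R) (h : R) (XX : set (vfield R d))
    (QQ : set (sfield R d)) : Prop :=
  (forall v, Xsp Om v -> (forall j, Hm Om s.+1 (v j)) ->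
     inf [set vnorm Om (v - w) | w in XX] <= Cv v * h ^+ s.+1 /\
     inf [set gradnorm Om (v - w) | w in XX] <= Cv v * h ^+ s) /\
  (forall q, Qsp Om q -> Hm Om s q ->
     inf [set L2norm Om (q - r) | r in QQ] <= Cq q * h ^+ s).

Definition fe_error (s l : nat) (Cfe h dt : R) (Nt : nat)
    (u uh : nat -> vfield R d) (p ph : nat -> sfield R d) : Prop :=
  forall n, (n <= Nt)%N ->
    vnorm Om (u n - uh n) ^+ 2 + h ^+ 2 * gradnorm Om (u n - uh n) ^+ 2
      <= Cfe * (h ^+ (2 * s + 2) + dt ^+ 2) /\
    L2norm Om (p n - ph n) ^+ 2 <= Cfe * (h ^+ (2 * l) + dt ^+ 2).

End taylor_hood.

(* The quantities on which the generic constants of the error estimate may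
   depend through the data: bounds for u in L^oo(0,T;H^1), u_t in L2(0,T;L2),
   p in L^oo(0,T;L2), and for the time-discrete L2 norm of f. *)
Record data_bound (R : realType) (d : nat) (Om : set 'rV[R]_d) (T B : R)
    (dt : R) (Nt : nat) (u ut f : R -> vfield R d) (p : R -> sfield R d) : Prop := {
  bound_u : forall t, 0 <= t <= T -> gradnorm Om (u t) <= B ;
  bound_ut : tnorm2 T (fun t => vnorm Om (ut t)) <= B ^+ 2 ;
  bound_p : forall t, 0 <= t <= T -> L2norm Om (p t) <= B ;
  bound_f : dt * \sum_(1 <= n < Nt.+1) vnorm Om (f (n%:R * dt)) ^+ 2 <= B ^+ 2 }.

(* squared time-discrete L2 norm dt * sum over the time levels 0 .. K *)
Definition dnorm2 (R : realType) (dt : R) (K : nat) (g : nat -> R) : R :=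
  dt * \sum_(n < K.+1) g n ^+ 2.

(* Main.v *)
Require Import Defs.
From HB Require Import structures.
From mathcomp Require Import all_boot all_order all_algebra.
From mathcomp Require Import all_classical all_reals all_analysis ess_sup_inf measurable_realfun.
From mathcomp Require Import ring lra.
Set Implicit Arguments.
Unset Strict Implicit.
Unset Printing Implicit Defensive.
Import Order.TTheory GRing.Theory Num.Theory.
Import numFieldNormedType.Exports.
Local Open Scope classical_set_scope.
Local Open Scope ring_scope.

(* The error splits as [e = eta - xi], with [xi] in the reduced space and [eta]
   L2-orthogonal to it. Squared L2 norms therefore add up exactly, and it remains
   to bound [xi] and its pressure analogue [pi], the excess [nu |grad eta|^2] left
   by the gradients being absorbed by the right-hand side.
   Testing the difference of the equations with [xi^(n+1)] and [pi^(n+1)] gives an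
   energy inequality. Its convective terms are controlled by
   [|b*(w,u,v)| <= K (|w| |grad w|)^(1/2) |grad u| |grad v|], which follows from
   [int w^2 v^2 <= K |w| |grad w| |grad v|^2] in [H10]. Its pressure term
   [(div P_R u, pi) <= alpha |div eta| |pi|] uses the principal angle and
   [div u = 0]; there [pi^(n+1)] is split as [pi^n] plus an increment that the
   left-hand side absorbs, so that the Gronwall lemma is explicit and the time step
   is unrestricted.
   The terms with [u_R] in the coefficient need the a priori stability of the
   scheme, whose constant is a multiple of [nu^-1 (1 + A)], where [A] collects the
   initial errors and [nu^-1 |grad eta|_{2,0}^2]. If [A < 1] this is a constant; if
   [A >= 1] the stability estimate alone is the claim. The surplus powers of [1/nu]
   go into the exponential. *)

(** * Integrals and L2 spaces *)

(** The difficulty lies in the coefficient [u_R] of the convective term. The projection is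
    orthogonal in L2 only, so the gradient of [P_R u] is known only up to that of [eta], and every
    bound on [u_R] carries a factor [1 + A] containing [nu^-1 |grad eta|^2]. Inserted as it stands
    into the error estimate, this factor would multiply two error terms; this is what the dichotomy
    on [A] avoids. The trilinear estimate keeps [(|w| |grad w|)^(1/2)] for two different reasons.
    For [w = xi^n], half of the dissipation of the previous step pays for the gradient, which leaves
    [|xi^n|^2 / nu^3], the rate in the exponential. For [w = u_R], Cauchy-Schwarz in time pairs
    [|grad u_R|] with [|grad eta|^2], which is the origin of the sum of fourth powers and of its
    factor [dt^(1/2) / nu^(3/2)]. The inequality for [w v] is proved by integration along lines for
    compactly supported C^1 functions, separately in dimensions 2 and 3, and extended by density. In
    time, a primitive of the squared norm of a measurable version of the derivative turns the bounds
    of the single steps into telescoping sums. *)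

Section cauchy_schwarz.
Context dsp (Y : measurableType dsp) (R : realType) (mu : {measure set Y -> \bar R}).
Context (D : set Y) (mD : measurable D).
Implicit Types f g : Y -> R.

(** Cauchy-Schwarz arguments divide by the two norms. Proving them with [a + e] and [b + e] instead
    makes the division legitimate when a norm vanishes, and this lemma removes [e]. *)
Lemma ler_mulDe (x a b : R) : 0 <= a -> 0 <= b ->
  (forall e, 0 < e -> x <= (a + e) * (b + e)) -> x <= a * b.
Proof.
move=> a0 b0 H; apply/ler_addgt0Pr => e e0.
pose c := a + b + 1.
have c0 : 0 < c by rewrite /c; lra.
pose r := Num.min 1 (e / c).
have r0 : 0 < r by rewrite lt_min ltr01 divr_gt0.
have r1 : r <= 1 by rewrite ge_min lexx.
have re : r * c <= e by rewrite -ler_pdivlMr// ge_min lexx orbT.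
apply: (le_trans (H r r0)).
have -> : (a + r) * (b + r) = a * b + r * c - r * (1 - r) by rewrite /c; ring.
have : 0 <= r * (1 - r) by rewrite mulr_ge0 ?(ltW r0)// subr_ge0.
lra.
Qed.

Lemma integral_mul_le f g (a b : R) : measurable_fun D f -> measurable_fun D g ->
  0 <= a -> 0 <= b ->
  (\int[mu]_(x in D) (f x ^+ 2)%:E <= (a ^+ 2)%:E)%E ->
  (\int[mu]_(x in D) (g x ^+ 2)%:E <= (b ^+ 2)%:E)%E ->
  (\int[mu]_(x in D) `|f x * g x|%:E <= (a * b)%:E)%E.
Proof.
move=> mf mg a0 b0 fa gb.
have mf2 : measurable_fun D (fun x => (f x ^+ 2)%:E).
  by apply/measurable_EFinP; exact: measurable_funX.
have mg2 : measurable_fun D (fun x => (g x ^+ 2)%:E).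
  by apply/measurable_EFinP; exact: measurable_funX.
(* Young's inequality with a free weight [t], integrated; optimizing the weight afterwards gives
   Cauchy-Schwarz. *)
have key t : 0 < t -> (\int[mu]_(x in D) `|f x * g x|%:E <=
    (t / 2 * a ^+ 2 + t^-1 / 2 * b ^+ 2)%:E)%E.
  move=> t0; apply: (@le_trans _ _ (\int[mu]_(x in D)
      ((t / 2)%:E * (f x ^+ 2)%:E + (t^-1 / 2)%:E * (g x ^+ 2)%:E))%E).
    apply: ge0_le_integral => //.
    - by apply/measurable_EFinP; apply: measurableT_comp => //; exact: measurable_funM.
    - by apply: emeasurable_funD; apply: emeasurable_funM => //; exact: measurable_cst.
    - move=> x _; rewrite -!EFinM -EFinD lee_fin ler_norml.
      have tI : t * t^-1 = 1 by rewrite divff// gt_eqF.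
      have ti0 : 0 < t^-1 by rewrite invr_gt0.
      have h1 := mulr_ge0 (ltW ti0) (sqr_ge0 (t * f x + g x)).
      have h2 := mulr_ge0 (ltW ti0) (sqr_ge0 (t * f x - g x)).
      have e1 : t^-1 * (t * f x + g x) ^+ 2 = (t * t^-1) * t * f x ^+ 2
         + 2 * (t * t^-1) * (f x * g x) + t^-1 * g x ^+ 2 by ring.
      have e2 : t^-1 * (t * f x - g x) ^+ 2 = (t * t^-1) * t * f x ^+ 2
         - 2 * (t * t^-1) * (f x * g x) + t^-1 * g x ^+ 2 by ring.
      move: h1 h2; rewrite e1 e2 tI; lra.
  rewrite ge0_integralD//; last 4 first.
  - by move=> x _; rewrite -EFinM lee_fin mulr_ge0 ?sqr_ge0// divr_ge0// ltW.
  - by apply: emeasurable_funM => //; exact: measurable_cst.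
  - by move=> x _; rewrite -EFinM lee_fin mulr_ge0 ?sqr_ge0// divr_ge0// invr_ge0 ltW.
  - by apply: emeasurable_funM => //; exact: measurable_cst.
  rewrite !ge0_integralZl_EFin//; try by
    [move=> x _; rewrite lee_fin sqr_ge0 | rewrite divr_ge0// ?invr_ge0 ltW].
  rewrite EFinD; apply: leeD; rewrite [in leRHS]EFinM; apply: lee_wpmul2l => //;
    by rewrite lee_fin divr_ge0// ?invr_ge0 ltW.
have Ifin : (\int[mu]_(x in D) `|f x * g x|%:E)%E \is a fin_num.
  rewrite ge0_fin_numE; last by apply: integral_ge0 => x _; rewrite lee_fin.
  exact: le_lt_trans (key 1 ltr01) (ltry _).
rewrite -(fineK Ifin) lee_fin; apply: ler_mulDe => // e e0.
have ae0 : 0 < a + e by rewrite ltr_wpDl.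
have be0 : 0 < b + e by rewrite ltr_wpDl.
(* The optimal weight is the ratio of the norms, here enlarged by [e] so that it is defined and
   positive. *)
have := key ((b + e) / (a + e)) (divr_gt0 be0 ae0).
rewrite -(fineK Ifin) lee_fin => /le_trans; apply.
set p := a + e; set q := b + e.
have ap : a ^+ 2 <= p ^+ 2 by rewrite ler_sqr ?nnegrE ?(ltW ae0)// lerDl ltW.
have bq : b ^+ 2 <= q ^+ 2 by rewrite ler_sqr ?nnegrE ?(ltW be0)// lerDl ltW.
have -> : p * q = q / p / 2 * p ^+ 2 + (q / p)^-1 / 2 * q ^+ 2.
  by field; rewrite !gt_eqF.
apply: lerD; apply: ler_wpM2l => //; rewrite divr_ge0// ?invr_ge0 divr_ge0// ltW//.
Qed.

End cauchy_schwarz.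

Section ae_integral.
Import HBNNSimple.
Context dsp (Y : measurableType dsp) (R : realType) (mu : {measure set Y -> \bar R}).

(** The integral of a nonnegative function is a supremum over the simple functions below it, so
    monotonicity holds for arbitrary functions, measurable or not. *)
Lemma ge0_integral_mono (f g : Y -> \bar R) :
  (forall x, 0 <= f x)%E -> (forall x, f x <= g x)%E ->
  (\int[mu]_x f x <= \int[mu]_x g x)%E.
Proof.
move=> f0 fg; rewrite !ge0_integralTE//; last by move=> x; exact: le_trans (fg x).
by apply: le_ereal_sup => _ [h /= hf <-]; exists h => //= x; exact: le_trans (fg x).
Qed.

(* [f] need not be measurable: this is applied to norms of functions of time of
   which only a version is known to be measurable. *)
Lemma ge0_ae_eq_integralr (D : set Y) (f g : Y -> \bar R) : measurable D ->
  measurable_fun D g -> (forall x, 0 <= f x)%E -> (forall x, 0 <= g x)%E ->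
  {ae mu, forall x, D x -> f x = g x} ->
  (\int[mu]_(x in D) f x = \int[mu]_(x in D) g x)%E.
Proof.
move=> mD mg f0 g0 [N [mN N0 sub]].
have p0 (h : Y -> \bar R) (A : set Y) : (forall x, 0 <= h x)%E ->
  forall x, (0 <= (h \_ A) x)%E.
  by move=> h0 x; rewrite patchE; case: ifP.
have mgD : measurable_fun setT (g \_ D) by apply/(measurable_restrictT _ mD).
have fgN x : ~ N x -> (f \_ D) x = (g \_ D) x.
  move=> nN; rewrite !patchE; case: ifPn => // xD.
  apply: contrapT => fgx; apply: nN; apply: sub => /= /(_ (set_mem xD)).
  exact: fgx.
rewrite (integral_mkcond D f) (integral_mkcond D g).
apply/eqP; rewrite eq_le; apply/andP; split.
(* The simple functions below [f] are measurable even when [f] is not, so the null set [N] may be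
   removed from their integrals. *)
- rewrite ge0_integralTE; last exact: p0.
  apply: ge_ereal_sup => _ [h /= hf <-].
  rewrite -integralT_nnsfun (@ge0_negligible_integral _ _ _ _ setT N)//; last 2 first.
  - exact/measurable_EFinP/measurable_funP.
  - by move=> x _; rewrite lee_fin.
  rewrite [leRHS](@ge0_negligible_integral _ _ _ _ setT N)//; last first.
    by move=> x _; exact: p0.
  rewrite integral_mkcond [leRHS]integral_mkcond; apply: ge0_integral_mono.
    by apply: p0 => x; rewrite lee_fin.
  move=> x; rewrite !patchE; case: ifPn => // /set_mem [_ nN].
  by have := hf x; rewrite fgN// patchE.
- rewrite (@ge0_negligible_integral _ _ _ _ setT N)//; last by move=> x _; exact: p0.
  rewrite integral_mkcond; apply: ge0_integral_mono; first exact/p0/p0.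
  move=> x; rewrite [leLHS]patchE; case: ifPn => [/set_mem[_ nN]|_]; last exact: p0.
  by rewrite fgN.
Qed.

Lemma ae_eq_integralr (D : set Y) (f g : Y -> \bar R) : measurable D ->
  measurable_fun D g -> {ae mu, forall x, D x -> f x = g x} ->
  (\int[mu]_(x in D) f x = \int[mu]_(x in D) g x)%E.
Proof.
move=> mD mg fg; rewrite integralE [RHS]integralE; congr (_ - _)%E.
- apply: ge0_ae_eq_integralr => //; first exact: measurable_funepos.
  by apply: filterS fg => x h Dx; rewrite !funeposE h.
- apply: ge0_ae_eq_integralr => //; first exact: measurable_funeneg.
  by apply: filterS fg => x h Dx; rewrite !funenegE h.
Qed.

End ae_integral.

(** * Boxes, and open sets in the product sigma-algebra *)

Section boxes.
Context (R : realType) (n : nat).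
Implicit Types (a c x : 'rV[R]_n) (O : set 'rV[R]_n).

Definition obox a c : set 'rV[R]_n := [set x | forall i, a ord0 i < x ord0 i < c ord0 i].
Definition cbox a c : set 'rV[R]_n := [set x | forall i, a ord0 i <= x ord0 i <= c ord0 i].

Lemma obox_cbox a c : obox a c `<=` cbox a c.
Proof. by move=> x h i; have /andP[/ltW -> /ltW ->] := h i. Qed.

Lemma measurable_rV_forall (P : 'I_n -> set (measurableTypeR R)) :
  (forall i, measurable (P i)) -> measurable [set x : 'rV[R]_n | forall i, P i (x ord0 i)].
Proof.
move=> mP.
rewrite (_ : mkset _ = \big[setI/setT]_(i < n) ((@rV_coord R n i) @^-1` P i)).
  apply: bigsetI_measurable => i _; rewrite -[X in measurable X]setTI.
  exact: measurable_rV_coord.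
rewrite -bigcap_seq; apply/seteqP; split => x /=.
  by move=> h i _; exact: h.
by move=> h i; apply: h => /=; rewrite mem_index_enum.
Qed.

Lemma measurable_obox a c : measurable (obox a c).
Proof.
rewrite (_ : obox a c = [set x | forall i, (`]a ord0 i, c ord0 i[%classic) (x ord0 i)]).
  by apply: (@measurable_rV_forall (fun i => `]a ord0 i, c ord0 i[%classic)) => i; exact: measurable_itv.
by apply/seteqP; split => x /= h i; have := h i; rewrite /= in_itv.
Qed.

Lemma measurable_cbox a c : measurable (cbox a c).
Proof.
rewrite (_ : cbox a c = [set x | forall i, (`[a ord0 i, c ord0 i]%classic) (x ord0 i)]).
  by apply: (@measurable_rV_forall (fun i => `[a ord0 i, c ord0 i]%classic)) => i; exact: measurable_itv.
by apply/seteqP; split => x /= h i; have := h i; rewrite /= in_itv.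
Qed.

Lemma compact_cbox a c : compact (cbox a c).
Proof.
have := @rV_compact R n (fun i => `[a ord0 i, c ord0 i]%classic).
rewrite (_ : mkset _ = cbox a c); first by apply => i; exact: segment_compact.
by apply/seteqP; split => x /= h i; have := h i; rewrite /= in_itv.
Qed.

Definition rat_row (q : 'rV[rat]_n) : 'rV[R]_n := map_mx ratr q.

(** Rational corners make the family countable. The closed box is asked to lie in [O] because it
    will be the compact support of the bump functions attached to the open one. *)
Lemma open_rat_box O x : open O -> O x -> exists q : 'rV[rat]_n * 'rV[rat]_n,
  obox (rat_row q.1) (rat_row q.2) x /\ cbox (rat_row q.1) (rat_row q.2) `<=` O.
Proof.
rewrite openE => /[apply] /nbhs_ballP[e /= e0 eO].
have e20 : 0 < e / 2 by rewrite divr_gt0.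
have Ha i : {q : rat | x ord0 i - e / 2 < ratr q < x ord0 i}.
  have xe : x ord0 i - e / 2 < x ord0 i by rewrite ltrBlDr ltrDl.
  by apply: cid; have [q] := rat_in_itvoo xe; rewrite in_itv/=; exists q.
have Hc i : {q : rat | x ord0 i < ratr q < x ord0 i + e / 2}.
  have xe : x ord0 i < x ord0 i + e / 2 by rewrite ltrDl.
  by apply: cid; have [q] := rat_in_itvoo xe; rewrite in_itv/=; exists q.
exists (\row_i sval (Ha i), \row_i sval (Hc i)); split => /=.
  move=> i; rewrite !mxE; case: (Ha i) (Hc i) => [p /= /andP[_ ->]] [q /= /andP[-> _]] //.
move=> y h; apply: eO; split => // i j; rewrite (ord1 i) /ball/=.
have := h j; rewrite !mxE; case: (Ha j) (Hc j) => [p /= /andP[h1 _]] [q /= /andP[_ h2]].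
move=> /andP[h3 h4]; rewrite ltr_norml; lra.
Qed.

(** The sigma-algebra of row vectors is generated by the coordinates and the topology by the norm.
    This countable union links the two and makes open sets and continuous functions measurable. *)
Lemma open_bigcup_boxes O : open O -> O = \bigcup_(q : 'rV[rat]_n * 'rV[rat]_n)
  (if `[< cbox (rat_row q.1) (rat_row q.2) `<=` O >]
   then obox (rat_row q.1) (rat_row q.2) else set0).
Proof.
move=> oO; apply/seteqP; split => x.
  move=> /(open_rat_box oO)[q [xq qO]]; exists q => //.
  by case: asboolP.
by move=> [q _]; case: asboolP => // h /obox_cbox /h.
Qed.

Lemma open_measurable_rV O : open O -> measurable O.
Proof.
move=> oO; rewrite (open_bigcup_boxes oO).
apply: countable_bigcupT_measurable; first exact: countableP.
by move=> q; case: ifP => // _; exact: measurable_obox.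
Qed.

Lemma continuous_measurable_rV (f : 'rV[R]_n -> R) : continuous f ->
  measurable_fun setT f.
Proof.
move=> cf; apply: (measurability _ (RGenOInfty.measurableE R)) => _ [_ [r ->] <-].
rewrite setTI; apply: open_measurable_rV.
by apply: open_comp => [x _|]; [exact: cf|exact: interval_open].
Qed.

End boxes.

(** * Semi-inner products and orthogonal projections *)

Section semi_inner_product.
Context (R : realType) (V : lmodType R).

(** One algebra for the scalar and vector L2 products, the product of gradients and finite sums.
    Definiteness is not asked for, since functions equal almost everywhere are not identified; the
    laws are relative to [P], since an integral or a chosen weak derivative is additive only for
    functions of the right space. *)
Record semi_ip (P : set V) (b : V -> V -> R) : Prop := {
  sip0 : P 0 ;
  sipPD : forall u v, P u -> P v -> P (u + v) ;
  sipPZ : forall a u, P u -> P (a *: u) ;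
  sipC : forall u v, P u -> P v -> b u v = b v u ;
  sipDl : forall u v w, P u -> P v -> P w -> b (u + v) w = b u w + b v w ;
  sipZl : forall a u v, P u -> P v -> b (a *: u) v = a * b u v ;
  sip_ge0 : forall u, P u -> 0 <= b u u }.

Context (P : set V) (b : V -> V -> R) (sb : semi_ip P b).
Local Notation nm u := (Num.sqrt (b u u)).

Lemma sipPN u : P u -> P (- u).
Proof. by move=> Pu; rewrite -scaleN1r; exact: (sipPZ sb). Qed.

Lemma sipPB u v : P u -> P v -> P (u - v).
Proof. by move=> Pu Pv; apply: (sipPD sb) => //; exact: sipPN. Qed.

Lemma sipP_sum (I : Type) (r : seq I) (F : I -> V) :
  (forall i, P (F i)) -> P (\sum_(i <- r) F i).
Proof. by move=> PF; elim/big_ind : _ => //; [exact: (sip0 sb)|exact: (sipPD sb)]. Qed.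

Lemma sipDr u v w : P u -> P v -> P w -> b w (u + v) = b w u + b w v.
Proof.
move=> Pu Pv Pw; rewrite (sipC sb)//; last exact: (sipPD sb).
by rewrite (sipDl sb)// (sipC sb Pu)// (sipC sb Pv).
Qed.

Lemma sipZr a u v : P u -> P v -> b u (a *: v) = a * b u v.
Proof.
move=> Pu Pv; rewrite (sipC sb)//; last exact: (sipPZ sb).
by rewrite (sipZl sb)// (sipC sb Pu).
Qed.

Lemma sipNl u v : P u -> P v -> b (- u) v = - b u v.
Proof. by move=> Pu Pv; rewrite -scaleN1r (sipZl sb)// mulN1r. Qed.

Lemma sipNr u v : P u -> P v -> b u (- v) = - b u v.
Proof. by move=> Pu Pv; rewrite -scaleN1r sipZr// mulN1r. Qed.

Lemma sipBl u v w : P u -> P v -> P w -> b (u - v) w = b u w - b v w.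
Proof. by move=> Pu Pv Pw; rewrite (sipDl sb) ?sipNl//; exact: sipPN. Qed.

Lemma sipBr u v w : P u -> P v -> P w -> b w (u - v) = b w u - b w v.
Proof. by move=> Pu Pv Pw; rewrite sipDr ?sipNr//; exact: sipPN. Qed.

Lemma sip0l v : P v -> b 0 v = 0.
Proof. by move=> Pv; rewrite -(scale0r v) (sipZl sb)// mul0r. Qed.

Lemma sip_suml (I : Type) (r : seq I) (F : I -> V) v : (forall i, P (F i)) -> P v ->
  b (\sum_(i <- r) F i) v = \sum_(i <- r) b (F i) v.
Proof.
move=> PF Pv; elim: r => [|i r ih]; first by rewrite !big_nil sip0l.
by rewrite !big_cons (sipDl sb) ?ih//; exact: sipP_sum.
Qed.

Lemma sipDD u v : P u -> P v -> b (u + v) (u + v) = b u u + 2 * b u v + b v v.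
Proof.
move=> Pu Pv; have Puv := sipPD sb Pu Pv.
rewrite (sipDl sb)// !sipDr// (sipC sb Pv Pu); ring.
Qed.

Lemma sipBB u v : P u -> P v -> b (u - v) (u - v) = b u u - 2 * b u v + b v v.
Proof.
move=> Pu Pv; rewrite sipDD//; last exact: sipPN.
rewrite sipNr// sipNl//; last exact: sipPN.
rewrite sipNr//; ring.
Qed.

Lemma sip_norm2 u : P u -> nm u ^+ 2 = b u u.
Proof. by move=> Pu; rewrite sqr_sqrtr//; exact: (sip_ge0 sb). Qed.

Lemma sip_normZ a u : P u -> nm (a *: u) = `|a| * nm u.
Proof.
move=> Pu; rewrite (sipZl sb) ?sipZr//; last exact: (sipPZ sb).
by rewrite mulrA -expr2 sqrtrM ?sqr_ge0// sqrtr_sqr.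
Qed.

Lemma sip_normN u : P u -> nm (- u) = nm u.
Proof. by move=> Pu; rewrite -scaleN1r sip_normZ// normrN1 mul1r. Qed.

Lemma sip_normBC u v : P u -> P v -> nm (u - v) = nm (v - u).
Proof. by move=> Pu Pv; rewrite -opprB sip_normN//; exact: sipPB. Qed.

Lemma sip_CS u v : P u -> P v -> `|b u v| <= nm u * nm v.
Proof.
move=> Pu Pv.
suff H w z : P w -> P z -> b w z <= nm w * nm z.
  rewrite ler_norml H// andbT lerNl -(sip_normN Pu) -sipNl//.
  by apply: H => //; exact: sipPN.
move=> Pw Pz; apply: ler_mulDe; rewrite ?sqrtr_ge0// => e e0.
set p := nm w + e; set q := nm z + e.
have p0 : 0 < p by rewrite ltr_wpDl ?sqrtr_ge0.
have q0 : 0 < q by rewrite ltr_wpDl ?sqrtr_ge0.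
(* With [p] and [q] just above the norms of [w] and [z], the square of [q *: w - p *: z] expands to
   [2 p q b w z <= q^2 b w w + p^2 b z z <= 2 p^2 q^2]. *)
have := sip_ge0 sb (sipPB (sipPZ sb q Pw) (sipPZ sb p Pz)).
rewrite sipBB; [|exact: (sipPZ sb)..].
rewrite !(sipZl sb)//; [|exact: (sipPZ sb)..].
rewrite !sipZr//.
have hw : b w w <= p ^+ 2.
  by rewrite -sip_norm2// ler_sqr ?nnegrE ?sqrtr_ge0 ?(ltW p0)// lerDl ltW.
have hz : b z z <= q ^+ 2.
  by rewrite -sip_norm2// ler_sqr ?nnegrE ?sqrtr_ge0 ?(ltW q0)// lerDl ltW.
move=> h; rewrite -(ler_pM2l (mulr_gt0 p0 q0)).
have h1 := ler_wpM2l (sqr_ge0 q) hw.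
have h2 := ler_wpM2l (sqr_ge0 p) hz.
nra.
Qed.

Lemma sip_normD u v : P u -> P v -> nm (u + v) <= nm u + nm v.
Proof.
move=> Pu Pv; rewrite -(@ler_pXn2r _ 2)// ?nnegrE ?addr_ge0 ?sqrtr_ge0//.
rewrite sip_norm2; last exact: (sipPD sb).
rewrite sqrrD !sip_norm2// sipDD// lerD2r lerD2l mulr2n.
have := le_trans (ler_norm _) (sip_CS Pu Pv); lra.
Qed.

Lemma sip_normB u v : P u -> P v -> nm (u - v) <= nm u + nm v.
Proof. by move=> Pu Pv; rewrite -(sip_normN Pv); apply: sip_normD => //; exact: sipPN. Qed.

Lemma sip_normD2 u v : P u -> P v -> nm (u + v) ^+ 2 <= 2 * nm u ^+ 2 + 2 * nm v ^+ 2.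
Proof.
move=> Pu Pv; have h : nm (u + v) ^+ 2 <= (nm u + nm v) ^+ 2.
  by rewrite ler_sqr ?nnegrE ?addr_ge0 ?sqrtr_ge0// sip_normD.
apply: le_trans h _.
have := sqr_ge0 (nm u - nm v); rewrite sqrrB sqrrD; lra.
Qed.

Lemma sip_normB2 u v : P u -> P v -> nm (u - v) ^+ 2 <= 2 * nm u ^+ 2 + 2 * nm v ^+ 2.
Proof.
by move=> Pu Pv; rewrite -(sip_normN Pv); apply: sip_normD2 => //; exact: sipPN.
Qed.

(** Testing an implicit difference quotient with the new value: the first two terms telescope over
    the time steps and the third is the numerical dissipation. *)
Lemma sip_BG u v : P u -> P v ->
  2 * b (u - v) u = nm u ^+ 2 - nm v ^+ 2 + nm (u - v) ^+ 2.
Proof.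
move=> Pu Pv; rewrite !sip_norm2//; last exact: sipPB.
rewrite sipBB// sipBl// (sipC sb Pv Pu); ring.
Qed.

Lemma sip_pythagoras u v : P u -> P v -> b u v = 0 ->
  nm (u - v) ^+ 2 = nm u ^+ 2 + nm v ^+ 2.
Proof.
move=> Pu Pv uv; rewrite !sip_norm2//; last exact: sipPB.
by rewrite sipBB// uv; ring.
Qed.

End semi_inner_product.

Section orthogonal_projection.
Context (R : realType) (V : lmodType R) (P : set V) (b : V -> V -> R).
Context (sb : semi_ip P b) (r : nat) (phi : 'I_r -> V).
Hypotheses (Pphi : forall i, P (phi i)) (ophi : orthonormal_family b phi).
Local Notation W := (lspan phi).

Lemma lspanD u v : W u -> W v -> W (u + v).
Proof.
move=> [c ->] [c' ->]; exists (fun i => c i + c' i).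
by rewrite -big_split; apply: eq_bigr => i _; rewrite scalerDl.
Qed.

Lemma lspanZ a u : W u -> W (a *: u).
Proof.
move=> [c ->]; exists (fun i => a * c i).
by rewrite scaler_sumr; apply: eq_bigr => i _; rewrite scalerA.
Qed.

Lemma lspanB u v : W u -> W v -> W (u - v).
Proof. by move=> Wu Wv; apply: lspanD => //; rewrite -scaleN1r; exact: lspanZ. Qed.

Lemma lspan_sub u : W u -> P u.
Proof. by move=> [c ->]; apply: (sipP_sum sb) => i; exact: (sipPZ sb). Qed.

(** The Fourier sum of [v] satisfies the defining property, so [xget] never returns its default
    value. *)
Lemma orth_projP v : P v ->
  W (orth_proj b W v) /\ forall z, W z -> b (v - orth_proj b W v) z = 0.
Proof.
move=> Pv; rewrite /orth_proj; case: xgetP => [w -> //|none].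
exfalso; apply: (none (\sum_(i < r) b v (phi i) *: phi i)); split.
  by exists (fun i => b v (phi i)).
move=> z [c ->].
have Ps : P (\sum_(i < r) b v (phi i) *: phi i).
  by apply: (sipP_sum sb) => i; exact: (sipPZ sb).
have Pd := sipPB sb Pv Ps.
rewrite (sipC sb)//; last by apply: (sipP_sum sb) => i; exact: (sipPZ sb).
rewrite (sip_suml sb)//; last by move=> i; exact: (sipPZ sb).
apply: big1 => i _; rewrite (sipZl sb)// (sipBr sb)// (sipC sb (Pphi i) Ps).
rewrite (sip_suml sb)//; last by move=> j; exact: (sipPZ sb).
rewrite (bigD1 i)//= (sipZl sb)// ophi eqxx mulr1 big1 ?addr0.
  by rewrite (sipC sb)// subrr mulr0.
by move=> j ji; rewrite (sipZl sb)// ophi (negPf ji) mulr0.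
Qed.

End orthogonal_projection.

(** * The space L2 and its inner product *)

Section L2_space.
Context (R : realType) (d : nat) (Om : set 'rV[R]_d) (mOm : measurable Om).
Local Notation leb := (lebesgue_rV R d).
Local Notation L2 := (L2 Om).
Local Notation ip := (ip Om).
Local Notation L2norm := (L2norm Om).
Implicit Types f g h : 'rV[R]_d -> R.

Lemma L2_integral f : L2 f ->
  (\int[leb]_(x in Om) (f x ^+ 2)%:E)%E = (L2norm f ^+ 2)%:E.
Proof.
move=> [mf f2]; rewrite /L2norm /ip sqr_sqrtr; last first.
  by apply: Rintegral_ge0 => x _; rewrite -expr2 sqr_ge0.
rewrite /Rintegral fineK//.
by rewrite ge0_fin_numE//; apply: integral_ge0 => x _; rewrite lee_fin sqr_ge0.
Qed.

Lemma L2_mul_integral f g : L2 f -> L2 g ->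
  (\int[leb]_(x in Om) `|f x * g x|%:E <= (L2norm f * L2norm g)%:E)%E.
Proof.
move=> Lf Lg; apply: integral_mul_le => //; rewrite ?sqrtr_ge0 ?L2_integral//.
- by case: Lf.
- by case: Lg.
Qed.

Lemma L2_mul_integrable f g : L2 f -> L2 g ->
  leb.-integrable Om (EFin \o (fun x => f x * g x)).
Proof.
move=> Lf Lg; apply/integrableP; split.
  by apply/measurable_EFinP; apply: measurable_funM; [case: Lf|case: Lg].
by apply: le_lt_trans (L2_mul_integral Lf Lg) (ltry _).
Qed.

Lemma L2_0 : L2 0.
Proof.
split; first exact: measurable_cst.
rewrite integral0_eq ?ltry// => x _.
by rewrite expr0n.
Qed.

Lemma L2_le f g h : measurable_fun Om f -> L2 g -> L2 h ->
  (forall x, Om x -> f x ^+ 2 <= g x ^+ 2 + h x ^+ 2) -> L2 f.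
Proof.
move=> mf [mg g2] [mh h2] fgh; split => //.
apply: (@le_lt_trans _ _ (\int[leb]_(x in Om) ((g x ^+ 2)%:E + (h x ^+ 2)%:E))%E).
  apply: ge0_le_integral => //.
  - by move=> x _; rewrite lee_fin sqr_ge0.
  - by apply/measurable_EFinP; exact: measurable_funX.
  - by apply: emeasurable_funD; apply/measurable_EFinP; exact: measurable_funX.
rewrite ge0_integralD//; last 4 first.
- by move=> x _; rewrite lee_fin sqr_ge0.
- by apply/measurable_EFinP; exact: measurable_funX.
- by move=> x _; rewrite lee_fin sqr_ge0.
- by apply/measurable_EFinP; exact: measurable_funX.
exact: lte_add_pinfty.
Qed.

Lemma L2Z a f : L2 f -> L2 (a *: f).
Proof.
move=> [mf f2]; split.
  by apply: measurable_funM => //; exact: measurable_cst.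
under eq_integral do rewrite /GRing.scale/= exprMn EFinM.
rewrite ge0_integralZl_EFin ?sqr_ge0//.
- by rewrite lte_mul_pinfty// ?lee_fin ?sqr_ge0.
- by move=> x _; rewrite lee_fin sqr_ge0.
- by apply/measurable_EFinP; exact: measurable_funX.
Qed.

Lemma L2D f g : L2 f -> L2 g -> L2 (f + g).
Proof.
move=> Lf Lg; apply: (@L2_le _ (2 *: f) (2 *: g)); try exact: L2Z.
  by apply: measurable_funD; [case: Lf|case: Lg].
move=> x _ /=; rewrite !fctE /GRing.scale/=.
have := sqr_ge0 (f x - g x); rewrite sqrrB sqrrD !exprMn; nra.
Qed.

Lemma ip_semi_ip : semi_ip L2 ip.
Proof.
split.
- exact: L2_0.
- by move=> f g; exact: L2D.
- by move=> a f; exact: L2Z.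
- by move=> f g _ _; apply: eq_Rintegral => x _; rewrite mulrC.
- move=> f g h Lf Lg Lh; rewrite /ip -RintegralD//; try exact: L2_mul_integrable.
  by apply: eq_Rintegral => x _; rewrite mulrDl.
- move=> a f g Lf Lg; rewrite /ip -RintegralZl//; last exact: L2_mul_integrable.
  by apply: eq_Rintegral => x _; rewrite mulrA.
- by move=> f _; apply: Rintegral_ge0 => x _; rewrite -expr2 sqr_ge0.
Qed.

Definition aeq f g := {ae leb, forall x, Om x -> f x = g x}.

Lemma ip_aeql f g h : L2 f -> L2 g -> L2 h -> aeq f g -> ip f h = ip g h.
Proof.
move=> [mf _] [mg _] [mh _] fg; rewrite /ip /Rintegral; congr fine.
apply: ae_eq_integral => //.
- by apply/measurable_EFinP; exact: measurable_funM.
- by apply/measurable_EFinP; exact: measurable_funM.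
- by apply: filterS fg => x fg Ox; rewrite fg.
Qed.

Lemma aeq_trans f g h : aeq f g -> aeq g h -> aeq f h.
Proof. by apply: filterS2 => x fg gh Ox; rewrite fg// gh. Qed.

Lemma aeqD f f' g g' : aeq f f' -> aeq g g' -> aeq (f + g) (f' + g').
Proof. by apply: filterS2 => x ff gg Ox; rewrite !fctE ff// gg. Qed.

Lemma aeq_ip0 f : L2 f -> ip f f = 0 -> aeq f 0.
Proof.
move=> Lf f0.
have := L2_integral Lf; rewrite /L2norm f0 sqrtr0 expr0n/=.
have [mf _] := Lf => I0.
have mf2 : measurable_fun Om (EFin \o (fun x => f x ^+ 2)).
  by apply/measurable_EFinP; exact: measurable_funX.
have : (\int[leb]_(x in Om) `|(f x ^+ 2)%:E| = 0)%E.
  by rewrite -[RHS]I0; apply: eq_integral => x _; rewrite gee0_abs// lee_fin sqr_ge0.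
move/(ae_eq_integral_abs _ mOm mf2); apply: filterS => x h Ox.
by have := h Ox => /= -[] /eqP; rewrite sqrf_eq0 => /eqP.
Qed.

End L2_space.

(** * Test functions *)

Section smooth_functions.
Context (R : realType) (d : nat).
Implicit Types (f g : 'rV[R]_d -> R) (x v : 'rV[R]_d).
Local Notation e_ i := (delta_mx ord0 i : 'rV[R]_d).

(** Reduces directional derivatives to derivatives of a function of one real variable, to which the
    fundamental theorem of calculus applies. *)
Lemma derivable_lineE f x v (t : R) :
  (derivable f (x + t *: v) v <-> derivable (fun s : R => f (x + s *: v)) t 1) /\
  'D_v f (x + t *: v) = 'D_1 (fun s : R => f (x + s *: v)) t.
Proof.
have E : (fun h => h^-1 *: ((f \o shift (x + t *: v)) (h *: v) - f (x + t *: v))) =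
  (fun h : R => h^-1 *: (((fun s : R => f (x + s *: v)) \o shift t) (h *: (1 : R))
                         - (fun s : R => f (x + s *: v)) t)).
  apply/funext => h /=; congr (_ *: (f _ - _)).
  by rewrite (_ : h *: (1 : R) = h) ?scalerDl 1?addrCA//; exact: mulr1.
by rewrite /derivable /derive E.
Qed.

Lemma Cn_continuous n f : Cn n f -> continuous f.
Proof. by case: n => [|n] []. Qed.

Lemma CnS n f : Cn n.+1 f -> Cn n f.
Proof.
elim: n f => [|n ih] f [cf H]; first by split.
by split => // i; have [df Cf] := H i; split => //; exact: ih.
Qed.

Lemma Cn_derivable n f i x : Cn n.+1 f -> derivable f x (e_ i).
Proof. by move=> [_ /(_ i)[]]. Qed.

Lemma Cn_partial n f i : Cn n.+1 f -> Cn n (partial i f).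
Proof. by move=> [_ /(_ i)[]]. Qed.

Lemma CnD n f g : Cn n f -> Cn n g -> Cn n (f + g).
Proof.
elim: n f g => [|n ih] f g [cf Hf] [cg Hg].
  by split => // x; apply: continuousD; [exact: cf|exact: cg].
split; first by move=> x; apply: continuousD; [exact: cf|exact: cg].
move=> i; have [df Cf] := Hf i; have [dg Cg] := Hg i; split.
  by move=> x; exact: derivableD.
rewrite (_ : partial i (f + g) = partial i f + partial i g); first exact: ih.
by apply/funext => x; rewrite /partial deriveD.
Qed.

Lemma CnZ n (a : R) f : Cn n f -> Cn n (a *: f).
Proof.
elim: n f => [|n ih] f [cf Hf].
  by split => // x; apply: continuousZr; exact: cf.
split; first by move=> x; apply: continuousZr; exact: cf.
move=> i; have [df Cf] := Hf i; split.
  by move=> x; exact: derivableZ.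
rewrite (_ : partial i (a *: f) = a *: partial i f); first exact: ih.
by apply/funext => x; rewrite /partial deriveZ.
Qed.

Lemma partialM f g i : (forall x, derivable f x (e_ i)) ->
  (forall x, derivable g x (e_ i)) ->
  partial i (f * g) = f * partial i g + partial i f * g.
Proof.
move=> df dg; apply/funext => x; rewrite /partial deriveM//.
by rewrite /GRing.scale/= [X in _ + X]mulrC.
Qed.

Lemma CnM n f g : Cn n f -> Cn n g -> Cn n (f * g).
Proof.
elim: n f g => [|n ih] f g [cf Hf] [cg Hg].
  by split => // x; apply: continuousM; [exact: cf|exact: cg].
split; first by move=> x; apply: continuousM; [exact: cf|exact: cg].
move=> i; have [df Cf] := Hf i; have [dg Cg] := Hg i; split.
  by move=> x; exact: derivableM.
rewrite partialM//; apply: CnD; apply: ih => //.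
  by apply: CnS.
by apply: CnS.
Qed.

Lemma Cn_cst n (a : R) : Cn n (cst a : 'rV[R]_d -> R).
Proof.
elim: n a => [|n ih] a; first by split => //; exact: cst_continuous.
split; first exact: cst_continuous.
move=> i; split; first by move=> x; exact: derivable_cst.
rewrite (_ : partial i _ = cst 0); first exact: ih.
by apply/funext => x; rewrite /partial derive_cst.
Qed.

Lemma Cn_prod n (I : Type) (r : seq I) (F : I -> 'rV[R]_d -> R) :
  (forall i, Cn n (F i)) -> Cn n (fun x => \prod_(i <- r) F i x).
Proof.
move=> CF; elim: r => [|i r ih].
  by under eq_fun do rewrite big_nil; exact: Cn_cst.
by under eq_fun do rewrite big_cons; exact: CnM.
Qed.

End smooth_functions.

Section test_functions.
Context (R : realType) (d : nat) (Om : set 'rV[R]_d).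
Implicit Types (f g : 'rV[R]_d -> R).
Local Notation test := (test_function Om).

Lemma testD f g : test f -> test g -> test (f + g).
Proof.
move=> [Cf [K [cK KO fK]]] [Cg [L [cL LO gL]]]; split.
  by move=> n; exact: CnD.
exists (K `|` L); split; [exact: compactU|by move=> x []; [exact: KO|exact: LO]|].
by move=> x /not_orP[nK nL]; rewrite fctE fK// gL// addr0.
Qed.

Lemma testZ (a : R) f : test f -> test (a *: f).
Proof.
move=> [Cf [K [cK KO fK]]]; split; first by move=> n; exact: CnZ.
by exists K; split => // x nK; rewrite [LHS](_ : _ = a * f x)// fK// mulr0.
Qed.

Lemma testM f g : test f -> test g -> test (f * g).
Proof.
move=> [Cf [K [cK KO fK]]] [Cg _]; split; first by move=> n; exact: CnM.
by exists K; split => // x nK; rewrite fctE fK// mul0r.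
Qed.

Lemma test0 : test 0.
Proof.
split; first by move=> n; exact: (@Cn_cst R d n 0).
by exists set0; split => //; exact: compact0.
Qed.

Lemma test_partial i f : test f -> test (partial i f).
Proof.
move=> [Cf [K [cK KO fK]]]; split; first by move=> n; exact: Cn_partial.
exists K; split => // x nK; rewrite /partial.
(* The complement of the compact support is open, so [f] vanishes in a neighbourhood of [x] and its
   derivative vanishes at [x]. *)
have cK' : closed K by apply: compact_closed => //; exact: norm_hausdorff.
have oK : open (~` K) by exact: closed_openC.
rewrite (@near_eq_derive _ _ _ f (cst 0)); first exact: derive_cst.
have : nbhs x (~` K) by exact: open_nbhs_nbhs.
by apply: filterS => y /= nKy; rewrite fK.
Qed.

Lemma test_derivable f i x : test f -> derivable f x (delta_mx ord0 i).
Proof. by move=> [Cf _]; exact: (@Cn_derivable _ _ 0 f i x (Cf 1%N)). Qed.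

Lemma test_continuous f : test f -> continuous f.
Proof. by move=> [Cf _]; exact: (Cn_continuous (Cf 0%N)). Qed.

Lemma test_partialM i f g : test f -> test g ->
  partial i (f * g) = f * partial i g + partial i f * g.
Proof. by move=> tf tg; apply: partialM => x; exact: test_derivable. Qed.

Lemma test_supp0 f x : test f -> ~ Om x -> f x = 0.
Proof. by move=> [_ [K [_ KO fK]]] nO; apply: fK => /KO. Qed.

End test_functions.

(** * Smooth functions flat at the origin *)

Section exp_bump.
Context (R : realType).
Implicit Types (p : {poly R}) (s t : R).

(** Monomial by monomial: [s^i / i!] is a term of the series of [exp s], whence
    [s^i exp(-s) <= i!]. *)
Lemma horner_expRN_bounded p : exists2 C, 0 <= C &
  forall s, 0 <= s -> `|p.[s]| * expR (- s) <= C.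
Proof.
exists (\sum_(i < size p) `|p`_i| * (i`!)%:R).
  by apply: sumr_ge0 => i _; exact: mulr_ge0.
move=> s s0; rewrite horner_coef.
apply: (@le_trans _ _ ((\sum_(i < size p) `|p`_i * s ^+ i|) * expR (- s))).
  by apply: ler_wpM2r; [exact: expR_ge0|exact: ler_norm_sum].
rewrite mulr_suml; apply: ler_sum => i _.
rewrite normrM -mulrA ler_wpM2l// ger0_norm ?exprn_ge0//.
rewrite expRN ler_pdivrMr ?expR_gt0//.
case: (nat_of_ord i) => [|n].
  by rewrite fact0 mul1r expr0 (le_trans _ (expR_ge1Dx _))// lerDl.
have f0 : (0 : R) < (n.+1)`!%:R by rewrite ltr0n fact_gt0.
have := expR_ge1Dxn n s0; rewrite -(ler_pM2l f0); apply: le_trans.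
by rewrite mulrDr mulr1 mulrCA divff ?mulr1 ?lerDr ?ltW// gt_eqF.
Qed.

(** The classical [exp(-1/t)] extended by zero; the polynomial factor in [1/t] covers all its
    derivatives at once. *)
Definition expbump p t : R := if 0 < t then p.[t^-1] * expR (- t^-1) else 0.

(** Quadratic decay at the origin is what makes the extension by zero differentiable there, with
    derivative 0. It is the boundedness of [s^2 p(s) exp(-s)] read at [s = 1/t]. *)
Lemma expbump_le p : exists2 C, 0 <= C & forall t, `|expbump p t| <= C * t ^+ 2.
Proof.
have [C C0 HC] := horner_expRN_bounded (p * 'X^2).
exists C => // t; rewrite /expbump; case: ifPn => t0; last first.
  by rewrite normr0 mulr_ge0// sqr_ge0.
have ti0 : 0 < t^-1 by rewrite invr_gt0.
have := HC t^-1 (ltW ti0); rewrite hornerM hornerXn normrM (ger0_norm (sqr_ge0 _)).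
rewrite [`|p.[_] * expR _|]normrM (ger0_norm (expR_ge0 _)).
rewrite -(@ler_pM2r _ (t ^+ 2)) ?exprn_gt0//.
apply: le_trans; rewrite le_eqVlt; apply/orP; left; apply/eqP.
by rewrite mulrAC -[_ * t^-1 ^+ 2 * t ^+ 2]mulrA -exprMn mulVf ?gt_eqF// expr1n mulr1.
Qed.

Lemma is_derive_expbump p t :
  is_derive t (1 : R) (expbump p) (expbump ('X^2 * (p - p^`())) t).
Proof.
have [t0|t0|->] := ltgtP t 0.
- have -> : expbump ('X^2 * (p - p^`())) t = 0 by rewrite /expbump ltNge (ltW t0).
  apply: (@near_eq_is_derive _ _ _ (cst 0 : R -> R)).
  have : nbhs t [set s | s < 0] by exact: open_nbhs_nbhs.
  by apply: filterS => s /= s0; rewrite /expbump ltNge ltW.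
- apply: (@near_eq_is_derive _ _ _ (fun s => p.[s^-1] * expR (- s^-1))).
    have : nbhs t [set s | 0 < s] by exact: open_nbhs_nbhs.
    by apply: filterS => s /= s0; rewrite /expbump s0.
  have dinv : is_derive t (1 : R) (fun s : R => s^-1) (- t ^- 2).
    apply: is_derive_eq; first by apply: is_deriveV; rewrite gt_eqF.
    by rewrite /GRing.scale/= mulr1.
  have d1 : is_derive t (1 : R) (fun s : R => p.[s^-1]) (p^`().[t^-1] * - t ^- 2).
    exact: (@is_derive1_comp _ (horner p) (fun s : R => s^-1)).
  have d2 : is_derive t (1 : R) (fun s : R => expR (- s^-1)) (expR (- t^-1) * - - t ^- 2).
    apply: (@is_derive1_comp _ expR (fun s : R => - s^-1)).
  apply: is_derive_eq.
  rewrite /expbump t0 hornerM hornerXn hornerD hornerN exprVn /GRing.scale/=.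
  by ring.
- have E0 q : expbump q 0 = 0 by rewrite /expbump ltxx.
  have [C C0 HC] := expbump_le p.
  have cv : (h^-1 *: ((expbump p \o shift 0) (h *: (1:R)) - expbump p 0))
      @[h --> 0^'] --> (0 : R).
    apply: (@cvg_to_0_linear _ _ C 1) => // h /andP[h0 _].
    rewrite /= addr0 E0 subr0 (_ : h *: (1 : R) = h); last exact: mulr1.
    rewrite normrM normfV mulrC ler_pdivrMr//.
    apply: le_trans (HC h) _.
    by rewrite -real_normK ?num_real// expr2 mulrA.
  apply: DeriveDef; first by apply: cvgP cv.
  by rewrite E0; apply: cvg_lim cv.
Qed.

(* Closed under derivation, since [p] absorbs the factors produced by the chain
   rule. *)
Definition expbumps : set (R -> R) :=
  [set g | exists p m b, g = fun t => expbump p (m * t + b)].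

Lemma is_derive_expbumps g : expbumps g ->
  exists2 g', expbumps g' & forall t, is_derive t (1 : R) g (g' t).
Proof.
move=> [p [m [b ->]]]; exists (fun t => expbump (m *: ('X^2 * (p - p^`()))) (m * t + b)).
  by exists (m *: ('X^2 * (p - p^`()))), m, b.
move=> t; have dl : is_derive t (1 : R) (fun s : R => m * s + b) m.
  have := is_deriveD (is_deriveZ m (is_derive_id t (1 : R))) (is_derive_cst b t (1 : R)).
  move=> /is_derive_eq; apply.
  by rewrite addr0 /GRing.scale/= mulr1.
apply: is_derive_eq.
  apply: (@is_derive1_comp _ (expbump p) (fun s : R => m * s + b)).
  exact: is_derive_expbump.
by rewrite /expbump; case: ifP => _; rewrite ?mul0r// hornerZ; ring.
Qed.

End exp_bump.

Section box_bump.
Context (R : realType) (d : nat).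
Local Notation e_ i := (delta_mx ord0 i : 'rV[R]_d).

Lemma Cn_expbumps n (g : R -> R) (i : 'I_d) : expbumps g ->
  Cn n (fun x : 'rV[R]_d => g (x ord0 i)).
Proof.
elim: n g => [|n ih] g Eg; have [g' Eg' dg] := is_derive_expbumps Eg.
all: have cg : continuous (fun x : 'rV[R]_d => g (x ord0 i)).
1,3: move=> x; apply: (@continuous_comp _ _ _ (fun x : 'rV[R]_d => x ord0 i) g);
  [exact: coord_continuous|apply: differentiable_continuous; apply/derivable1_diffP;
   exact: (@ex_derive _ _ _ _ _ _ _ (dg _))].
  by split.
split => // j.
have [<-|ij] := eqVneq i j.
  have E x : is_derive x (e_ i) (fun x : 'rV[R]_d => g (x ord0 i)) (g' (x ord0 i)).
    have Q : (fun h : R => h^-1 *: (((fun x : 'rV[R]_d => g (x ord0 i)) \o shift x) (h *: e_ i)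
               - g (x ord0 i)))
      = (fun h : R => h^-1 *: ((g \o shift (x ord0 i)) (h *: (1 : R)) - g (x ord0 i))).
      by apply/funext => h /=; rewrite !mxE !eqxx.
    have D := dg (x ord0 i).
    by split; [rewrite /derivable Q; exact: ex_derive|rewrite /derive Q; exact: derive_val].
  split; first by move=> x; have /@ex_derive := E x.
  rewrite (_ : partial i _ = fun x => g' (x ord0 i)); first exact: ih.
  by apply/funext => x; rewrite /partial; have /@derive_val := E x.
have E x : is_derive x (e_ j) (fun x : 'rV[R]_d => g (x ord0 i)) 0.
  have Q : (fun h : R => h^-1 *: (((fun x : 'rV[R]_d => g (x ord0 i)) \o shift x) (h *: e_ j)
             - g (x ord0 i)))
    = (fun h : R => h^-1 *: ((cst 0 \o shift (0:R)) (h *: (1 : R)) - cst (0:R) (0:R))).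
    apply/funext => h /=; rewrite !mxE (negPf ij) andbF mulr0 add0r subrr.
    by rewrite subrr.
  have D := is_derive_cst (0 : R) (0 : R) (1 : R).
  by split; [rewrite /derivable Q; exact: ex_derive|rewrite /derive Q; exact: derive_val].
split; first by move=> x; have /@ex_derive := E x.
rewrite (_ : partial j _ = cst 0); first exact: Cn_cst.
by apply/funext => x; rewrite /partial; have /@derive_val := E x.
Qed.

(** The dilation by [m.+1] drives [expbump 1] to 1 on the positive half-line while it stays 0
    elsewhere, so the product increases its plateau to the whole open box without enlarging its
    support. *)
Definition box_bump (a c : 'rV[R]_d) (m : nat) : 'rV[R]_d -> R :=
  fun x => \prod_(i < d) (expbump 1 (m.+1%:R * (x ord0 i - a ord0 i)) *
                          expbump 1 (m.+1%:R * (c ord0 i - x ord0 i))).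

Lemma Cn_box_bump n a c m : Cn n (box_bump a c m).
Proof.
apply: Cn_prod => i; apply: CnM.
  apply: (@Cn_expbumps n (fun t => expbump 1 (m.+1%:R * (t - a ord0 i)))).
  exists 1, (m.+1%:R), (- (m.+1%:R * a ord0 i)); apply/funext => t.
  by rewrite mulrBr.
apply: (@Cn_expbumps n (fun t => expbump 1 (m.+1%:R * (c ord0 i - t)))).
exists 1, (- (m.+1%:R)), (m.+1%:R * c ord0 i); apply/funext => t.
by rewrite mulrBr mulNr addrC.
Qed.

Lemma expbump1_itv (t : R) : 0 <= expbump 1 t <= 1.
Proof.
rewrite /expbump; case: ifP => [t0|_]; last by rewrite lexx ler01.
by rewrite hornerC mul1r expR_ge0/= -expR0 ler_expR oppr_le0 invr_ge0 ltW.
Qed.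

Lemma expbump1_cvg (t : R) : 0 < t -> expbump 1 (m.+1%:R * t) @[m --> \oo] --> (1 : R).
Proof.
move=> t0.
rewrite (_ : (fun m => _) = (fun m : nat => expR (- (m.+1%:R^-1 * t^-1)))); last first.
  apply/funext => m; rewrite /expbump mulr_gt0// hornerC mul1r invfM//.
rewrite -[X in _ --> X]expR0; apply: continuous_cvg; first exact: continuous_expR.
rewrite -oppr0 -(mul0r t^-1); apply: cvgN; apply: cvgMl.
exact: cvg_harmonic.
Qed.

Lemma box_bump_out a c m x : ~ obox a c x -> box_bump a c m x = 0.
Proof.
move=> /existsNP[i ni]; rewrite /box_bump (bigD1 i)//=.
have [ax|ax] := ltP (a ord0 i) (x ord0 i); last first.
  rewrite [expbump 1 (_ * (x _ _ - _))]/expbump pmulr_rgt0// subr_gt0 ltNge ax/=.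
  by rewrite !mul0r.
have [cx|cx] := ltP (x ord0 i) (c ord0 i); first by case: ni; rewrite ax.
rewrite [expbump 1 (_ * (c _ _ - _))]/expbump pmulr_rgt0// subr_gt0 ltNge cx/=.
by rewrite mulr0 !mul0r.
Qed.

Lemma box_bump_itv a c m x : 0 <= box_bump a c m x <= 1.
Proof.
have H i : 0 <= expbump 1 (m.+1%:R * (x ord0 i - a ord0 i)) *
            expbump 1 (m.+1%:R * (c ord0 i - x ord0 i)) <= 1.
  have /andP[h1 h2] := expbump1_itv (m.+1%:R * (x ord0 i - a ord0 i)).
  have /andP[h3 h4] := expbump1_itv (m.+1%:R * (c ord0 i - x ord0 i)).
  by rewrite mulr_ge0// mulr_ile1.
rewrite /box_bump; apply/andP; split.
  by apply: prodr_ge0 => i _; case/andP: (H i).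
by apply: prodr_ile1 => i _.
Qed.

Lemma box_bump_cvg a c x : box_bump a c m x @[m --> \oo] --> (\1_(obox a c) x : R).
Proof.
rewrite indicE; have [xb|nxb] := boolP (x \in obox a c); last first.
  rewrite (_ : (fun m => _) = cst 0); first exact: cvg_cst.
  by apply/funext => m; rewrite box_bump_out// => /mem_set; exact/negP.
have -> : (true%:R : R) = \prod_(i < d) (1 * 1) by rewrite mulr1 big1.
rewrite /box_bump; apply: cvg_big => [|i _]; first exact: mul_continuous.
have /andP[h1 h2] := set_mem xb i.
by apply: cvgM; apply: expbump1_cvg; rewrite subr_gt0.
Qed.

Lemma test_box_bump (Om : set 'rV[R]_d) a c m : cbox a c `<=` Om ->
  test_function Om (box_bump a c m).
Proof.
move=> bO; split; first by move=> n; exact: Cn_box_bump.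
exists (cbox a c); split => //; first exact: compact_cbox.
by move=> x nx; rewrite box_bump_out// => /obox_cbox.
Qed.

End box_bump.

(** * Functions orthogonal to all test functions vanish almost everywhere *)

Section fundamental_lemma.
Context (R : realType) (d : nat).
Local Notation leb n := (lebesgue_rV R n).

Lemma lebesgue_cbox_fin n (a c : 'rV[R]_n) : (leb n (cbox a c) < +oo)%E.
Proof.
elim: n a c => [|n ih] a c.
  by rewrite /= diracE; case: (_ \in _); rewrite ltry.
rewrite /= /lebesgue_rV_step /pushforward.
pose t (x : 'rV[R]_n.+1) : 'rV[R]_n := \row_j x ord0 (rshift 1 j).
apply: (@le_lt_trans _ _ ((@lebesgue_measure R \x leb n)%E
    (`[a ord0 ord0, c ord0 ord0]%classic `*` cbox (t a) (t c)))).
  apply: le_measure; rewrite ?inE.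
  - rewrite -[X in measurable X]setTI; apply: measurable_rV_cons => //.
    exact: measurable_cbox.
  - by apply: measurableX => //; exact: measurable_cbox.
  move=> [x y] /= h; split => /=.
    have := h ord0; rewrite (_ : ord0 = lshift n ord0 :> 'I_(1 + n)); last exact/val_inj.
    by rewrite /rV_cons (row_mxEl (const_mx x : 'rV[R]_1)) mxE in_itv.
  move=> j; have := h (rshift 1 j).
  by rewrite /rV_cons (row_mxEr (const_mx x : 'rV[R]_1)) !mxE.
rewrite product_measure1E//; last exact: measurable_cbox.
rewrite lte_mul_pinfty//.
rewrite [X in X \is a fin_num](_ : _ =
  (@lebesgue_measure R) `[a ord0 ord0, c ord0 ord0]%classic)//.
by rewrite lebesgue_measure_itv/=; case: ifP.
Qed.

Lemma lebesgue_bounded_fin (A : set 'rV[R]_d) : measurable A -> bounded_set A ->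
  (leb d A < +oo)%E.
Proof.
move=> mA [M [_ HM]].
apply: le_lt_trans (lebesgue_cbox_fin (const_mx (- (M + 1))) (const_mx (M + 1))).
apply: le_measure; rewrite ?inE//; first exact: measurable_cbox.
move=> x Ax i; rewrite !mxE -ler_norml.
apply: le_trans (HM (M + 1) _ x Ax); last by rewrite ltrDl.
rewrite [leRHS]/Num.norm /= mx_normrE; apply/bigmax_geP; right => /=.
by exists (ord0, i).
Qed.

Definition oboxes : set (set 'rV[R]_d) := [set B | exists a c, B = obox a c].

Definition row_max (a b : 'rV[R]_d) : 'rV[R]_d := \row_i Num.max (a ord0 i) (b ord0 i).
Definition row_min (a b : 'rV[R]_d) : 'rV[R]_d := \row_i Num.min (a ord0 i) (b ord0 i).

Lemma setI_obox (a c a' c' : 'rV[R]_d) :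
  obox a c `&` obox a' c' = obox (row_max a a') (row_min c c').
Proof.
apply/seteqP; split => x /=.
  move=> [h h'] i; rewrite !mxE gt_max lt_min.
  by have /andP[-> ->] := h i; have /andP[-> ->] := h' i.
by move=> h; split => i; have := h i; rewrite !mxE gt_max lt_min =>
  /andP[/andP[h1 h2] /andP[h3 h4]]; rewrite ?h1 ?h2 ?h3 ?h4.
Qed.

Lemma cbox_maxmin (a c a' c' : 'rV[R]_d) :
  cbox (row_max a a') (row_min c c') `<=` cbox a c.
Proof.
move=> x h i; have := h i; rewrite !mxE ge_max le_min.
by move=> /andP[/andP[-> _] /andP[-> _]].
Qed.

Lemma setI_closed_oboxes : setI_closed oboxes.
Proof.
move=> _ _ [a [c ->]] [a' [c' ->]]; rewrite setI_obox.
by exists (row_max a a'), (row_min c c').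
Qed.

(** Needed for Dynkin induction. A half-space in one coordinate is open, hence a countable union of
    rational boxes. *)
Lemma measurable_oboxesE : @measurable _ 'rV[R]_d = <<s oboxes >>.
Proof.
apply/seteqP; split; last first.
  apply: smallest_sub; first exact: sigma_algebra_measurable.
  by move=> _ [a [c ->]]; exact: measurable_obox.
have op O : open O -> <<s oboxes >> O.
  move=> oO; rewrite (open_bigcup_boxes oO).
  apply: (@countable_bigcupT_measurable _ (g_sigma_algebraType oboxes)).
    exact: countableP.
  move=> q; case: ifP => _; last exact: (@measurable0 _ (g_sigma_algebraType oboxes)).
  by apply: sub_sigma_algebra; exists (rat_row R q.1), (rat_row R q.2).
apply: smallest_sub; first exact: smallest_sigma_algebra.
rewrite -bigcup_seq => A [i /= _ [B mB <-]].
have mi : @measurable_fun _ _ (g_sigma_algebraType oboxes) (measurableTypeR R) setT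
    (@rV_coord R d i).
  apply: (measurability _ (RGenOInfty.measurableE R)) => _ [_ [r ->] <-].
  rewrite setTI; apply: op; apply: open_comp => [x _|]; last exact: interval_open.
  exact: coord_continuous.
exact: mi.
Qed.

Lemma L2_indic_obox (A : set 'rV[R]_d) (a c : 'rV[R]_d) : measurable A ->
  L2 A (\1_(obox a c)).
Proof.
move=> mA; split; first by apply: measurable_indic; exact: measurable_obox.
rewrite (eq_integral (fun x => (\1_(obox a c) x)%:E)); last first.
  by move=> x _; rewrite indicE; case: (_ \in _); rewrite ?expr1n ?expr0n.
rewrite integral_indic//; last exact: measurable_obox.
apply: le_lt_trans (lebesgue_cbox_fin a c); apply: le_measure; rewrite ?inE.
- by apply: measurableI => //; exact: measurable_obox.
- exact: measurable_cbox.
- by move=> x [/obox_cbox].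
Qed.

Context (Om : set 'rV[R]_d) (oOm : open Om).
Local Notation L2 := (L2 Om).

(** Dominated convergence in [ip Om g (box_bump a c m) = 0]: the majorant is [g] on the box,
    integrable as the product of [g] with an indicator that lies in L2. *)
Lemma integral_obox_eq0 g a c : L2 g ->
  (forall phi, test_function Om phi -> ip Om g phi = 0) ->
  cbox a c `<=` Om -> (\int[leb d]_(x in obox a c) (g x)%:E = 0)%E.
Proof.
move=> Lg H bO.
have mOm := open_measurable_rV oOm.
have J0 x : 0 <= (\1_(obox a c) x : R) by rewrite indicE.
have L1 : L2 (\1_(obox a c)) by exact: L2_indic_obox.
have ig := L2_mul_integrable mOm Lg L1.
pose f_ m := EFin \o (fun x => g x * box_bump a c m x).
pose f := EFin \o (fun x => g x * \1_(obox a c) x).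
have mb m : measurable_fun Om (box_bump a c m).
  apply: measurable_funTS; apply: continuous_measurable_rV.
  exact: Cn_continuous (Cn_box_bump 0 a c m).
have mf_ m : measurable_fun Om (f_ m).
  by apply/measurable_EFinP; apply: measurable_funM => //; case: Lg.
have mf : measurable_fun Om f by apply: measurable_int ig.
have cv x : Om x -> f_ ^~ x @ \oo --> f x.
  move=> _; apply: cvg_EFin; first exact: nearW.
  by apply: cvgMr; exact: box_bump_cvg.
have dom x m : Om x -> (`|f_ m x| <= (abse \o f) x)%E.
  move=> _; rewrite /f_ /f /= lee_fin !normrM ler_wpM2l// (ger0_norm (J0 x)).
  have [b0 b1] := andP (box_bump_itv a c m x).
  have [xJ|xJ] := pselect (obox a c x); last by rewrite box_bump_out// normr0.
  by rewrite indicE (mem_set xJ) ger0_norm.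
have [_ _ cvf] := dominated_convergence mOm mf_ mf (aeW (leb d) cv) (integrable_abse ig)
  (aeW (leb d) dom).
have i0 m : (\int[leb d]_(x in Om) f_ m x = 0)%E.
  have tb := test_box_bump m bO.
  have L2b : L2 (box_bump a c m).
    split => //; apply: le_lt_trans L1.2; apply: ge0_le_integral => //.
    - by move=> x _; rewrite lee_fin sqr_ge0.
    - by apply/measurable_EFinP; exact: measurable_funX.
    - by apply/measurable_EFinP; apply: measurable_funX; case: L1.
    - move=> x _; rewrite lee_fin; have [xJ|xJ] := pselect (obox a c x).
        by rewrite indicE (mem_set xJ) expr1n expr_le1//; case/andP: (box_bump_itv a c m x).
      by rewrite box_bump_out// expr0n sqr_ge0.
  have := H _ tb; rewrite /ip /Rintegral => h.
  rewrite -[LHS]fineK ?h//; apply: integrable_fin_num => //.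
  exact: (L2_mul_integrable mOm Lg L2b).
have E : (\int[leb d]_(x in obox a c) (g x)%:E = \int[leb d]_(x in Om) f x)%E.
  have -> : obox a c = Om `&` obox a c by rewrite setIidr// => x /obox_cbox /bO.
  rewrite integral_mkcondr; apply: eq_integral => x _.
  by rewrite patchE /f /= indicE; case: (_ \in _); rewrite ?mulr1// mulr0.
rewrite E; have /cvg_lim <- // := cvf.
rewrite (_ : [sequence _]_n = cst 0%E); first exact: lim_cst.
by apply/funext => m; exact: i0.
Qed.

(* Bumps converge to the indicators of open boxes, which form a pi-system. *)
Lemma weak_zero g : L2 g ->
  (forall phi, test_function Om phi -> ip Om g phi = 0) -> aeq Om g 0.
Proof.
move=> Lg H; have mOm := open_measurable_rV oOm.
have mg : measurable_fun Om g by case: Lg.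
have box0 (q : 'rV[rat]_d * 'rV[rat]_d) :
  cbox (rat_row R q.1) (rat_row R q.2) `<=` Om ->
  {ae leb d, forall x, obox (rat_row R q.1) (rat_row R q.2) x -> g x = 0}.
  set a := rat_row _ _; set c := rat_row _ _ => bO.
  have mJ := measurable_obox a c.
  have JO : obox a c `<=` Om by move=> x /obox_cbox /bO.
  have ig : (leb d).-integrable (obox a c) (EFin \o g).
    have L1 := L2_indic_obox a c mOm.
    apply: (@eq_integrable _ _ _ _ _ mJ (EFin \o (fun x => g x * \1_(obox a c) x))).
      by move=> x xJ; rewrite /= indicE xJ mulr1.
    by apply: integrableS (L2_mul_integrable mOm Lg L1).
  have mI A : measurable A -> measurable (obox a c `&` A) by exact: measurableI.
  have Z A : measurable A -> (\int[leb d]_(x in obox a c `&` A) (g x)%:E = 0)%E.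
    rewrite measurable_oboxesE => mA; refine (@dynkin_induction _ _ oboxes
       (fun A => (\int[leb d]_(x in obox a c `&` A) (g x)%:E = 0)%E)
       measurable_oboxesE setI_closed_oboxes _ _ _ _ A mA).
    - by rewrite setIT; exact: integral_obox_eq0.
    - move=> _ [a' [c' ->]]; rewrite setI_obox; apply: integral_obox_eq0 => //.
      by move=> x /cbox_maxmin /bO.
    - move=> S mS S0.
      have : (\int[leb d]_(x in obox a c) (g x)%:E = 0)%E by exact: integral_obox_eq0.
      rewrite -[X in (\int[_]_(x in X) _)%E](setUIDK (obox a c) S) integral_setU //=.
      + by rewrite setDE S0 add0e.
      + exact: mI.
      + exact: measurableD.
      + by rewrite setUIDK; apply: measurable_int ig.
      + by apply/disj_setPS => x [[_ ?] [_ ?]].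
    - move=> F mF tF F0; rewrite setI_bigcupr integral_bigcup//.
      + by apply: eseries0 => k _ _; exact: F0.
      + by apply: trivIset_setIl.
      + by move=> k; exact: mI.
      + rewrite -setI_bigcupr; apply: integrableS ig => //.
        by apply: mI; exact: bigcupT_measurable.
  have : ae_eq (leb d) (obox a c) (EFin \o g) (cst 0%E).
    apply: integral_ae_eq => // E EJ mE.
    by rewrite integral0 -(setIidr EJ) Z.
  by apply: filterS => x h xJ; have [] := h xJ.
(* The exceptional sets of the rational boxes inside [Om] are united along the enumeration of pairs
   of rational vectors; countability keeps the union negligible. *)
have : {ae leb d, forall x, forall n : nat, forall q : 'rV[rat]_d * 'rV[rat]_d,
    unpickle n = Some q -> cbox (rat_row R q.1) (rat_row R q.2) `<=` Om ->
    obox (rat_row R q.1) (rat_row R q.2) x -> g x = 0}.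
  apply: ae_foralln => n; case: (unpickle n) => [q|]; last by apply: aeW.
  have [qO|nqO] := pselect (cbox (rat_row R q.1) (rat_row R q.2) `<=` Om).
    by apply: filterS (box0 q qO) => x h _ [<-] _.
  by apply: aeW => x _ [<-] /nqO.
apply: filterS => x h Ox.
by have [q [xq qO]] := open_rat_box oOm Ox; exact: (h _ _ (pickleK q)).
Qed.

End fundamental_lemma.

(** * Poincare and Gagliardo-Nirenberg inequalities for C^1 functions *)

Section slices.
Context (R : realType).
Local Notation leb n := (lebesgue_rV R n).
Local Notation leb1 := (@lebesgue_measure R).
Local Notation e_ i := (delta_mx ord0 i).

Definition row_cons (n : nat) (x : R) (v : 'rV[R]_n) : 'rV[R]_n.+1 := rV_cons (x, v).

Lemma cons0 n x (v : 'rV[R]_n) : row_cons x v ord0 ord0 = x.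
Proof.
rewrite (_ : ord0 = lshift n ord0 :> 'I_(1 + n)); last exact/val_inj.
by rewrite /row_cons /rV_cons (row_mxEl (const_mx x : 'rV[R]_1)) mxE.
Qed.

Lemma consS n x (v : 'rV[R]_n) j : row_cons x v ord0 (lift ord0 j) = v ord0 j.
Proof.
rewrite (_ : lift ord0 j = rshift 1 j :> 'I_(1 + n)); last exact/val_inj.
by rewrite /row_cons /rV_cons (row_mxEr (const_mx x : 'rV[R]_1)).
Qed.

Lemma eq_row_cons n (x y : 'rV[R]_n.+1) : x ord0 ord0 = y ord0 ord0 ->
  (forall j, x ord0 (lift ord0 j) = y ord0 (lift ord0 j)) -> x = y.
Proof.
move=> h0 hS; apply/rowP => i.
by have [j ->|->] := unliftP ord0 i; [exact: hS|exact: h0].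
Qed.

Lemma cons_lineL n t (v : 'rV[R]_n) : row_cons t v = row_cons 0 v + t *: e_ ord0.
Proof.
apply: eq_row_cons => [|j].
  by rewrite cons0 mxE cons0 !mxE eqxx mulr1 add0r.
by rewrite consS mxE consS !mxE mulr0 addr0.
Qed.

Lemma cons_lineR n x (v : 'rV[R]_n) t j :
  row_cons x (v + t *: e_ j) = row_cons x v + t *: e_ (lift ord0 j).
Proof.
apply: eq_row_cons => [|k].
  by rewrite cons0 mxE cons0 !mxE mulr0 addr0.
by rewrite consS mxE [RHS]mxE consS !mxE (inj_eq lift_inj).
Qed.

Lemma continuous_consR n (x : R) : continuous (fun v : 'rV[R]_n => row_cons x v).
Proof.
move=> v P /nbhs_ballP[e /= e0 eP]; apply/nbhs_ballP; exists e => //= w [_ vw].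
apply: eP; split => // i k; rewrite (ord1 i).
have [j ->|->] := unliftP ord0 k; first by rewrite !consS.
by rewrite !cons0; exact: ballxx.
Qed.

Lemma continuous_consL n (v : 'rV[R]_n) : continuous (fun x : R => row_cons x v).
Proof.
move=> x P /nbhs_ballP[e /= e0 eP]; apply/nbhs_ballP; exists e => //= w xw.
apply: eP; split => // i k; rewrite (ord1 i).
have [j ->|->] := unliftP ord0 k; first by rewrite !consS; exact: ballxx.
by rewrite !cons0.
Qed.

Lemma measurable_cons n : measurable_fun setT
  (fun p : measurableTypeR R * 'rV[R]_n => row_cons p.1 p.2).
Proof.
rewrite (_ : (fun _ => _) = @rV_cons R n); first exact: measurable_rV_cons.
by apply/funext => -[].
Qed.

Section tonelli.
Context (n : nat) (F : 'rV[R]_n.+1 -> \bar R) (mF : measurable_fun setT F).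

Let mFc : measurable_fun setT
  (fun p : measurableTypeR R * 'rV[R]_n => F (row_cons p.1 p.2)).
Proof. by apply: measurableT_comp mF _; exact: measurable_cons. Qed.

Let cE : (fun p : measurableTypeR R * 'rV[R]_n => F (row_cons p.1 p.2)) = F \o @rV_cons R n.
Proof. by apply/funext => -[]. Qed.

Lemma measurable_cons_slice x : measurable_fun setT (fun v : 'rV[R]_n => F (row_cons x v)).
Proof.
have mx : measurable_fun setT (fun v : 'rV[R]_n => (x, v) : measurableTypeR R * 'rV[R]_n).
  by apply: measurable_fun_pair => //; exact: measurable_cst.
exact: (measurableT_comp mFc mx).
Qed.

Lemma tonelli_consL : (forall x, 0 <= F x)%E ->
  (\int[leb n.+1]_x F x = \int[leb1]_x \int[leb n]_v F (row_cons x v))%E.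
Proof.
move=> F0; rewrite ge0_integral_pushforward//; last exact: measurable_rV_cons.
by rewrite preimage_setT -cE fubini_tonelli1.
Qed.

Lemma tonelli_consR : (forall x, 0 <= F x)%E ->
  (\int[leb n.+1]_x F x = \int[leb n]_v \int[leb1]_x F (row_cons x v))%E.
Proof.
move=> F0; rewrite ge0_integral_pushforward//; last exact: measurable_rV_cons.
by rewrite preimage_setT -cE fubini_tonelli2.
Qed.

Lemma measurable_integral_consR : (forall x, 0 <= F x)%E ->
  measurable_fun setT (fun x : R => (\int[leb n]_v F (row_cons x v))%E).
Proof. by move=> F0; exact: (measurable_fun_fubini_tonelli_F _ mFc). Qed.

Lemma measurable_integral_consL : (forall x, 0 <= F x)%E ->
  measurable_fun setT (fun v : 'rV[R]_n => (\int[leb1]_x F (row_cons x v))%E).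
Proof. by move=> F0; exact: (measurable_fun_fubini_tonelli_G _ mFc). Qed.

Context (iF : (leb n.+1).-integrable setT F).

Let iFc : (leb1 \x leb n)%E.-integrable setT (F \o @rV_cons R n).
Proof.
apply/integrableP; split; first by rewrite -cE.
rewrite -(@ge0_integral_pushforward _ _ _ _ _ _ _ _ setT (abse \o F))//.
- by case/integrableP : iF.
- exact: measurable_rV_cons.
- exact: measurableT_comp.
- by move=> y _; exact: abse_ge0.
Qed.

Lemma fubini_consL : (\int[leb n.+1]_x F x = \int[leb1]_x \int[leb n]_v F (row_cons x v))%E.
Proof.
rewrite integral_pushforward//; first by rewrite preimage_setT -(integral12_prod_meas1 iFc).
- exact: measurable_rV_cons.

Qed.

Lemma fubini_consR : (\int[leb n.+1]_x F x = \int[leb n]_v \int[leb1]_x F (row_cons x v))%E.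
Proof.
rewrite integral_pushforward//; first by rewrite preimage_setT -(integral21_prod_meas1 iFc).
- exact: measurable_rV_cons.

Qed.

End tonelli.
End slices.

(** * Compactly supported functions and integration along coordinate lines *)

Section compact_support.
Context (R : realType).
Local Notation leb n := (lebesgue_rV R n).
Local Notation leb1 := (@lebesgue_measure R).
Local Notation e_ i := (delta_mx ord0 i).

(** Compact support is expressed coordinate by coordinate, a form that passes with the same bound to
    the slices obtained by freezing the first coordinate. *)
Definition C0c (n : nat) (f : 'rV[R]_n -> R) : Prop := continuous f /\
  exists M : R, forall (x : 'rV[R]_n) i, M < `|x ord0 i| -> f x = 0.

Definition C1c (n : nat) (f : 'rV[R]_n -> R) : Prop :=
  [/\ C0c f, forall i x, derivable f x (e_ i) & forall i, continuous (partial i f)].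

Lemma C0c_measurable n (f : 'rV[R]_n -> R) : C0c f -> measurable_fun setT f.
Proof. by move=> [cf _]; exact: continuous_measurable_rV. Qed.

Lemma C0c_integrable n (f : 'rV[R]_n -> R) : C0c f ->
  (leb n).-integrable setT (EFin \o f).
Proof.
move=> fc; have mf := C0c_measurable fc; have [cf [M fM]] := fc.
pose K : set 'rV[R]_n := cbox (const_mx (- M)) (const_mx M).
have fK : f = f \_ K.
  apply/funext => x; rewrite patchE; case: ifPn => // /negP xK.
  have : ~ K x by move=> /mem_set.
  move=> /existsNP[i]; rewrite !mxE -ler_norml => /negP; rewrite -ltNge.
  exact: fM.
rewrite fK -restrict_EFin; apply/(integrable_mkcond _ _).1; first exact: measurable_cbox.
apply: measurable_bounded_integrable.
- exact: measurable_cbox.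
- exact: lebesgue_cbox_fin.
- exact: measurable_funTS.
- have /compact_bounded [B [Br HB]] : compact [set f x | x in K].
    apply: continuous_compact; last exact: compact_cbox.
    exact: continuous_subspaceT.
  exists B; split => // y yB x Kx; apply: (HB y yB); exact: imageP.
Qed.

Lemma C0cM n (f g : 'rV[R]_n -> R) : C0c f -> continuous g -> C0c (f * g).
Proof.
move=> [cf [M fM]] cg; split; first by move=> x; apply: continuousM; [exact: cf|exact: cg].
by exists M => x i /fM; rewrite fctE => ->; rewrite mul0r.
Qed.

Lemma C0c_partial n (f : 'rV[R]_n -> R) i : C1c f -> C0c (partial i f).
Proof.
move=> [[cf [M fM]] df cdf]; split => //; exists M => x j Mx.
rewrite /partial (@near_eq_derive _ _ _ f (cst 0)); first exact: derive_cst.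
have : nbhs x [set y : 'rV[R]_n | M < `|y ord0 j|].
  apply: open_nbhs_nbhs; split => //.
  apply: (@open_comp _ _ (fun y : 'rV[R]_n => `|y ord0 j|) [set r | M < r]).
    move=> y _; apply: (@continuous_comp _ _ _ (fun y : 'rV[R]_n => y ord0 j) Num.norm).
      exact: coord_continuous.
    exact: norm_continuous.
  exact: open_gt.
by apply: filterS => y /= /fM.
Qed.

Lemma C1cM n (f g : 'rV[R]_n -> R) : C1c f -> C1c g -> C1c (f * g).
Proof.
move=> [cf df pf] [cg dg pg]; split.
- by apply: C0cM => //; case: cg.
- by move=> i x; apply: derivableM; [exact: df|exact: dg].
- move=> i; rewrite partialM; [|exact: df|exact: dg].
  by move=> x; apply: continuousD; apply: continuousM; [case: cf => + _; exact|exact: pg|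
     exact: pf|case: cg => + _; exact].
Qed.

Lemma C0c_slice n (f : 'rV[R]_n.+1 -> R) x : C0c f -> C0c (fun v => f (row_cons x v)).
Proof.
move=> [cf [M fM]]; split.
  move=> v; apply: (@continuous_comp _ _ _ (fun v : 'rV[R]_n => row_cons x v) f).
    exact: continuous_consR.
  exact: cf.
by exists M => v i Mv; apply: (fM _ (lift ord0 i)); rewrite consS.
Qed.

Lemma derivable_cons n (f : 'rV[R]_n.+1 -> R) x v i :
  (derivable f (row_cons x v) (e_ (lift ord0 i)) <->
     derivable (fun v : 'rV[R]_n => f (row_cons x v)) v (e_ i)) /\
  partial (lift ord0 i) f (row_cons x v) = partial i (fun v => f (row_cons x v)) v.
Proof.
have E : (fun s : R => f (row_cons x v + s *: e_ (lift ord0 i))) =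
   (fun s : R => f (row_cons x (v + s *: e_ i))).
  by apply/funext => s; rewrite cons_lineR.
have [h1 h2] := derivable_lineE (fun v => f (row_cons x v)) v (e_ i) 0.
have [h3 h4] := derivable_lineE f (row_cons x v) (e_ (lift ord0 i)) 0.
rewrite scale0r addr0 -E in h1 h2; rewrite scale0r addr0 in h3 h4.
split; last exact: etrans h4 (esym h2).
exact (conj (fun D => h1.2 (h3.1 D)) (fun D => h3.2 (h1.1 D))).
Qed.

Lemma C1c_slice n (f : 'rV[R]_n.+1 -> R) x : C1c f -> C1c (fun v => f (row_cons x v)).
Proof.
move=> [cf df pf]; split; first exact: C0c_slice.
  move=> i v; exact ((derivable_cons f x v i).1.1 (df _ _)).
move=> i; rewrite (_ : partial i _ = fun v => partial (lift ord0 i) f (row_cons x v)).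
  move=> v; apply: (@continuous_comp _ _ _ (fun v : 'rV[R]_n => row_cons x v)).
    exact: continuous_consR.
  exact: pf.
by apply/funext => v; rewrite (derivable_cons f x v i).2.
Qed.

Section line.
Context (n : nat) (f : 'rV[R]_n.+1 -> R) (fc : C1c f) (v : 'rV[R]_n).
Let g t := f (row_cons t v).
Let g' t := partial ord0 f (row_cons t v).

Let dg t : is_derive t (1 : R) g (g' t).
Proof.
have [_ df _] := fc.
have [h1 h2] := derivable_lineE f (row_cons 0 v) (e_ ord0) t.
have E : (fun s : R => f (row_cons 0 v + s *: e_ ord0)) = g.
  by apply/funext => s; rewrite /g (cons_lineL s).
rewrite E -cons_lineL in h1 h2.
exact (DeriveDef (h1.1 (df ord0 _)) (esym h2)).
Qed.

Let cg' : continuous g'.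
Proof.
move=> t; apply: (@continuous_comp _ _ _ (fun t : R => row_cons t v)).
  exact: continuous_consL.
by case: fc => _ _ + ; apply.
Qed.

Let cg : continuous g.
Proof.
move=> t; apply: (@continuous_comp _ _ _ (fun t : R => row_cons t v)).
  exact: continuous_consL.
by case: fc => -[+ _] _ _; apply.
Qed.

Lemma line_FTC a b : a < b ->
  (\int[leb1]_(t in `[a, b]) (g' t)%:E = (g b)%:E - (g a)%:E)%E.
Proof.
move=> ab; apply: (@continuous_FTC2 _ g' g) => //.
- exact: continuous_subspaceT.
- split.
  + by move=> t _; exact: (@ex_derive _ _ _ _ _ _ _ (dg t)).
  + by apply: cvg_at_right_filter; exact: cg.
  + by apply: cvg_at_left_filter; exact: cg.
- by move=> t _; rewrite derive1E; exact: (@derive_val _ _ _ _ _ _ _ (dg t)).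
Qed.

Lemma line_integral0 : (\int[leb1]_t (g' t)%:E = 0)%E.
Proof.
have [[_ [M fM]] _ _] := fc.
have [_ [N pN]] := C0c_partial ord0 fc.
(* The bounds for the supports of [f] and of its derivative come from separate existential
   statements, so [L] exceeds both; being positive, it makes the interval nondegenerate. *)
pose L := Num.max 0 (Num.max M N) + 1.
have L0 : 0 < L by rewrite /L ltr_wpDl// le_max lexx.
have LM : M < L by rewrite /L ltr_pwDr// !le_max lexx orbT.
have LN : N < L by rewrite /L ltr_pwDr// !le_max lexx !orbT.
have -> : (\int[leb1]_t (g' t)%:E = \int[leb1]_(t in `[(- L)%R, L]) (g' t)%:E)%E.
  rewrite [RHS]integral_mkcond; apply: eq_integral => t _.
  rewrite patchE; case: ifPn => //; rewrite notin_setE/= in_itv/= -ler_norml => /negP.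
  by rewrite -ltNge => Lt; rewrite /g' (pN _ ord0)// cons0 (lt_trans LN).
rewrite line_FTC; last by rewrite gtrN.
by rewrite /g !(fM _ ord0) ?subee// cons0 ?normrN gtr0_norm.
Qed.

(** To the left of the support the function is zero, so its value at [s] is the integral of its
    derivative from a far point [a] to [s]. *)
Lemma line_le s : (`|g s|%:E <= \int[leb1]_t `|g' t|%:E)%E.
Proof.
have [[_ [M fM]] _ _] := fc.
pose a := Num.min s (- `|M|) - 1.
have as_ : a < s by rewrite /a ltrBlDr ltr_pwDr// ge_min lexx.
have aM : M < `|a|.
  have : a < - `|M| by rewrite /a ltrBlDr ltr_pwDr// ge_min lexx orbT.
  have := ler_norm M; have := normr_ge0 M; have := ler_norm (- a); rewrite normrN; lra.
have ga : g a = 0 by rewrite /g (fM _ ord0)// cons0.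
have -> : `|g s|%:E = (`|\int[leb1]_(t in `[a, s]) (g' t)%:E|)%E.
  by rewrite line_FTC// ga sube0.
have mg' : measurable_fun setT g' by exact: continuous_measurable_fun.
apply: le_trans (le_abse_integral _ _ _) _ => //.
  by apply/measurable_EFinP; exact: measurable_funTS.
apply: ge0_subset_integral => //.
by apply/measurable_EFinP; exact: measurableT_comp.
Qed.

End line.

(** Integration by parts in disguise: applied to a product it moves a derivative from one factor to
    the other. The first coordinate is handled line by line, the others by induction on slices. *)
Lemma integral_partial0 n (f : 'rV[R]_n -> R) i : C1c f ->
  (\int[leb n]_x (partial i f x)%:E = 0)%E.
Proof.
elim: n f i => [|n ih] f i fc; first by case: i.
have ic := C0c_integrable (C0c_partial i fc).
have mc : measurable_fun setT (EFin \o partial i f) by exact: measurable_int ic.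
have [j ij|i0] := unliftP ord0 i.
  rewrite (fubini_consL mc ic) integral0_eq// => x _.
  rewrite ij -[RHS](ih (fun v => f (row_cons x v)) j); last exact: C1c_slice.
  by apply: eq_integral => v _; rewrite /= (derivable_cons f x v j).2.
rewrite (fubini_consR mc ic) integral0_eq// => v _.
by rewrite i0; exact: line_integral0.
Qed.

End compact_support.

Section sobolev_inequalities.
Context (R : realType).
Local Notation leb n := (lebesgue_rV R n).
Local Notation leb1 := (@lebesgue_measure R).
Local Notation nm f := (L2norm setT f).

Lemma C0c_L2 n (f : 'rV[R]_n -> R) : C0c f -> L2 setT f.
Proof.
move=> fc; split; first exact: C0c_measurable.
have := C0c_integrable (C0cM fc fc.1) => /integrableP[_].
apply: le_lt_trans; rewrite le_eqVlt; apply/orP; left; apply/eqP.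
by apply: eq_integral => x _; rewrite /= fctE -expr2 ger0_norm// sqr_ge0.
Qed.

Lemma C0c_abs_fin n (f : 'rV[R]_n -> R) : C0c f ->
  (\int[leb n]_x `|f x|%:E)%E \is a fin_num.
Proof.
move=> fc; rewrite ge0_fin_numE; last by apply: integral_ge0 => x _; rewrite lee_fin.
by have /integrableP[] := C0c_integrable fc.
Qed.

Lemma C0c_mul_abs_le n (f g : 'rV[R]_n -> R) : C0c f -> C0c g ->
  (\int[leb n]_x `|f x * g x|%:E <= (nm f * nm g)%:E)%E.
Proof. by move=> fc gc; apply: L2_mul_integral => //; exact: C0c_L2. Qed.

Lemma partial_sqr n (f : 'rV[R]_n -> R) i : C1c f ->
  partial i (f * f) = 2 *: (f * partial i f).
Proof.
move=> [_ df _]; rewrite partialM//; apply/funext => x.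
by rewrite [RHS](_ : _ = 2 * (f x * partial i f x))// !fctE mulrC -mulr2n mulr_natl.
Qed.

Lemma integral_partial_sqr_le n (f : 'rV[R]_n -> R) i : C1c f ->
  (\int[leb n]_x `|partial i (f * f) x|%:E <= (2 * nm f * nm (partial i f))%:E)%E.
Proof.
move=> fc; have [cf _ _] := fc; have pc := C0c_partial i fc.
rewrite (eq_integral (fun x => 2%:E * `|f x * partial i f x|%:E)%E); last first.
  move=> x _; rewrite partial_sqr// [X in `|X|](_ : _ = 2 * (f x * partial i f x))//.
  by rewrite normrM ger0_norm.
rewrite ge0_integralZl_EFin//.
- by rewrite -mulrA EFinM lee_wpmul2l// C0c_mul_abs_le.
- apply/measurable_EFinP; apply: measurableT_comp => //.
  by apply: measurable_funM; exact: C0c_measurable.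
Qed.

(** On each line [f^2] is at most the integral of [|d_0 (f^2)|], and it is nonzero only on a segment
    of length [2 * M]. Integrating gives [|f|^2 <= 2 M * 2 |f| |d_0 f|], and one factor [|f|]
    cancels. *)
Lemma poincare_C1c n (f : 'rV[R]_n.+1 -> R) (M : R) : 0 <= M -> C1c f ->
  (forall x : 'rV[R]_n.+1, M < `|x ord0 ord0| -> f x = 0) -> nm f <= 4 * M * nm (partial ord0 f).
Proof.
move=> M0 fc fM; have [cf _ _] := fc; have ffc := C1cM fc fc.
have pc := C0c_partial ord0 ffc.
have mp : measurable_fun setT (fun x => `|partial ord0 (f * f) x|%:E : \bar R).
  by apply/measurable_EFinP; apply: measurableT_comp => //; exact: C0c_measurable.
have mf2 : measurable_fun setT (fun x => (f x ^+ 2)%:E : \bar R).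
  by apply/measurable_EFinP; apply: measurable_funX; exact: C0c_measurable.
have [|n0] := eqVneq (nm f) 0.
  by move=> ->; rewrite !mulr_ge0// sqrtr_ge0.
have npos : 0 < nm f by rewrite lt_def n0 sqrtr_ge0.
suff H : nm f ^+ 2 <= 2 * M * (2 * nm f * nm (partial ord0 f)).
  rewrite -(ler_pM2l npos) -expr2; apply: le_trans H _.
  by rewrite le_eqVlt; apply/orP; left; apply/eqP; ring.
rewrite -lee_fin -L2_integral//; last exact: C0c_L2.
rewrite tonelli_consR//; last by move=> x; rewrite lee_fin sqr_ge0.
apply: (@le_trans _ _ ((2 * M)%:E *
   \int[leb n]_v \int[leb1]_s `|partial ord0 (f * f) (row_cons s v)|%:E)%E); last first.
  rewrite [leRHS]EFinM lee_wpmul2l ?lee_fin ?mulr_ge0// -(tonelli_consR mp)//.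
  exact: integral_partial_sqr_le.
rewrite -ge0_integralZl_EFin ?mulr_ge0//; last 2 first.
- by move=> v _; apply: integral_ge0 => s _.
- exact: (measurable_integral_consL mp).
apply: ge0_le_integral => //.
- by move=> v _; apply: integral_ge0 => s _; rewrite lee_fin sqr_ge0.
- by apply: (measurable_integral_consL mf2) => x; rewrite lee_fin sqr_ge0.
- apply: emeasurable_funM; first exact: measurable_cst.
  exact: (measurable_integral_consL mp).
move=> v _.
apply: (@le_trans _ _ (\int[leb1]_(t in `[(- M)%R, M])
   cst (\int[leb1]_s `|partial ord0 (f * f) (row_cons s v)|%:E) t)%E).
  rewrite [leRHS]integral_mkcond; apply: ge0_integral_mono.
    by move=> t; rewrite lee_fin sqr_ge0.
  move=> t; rewrite patchE; case: ifPn => [_|].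
    have := line_le ffc v t; apply: le_trans.
    by rewrite fctE -expr2 ger0_norm// sqr_ge0.
  rewrite notin_setE/= in_itv/= -ler_norml => /negP; rewrite -ltNge => Mt.
  by rewrite fM ?cons0// expr0n.
rewrite integral_cst//= lebesgue_measure_itv/= muleC.
case: ifPn => _; last by rewrite mul0e mule_ge0 ?lee_fin ?mulr_ge0// integral_ge0.
by rewrite -EFinD opprK -mulr2n mulr_natl.
Qed.

Lemma line_le1 (f : 'rV[R]_1 -> R) v : C1c f ->
  (`|f v|%:E <= \int[leb 1]_x `|partial ord0 f x|%:E)%E.
Proof.
move=> fc.
have mp : measurable_fun setT (fun x => `|partial ord0 f x|%:E : \bar R).
  apply/measurable_EFinP; apply: measurableT_comp => //.
  by apply: C0c_measurable; exact: C0c_partial.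
(* The iterated measure starts from the Dirac mass at the only vector of length 0, so the outer
   integral is a single value. *)
rewrite tonelli_consR//= integral_dirac//; last exact: (measurable_integral_consL mp).
rewrite diracE in_setT mul1e.
have -> : v = row_cons (v ord0 ord0) 0 by apply: eq_row_cons => [|[]//]; rewrite cons0.
exact: line_le.
Qed.

(** Separation of variables: [|u|] is bounded by an integral along the first coordinate, which
    depends only on the second, and [|w|] by an integral along the second, which depends only on the
    first. *)
Lemma integral_mul2_le (u w : 'rV[R]_2 -> R) : C1c u -> C1c w ->
  (\int[leb 2]_x `|u x * w x|%:E <=
   (\int[leb 2]_x `|partial ord0 u x|%:E) * \int[leb 2]_x `|partial (lift ord0 ord0) w x|%:E)%E.
Proof.
move=> uc wc.
have mabs (h : 'rV[R]_2 -> R) : C0c h -> measurable_fun setT (fun x => `|h x|%:E : \bar R).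
  by move=> hc; apply/measurable_EFinP; apply: measurableT_comp => //; exact: C0c_measurable.
have [cu _ _] := uc; have [cw _ _] := wc.
have muw : measurable_fun setT (fun x => `|u x * w x|%:E : \bar R).
  by apply: (mabs (u * w)); exact: C0cM cw.1.
have mu0 := mabs _ (C0c_partial ord0 uc).
have mw1 := mabs _ (C0c_partial (lift ord0 ord0) wc).
rewrite tonelli_consL// (tonelli_consR mu0)// (tonelli_consL mw1)//.
pose G (v : 'rV[R]_1) : \bar R := (\int[leb1]_x `|partial ord0 u (row_cons x v)|%:E)%E.
pose A x : \bar R := (\int[leb 1]_v `|partial (lift ord0 ord0) w (row_cons x v)|%:E)%E.
have G0 v : (0 <= G v)%E by apply: integral_ge0.
have A0 x : (0 <= A x)%E by apply: integral_ge0.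
have mG : measurable_fun setT G by exact: (measurable_integral_consL mu0).
have mA : measurable_fun setT A by exact: (measurable_integral_consR mw1).
rewrite -[X in (_ <= X * _)%E]/(\int[leb 1]_v G v)%E.
rewrite -[X in (_ <= _ * X)%E]/(\int[leb1]_x A x)%E.
rewrite -ge0_integralZl//; last by apply: integral_ge0.
apply: ge0_le_integral => //.
- by move=> x _; apply: integral_ge0.
- exact: (measurable_integral_consR muw).
- by apply: emeasurable_funM; [exact: measurable_cst|exact: mA].
move=> x _; rewrite muleC -ge0_integralZl//.
apply: ge0_le_integral => //.
- exact: (measurable_cons_slice muw x).
- by apply: emeasurable_funM; [exact: measurable_cst|exact: mG].
move=> v _; rewrite normrM EFinM muleC; apply: lee_pmul => //.
  apply: le_trans (line_le1 v (C1c_slice x wc)) _.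
  rewrite le_eqVlt; apply/orP; left; apply/eqP; apply: eq_integral => z _.
  by rewrite (derivable_cons w x z ord0).2.
exact: line_le.
Qed.

End sobolev_inequalities.

(** * The L2 norm of a product in dimensions two and three *)

Section key_inequality.
Context (R : realType).
Local Notation leb n := (lebesgue_rV R n).
Local Notation leb1 := (@lebesgue_measure R).
Local Notation nm f := (L2norm setT f).

(** Ladyzhenskaya's argument: [integral_mul2_le] applied to [w^2] and [v^2] bounds the left side by
    [4 |w| W |v| V]. The Poincare inequality then replaces [|v|] by [4 * M * V]. *)
Lemma L2norm_mul_le2 (w v : 'rV[R]_2 -> R) (M W V : R) : 0 <= M -> C1c w -> C1c v ->
  (forall x : 'rV[R]_2, M < `|x ord0 ord0| -> v x = 0) ->
  (forall i, nm (partial i w) <= W) -> (forall i, nm (partial i v) <= V) ->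
  nm (w * v) ^+ 2 <= 16 * M * nm w * W * V ^+ 2.
Proof.
move=> M0 wc vc vM hW hV.
have W0 : 0 <= W := le_trans (sqrtr_ge0 _) (hW ord0).
have V0 : 0 <= V := le_trans (sqrtr_ge0 _) (hV ord0).
have [cw _ _] := wc; have [cv _ _] := vc.
have Lwv : L2 setT (w * v) by apply/C0c_L2/C0cM => //; exact: cv.1.
have h : nm (w * v) ^+ 2 <= (2 * nm w * W) * (2 * nm v * V).
  rewrite -lee_fin -L2_integral//.
  apply: (@le_trans _ _ (\int[leb 2]_x `|(w * w) x * (v * v) x|%:E)%E).
    rewrite le_eqVlt; apply/orP; left; apply/eqP; apply: eq_integral => x _.
    by rewrite !fctE -!expr2 -exprMn ger0_norm// sqr_ge0.
  apply: le_trans (integral_mul2_le (C1cM wc wc) (C1cM vc vc)) _.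
  rewrite EFinM; apply: lee_pmul; try by apply: integral_ge0 => x _; rewrite lee_fin.
    apply: le_trans (integral_partial_sqr_le ord0 wc) _.
    by rewrite lee_fin ler_wpM2l// mulr_ge0// sqrtr_ge0.
  apply: le_trans (integral_partial_sqr_le _ vc) _.
  by rewrite lee_fin ler_wpM2l// mulr_ge0// sqrtr_ge0.
apply: le_trans h _.
have hv : nm v <= 4 * M * V.
  apply: le_trans (poincare_C1c M0 vc vM) _.
  by rewrite ler_wpM2l// mulr_ge0.
have -> : 16 * M * nm w * W * V ^+ 2 = (2 * nm w * W) * (2 * (4 * M * V) * V) by ring.
rewrite ler_wpM2l ?mulr_ge0// ?sqrtr_ge0//.
by rewrite ler_wpM2r// ler_wpM2l.
Qed.

Lemma C0c_line_fin n (h : 'rV[R]_n.+1 -> R) v : C0c h ->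
  (\int[leb1]_t `|h (row_cons t v)|%:E)%E \is a fin_num.
Proof.
move=> hc; have [ch [N hN]] := hc.
have cg : continuous (fun t : R => h (row_cons t v)).
  move=> t; apply: (@continuous_comp _ _ _ (fun t : R => row_cons t v)).
    exact: continuous_consL.
  exact: ch.
have /integrableP[_] : leb1.-integrable `[- N, N] (EFin \o (fun t => h (row_cons t v))).
  apply: continuous_compact_integrable; first exact: segment_compact.
  exact: continuous_subspaceT.
rewrite ge0_fin_numE; last by apply: integral_ge0 => x _; rewrite lee_fin.
rewrite integral_mkcond; apply: le_lt_trans; apply: ge0_integral_mono => //.
move=> t; rewrite patchE; case: ifPn => //.
rewrite notin_setE/= in_itv/= -ler_norml => /negP; rewrite -ltNge => Lt.
by rewrite (hN _ ord0) ?cons0// normr0.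
Qed.

Lemma partial_pow4 n (f : 'rV[R]_n -> R) i : C1c f ->
  partial i ((f * f) * (f * f)) = 4 *: ((f * f * f) * partial i f).
Proof.
move=> fc; rewrite partial_sqr; last exact: C1cM.
rewrite partial_sqr//; apply/funext => x.
rewrite [RHS](_ : _ = 4 * (f x * f x * f x * partial i f x))//.
rewrite [LHS](_ : _ = 2 * (f x * f x * (2 * (f x * partial i f x))))//.
ring.
Qed.

Lemma measurable_sqrt_fine dsp (Y : measurableType dsp) (F : Y -> \bar R) :
  measurable_fun setT F -> measurable_fun setT (fun x => Num.sqrt (fine (F x))).
Proof.
move=> mF; apply: (@measurableT_comp _ _ _ _ _ _ (@Num.sqrt R)).
  by apply: continuous_measurable_fun; exact: sqrt_continuous.
exact: (measurableT_comp (fine_measurable measurableT) mF).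
Qed.

(* Gagliardo-Nirenberg-Sobolev: the L6 norm is controlled by the gradient. *)
Lemma L2norm_cube_le (f : 'rV[R]_3 -> R) (D : R) : C1c f ->
  (forall i, nm (partial i f) <= D) -> nm (f * f * f) <= 64 * D ^+ 3.
Proof.
move=> fc hD.
have D0 : 0 <= D := le_trans (sqrtr_ge0 _) (hD ord0).
pose S := nm (f * f * f); have S0 : 0 <= S by exact: sqrtr_ge0.
(* [P] bounds the integral of each [|d_i (f^4)| = 4 |f^3| |d_i f|] by Cauchy-Schwarz. The unknown
   [S] itself occurs in it, and the argument closes by solving for [S]. *)
pose P := 4 * S * D; have P0 : 0 <= P by rewrite /P !mulr_ge0.
have ffc := C1cM fc fc.
pose u := (f * f) * (f * f); have uc : C1c u by exact: C1cM.
have [cu _ _] := uc.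
have f3c : C0c (f * f * f) by case: (C1cM ffc fc).
have Gam i : (\int[leb 3]_x `|partial i u x|%:E <= P%:E)%E.
  rewrite (eq_integral (fun x => 4%:E * `|(f * f * f) x * partial i f x|%:E)%E); last first.
    move=> x _; rewrite partial_pow4//.
    rewrite [X in `|X|](_ : _ = 4 * ((f * f * f) x * partial i f x))//.
    by rewrite normrM ger0_norm.
  rewrite ge0_integralZl_EFin//; last first.
    apply/measurable_EFinP; apply: measurableT_comp => //.
    by apply: measurable_funM; apply: C0c_measurable => //; exact: C0c_partial.
  rewrite (_ : P = 4 * (S * D)); last by rewrite /P mulrA.
  rewrite [leRHS]EFinM lee_wpmul2l//.
  apply: le_trans (C0c_mul_abs_le f3c (C0c_partial i fc)) _.
  by rewrite lee_fin ler_wpM2l.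
have mabs i : measurable_fun setT (fun x => `|partial i u x|%:E : \bar R).
  apply/measurable_EFinP; apply: measurableT_comp => //.
  by apply: C0c_measurable; exact: C0c_partial.
pose i1 : 'I_3 := lift ord0 ord0; pose i2 : 'I_3 := lift ord0 (lift ord0 ord0).
pose G (v : 'rV[R]_2) : \bar R := (\int[leb1]_x `|partial ord0 u (row_cons x v)|%:E)%E.
pose A i (x : measurableTypeR R) : \bar R := (\int[leb 2]_v `|partial i u (row_cons x v)|%:E)%E.
have G0 v : (0 <= G v)%E by apply: integral_ge0.
have A0 i x : (0 <= A i x)%E by apply: integral_ge0.
have mG : measurable_fun setT G by exact: (measurable_integral_consL (mabs ord0)).
have mA i : measurable_fun setT (A i) by exact: (measurable_integral_consR (mabs i)).
have Gfin v : G v \is a fin_num by apply: C0c_line_fin; exact: C0c_partial.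
have Afin i x : A i x \is a fin_num.
  by apply: (C0c_abs_fin (C0c_slice x (C0c_partial i uc))).
have IG : (\int[leb 2]_v G v <= P%:E)%E.
  by rewrite -[X in (X <= _)%E](tonelli_consR (mabs ord0)).
have IA i : (\int[leb1]_x A i x <= P%:E)%E.
  by rewrite -[X in (X <= _)%E](tonelli_consL (mabs i)).
have uG x v : (`|u (row_cons x v)|%:E <= G v)%E by exact: line_le.
have IuA x : (\int[leb 2]_v (u (row_cons x v) ^+ 2)%:E <= A i1 x * A i2 x)%E.
  have uxc := C1c_slice x uc.
  apply: (@le_trans _ _ (\int[leb 2]_v `|u (row_cons x v) * u (row_cons x v)|%:E)%E).
    rewrite le_eqVlt; apply/orP; left; apply/eqP; apply: eq_integral => v _.
    by rewrite -expr2 ger0_norm// sqr_ge0.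
  have E j : (\int[leb 2]_v `|partial j (fun v => u (row_cons x v)) v|%:E = A (lift ord0 j) x)%E.
    by apply: eq_integral => v _; rewrite (derivable_cons u x v j).2.
  have E1 : A i1 x = _ := esym (E ord0).
  have E2 : A i2 x = _ := esym (E (lift ord0 ord0)).
  by rewrite E1 E2; exact: integral_mul2_le.
clearbody G A.
pose g v := Num.sqrt (fine (G v)); pose a i (x : measurableTypeR R) := Num.sqrt (fine (A i x)).
have mg : measurable_fun setT g by exact: measurable_sqrt_fine.
have ma i : measurable_fun setT (a i) by exact: measurable_sqrt_fine.
have g0 v : 0 <= g v by exact: sqrtr_ge0.
have a0 i x : 0 <= a i x by exact: sqrtr_ge0.
have gE v : (g v ^+ 2)%:E = G v by rewrite sqr_sqrtr ?fine_ge0// fineK.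
have aE i x : (a i x ^+ 2)%:E = A i x by rewrite sqr_sqrtr ?fine_ge0// fineK.
clearbody a g.
pose r := Num.sqrt P; have r0 : 0 <= r by exact: sqrtr_ge0.
have rP : r ^+ 2 = P by rewrite sqr_sqrtr.
have Ig : (\int[leb 2]_v (g v ^+ 2)%:E <= (r ^+ 2)%:E)%E.
  have -> : (\int[leb 2]_v (g v ^+ 2)%:E = \int[leb 2]_v G v)%E.
    by apply: eq_integral => v _; rewrite gE.
  by rewrite rP.
have Ia i : (\int[leb1]_x (a i x ^+ 2)%:E <= (r ^+ 2)%:E)%E.
  have -> : (\int[leb1]_x (a i x ^+ 2)%:E = \int[leb1]_x A i x)%E.
    by apply: eq_integral => x _; rewrite aE.
  by rewrite rP.
have Iu x : (\int[leb 2]_v (u (row_cons x v) ^+ 2)%:E <= ((a i1 x * a i2 x) ^+ 2)%:E)%E.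
  by rewrite exprMn EFinM !aE; exact: IuA.
have rz0 : P = 0 -> r = 0 by move=> P00; rewrite /r P00 sqrtr0.
clearbody r.
(* Write [f^6 = f^2 u] with [u = f^4]. Along the first coordinate [f^2 <= g]; on a slice the
   two-dimensional inequality bounds the L2 norm of [u] by [a i1 x * a i2 x]. Cauchy-Schwarz in [v]
   and then in [x] produces three factors, each at most [r = P^(1/2)]. *)
have S2 : S ^+ 2 <= r * (r * r).
  rewrite -lee_fin -L2_integral//; last exact: C0c_L2.
  have m6 : measurable_fun setT (fun x => ((f * f * f) x ^+ 2)%:E : \bar R).
    by apply/measurable_EFinP; apply: measurable_funX; exact: C0c_measurable.
  rewrite (tonelli_consL m6)//; last by move=> x; rewrite lee_fin sqr_ge0.
  apply: (@le_trans _ _ (\int[leb1]_x (r%:E * `|a i1 x * a i2 x|%:E))%E); last first.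
    rewrite ge0_integralZl_EFin//; last first.
      by apply/measurable_EFinP; apply: measurableT_comp => //;
      exact: (measurable_funM (ma i1) (ma i2)).
    rewrite [leRHS]EFinM lee_wpmul2l//.
    have h := integral_mul_le measurableT (ma i1) (ma i2) r0 r0 (Ia i1) (Ia i2).
    exact: h.
  apply: ge0_le_integral => //.
  - by move=> x _; apply: integral_ge0 => v _; rewrite lee_fin sqr_ge0.
  - by apply: (measurable_integral_consR m6) => x; rewrite lee_fin sqr_ge0.
  - apply: emeasurable_funM; first exact: measurable_cst.
    apply/measurable_EFinP; apply: measurableT_comp => //.
    exact: (measurable_funM (ma i1) (ma i2)).
  move=> x _; rewrite ger0_norm ?mulr_ge0// -EFinM.
  apply: le_trans (integral_mul_le measurableT mg _ r0 _ Ig (Iu x)); last 2 first.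
  - by apply: C0c_measurable; exact: C0c_slice.
  - by rewrite mulr_ge0.
  apply: ge0_integral_mono => v; first by rewrite lee_fin sqr_ge0.
  rewrite lee_fin normrM ger0_norm//.
  have uE : u (row_cons x v) = (f (row_cons x v) ^+ 2) ^+ 2 by rewrite /u !fctE; ring.
  rewrite uE (ger0_norm (sqr_ge0 (f (row_cons x v) ^+ 2))).
  rewrite [leLHS](_ : _ = f (row_cons x v) ^+ 2 * (f (row_cons x v) ^+ 2) ^+ 2); last first.
    by rewrite !fctE; ring.
  rewrite ler_wpM2r ?sqr_ge0//.
  rewrite -(@ler_pXn2r _ 2)// ?nnegrE ?sqr_ge0// -uE -lee_fin gE.
  by apply: le_trans (uG x v); rewrite lee_fin ler_norm.
rewrite -/S.
have [Dz|Dn] := eqVneq D 0.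
  have rz : r = 0 by apply: rz0; rewrite /P Dz mulr0.
  move: S2; rewrite rz !mul0r Dz expr0n mulr0 => S2.
  have : S ^+ 2 == 0 by rewrite eq_le S2 sqr_ge0.
  by rewrite sqrf_eq0 => /eqP ->.
have Dp : 0 < D by rewrite lt_def Dn.
have [rz|rn] := eqVneq r 0.
  move: S2; rewrite rz !mul0r => S2.
  have : S ^+ 2 == 0 by rewrite eq_le S2 sqr_ge0.
  by rewrite sqrf_eq0 => /eqP ->; rewrite mulr_ge0// exprn_ge0.
have rp : 0 < r by rewrite lt_def rn.
(* Since [r^2 = 4 S D], the bound [S^2 <= r^3] becomes [r^4 <= 16 D^2 r^3], that is [r <= 16 D^2],
   and squaring yields [S <= 64 D^3]. *)
have r4 : r ^+ 3 * r <= r ^+ 3 * (16 * D ^+ 2).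
  have -> : r ^+ 3 * r = 16 * D ^+ 2 * S ^+ 2.
    by rewrite (_ : r ^+ 3 * r = (r ^+ 2) ^+ 2); [rewrite rP /P; ring|ring].
  rewrite [leRHS](_ : _ = 16 * D ^+ 2 * (r * (r * r))); last by ring.
  by rewrite ler_wpM2l// mulr_ge0// sqr_ge0.
rewrite ler_pM2l ?exprn_gt0// in r4.
have r2 : r ^+ 2 <= (16 * D ^+ 2) ^+ 2.
  by rewrite ler_sqr ?nnegrE// mulr_ge0// sqr_ge0.
rewrite rP /P in r2.
rewrite -(ler_pM2r (mulr_gt0 (ltr0n _ 4) Dp)).
apply: le_trans (_ : 4 * S * D <= _); first by rewrite le_eqVlt; apply/orP; left; apply/eqP; ring.
apply: le_trans r2 _; rewrite le_eqVlt; apply/orP; left; apply/eqP; ring.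
Qed.

(** Cauchy-Schwarz in the form [|w v|^2 <= |w| |w v^2|], after which the last factor is controlled
    by the norms of [w^3] and [v^3]. This mixes two L6 norms without Holder's inequality: a weighted
    Young inequality does the same once [W] and [V] are taken as weights. *)
Lemma L2norm_mul_le3 (w v : 'rV[R]_3 -> R) (W V : R) : 0 < W -> 0 < V -> C1c w -> C1c v ->
  (forall i, nm (partial i w) <= W) -> (forall i, nm (partial i v) <= V) ->
  nm (w * v) ^+ 2 <= 128 * nm w * W * V ^+ 2.
Proof.
move=> W0 V0 wc vc hW hV.
have [cw _ _] := wc; have [cv _ _] := vc.
have cwv : C0c (w * v) by apply: C0cM => //; exact: cv.1.
have cwvv : C0c (w * v * v) by apply: C0cM => //; exact: cv.1.
have w3c : C0c (w * w * w) by case: (C1cM (C1cM wc wc) wc).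
have v3c : C0c (v * v * v) by case: (C1cM (C1cM vc vc) vc).
have h1 : nm (w * v) ^+ 2 <= nm w * nm (w * v * v).
  rewrite -lee_fin -L2_integral//; last exact: C0c_L2.
  apply: le_trans (C0c_mul_abs_le cw cwvv).
  rewrite le_eqVlt; apply/orP; left; apply/eqP; apply: eq_integral => x _.
  rewrite !fctE (_ : _ * (_ * _ * _) = (w x * v x) ^+ 2); last by ring.
  by rewrite ger0_norm// sqr_ge0.
have h2 : nm (w * v * v) ^+ 2 <=
    V ^+ 4 / W ^+ 4 * nm (w * w * w) ^+ 2 + W ^+ 2 / V ^+ 2 * nm (v * v * v) ^+ 2.
  rewrite -lee_fin -L2_integral//; last exact: C0c_L2.
  have c1 : 0 <= V ^+ 4 / W ^+ 4 by rewrite divr_ge0// exprn_ge0// ltW.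
  have c2 : 0 <= W ^+ 2 / V ^+ 2 by rewrite divr_ge0// exprn_ge0// ltW.
  have msq (h : 'rV[R]_3 -> R) : C0c h -> measurable_fun setT (fun x => (h x ^+ 2)%:E : \bar R).
    by move=> hc; apply/measurable_EFinP; apply: measurable_funX; exact: C0c_measurable.
  have e0 (h : 'rV[R]_3 -> R) x : (0 <= (h x ^+ 2)%:E)%E by rewrite lee_fin sqr_ge0.
  rewrite EFinD !(EFinM _ (_ ^+ 2)) -!L2_integral//; try exact: C0c_L2.
  rewrite -!ge0_integralZl_EFin//; try exact: msq.
  rewrite -ge0_integralD//; last 4 first.
  - by move=> x _; rewrite mule_ge0.
  - by apply: emeasurable_funM; [exact: measurable_cst|exact: msq].
  - by move=> x _; rewrite mule_ge0.
  - by apply: emeasurable_funM; [exact: measurable_cst|exact: msq].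
  apply: ge0_integral_mono => x //.
  rewrite -!EFinM -EFinD lee_fin !fctE.
  (* In these normalized variables the pointwise inequality is just [a b^2 <= a^3 + b^3]. *)
  pose a := (w x / W) ^+ 2; pose b := (v x / V) ^+ 2.
  have a0 : 0 <= a by exact: sqr_ge0.
  have b0 : 0 <= b by exact: sqr_ge0.
  have wx : w x ^+ 2 = a * W ^+ 2 by rewrite /a; field; rewrite gt_eqF.
  have vx : v x ^+ 2 = b * V ^+ 2 by rewrite /b; field; rewrite gt_eqF.
  rewrite (_ : _ ^+ 2 = w x ^+ 2 * (v x ^+ 2) ^+ 2); last by ring.
  rewrite (_ : (w x * w x * w x) ^+ 2 = (w x ^+ 2) ^+ 3); last by ring.
  rewrite (_ : (v x * v x * v x) ^+ 2 = (v x ^+ 2) ^+ 3); last by ring.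
  rewrite wx vx.
  rewrite [leRHS](_ : _ = (W ^+ 2 * V ^+ 4) * (a ^+ 3 + b ^+ 3)); last first.
    by field; rewrite !gt_eqF.
  rewrite [leLHS](_ : _ = (W ^+ 2 * V ^+ 4) * (a * b ^+ 2)); last by ring.
  apply: ler_wpM2l; first by rewrite mulr_ge0 ?exprn_ge0 ?ltW.
  clearbody a b.
  have a30 : 0 <= a ^+ 3 by exact: exprn_ge0.
  have b30 : 0 <= b ^+ 3 by exact: exprn_ge0.
  have [ab|/ltW ba] := leP a b.
    have : a * b ^+ 2 <= b ^+ 3 by rewrite [leRHS]exprS ler_wpM2r// sqr_ge0.
    by move=> h; apply: le_trans h _; rewrite lerDr.
  have : a * b ^+ 2 <= a ^+ 3 by rewrite [leRHS]exprS ler_wpM2l// ler_sqr ?nnegrE.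
  by move=> h; apply: le_trans h _; rewrite lerDl.
have hw3 := L2norm_cube_le wc hW; have hv3 := L2norm_cube_le vc hV.
have sq (x y : R) : 0 <= x -> x <= y -> x ^+ 2 <= y ^+ 2.
  by move=> x0 xy; rewrite ler_sqr// nnegrE// (le_trans x0).
have h3 : nm (w * v * v) ^+ 2 <= (128 * (W * V ^+ 2)) ^+ 2.
  apply: le_trans h2 _.
  apply: (@le_trans _ _ (V ^+ 4 / W ^+ 4 * (64 * W ^+ 3) ^+ 2 + W ^+ 2 / V ^+ 2 * (64 * V ^+ 3) ^+ 2)).
    apply: lerD; (apply: ler_wpM2l; first by rewrite divr_ge0 ?exprn_ge0 ?ltW);
      apply: sq => //; exact: sqrtr_ge0.
  (* Both summands equal [64^2 (W V^2)^2]. Their sum, with constant 8192, is below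
     [128^2 (W V^2)^2], a perfect square. *)
  rewrite [leLHS](_ : _ = 8192 * (W * V ^+ 2) ^+ 2); last first.
    by field; rewrite !gt_eqF.
  rewrite [leRHS]exprMn ler_wpM2r ?sqr_ge0//.
  rewrite -natrX ler_nat//.
have h4 : nm (w * v * v) <= 128 * (W * V ^+ 2).
  have p0 : 0 <= 128 * (W * V ^+ 2) by rewrite mulr_ge0// mulr_ge0 ?sqr_ge0// ltW.
  by rewrite -ler_sqr ?nnegrE ?sqrtr_ge0.
apply: le_trans h1 _.
rewrite [leRHS](_ : _ = nm w * (128 * (W * V ^+ 2))); last by ring.
by rewrite ler_wpM2l// sqrtr_ge0.
Qed.

End key_inequality.

(** * Weak derivatives and the space H10 *)

Section weak_derivatives.
Context (R : realType) (d : nat) (Om : set 'rV[R]_d) (oOm : open Om).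
Local Notation leb := (lebesgue_rV R d).
Local Notation L2 := (L2 Om).
Local Notation ip := (ip Om).
Local Notation nm := (L2norm Om).
Local Notation test := (test_function Om).
Local Notation wD := (wD Om).
Local Notation aeq := (aeq Om).
Implicit Types f g phi : 'rV[R]_d -> R.

Let mOm : measurable Om := open_measurable_rV oOm.
Let S := ip_semi_ip mOm.

Lemma L2normZ a f : L2 f -> nm (a *: f) = `|a| * nm f.
Proof. exact: (sip_normZ S). Qed.

Lemma test_C1c phi : test phi -> C1c phi.
Proof.
move=> tp; have [Cp [K [cK KO pK]]] := tp; split.
- split; first exact: test_continuous tp.
  have [M [_ HM]] := compact_bounded cK.
  exists (M + 1) => x i Mx; apply: pK => Kx.
  have : `|x ord0 i| <= M + 1.
    apply: le_trans (HM (M + 1) _ x Kx); last by rewrite ltrDl.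
    rewrite [leRHS]/Num.norm /= mx_normrE; apply/bigmax_geP; right => /=.
    by exists (ord0, i).
  by rewrite leNgt Mx.
- by move=> i x; exact: test_derivable tp.
- by move=> i; exact: test_continuous (test_partial i tp).
Qed.

Lemma ip_setT f g : (forall x, ~ Om x -> f x = 0) -> ip f g = Defs.ip setT f g.
Proof.
move=> f0; rewrite /Defs.ip /Rintegral; congr fine.
rewrite integral_mkcond; apply: eq_integral => x _; rewrite patchE; case: ifPn => //.
by rewrite notin_setE => /f0 ->; rewrite mul0r.
Qed.

Lemma L2norm_setT f : (forall x, ~ Om x -> f x = 0) -> nm f = L2norm setT f.
Proof. by move=> f0; rewrite /L2norm ip_setT. Qed.

Lemma test_L2 phi : test phi -> L2 phi.
Proof.
move=> tp; have [mp p2] := C0c_L2 (let: And3 h _ _ := test_C1c tp in h); split.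
  exact: measurable_funTS.
apply: le_lt_trans p2; apply: ge0_subset_integral => //.
- by apply/measurable_EFinP; exact: measurable_funX.
- by move=> x _; rewrite lee_fin sqr_ge0.
Qed.

Lemma L2norm_le f g : L2 f -> L2 g -> (forall x, Om x -> `|f x| <= `|g x|) -> nm f <= nm g.
Proof.
move=> Lf Lg fg; rewrite -ler_sqr ?nnegrE ?sqrtr_ge0// -lee_fin -!L2_integral//.
have [mf _] := Lf; have [mg _] := Lg.
apply: ge0_le_integral => //.
- by move=> x _; rewrite lee_fin sqr_ge0.
- by apply/measurable_EFinP; exact: measurable_funX.
- by apply/measurable_EFinP; exact: measurable_funX.
- move=> x Ox; rewrite lee_fin -(real_normK (num_real (f x))) -(real_normK (num_real (g x))).
  by rewrite ler_sqr ?nnegrE ?normr_ge0// fg.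
Qed.

Lemma L2_aeq_norm f g : L2 f -> L2 g -> aeq f g -> nm f = nm g.
Proof.
move=> Lf Lg fg; rewrite /L2norm; congr Num.sqrt.
by rewrite (ip_aeql mOm Lf Lg)// (sipC S)// (ip_aeql mOm Lf Lg).
Qed.

Lemma ip_aeqr f g h : L2 f -> L2 g -> L2 h -> aeq f g -> ip h f = ip h g.
Proof. by move=> Lf Lg Lh fg; rewrite !(sipC S Lh)//; exact: ip_aeql. Qed.

Lemma ip_test_partial i phi psi : test phi -> test psi ->
  ip phi (partial i psi) = - ip (partial i phi) psi.
Proof.
move=> tp ts.
have Lp := test_L2 tp; have Ls := test_L2 ts.
have Lpi := test_L2 (test_partial i tp); have Lsi := test_L2 (test_partial i ts).
apply/eqP; rewrite -addr_eq0 /Defs.ip -RintegralD//; try exact: L2_mul_integrable.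
apply/eqP; rewrite (@eq_Rintegral _ _ _ _ _ (partial i (phi * psi))); last first.
  by move=> x _; rewrite (test_partialM i tp ts) !fctE.
have tps := testM tp ts.
rewrite /Rintegral -[RHS]/(fine 0%E); congr fine.
rewrite -[RHS](integral_partial0 i (test_C1c tps)) integral_mkcond.
apply: eq_integral => x _; rewrite patchE; case: ifPn => //.
by rewrite notin_setE => /(test_supp0 (test_partial i tps)) ->.
Qed.

Lemma test_weak_partial i phi : test phi -> weak_partial Om i phi (partial i phi).
Proof.
move=> tp; split; first exact/test_L2/test_partial.
by move=> psi ts; exact: ip_test_partial.
Qed.

Lemma weak_partial_uniq i f g g' : weak_partial Om i f g -> weak_partial Om i f g' ->
  aeq g g'.
Proof.
move=> [Lg Hg] [Lg' Hg'].
have : aeq (g - g') 0.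
  apply: weak_zero => //; first exact: (sipPB S).
  move=> phi tp; rewrite (sipBl S)//; last exact: test_L2.
  by apply/eqP; rewrite subr_eq0 -(inj_eq oppr_inj) -Hg// -Hg'.
by apply: filterS => x h Ox; apply/eqP; rewrite -subr_eq0; apply/eqP/h.
Qed.

Lemma weak_partialD i f g f' g' : L2 f -> L2 f' -> weak_partial Om i f g ->
  weak_partial Om i f' g' -> weak_partial Om i (f + f') (g + g').
Proof.
move=> Lf Lf' [Lg Hg] [Lg' Hg']; split; first exact: L2D.
move=> phi tp; have Lp := test_L2 tp; have Lpi := test_L2 (test_partial i tp).
by rewrite !(sipDl S)// Hg// Hg'// opprD.
Qed.

Lemma weak_partialZ i (a : R) f g : L2 f -> weak_partial Om i f g ->
  weak_partial Om i (a *: f) (a *: g).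
Proof.
move=> Lf [Lg Hg]; split; first exact: L2Z.
move=> phi tp; have Lp := test_L2 tp; have Lpi := test_L2 (test_partial i tp).
by rewrite !(sipZl S)// Hg// mulrN.
Qed.

Lemma wD_weak i f g : weak_partial Om i f g -> weak_partial Om i f (wD i f).
Proof.
by move=> h; rewrite /Defs.wD; case: xgetP => [w -> //|none]; case: (none g).
Qed.

Lemma wD_aeq i f g : weak_partial Om i f g -> aeq (wD i f) g.
Proof. by move=> h; exact: weak_partial_uniq (wD_weak h) h. Qed.

Lemma Hm1_L2 f : Hm Om 1 f -> L2 f. Proof. by case. Qed.

Lemma Hm1_weak f i : Hm Om 1 f -> weak_partial Om i f (wD i f).
Proof. by move=> [_ /(_ i)[[g wg] _]]; exact: wD_weak wg. Qed.

Lemma Hm1_wD_L2 f i : Hm Om 1 f -> L2 (wD i f).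
Proof. by move=> /(Hm1_weak i)[]. Qed.

Lemma Hm1I f : L2 f -> (forall i, exists g, weak_partial Om i f g) -> Hm Om 1 f.
Proof.
move=> Lf H; split => // i; split => //; split => //.
by have [g wg] := H i; case: (wD_weak wg).
Qed.

Local Opaque Hm.

Lemma Hm1D f g : Hm Om 1 f -> Hm Om 1 g -> Hm Om 1 (f + g).
Proof.
move=> Hf Hg; apply: Hm1I; first by apply: L2D => //; exact: Hm1_L2.
by move=> i; exists (wD i f + wD i g); apply: weak_partialD;
  [exact: Hm1_L2|exact: Hm1_L2|exact: Hm1_weak|exact: Hm1_weak].
Qed.

Lemma Hm1Z a f : Hm Om 1 f -> Hm Om 1 (a *: f).
Proof.
move=> Hf; apply: Hm1I; first by apply: L2Z => //; exact: Hm1_L2.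
by move=> i; exists (a *: wD i f); apply: weak_partialZ; [exact: Hm1_L2|exact: Hm1_weak].
Qed.

Lemma Hm1N f : Hm Om 1 f -> Hm Om 1 (- f).
Proof. by rewrite -[- f]scaleN1r; exact: Hm1Z. Qed.

Lemma Hm1B f g : Hm Om 1 f -> Hm Om 1 g -> Hm Om 1 (f - g).
Proof. by move=> Hf Hg; exact: Hm1D Hf (Hm1N Hg). Qed.

Lemma test_Hm1 phi : test phi -> Hm Om 1 phi.
Proof.
move=> tp; apply: Hm1I; first exact: test_L2.
by move=> i; exists (partial i phi); exact: test_weak_partial.
Qed.

Lemma wDD i f g : Hm Om 1 f -> Hm Om 1 g -> aeq (wD i (f + g)) (wD i f + wD i g).
Proof.
move=> Hf Hg; apply: wD_aeq; apply: weak_partialD;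
  [exact: Hm1_L2|exact: Hm1_L2|exact: Hm1_weak|exact: Hm1_weak].
Qed.

Lemma wDZ i a f : Hm Om 1 f -> aeq (wD i (a *: f)) (a *: wD i f).
Proof.
by move=> Hf; apply: wD_aeq; apply: weak_partialZ; [exact: Hm1_L2|exact: Hm1_weak].
Qed.

Lemma wDN i f : Hm Om 1 f -> aeq (wD i (- f)) (- wD i f).
Proof. by move=> Hf; rewrite -[- f]scaleN1r -[- wD i f]scaleN1r; exact: wDZ. Qed.

Lemma wDB i f g : Hm Om 1 f -> Hm Om 1 g -> aeq (wD i (f - g)) (wD i f - wD i g).
Proof.
move=> Hf Hg; apply: aeq_trans (wDD i Hf (Hm1N Hg)) _.
by apply: aeqD; [exact: aeW|exact: wDN].
Qed.

Lemma wD_test i phi : test phi -> aeq (wD i phi) (partial i phi).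
Proof. by move=> tp; apply: wD_aeq; exact: test_weak_partial. Qed.

Lemma Hnorm1E f : Hnorm Om 1 f ^+ 2 = nm f ^+ 2 + \sum_(i < d) nm (wD i f) ^+ 2.
Proof.
rewrite /Hnorm sqr_sqrtr; last first.
  by apply: sumr_ge0 => j _; apply: sumr_ge0 => a _; exact: sqr_ge0.
rewrite big_ord_recl big_ord_recl big_ord0 addr0; congr (_ + _).
  rewrite (bigD1 [tuple])//= big1 ?addr0// => a /eqP[]; apply/val_inj/size0nil; exact: size_tuple.
rewrite (reindex (fun i : 'I_d => [tuple i])); first by [].
exists (fun a : 1.-tuple 'I_d => tnth a ord0) => [i _|a _]; first by [].
by case: a => [[|x [|y a]] p]//; exact/val_inj.
Qed.

Lemma L2norm_wDs_le m f a : (size a <= m)%N -> nm (wDs Om a f) <= Hnorm Om m f.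
Proof.
move=> am; rewrite -[leLHS]ger0_norm ?sqrtr_ge0// -sqrtr_sqr ler_sqrt; last first.
  by apply: sumr_ge0 => j _; apply: sumr_ge0 => b _; exact: sqr_ge0.
rewrite (bigD1 (Ordinal (am : size a < m.+1)%N))//= (bigD1 (in_tuple a))//=.
rewrite -addrA lerDl addr_ge0//; first by apply: sumr_ge0 => b _; exact: sqr_ge0.
by apply: sumr_ge0 => j _; apply: sumr_ge0 => b _; exact: sqr_ge0.
Qed.

Lemma H10_Hm1 f : H10 Om f -> Hm Om 1 f. Proof. by case. Qed.

(** The H1 norm of [f - phi] involves a chosen representative of its weak derivative. Here this is
    replaced by the difference of [wD i f] and the classical derivative of [phi], which is linear in
    both and can be transported by the triangle inequality. *)
Lemma H10P f : H10 Om f <-> Hm Om 1 f /\ forall e, 0 < e -> exists2 phi, test phi &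
  nm (f - phi) < e /\ forall i, nm (wD i f - partial i phi) < e.
Proof.
have E i phi : Hm Om 1 f -> test phi -> nm (wD i (f - phi)) = nm (wD i f - partial i phi).
  move=> Hf tp; have Hp := test_Hm1 tp.
  apply: L2_aeq_norm.
  - by apply: Hm1_wD_L2; exact: Hm1B.
  - by apply: (sipPB S); [exact: Hm1_wD_L2|exact/test_L2/test_partial].
  apply: aeq_trans (wDB i Hf Hp) _.
  by apply: filterS (wD_test i tp) => x h Ox; rewrite !fctE h.
split=> -[Hf H]; split => // e e0.
  have [phi tp Hphi] := H e e0; exists phi => //; split.
    by apply: le_lt_trans Hphi; exact: (@L2norm_wDs_le 1 (f - phi) [::]).
  move=> i; rewrite -E//; apply: le_lt_trans Hphi.
  exact: (@L2norm_wDs_le 1 (f - phi) [:: i]).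
(* The squared H1 norm has [d.+1] summands, each at most [e' ^+ 2]; dividing by [d.+2] makes their
   sum strictly less than [e ^+ 2]. *)
pose e' := e / d.+2%:R; have e'0 : 0 < e' by rewrite divr_gt0.
have [phi tp [h1 h2]] := H e' e'0; exists phi => //.
rewrite -ltr_sqr ?nnegrE ?sqrtr_ge0 ?(ltW e0)// Hnorm1E.
have sq x : 0 <= x -> x < e' -> x ^+ 2 <= e' ^+ 2.
  by move=> x0 xe; rewrite ler_sqr ?nnegrE ?(ltW e'0)// ltW.
apply: (@le_lt_trans _ _ (d.+1%:R * e' ^+ 2)).
  rewrite -[d.+1]addn1 natrD mulrDl mul1r [leLHS]addrC.
  apply: lerD; last by apply: sq => //; exact: sqrtr_ge0.
  apply: (@le_trans _ _ (\sum_(i < d) e' ^+ 2)).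
    by apply: ler_sum => i _; rewrite E//; apply: sq => //; exact: sqrtr_ge0.
  by rewrite sumr_const card_ord mulr_natl.
rewrite /e' expr_div_n mulrCA gtr_pMr ?exprn_gt0//.
rewrite ltr_pdivrMr ?exprn_gt0// mul1r -natrX ltr_nat.
by rewrite expnS expn1 (@leq_trans d.+2)// leq_pmulr.
Qed.

Lemma H10D f g : H10 Om f -> H10 Om g -> H10 Om (f + g).
Proof.
move=> /H10P[Hf Af] /H10P[Hg Ag]; apply/H10P; split; first exact: Hm1D.
move=> e e0; have e20 : 0 < e / 2 by rewrite divr_gt0.
have [phi tp [p1 p2]] := Af _ e20; have [psi ts [s1 s2]] := Ag _ e20.
exists (phi + psi); first exact: testD.
have Lf := Hm1_L2 Hf; have Lg := Hm1_L2 Hg.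
have Lp := test_L2 tp; have Ls := test_L2 ts.
split.
  rewrite opprD addrACA [e]splitr; apply: le_lt_trans (sip_normD S _ _) (ltrD p1 s1);
    exact: (sipPB S).
move=> i.
have Lfi := Hm1_wD_L2 i Hf; have Lgi := Hm1_wD_L2 i Hg.
have Lpi := test_L2 (test_partial i tp); have Lsi := test_L2 (test_partial i ts).
have -> : partial i (phi + psi) = partial i phi + partial i psi.
  by apply/funext => x; rewrite /partial deriveD//;
    [exact: test_derivable tp|exact: test_derivable ts].
rewrite (@L2_aeq_norm _ ((wD i f - partial i phi) + (wD i g - partial i psi))).
- by rewrite [e]splitr; apply: le_lt_trans (sip_normD S _ _) (ltrD (p2 i) (s2 i));
    exact: (sipPB S).
- apply: (sipPB S); last exact: L2D.
  by apply: Hm1_wD_L2; exact: Hm1D.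
- by apply: L2D => //; exact: (sipPB S).
apply: filterS (wDD i Hf Hg) => x h Ox; rewrite !fctE h// !fctE opprD addrACA //.
Qed.

Lemma H10Z a f : H10 Om f -> H10 Om (a *: f).
Proof.
move=> /H10P[Hf Af]; apply/H10P; split; first exact: Hm1Z.
move=> e e0; have a0 : 0 < `|a| + 1 by rewrite ltr_wpDl.
have [phi tp [p1 p2]] := Af _ (divr_gt0 e0 a0).
exists (a *: phi); first exact: testZ.
have Lf := Hm1_L2 Hf; have Lp := test_L2 tp.
have lt x : 0 <= x -> x < e / (`|a| + 1) -> `|a| * x < e.
  move=> x0; rewrite ltr_pdivlMr// mulrC; apply: le_lt_trans.
  by rewrite ler_wpM2r// lerDl.
split.
  rewrite -scalerBr L2normZ//; last exact: (sipPB S).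
  by apply: lt => //; exact: sqrtr_ge0.
move=> i; have Lfi := Hm1_wD_L2 i Hf; have Lpi := test_L2 (test_partial i tp).
have -> : partial i (a *: phi) = a *: partial i phi.
  by apply/funext => x; rewrite /partial deriveZ//; exact: test_derivable tp.
rewrite (@L2_aeq_norm _ (a *: (wD i f - partial i phi))).
- rewrite L2normZ//; last exact: (sipPB S).
  by apply: lt => //; exact: sqrtr_ge0.
- by apply: (sipPB S); [apply: Hm1_wD_L2; exact: Hm1Z|exact: L2Z].
- by apply: L2Z => //; exact: (sipPB S).
by apply: filterS (wDZ i a Hf) => x h Ox; rewrite !fctE h// -scalerBr.
Qed.

Lemma H10_0 : H10 Om 0.
Proof.
have t0 := test0 Om; apply/H10P; split; first exact: test_Hm1.
move=> e e0; exists 0 => //.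
have L0 : L2 0 by exact: L2_0.
have n0 : nm 0 = 0 by rewrite /L2norm (sip0l S)// sqrtr0.
split; first by rewrite subrr n0.
move=> i; have Lpi := test_L2 (test_partial i t0).
have LD : L2 (wD i 0) by apply: Hm1_wD_L2; exact: test_Hm1.
rewrite (@L2_aeq_norm _ 0) ?n0//; first exact: (sipPB S).
by apply: filterS (wD_test i t0) => x h Ox; rewrite fctE h// subrr.
Qed.

Lemma test_H10 phi : test phi -> H10 Om phi.
Proof.
move=> tp; apply/H10P; split; first exact: test_Hm1.
move=> e e0; exists phi => //.
have n0 : nm 0 = 0 by rewrite /L2norm (sip0l S) ?sqrtr0//; exact: L2_0.
split; first by rewrite subrr n0.
move=> i; have Lpi := test_L2 (test_partial i tp).
have LD : L2 (wD i phi) by apply: Hm1_wD_L2; exact: test_Hm1.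
rewrite (@L2_aeq_norm _ 0) ?n0//; first exact: (sipPB S).
  exact: L2_0.
by apply: filterS (wD_test i tp) => x h Ox; rewrite fctE h// subrr.
Qed.

End weak_derivatives.

(** * Poincare and product inequalities in H10 *)

Section sobolev_H10.
Context (R : realType).

Lemma bounded_coord d (Om : set 'rV[R]_d) : bounded_set Om ->
  exists2 M, 0 <= M & forall x i, Om x -> `|x ord0 i| <= M.
Proof.
move=> [M [_ HM]]; exists (`|M| + 1) => [|x i Ox]; first by rewrite addr_ge0.
apply: le_trans (HM (`|M| + 1) _ x Ox); last by rewrite (le_lt_trans (ler_norm M))// ltrDl.
rewrite [leRHS]/Num.norm /= mx_normrE; apply/bigmax_geP; right => /=.
by exists (ord0, i).
Qed.

Lemma poincare_test d (Om : set 'rV[R]_d) (i0 : 'I_d) : bounded_set Om ->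
  exists2 C, 0 < C & forall phi G, test_function Om phi ->
    (forall i, L2norm setT (partial i phi) <= G) -> L2norm setT phi <= C * G.
Proof.
case: d Om i0 => [Om []//|n] Om _ bO; have [M M0 HM] := bounded_coord bO.
exists (4 * M + 1) => [|phi G tp hG]; first by rewrite ltr_wpDl// mulr_ge0.
have G0 : 0 <= G := le_trans (sqrtr_ge0 _) (hG ord0).
apply: (@le_trans _ _ (4 * M * L2norm setT (partial ord0 phi))).
  apply: poincare_C1c => //; first exact: test_C1c tp.
  by move=> x Mx; apply: (test_supp0 tp) => /(HM _ ord0); rewrite leNgt Mx.
have : 4 * M * L2norm setT (partial ord0 phi) <= 4 * M * G.
  by rewrite ler_wpM2l// mulr_ge0.
by move=> h; apply: le_trans h _; rewrite ler_wpM2r// lerDl.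
Qed.

Lemma L2norm_mul_test d (Om : set 'rV[R]_d) : (2 <= d <= 3)%N -> bounded_set Om ->
  exists2 K, 0 < K & forall w v (W V : R), test_function Om w -> test_function Om v ->
    0 < W -> 0 < V -> (forall i, L2norm setT (partial i w) <= W) ->
    (forall i, L2norm setT (partial i v) <= V) ->
    L2norm setT (w * v) ^+ 2 <= K * L2norm setT w * W * V ^+ 2.
Proof.
case: d Om => [//|[//|[|[|//]]]] Om _ bO; have [M M0 HM] := bounded_coord bO.
- exists (16 * M + 1) => [|w v W V tw tv W0 V0 hW hV]; first by rewrite ltr_wpDl// mulr_ge0.
  apply: le_trans (L2norm_mul_le2 M0 (test_C1c tw) (test_C1c tv) _ hW hV) _.
    by move=> x Mx; apply: (test_supp0 tv) => /(HM _ ord0); rewrite leNgt Mx.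
  rewrite !ler_wpM2r ?sqr_ge0 ?sqrtr_ge0 ?(ltW W0)//.
  by rewrite lerDl.
- exists 128 => // w v W V tw tv W0 V0 hW hV.
  exact: (L2norm_mul_le3 W0 V0 (test_C1c tw) (test_C1c tv) hW hV).
Qed.

Context (d : nat) (Om : set 'rV[R]_d) (oOm : open Om) (bOm : bounded_set Om).
Local Notation leb := (lebesgue_rV R d).
Local Notation L2 := (L2 Om).
Local Notation ip := (ip Om).
Local Notation nm := (L2norm Om).
Local Notation test := (test_function Om).
Local Notation wD := (wD Om).
Implicit Types f g w v phi : 'rV[R]_d -> R.

Let mOm : measurable Om := open_measurable_rV oOm.
Let S := ip_semi_ip mOm.

Lemma test_bounded phi : test phi -> exists2 B, 0 <= B & forall x, `|phi x| <= B.
Proof.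
move=> tp; have [Cp [K [cK KO pK]]] := tp.
have [B [_ HB]] : bounded_set [set phi x | x in K].
  apply/compact_bounded/continuous_compact => //.
  by apply: continuous_subspaceT; exact: test_continuous tp.
exists (`|B| + 1) => [|x]; first by rewrite addr_ge0.
have [Kx|nKx] := pselect (K x); last by rewrite pK// normr0 addr_ge0.
by apply: HB; [rewrite (le_lt_trans (ler_norm B))// ltrDl|exists x].
Qed.

Lemma L2_dom f g : measurable_fun Om f -> L2 g -> (forall x, Om x -> `|f x| <= `|g x|) -> L2 f.
Proof.
move=> mf Lg fg; have L0 : L2 0 by exact: L2_0.
apply: (L2_le mOm mf Lg L0) => x Ox.
rewrite [X in _ + X]expr0n addr0 -(real_normK (num_real (f x))) -(real_normK (num_real (g x))).
by rewrite ler_sqr ?nnegrE// fg.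
Qed.

Lemma L2M_bounded f g B : 0 <= B -> measurable_fun Om f -> L2 g ->
  (forall x, Om x -> `|f x| <= B) -> L2 (f * g) /\ nm (f * g) <= B * nm g.
Proof.
move=> B0 mf Lg fB.
have h x : Om x -> `|(f * g) x| <= `|(B *: g) x|.
  move=> Ox; rewrite [X in `|X| <= _](_ : _ = f x * g x)//.
  rewrite [X in _ <= `|X|](_ : _ = B * g x)// !normrM (ger0_norm B0).
  by rewrite ler_wpM2r// fB.
have LBg : L2 (B *: g) by apply: L2Z.
have Lfg : L2 (f * g).
  by apply: L2_dom LBg h; apply: measurable_funM => //; case: Lg.
split => //; apply: le_trans (L2norm_le oOm Lfg LBg h) _.
by rewrite L2normZ// ger0_norm.
Qed.

Lemma test_normT phi : test phi -> nm phi = L2norm setT phi.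
Proof. by move=> tp; apply: L2norm_setT => x; exact: test_supp0. Qed.

Lemma poincare_H10 (i0 : 'I_d) : exists2 C, 0 < C & forall f G, H10 Om f ->
  (forall i, nm (wD i f) <= G) -> nm f <= C * G.
Proof.
have [C C0 HC] := poincare_test i0 bOm; exists C => // f G /H10P - /(_ oOm) [Hf Af] hG.
have Lf := Hm1_L2 Hf.
apply/ler_addgt0Pr => e e0; pose e' := e / (C + 1).
have C10 : 0 < C + 1 by rewrite ltr_wpDl// ltW.
have [phi tp [p1 p2]] := Af e' (divr_gt0 e0 C10).
have Lp := test_L2 oOm tp.
have hp : nm phi <= C * (G + e').
  rewrite (test_normT tp); apply: HC => // i.
  have Lpi := test_L2 oOm (test_partial i tp); have Lfi := Hm1_wD_L2 i Hf.
  rewrite -(test_normT (test_partial i tp)).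
  rewrite (_ : partial i phi = wD i f - (wD i f - partial i phi)); last first.
    by rewrite opprB addrCA subrr addr0.
  apply: le_trans (sip_normB S Lfi (sipPB S Lfi Lpi)) _.
  by apply: lerD; [exact: hG|exact: ltW (p2 i)].
rewrite (_ : f = (f - phi) + phi); last by rewrite subrK.
apply: le_trans (sip_normD S (sipPB S Lf Lp) Lp) _.
apply: le_trans (lerD (ltW p1) hp) _.
have -> : e' + C * (G + e') = C * G + e' * (C + 1) by ring.
by rewrite lerD2l /e' divfK ?gt_eqF.
Qed.

Lemma H10_test_approx f e : H10 Om f -> 0 < e -> exists phi,
  [/\ test phi, nm (f - phi) < e, nm phi <= nm f + e &
      forall G, (forall i, nm (wD i f) <= G) -> forall i, L2norm setT (partial i phi) <= G + e].
Proof.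
move=> /H10P - /(_ oOm) [Hf Af] e0; have [phi tp [p1 p2]] := Af e e0.
have Lf := Hm1_L2 Hf; have Lp := test_L2 oOm tp.
exists phi; split => //.
  rewrite (_ : phi = f - (f - phi)); last by rewrite opprB addrCA subrr addr0.
  apply: le_trans (sip_normB S Lf (sipPB S Lf Lp)) _.
  by rewrite lerD2l ltW// opprB addrCA subrr addr0.
move=> G hG i.
have Lpi := test_L2 oOm (test_partial i tp); have Lfi := Hm1_wD_L2 i Hf.
rewrite -(test_normT (test_partial i tp)).
rewrite (_ : partial i phi = wD i f - (wD i f - partial i phi)); last first.
  by rewrite opprB addrCA subrr addr0.
apply: le_trans (sip_normB S Lfi (sipPB S Lfi Lpi)) _.
by apply: lerD; [exact: hG|exact: ltW (p2 i)].
Qed.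

Lemma ler_addM_gt0 (x y c : R) : (forall e, 0 < e -> e <= 1 -> x <= y + c * e) -> x <= y.
Proof.
move=> H; apply/ler_addgt0Pr => e e0.
have c0 : 0 < `|c| + 1 by rewrite ltr_wpDl.
pose r := Num.min 1 (e / (`|c| + 1)).
have r0 : 0 < r by rewrite lt_min ltr01 divr_gt0.
have r1 : r <= 1 by rewrite ge_min lexx.
apply: le_trans (H r r0 r1) _; rewrite lerD2l.
apply: (@le_trans _ _ ((`|c| + 1) * r)).
  rewrite ler_wpM2r ?(ltW r0)// (le_trans (ler_norm c))// lerDl//.
by rewrite mulrC -ler_pdivlMr// ge_min lexx orbT.
Qed.

(** Monotone convergence over the sets where [|v| <= k], which exhaust [Om]. It provides both
    membership in L2 and the bound for a product that is not yet known to be square integrable; the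
    constant [c] must not depend on [k]. *)
Lemma L2_mul_trunc f (c : R) : measurable_fun Om f -> forall v, measurable_fun Om v ->
  0 <= c -> (forall k : nat, exists h, [/\ L2 h, nm h <= c &
     forall x, Om x -> `|v x| <= k%:R -> h x = f x]) -> L2 f /\ nm f <= c.
Proof.
move=> mf v mv c0 H.
pose F k := Om `&` [set x | `|v x| <= k%:R].
have mF k : measurable (F k).
  have mav : measurable_fun Om (fun x => `|v x|) by exact: measurableT_comp.
  rewrite (_ : F k = Om `&` (fun x => `|v x|) @^-1` `]-oo, k%:R]%classic); first exact: mav.
  by apply/seteqP; split => x [Ox h]; split => //; move: h; rewrite /= in_itv.
have UF : \bigcup_k F k = Om.
  apply/seteqP; split => [x [k _ []]//|x Ox].
  have [k hk] : exists k : nat, `|v x| <= k%:R.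
    exists (Num.truncn `|v x|).+1; apply: ltW.
    by have /truncn_itv/andP[] := normr_ge0 (v x).
  by exists k.
have mf2 : measurable_fun Om (fun x => (f x ^+ 2)%:E : \bar R).
  by apply/measurable_EFinP; exact: measurable_funX.
have bF k : (\int[leb]_(x in F k) (f x ^+ 2)%:E <= (c ^+ 2)%:E)%E.
  have [h [Lh hc hE]] := H k.
  apply: (@le_trans _ _ (\int[leb]_(x in Om) (h x ^+ 2)%:E)%E); last first.
    by rewrite L2_integral// lee_fin ler_sqr ?nnegrE// sqrtr_ge0.
  rewrite (@eq_integral _ _ _ _ _ (fun x => (h x ^+ 2)%:E)); last first.
    by move=> x /set_mem [Ox vx]; rewrite hE.
  apply: ge0_subset_integral => //.
  - by apply/measurable_EFinP; apply: measurable_funX; case: Lh.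
  - by move=> x _; rewrite lee_fin sqr_ge0.
  - by move=> x [].
have ndF : nondecreasing_seq F.
  move=> k j kj; apply/subsetPset => x [Ox vx]; split => //.
  by apply: le_trans vx _; rewrite ler_nat.
have cv := @ge0_nondecreasing_set_cvg_integral _ _ _ F (fun x => (f x ^+ 2)%:E) leb ndF mF
  (fun k => measurable_funS mOm (fun x (h : F k x) => h.1) mf2)
  (fun k x _ => ltac:(by rewrite lee_fin sqr_ge0)).
have b2 : (\int[leb]_(x in Om) (f x ^+ 2)%:E <= (c ^+ 2)%:E)%E.
  move: cv; rewrite UF => /cvg_lim <-//; apply: lime_le; last exact: nearW.
  apply: ereal_nondecreasing_is_cvgn; apply: ge0_nondecreasing_set_nondecreasing_integral => //.
  - by move=> k; apply: measurable_funS mf2 => // x [].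
  - by move=> k x _; rewrite lee_fin sqr_ge0.
have Lf : L2 f by split => //; apply: le_lt_trans b2 (ltry _).
split => //; rewrite -ler_sqr ?nnegrE ?sqrtr_ge0//.
by rewrite -lee_fin -L2_integral.
Qed.

Hypothesis hd : (2 <= d <= 3)%N.

(* First [w] is a test function, hence bounded; the general [w] is approximated,
   [v] being truncated to the sets where it is bounded. *)
Lemma L2norm_mul_H10 : exists2 K, 0 < K & forall w v (W V : R), H10 Om w -> H10 Om v ->
  0 < W -> 0 < V -> (forall i, nm (wD i w) <= W) -> (forall i, nm (wD i v) <= V) ->
  L2 (w * v) /\ nm (w * v) ^+ 2 <= K * nm w * W * V ^+ 2.
Proof.
have [K K0 HK] := L2norm_mul_test hd bOm; exists K => //.
have step1 phi v (W V : R) : test phi -> H10 Om v -> 0 < W -> 0 < V ->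
    (forall i, L2norm setT (partial i phi) <= W) -> (forall i, nm (wD i v) <= V) ->
    L2 (phi * v) /\ nm (phi * v) <= Num.sqrt (K * nm phi * W) * V.
  move=> tp Hv W0 V0 hW hV.
  have [B B0 HB] := test_bounded tp.
  have Lp := test_L2 oOm tp; have Lv := Hm1_L2 (H10_Hm1 Hv).
  have mp : measurable_fun Om phi by case: Lp.
  have [Lpv _] := L2M_bounded B0 mp Lv (fun x _ => HB x).
  split => //; set c := Num.sqrt _.
  have c0 : 0 <= c by exact: sqrtr_ge0.
  have c2 : c ^+ 2 = K * nm phi * W.
    by rewrite sqr_sqrtr// !mulr_ge0 ?sqrtr_ge0// ltW.
  apply: (@ler_addM_gt0 _ _ (c + B)) => e e0 e1.
  have [psi [ts s1 _ s2]] := H10_test_approx Hv e0.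
  have Ls := test_L2 oOm ts.
  have Ld := sipPB S Lv Ls.
  have [Lpd hpd] := L2M_bounded B0 mp Ld (fun x _ => HB x).
  have tps := testM tp ts; have Lps := test_L2 oOm tps.
  have hps : nm (phi * psi) <= c * (V + e).
    have Ve0 : 0 < V + e by rewrite addr_gt0.
    rewrite -ler_sqr ?nnegrE ?sqrtr_ge0 ?mulr_ge0 ?(ltW Ve0)//.
    rewrite exprMn c2 !(test_normT tp) (test_normT tps).
    by apply: HK => //; exact: s2.
  rewrite (_ : phi * v = phi * psi + phi * (v - psi)); last by rewrite -mulrDr addrCA subrr addr0.
  apply: le_trans (sip_normD S Lps Lpd) _.
  have : B * nm (v - psi) <= B * e by rewrite ler_wpM2l// ltW.
  move: hps hpd; rewrite /Defs.L2norm; lra.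
move=> w v W V Hw Hv W0 V0 hW hV.
have Lw := Hm1_L2 (H10_Hm1 Hw); have Lv := Hm1_L2 (H10_Hm1 Hv).
have [mw _] := Lw; have [mv _] := Lv.
have mwv : measurable_fun Om (w * v) by exact: measurable_funM.
(* The slack [del] is fixed before the truncation level [k]: the approximation of [w] may depend on
   [k], the resulting bound may not. *)
have main del : 0 < del -> L2 (w * v) /\
    nm (w * v) <= Num.sqrt (K * (nm w + del) * (W + del)) * V.
  move=> del0; apply: (L2_mul_trunc mwv mv); first by rewrite mulr_ge0 ?sqrtr_ge0// ltW.
  move=> k; pose E := Om `&` [set x | `|v x| <= k%:R].
  have mav : measurable_fun Om (fun x => `|v x|) by exact: measurableT_comp.
  have mE : measurable E.
    rewrite (_ : E = Om `&` (fun x => `|v x|) @^-1` `]-oo, k%:R]%classic); first exact: mav.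
    by apply/seteqP; split => x [Ox h]; split => //; move: h; rewrite /= in_itv.
  pose vk : 'rV[R]_d -> R := v * \1_E.
  have mvk : measurable_fun Om vk by apply: measurable_funM => //; exact: measurable_indic.
  have vkb x : Om x -> `|vk x| <= k%:R.
    move=> Ox; rewrite /vk [X in `|X|](_ : _ = v x * \1_E x)// indicE.
    have [xE|xE] := boolP (x \in E); last by rewrite mulr0 normr0.
    by rewrite mulr1; have [] := set_mem xE.
  have [Lvw _] := L2M_bounded (ler0n R k) mvk Lw vkb.
  exists (vk * w); split => //; last first.
    move=> x Ox vx; rewrite [LHS](_ : _ = v x * \1_E x * w x)//.
    by rewrite indicE mem_set// mulr1 mulrC.
  apply: (@ler_addM_gt0 _ _ k%:R) => e0 e00 e01.
  pose e := Num.min e0 del.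
  have ep : 0 < e by rewrite lt_min e00 del0.
  have ee0 : e <= e0 by rewrite ge_min lexx.
  have edel : e <= del by rewrite ge_min lexx orbT.
  have [phi [tp p1 p2 p3]] := H10_test_approx Hw ep.
  have Lp := test_L2 oOm tp.
  have We : 0 < W + e by rewrite addr_gt0.
  have [Lpv hpv] := step1 phi v (W + e) V tp Hv We V0 (p3 W hW) hV.
  have [Lpvk hpvk] : L2 (vk * phi) /\ nm (vk * phi) <= nm (phi * v).
    have hh x : Om x -> `|(vk * phi) x| <= `|(phi * v) x|.
      move=> Ox; rewrite [X in `|X| <= _](_ : _ = v x * \1_E x * phi x)//.
      rewrite [X in _ <= `|X|](_ : _ = phi x * v x)// !normrM mulrC ler_wpM2l//.
      by rewrite indicE; case: (_ \in _); rewrite ?normr1 ?mulr1// normr0 mulr0.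
    have L : L2 (vk * phi).
      by apply: L2_dom Lpv hh; apply: measurable_funM => //; case: Lp.
    by split => //; exact: (L2norm_le oOm).
  have Ld := sipPB S Lw Lp.
  have [Lvd hvd] := L2M_bounded (ler0n R k) mvk Ld vkb.
  rewrite (_ : vk * w = vk * phi + vk * (w - phi)); last first.
    by rewrite -mulrDr addrCA subrr addr0.
  apply: le_trans (sip_normD S Lpvk Lvd) _.
  have h1 : Num.sqrt (K * nm phi * (W + e)) * V <= Num.sqrt (K * (nm w + del) * (W + del)) * V.
    rewrite ler_wpM2r ?(ltW V0)// ler_wsqrtr//.
    apply: ler_pM; rewrite ?mulr_ge0 ?sqrtr_ge0 ?(ltW K0) ?(ltW We)//.
      rewrite ler_wpM2l ?(ltW K0)// (le_trans p2)// lerD2l//.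
    by rewrite lerD2l.
  have h2 : k%:R * nm (w - phi) <= k%:R * e0.
    by rewrite ler_wpM2l// ltW// (lt_le_trans p1).
  move: hpvk hpv hvd h1 h2; rewrite /Defs.L2norm; lra.
have [Lwv _] := main 1 ltr01; split => //.
have C0 : 0 < K * V ^+ 2 by rewrite mulr_gt0// exprn_gt0.
have -> : K * nm w * W * V ^+ 2 = nm w * W * (K * V ^+ 2) by ring.
(* The slack is removed from the two factors [nm w] and [W] at once, the rest being a positive
   constant. *)
rewrite -ler_pdivrMr//; apply: ler_mulDe; rewrite ?sqrtr_ge0 ?(ltW W0)// => e e0.
rewrite ler_pdivrMr//; have [_ h] := main e e0.
have We : 0 < W + e by rewrite addr_gt0.
have ne : 0 < nm w + e by rewrite ltr_wpDl// sqrtr_ge0.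
have -> : (nm w + e) * (W + e) * (K * V ^+ 2) =
    (Num.sqrt (K * (nm w + e) * (W + e)) * V) ^+ 2.
  rewrite exprMn sqr_sqrtr; first by ring.
  by rewrite !mulr_ge0// ltW.
by rewrite ler_sqr ?nnegrE ?sqrtr_ge0// mulr_ge0 ?sqrtr_ge0// ltW.
Qed.

End sobolev_H10.

Lemma ler_rot (R : realDomainType) (C x y z : R) : C * x * y * z <= C * y * z * x.
Proof. by rewrite [leLHS](_ : _ = C * y * z * x) ?lexx//; ring. Qed.

Lemma subr_addC (V : zmodType) (a b : V) : a + b - (b + a) = 0.
Proof. by rewrite [b + a]addrC subrr. Qed.

Lemma addr3B (V : zmodType) (a a' b b' c c' : V) :
  a - a' + (b - b') + (c - c') = a + b + c - (a' + b' + c').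
Proof. by rewrite !opprD [a - a' + _]addrACA [LHS]addrACA. Qed.

Lemma ler_pM_rot (R : realDomainType) (C x y z p q : R) : 0 <= p -> 0 <= q ->
  p <= C * y * z -> q <= x -> p * q <= C * x * y * z.
Proof.
move=> p0 q0 h hq; rewrite [leRHS](_ : _ = C * y * z * x); last by ring.
exact: ler_pM.
Qed.

Lemma ler_norm3 (R : realDomainType) (a b c C x y z : R) :
  `|a| <= C * z * x * y -> `|b| <= C * x * z * y -> `|c| <= C * y * z * x ->
  `|a + b + c| <= 3 * C * z * x * y.
Proof.
move=> h1 h2 h3; rewrite [leRHS](_ : _ = C * z * x * y + C * x * z * y + C * y * z * x); last by ring.
by apply: le_trans (ler_normD _ _) (lerD (le_trans (ler_normD _ _) (lerD h1 h2)) h3).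
Qed.

(** The product inequality requires positive bounds for the two gradients. It is therefore applied
    with the seminorms plus [e], and the limit is taken here. *)
Lemma le_sqrt_mul_slack (R : realType) (n a b c K : R) : 0 <= n -> 0 <= a -> 0 <= b ->
  0 <= c -> 0 <= K ->
  (forall e, 0 < e -> n ^+ 2 <= K * a * (b + e) * (c + e) ^+ 2) ->
  n <= Num.sqrt K * Num.sqrt (a * b) * c.
Proof.
move=> n0 a0 b0 c0 K0 H.
rewrite -ler_sqr ?nnegrE ?mulr_ge0 ?sqrtr_ge0//.
have sK : Num.sqrt K ^+ 2 = K by rewrite sqr_sqrtr.
have sab : Num.sqrt (a * b) ^+ 2 = a * b by rewrite sqr_sqrtr// mulr_ge0.
have -> : (Num.sqrt K * Num.sqrt (a * b) * c) ^+ 2 = (K * a) * (b * c ^+ 2).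
  by rewrite !exprMn sK sab; ring.
apply: (@ler_addM_gt0 _ _ _ (K * a * ((c + 1) ^+ 2 + b * (2 * c + 1)))) => e e0 e1.
apply: le_trans (H e e0) _.
have Ka : 0 <= K * a by rewrite mulr_ge0.
rewrite [leRHS](_ : _ = (K * a) * (b * c ^+ 2 + ((c + 1) ^+ 2 + b * (2 * c + 1)) * e)); last by ring.
rewrite -mulrA; apply: ler_wpM2l => //.
have h1 : 0 <= b * e * (1 - e) by rewrite !mulr_ge0 ?(ltW e0)// subr_ge0.
have h2 : 0 <= e * (1 - e) * (2 * c + 1 + e).
  apply: mulr_ge0; first by rewrite mulr_ge0 ?(ltW e0)// subr_ge0.
  by rewrite !addr_ge0 ?mulr_ge0// ltW.
have -> : (b + e) * (c + e) ^+ 2 = b * c ^+ 2 + ((c + 1) ^+ 2 + b * (2 * c + 1)) * e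
   - b * e * (1 - e) - e * (1 - e) * (2 * c + 1 + e) by ring.
lra.
Qed.

(** * Integration by parts for products of H10 functions *)

Section scalar_forms.
Context (R : realType) (d : nat) (Om : set 'rV[R]_d).
Hypotheses (oOm : open Om) (bOm : bounded_set Om) (hd : (2 <= d <= 3)%N).
Local Notation L2 := (L2 Om).
Local Notation ip := (ip Om).
Local Notation nm := (L2norm Om).
Local Notation test := (test_function Om).
Local Notation wD := (wD Om).
Local Notation aeq := (aeq Om).
Local Notation H10 := (H10 Om).
Implicit Types f g u v w phi : 'rV[R]_d -> R.

Let mOm : measurable Om := open_measurable_rV oOm.
Let S := ip_semi_ip mOm.

Lemma ip_mulAC f g h : ip (f * g) h = ip (f * h) g.
Proof. by apply: eq_Rintegral => x _; rewrite !fctE mulrAC. Qed.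

Lemma ip_mulCA f g h : ip (f * g) h = ip (g * h) f.
Proof. by apply: eq_Rintegral => x _; rewrite !fctE mulrC mulrCA mulrC (mulrC (h x)) -mulrA. Qed.

Lemma ip_partial_cst1 i phi : test phi -> ip (partial i phi) (cst 1) = 0.
Proof.
move=> tp; rewrite ip_setT; last by move=> x; apply/test_supp0/test_partial.
rewrite /Defs.ip /Rintegral (eq_integral (fun x => (partial i phi x)%:E)); last first.
  by move=> x _; rewrite mulr1.
by rewrite (integral_partial0 i (test_C1c tp)).
Qed.

Lemma L2_cst1 : L2 (cst 1).
Proof.
split; first exact: measurable_cst.
under eq_integral do rewrite expr1n.
by rewrite integral_cst// mul1e; exact: lebesgue_bounded_fin.
Qed.

Lemma L2_CS f g : L2 f -> L2 g -> `|ip f g| <= nm f * nm g.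
Proof. exact: (sip_CS S). Qed.

Lemma L2B f g : L2 f -> L2 g -> L2 (f - g).
Proof. exact: (sipPB S). Qed.

Lemma ipC f g : L2 f -> L2 g -> ip f g = ip g f.
Proof. exact: (sipC S). Qed.

Lemma ipDl f g h : L2 f -> L2 g -> L2 h -> ip (f + g) h = ip f h + ip g h.
Proof. exact: (sipDl S). Qed.

Lemma ipBl f g h : L2 f -> L2 g -> L2 h -> ip (f - g) h = ip f h - ip g h.
Proof. exact: (sipBl S). Qed.

Lemma ipBr f g h : L2 f -> L2 g -> L2 h -> ip h (f - g) = ip h f - ip h g.
Proof. exact: (sipBr S). Qed.

Lemma L2norm_ge0 f : 0 <= nm f. Proof. exact: sqrtr_ge0. Qed.

Local Opaque Hm Defs.L2 Defs.ip Defs.wD Defs.L2norm.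

Definition gsnorm f : R := Num.sqrt (\sum_(i < d) nm (wD i f) ^+ 2).

Lemma gsnorm_ge0 f : 0 <= gsnorm f. Proof. exact: sqrtr_ge0. Qed.

Lemma gsnorm2 f : gsnorm f ^+ 2 = \sum_(i < d) nm (wD i f) ^+ 2.
Proof. by rewrite sqr_sqrtr//; apply: sumr_ge0 => i _; exact: sqr_ge0. Qed.

Lemma L2norm_wD_le f i : nm (wD i f) <= gsnorm f.
Proof.
rewrite -ler_sqr ?nnegrE ?gsnorm_ge0 ?L2norm_ge0// gsnorm2 (bigD1 i)//= lerDl.
by apply: sumr_ge0 => j _; exact: sqr_ge0.
Qed.

Lemma gsnorm_le_Hnorm f : gsnorm f <= Hnorm Om 1 f.
Proof.
by rewrite -ler_sqr ?nnegrE ?sqrtr_ge0// gsnorm2 Hnorm1E lerDr sqr_ge0.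
Qed.

Lemma H10_L2 f : H10 f -> L2 f.
Proof. by move=> Hf; exact: Hm1_L2 (H10_Hm1 Hf). Qed.

Lemma H10_wD_L2 f i : H10 f -> L2 (wD i f).
Proof. by move=> Hf; exact: Hm1_wD_L2 (H10_Hm1 Hf). Qed.

Lemma H10B f g : H10 f -> H10 g -> H10 (f - g).
Proof. by move=> Hf Hg; rewrite -[- g]scaleN1r; exact: (H10D oOm Hf (H10Z oOm _ Hg)). Qed.

Lemma poincare_gs : exists2 C, 0 < C & forall f, H10 f -> nm f <= C * gsnorm f.
Proof.
have i0 : 'I_d by move: hd; case: (d) => // n _; exact: ord0.
have [C C0 HC] := poincare_H10 oOm bOm i0; exists C => // f Hf.
by apply: HC => // i; exact: L2norm_wD_le.
Qed.

Lemma H10M_L2 w v : H10 w -> H10 v -> L2 (w * v).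
Proof.
move=> Hw Hv; have [K K0 HK] := L2norm_mul_H10 oOm bOm hd.
have pos f : 0 < gsnorm f + 1 by rewrite ltr_wpDl// gsnorm_ge0.
have le f i : nm (wD i f) <= gsnorm f + 1.
  by apply: le_trans (L2norm_wD_le f i) _; rewrite lerDl.
by have [] := HK w v _ _ Hw Hv (pos w) (pos v) (le w) (le v).
Qed.

Lemma L2norm_mul_gs : exists2 K, 0 < K & forall w v, H10 w -> H10 v ->
  nm (w * v) <= K * Num.sqrt (nm w * gsnorm w) * gsnorm v.
Proof.
have [K K0 HK] := L2norm_mul_H10 oOm bOm hd.
exists (Num.sqrt K) => [|w v Hw Hv]; first by rewrite sqrtr_gt0.
apply: le_sqrt_mul_slack; rewrite ?L2norm_ge0 ?gsnorm_ge0 ?(ltW K0)// => e e0.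
have [] // := HK w v (gsnorm w + e) (gsnorm v + e) Hw Hv.
- by rewrite ltr_wpDl// gsnorm_ge0.
- by rewrite ltr_wpDl// gsnorm_ge0.
- by move=> i; apply: le_trans (L2norm_wD_le w i) _; rewrite lerDl ltW.
- by move=> i; apply: le_trans (L2norm_wD_le v i) _; rewrite lerDl ltW.
Qed.

(** The one density argument of the development: identities are checked on test functions, and
    continuity in the gradient seminorm extends them. *)
Lemma H10_density (F : ('rV[R]_d -> R) -> R) (C : R) : 0 <= C ->
  (forall phi, test phi -> F phi = 0) ->
  (forall f phi, H10 f -> test phi -> `|F f - F phi| <= C * gsnorm (f - phi)) ->
  forall f, H10 f -> F f = 0.
Proof.
move=> C0 F0 HF f Hf; apply/eqP; rewrite -normr_le0.
apply: (@ler_addM_gt0 _ _ _ C) => e e0 e1; rewrite add0r.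
have [phi tp hp] := Hf.2 e e0.
have := HF f phi Hf tp; rewrite (F0 phi tp) subr0 => /le_trans; apply.
by rewrite ler_wpM2l// (le_trans (gsnorm_le_Hnorm _))// ltW.
Qed.

Lemma ip_wDB i f g h : H10 f -> H10 g -> L2 h ->
  ip h (wD i (f - g)) = ip h (wD i f) - ip h (wD i g).
Proof.
move=> Hf Hg Lh.
have Lf := H10_wD_L2 i Hf; have Lg := H10_wD_L2 i Hg.
have E := wDB oOm i (H10_Hm1 Hf) (H10_Hm1 Hg).
have LB : L2 (wD i (f - g)) by exact: H10_wD_L2 (H10B Hf Hg).
have LB' : L2 (wD i f - wD i g) by exact: L2B.
have := ip_aeqr oOm LB LB' Lh E.
move=> ->.
exact: ipBr.
Qed.

Local Opaque Defs.H10.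

(** The integral of [d_i (w u v)] written out by the product rule, in a form that makes sense for
    weak derivatives. *)
Definition tri i w u v : R := ip (u * v) (wD i w) + ip (w * v) (wD i u) + ip (w * u) (wD i v).

(** A product of two H10 functions is in L2, so each summand is a plain L2 pairing. The Poincare
    inequality turns [(|u| |grad u|)^(1/2)] into a multiple of [|grad u|], which gives continuity in
    each argument. *)
Lemma tri_le : exists2 C, 0 < C & forall i w u v, H10 w -> H10 u -> H10 v ->
  `|tri i w u v| <= C * gsnorm w * gsnorm u * gsnorm v.
Proof.
have [Cp Cp0 HCp] := poincare_gs; have [K K0 HK] := L2norm_mul_gs.
pose C := K * Num.sqrt Cp.
have C0 : 0 < C by rewrite mulr_gt0// sqrtr_gt0.
have CE : C = K * Num.sqrt Cp by [].
clearbody C.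
have H i w u v : H10 w -> H10 u -> H10 v ->
    `|ip (u * v) (wD i w)| <= C * gsnorm w * gsnorm u * gsnorm v.
  move=> Hw Hu Hv; apply: le_trans (L2_CS (H10M_L2 Hu Hv) (H10_wD_L2 i Hw)) _.
  have gw := L2norm_wD_le w i.
  have : nm (u * v) <= C * gsnorm u * gsnorm v.
    apply: le_trans (HK u v Hu Hv) _; rewrite ler_wpM2r ?gsnorm_ge0//.
    rewrite CE -mulrA ler_wpM2l ?(ltW K0)//.
    apply: (@le_trans _ _ (Num.sqrt (Cp * gsnorm u ^+ 2))).
      by rewrite ler_wsqrtr// expr2 mulrA ler_wpM2r ?gsnorm_ge0// HCp.
    by rewrite sqrtrM ?(ltW Cp0)// sqrtr_sqr ger0_norm ?gsnorm_ge0.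
  by move=> h; exact: (ler_pM_rot (L2norm_ge0 _) (L2norm_ge0 _) h gw).
exists (3 * C) => [|i w u v Hw Hu Hv]; first by rewrite mulr_gt0.
exact: (ler_norm3 (H i w u v Hw Hu Hv) (H i u w v Hu Hw Hv) (H i v w u Hv Hw Hu)).
Qed.

Lemma triBl i w w' u v : H10 w -> H10 w' -> H10 u -> H10 v ->
  tri i (w - w') u v = tri i w u v - tri i w' u v.
Proof.
move=> Hw Hw' Hu Hv.
have E1 : (w - w') * v = w * v - w' * v by rewrite mulrBl.
have E2 : (w - w') * u = w * u - w' * u by rewrite mulrBl.
rewrite /tri E1 E2 (ip_wDB i Hw Hw' (H10M_L2 Hu Hv)).
rewrite (ipBl (H10M_L2 Hw Hv) (H10M_L2 Hw' Hv) (H10_wD_L2 i Hu)).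
rewrite (ipBl (H10M_L2 Hw Hu) (H10M_L2 Hw' Hu) (H10_wD_L2 i Hv)).
exact: addr3B.
Qed.

Lemma triCA i w u v : tri i w u v = tri i u w v.
Proof. 
have e : w * u = u * w by exact: mulrC.
rewrite /tri e; exact: (congr1 (fun s => s + ip (u * w) (wD i v)) (addrC _ _)).
Qed.

Lemma triC i w u v : tri i w u v = tri i w v u.
Proof. rewrite /tri (mulrC u v); exact: addrAC. Qed.

Lemma tri_test i w u v : test w -> test u -> test v -> tri i w u v = 0.
Proof.
move=> tw tu tv; rewrite /tri.
have Lw := test_L2 oOm tw; have Lu := test_L2 oOm tu; have Lv := test_L2 oOm tv.
have Lwi := test_L2 oOm (test_partial i tw); have Lui := test_L2 oOm (test_partial i tu).
have Lvi := test_L2 oOm (test_partial i tv).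
have E f g h : test f -> test g -> test h -> ip (f * g) (wD i h) = ip (f * g) (partial i h).
  move=> tf tg th; exact: (ip_aeqr oOm (H10_wD_L2 i (test_H10 oOm th))
    (test_L2 oOm (test_partial i th)) (test_L2 oOm (testM tf tg)) (wD_test oOm i th)).
rewrite (E _ _ _ tu tv tw) (E _ _ _ tw tv tu) (E _ _ _ tw tu tv); have twu := testM tw tu.
rewrite (ip_test_partial oOm i twu tv) (test_partialM i tw tu).
have L1 := test_L2 oOm (testM tw (test_partial i tu)).
have L2' := test_L2 oOm (testM (test_partial i tw) tu).
rewrite (ipDl L1 L2' Lv).
rewrite (ip_mulAC w (partial i u) v) (ip_mulCA (partial i w) u v).
exact: subr_addC.
Qed.

(** Density is used in one argument at a time, because [tri] is linear and continuous in each but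
    not jointly linear. *)
Lemma tri0 i w u v : H10 w -> H10 u -> H10 v -> tri i w u v = 0.
Proof.
have [C C0 HC] := tri_le.
have main w' u' v' : H10 w' -> H10 u' -> H10 v' ->
   (forall phi, test phi -> tri i phi u' v' = 0) -> tri i w' u' v' = 0.
  move=> Hw Hu Hv H.
  apply: (@H10_density (fun w => tri i w u' v') (C * gsnorm u' * gsnorm v')) => //.
    by rewrite !mulr_ge0 ?gsnorm_ge0// ltW.
  move=> f phi Hf tp; have Hp := test_H10 oOm tp; rewrite -triBl//.
  apply: le_trans (HC i _ _ _ (H10B Hf Hp) Hu Hv) _.
  exact: ler_rot.
move=> Hw Hu Hv; apply: (main _ _ _ Hw Hu Hv) => phi tp; have Hp := test_H10 oOm tp.
(* By symmetry of [tri], the next argument that is not yet a test function is moved to the first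
   place, the only one that [main] handles. *)
rewrite triCA; apply: (main _ _ _ Hu Hp Hv) => psi ts; have Hs := test_H10 oOm ts.
rewrite triCA triC triCA; apply: (main _ _ _ Hv Hp Hs) => chi tc.
exact: tri_test.
Qed.

(** Derivatives of functions vanishing on the boundary have mean zero. Hence divergences of
    velocities lie in [Q] and may serve as pressure test functions. *)
Lemma ip_wD_cst1 i f : H10 f -> ip (wD i f) (cst 1) = 0.
Proof.
have L1 := L2_cst1.
have n0 : 0 <= nm (cst 1) by exact: L2norm_ge0.
apply: (@H10_density (fun f => ip (wD i f) (cst 1)) (nm (cst 1))) => // [phi tp|{}f phi Hf tp].
  have tpi := test_partial i tp.
  rewrite (ip_aeql mOm _ (test_L2 oOm tpi) L1 (wD_test oOm i tp)); last first.
    exact: H10_wD_L2 (test_H10 oOm tp).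
  exact: ip_partial_cst1.
have Hp := test_H10 oOm tp.
rewrite !(ipC _ L1); try exact: H10_wD_L2.
rewrite -ip_wDB//; apply: le_trans (L2_CS L1 (H10_wD_L2 i (H10B Hf Hp))) _.
by rewrite ler_wpM2l//; exact: L2norm_wD_le.
Qed.

End scalar_forms.

(** * Velocity fields and the trilinear form *)

Section vector_forms.
Context (R : realType) (d : nat) (Om : set 'rV[R]_d).
Hypotheses (oOm : open Om) (bOm : bounded_set Om) (hd : (2 <= d <= 3)%N).
Local Notation leb := (lebesgue_rV R d).
Local Notation L2 := (L2 Om).
Local Notation ip := (ip Om).
Local Notation nm := (L2norm Om).
Local Notation wD := (wD Om).
Local Notation aeq := (aeq Om).
Local Notation X := (Xsp Om).
Implicit Types u v w : vfield R d.

Let mOm : measurable Om := open_measurable_rV oOm.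
Let S := ip_semi_ip mOm.

Definition L2v v : Prop := forall j, L2 (v j).

Lemma ip_sum_mul (I : Type) (r : seq I) (a b : I -> 'rV[R]_d -> R) (v : 'rV[R]_d -> R) :
  (forall i, L2 (a i * v)) -> (forall i, L2 (b i)) ->
  ip (fun x => \sum_(i <- r) a i x * b i x) v = \sum_(i <- r) ip (a i * v) (b i).
Proof.
move=> La Lb; have int i := L2_mul_integrable mOm (La i) (Lb i).
have E : ip (fun x => \sum_(i <- r) a i x * b i x) v =
    \int[leb]_(x in Om) (\sum_(i <- r) (a i * v) x * b i x).
  apply: eq_Rintegral => x _; rewrite mulr_suml; apply: eq_bigr => i _.
  by rewrite mulrAC.
rewrite E; elim: r {E} => [|i r ih].
  rewrite big_nil /Rintegral integral0_eq// => x _; by rewrite big_nil.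
rewrite big_cons -ih -RintegralD//.
- by apply: eq_Rintegral => x _; rewrite big_cons.
- have := @integrable_sum _ _ _ leb Om mOm _ r xpredT
    (fun i => EFin \o (fun x => (a i * v) x * b i x)) (fun i _ => int i).
  by apply: eq_integrable => // x _; rewrite /= sumEFin.
Qed.

Lemma L2_sum (I : Type) (r : seq I) (F : I -> 'rV[R]_d -> R) :
  (forall i, L2 (F i)) -> L2 (\sum_(i <- r) F i).
Proof. exact: (sipP_sum S). Qed.

Lemma ip_suml (I : Type) (r : seq I) (F : I -> 'rV[R]_d -> R) f : (forall i, L2 (F i)) -> L2 f ->
  ip (\sum_(i <- r) F i) f = \sum_(i <- r) ip (F i) f.
Proof. exact: (sip_suml S). Qed.

Lemma L2norm2 f : L2 f -> nm f ^+ 2 = ip f f.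
Proof. exact: (sip_norm2 S). Qed.

Lemma L2normD f g : L2 f -> L2 g -> nm (f + g) <= nm f + nm g.
Proof. exact: (sip_normD S). Qed.

Lemma L2norm_sum_le (I : Type) (r : seq I) (F : I -> 'rV[R]_d -> R) : (forall i, L2 (F i)) ->
  nm (\sum_(i <- r) F i) <= \sum_(i <- r) nm (F i).
Proof.
move=> LF; elim: r => [|i r ih].
  by rewrite !big_nil /Defs.L2norm (sip0l S (L2_0 _)) sqrtr0.
rewrite !big_cons; apply: le_trans (L2normD (LF i) (L2_sum r LF)) _.
by rewrite lerD2l.
Qed.

Lemma ip_cst1E q : ip q (cst 1) = \int[leb]_(x in Om) q x.
Proof. by apply: eq_Rintegral => x _; rewrite mulr1. Qed.

Lemma ipZl a f g : L2 f -> L2 g -> ip (a *: f) g = a * ip f g.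
Proof. exact: (sipZl S). Qed.

Lemma ip_ge0 f : L2 f -> 0 <= ip f f.
Proof. exact: (sip_ge0 S). Qed.

Local Opaque Hm Defs.L2 Defs.ip Defs.wD Defs.L2norm Defs.H10.

Lemma vip_semi_ip : semi_ip L2v (vip Om).
Proof.
split.
- by move=> j; exact: L2_0.
- by move=> u v Lu Lv j; exact: (L2D mOm (Lu j) (Lv j)).
- by move=> a u Lu j; exact: (L2Z mOm a (Lu j)).
- by move=> u v Lu Lv; apply: eq_bigr => j _; exact: (ipC oOm (Lu j) (Lv j)).
- move=> u v w Lu Lv Lw; rewrite /vip -big_split; apply: eq_bigr => j _.
  exact: (ipDl oOm (Lu j) (Lv j) (Lw j)).
- move=> a u v Lu Lv; rewrite /vip mulr_sumr; apply: eq_bigr => j _.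
  exact: (ipZl a (Lu j) (Lv j)).
- by move=> u Lu; apply: sumr_ge0 => j _; exact: (ip_ge0 (Lu j)).
Qed.

Lemma X_L2v v : X v -> L2v v.
Proof. by move=> Xv j; exact: (H10_L2 (Xv j)). Qed.

Lemma X_wD_L2 v i j : X v -> L2 (wD i (v j)).
Proof. by move=> Xv; exact: (H10_wD_L2 i (Xv j)). Qed.

Lemma grad_semi_ip : semi_ip X (gradip Om).
Proof.
split.
- by move=> j; exact: (H10_0 oOm).
- by move=> u v Xu Xv j; exact: (H10D oOm (Xu j) (Xv j)).
- by move=> a u Xu j; exact: (H10Z oOm a (Xu j)).
- move=> u v Xu Xv; apply: eq_bigr => i _; apply: eq_bigr => j _.
  exact: (ipC oOm (X_wD_L2 i j Xu) (X_wD_L2 i j Xv)).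
- move=> u v w Xu Xv Xw; rewrite /gradip -big_split; apply: eq_bigr => i _.
  rewrite -big_split; apply: eq_bigr => j _.
  have Lu := X_wD_L2 i j Xu; have Lv := X_wD_L2 i j Xv; have Lw := X_wD_L2 i j Xw.
  have Luv := H10_wD_L2 i (H10D oOm (Xu j) (Xv j)).
  have E := wDD oOm i (H10_Hm1 (Xu j)) (H10_Hm1 (Xv j)).
  apply: etrans (ip_aeql mOm Luv (L2D mOm Lu Lv) Lw E) _.
  exact: (ipDl oOm Lu Lv Lw).
- move=> a u v Xu Xv; rewrite /gradip mulr_sumr; apply: eq_bigr => i _.
  rewrite mulr_sumr; apply: eq_bigr => j _.
  have Lu := X_wD_L2 i j Xu; have Lv := X_wD_L2 i j Xv.
  have Lau := H10_wD_L2 i (H10Z oOm a (Xu j)).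
  have E := wDZ oOm i a (H10_Hm1 (Xu j)).
  apply: etrans (ip_aeql mOm Lau (L2Z mOm a Lu) Lv E) _.
  exact: (ipZl a Lu Lv).
- move=> u Xu; apply: sumr_ge0 => i _; apply: sumr_ge0 => j _.
  exact: (ip_ge0 (X_wD_L2 i j Xu)).
Qed.

Lemma vnorm2 v : L2v v -> vnorm Om v ^+ 2 = \sum_(j < d) nm (v j) ^+ 2.
Proof.
move=> Lv; rewrite (sip_norm2 vip_semi_ip Lv); apply: eq_bigr => j _.
by rewrite L2norm2.
Qed.

Lemma gradnorm2 v : X v -> gradnorm Om v ^+ 2 = \sum_(j < d) gsnorm Om (v j) ^+ 2.
Proof.
move=> Xv; rewrite (sip_norm2 grad_semi_ip Xv) /gradip exchange_big; apply: eq_bigr => j _.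
rewrite gsnorm2; apply: eq_bigr => i _.
by rewrite (L2norm2 (X_wD_L2 i j Xv)).
Qed.

Lemma vnorm_ge0 v : 0 <= vnorm Om v. Proof. exact: sqrtr_ge0. Qed.
Lemma gradnorm_ge0 v : 0 <= gradnorm Om v. Proof. exact: sqrtr_ge0. Qed.

Lemma le_sqr_sum (F : 'I_d -> R) (c : R) j : 0 <= c -> 0 <= F j ->
  c ^+ 2 = \sum_(i < d) F i ^+ 2 -> F j <= c.
Proof.
move=> c0 F0 E; rewrite -ler_sqr ?nnegrE// E (bigD1 j)//= lerDl.
by apply: sumr_ge0 => k _; exact: sqr_ge0.
Qed.

Lemma L2norm_le_vnorm v j : L2v v -> nm (v j) <= vnorm Om v.
Proof.
move=> Lv; apply: (le_sqr_sum (vnorm_ge0 v) (L2norm_ge0 Om (v j)) (F := fun j => nm (v j))).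
exact: (vnorm2 Lv).
Qed.

Lemma gsnorm_le_gradnorm v j : X v -> gsnorm Om (v j) <= gradnorm Om v.
Proof.
move=> Xv; apply: (le_sqr_sum (gradnorm_ge0 v) (gsnorm_ge0 Om (v j)) (F := fun j => gsnorm Om (v j))).
exact: (gradnorm2 Xv).
Qed.

Lemma L2norm_wD_le_gradnorm v i j : X v -> nm (wD i (v j)) <= gradnorm Om v.
Proof.
by move=> Xv; apply: le_trans (L2norm_wD_le Om (v j) i) (gsnorm_le_gradnorm j Xv).
Qed.

Lemma poincare_X : exists2 C, 0 < C & forall v, X v -> vnorm Om v <= C * gradnorm Om v.
Proof.
have [C C0 HC] := poincare_gs oOm bOm hd; exists C => // v Xv.
have h0 : 0 <= C * gradnorm Om v by rewrite mulr_ge0 ?gradnorm_ge0// ltW.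
rewrite -ler_sqr ?nnegrE ?vnorm_ge0// (vnorm2 (X_L2v Xv)) exprMn (gradnorm2 Xv) mulr_sumr.
apply: ler_sum => j _; rewrite -exprMn ler_sqr ?nnegrE ?L2norm_ge0 ?mulr_ge0 ?gsnorm_ge0 ?(ltW C0)//.
exact: HC (Xv j).
Qed.

Lemma vip_convect w u v : X w -> X u -> X v -> vip Om (convect Om w u) v =
  \sum_(j < d) \sum_(i < d) ip (w i * v j) (wD i (u j)).
Proof.
move=> Xw Xu Xv; apply: eq_bigr => j _.
apply: (ip_sum_mul _ (a := w) (b := fun i => wD i (u j)) (v := v j)) => i.
  exact: (H10M_L2 oOm bOm hd (Xw i) (Xv j)).
exact: (X_wD_L2 i j Xu).
Qed.

Lemma ip_mulD_l (a b c e : 'rV[R]_d -> R) : H10 Om a -> H10 Om b -> H10 Om c -> L2 e ->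
  ip ((a - b) * c) e = ip (a * c) e - ip (b * c) e.
Proof.
move=> Ha Hb Hc Le; have E : (a - b) * c = a * c - b * c by rewrite mulrBl.
rewrite E; exact: (ipBl oOm (H10M_L2 oOm bOm hd Ha Hc) (H10M_L2 oOm bOm hd Hb Hc) Le).
Qed.

Lemma ip_mulD_r (a b c e : 'rV[R]_d -> R) : H10 Om a -> H10 Om b -> H10 Om c -> L2 e ->
  ip (c * (a - b)) e = ip (c * a) e - ip (c * b) e.
Proof.
move=> Ha Hb Hc Le; rewrite mulrC (mulrC c a) (mulrC c b); exact: ip_mulD_l.
Qed.

Definition trilin w u v : R := \sum_(j < d) \sum_(i < d) ip (w i * v j) (wD i (u j)).

Lemma bstarE w u v : X w -> X u -> X v ->
  bstar Om w u v = 2^-1 * trilin w u v - 2^-1 * trilin w v u.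
Proof. by move=> Xw Xu Xv; rewrite /bstar !vip_convect. Qed.

Lemma trilinBl w w' u v : X w -> X w' -> X u -> X v ->
  trilin (w - w') u v = trilin w u v - trilin w' u v.
Proof.
move=> Xw Xw' Xu Xv; rewrite /trilin -sumrB; apply: eq_bigr => j _.
rewrite -sumrB; apply: eq_bigr => i _.
exact: (ip_mulD_l (Xw i) (Xw' i) (Xv j) (X_wD_L2 i j Xu)).
Qed.

Lemma trilinBm w u u' v : X w -> X u -> X u' -> X v ->
  trilin w (u - u') v = trilin w u v - trilin w u' v.
Proof.
move=> Xw Xu Xu' Xv; rewrite /trilin -sumrB; apply: eq_bigr => j _.
rewrite -sumrB; apply: eq_bigr => i _.
exact: (ip_wDB oOm i (Xu j) (Xu' j) (H10M_L2 oOm bOm hd (Xw i) (Xv j))).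
Qed.

Lemma trilinBr w u v v' : X w -> X u -> X v -> X v' ->
  trilin w u (v - v') = trilin w u v - trilin w u v'.
Proof.
move=> Xw Xu Xv Xv'; rewrite /trilin -sumrB; apply: eq_bigr => j _.
rewrite -sumrB; apply: eq_bigr => i _.
exact: (ip_mulD_r (Xv j) (Xv' j) (Xw i) (X_wD_L2 i j Xu)).
Qed.

Lemma XB u v : X u -> X v -> X (u - v).
Proof. exact: (sipPB grad_semi_ip). Qed.

Lemma bstarBl w w' u v : X w -> X w' -> X u -> X v ->
  bstar Om (w - w') u v = bstar Om w u v - bstar Om w' u v.
Proof.
move=> Xw Xw' Xu Xv.
rewrite (bstarE (XB Xw Xw') Xu Xv) (bstarE Xw Xu Xv) (bstarE Xw' Xu Xv).
rewrite (trilinBl Xw Xw' Xu Xv) (trilinBl Xw Xw' Xv Xu).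
move: (trilin w u v) (trilin w' u v) (trilin w v u) (trilin w' v u) => a b c e; ring.
Qed.

Lemma bstarBm w u u' v : X w -> X u -> X u' -> X v ->
  bstar Om w (u - u') v = bstar Om w u v - bstar Om w u' v.
Proof.
move=> Xw Xu Xu' Xv.
rewrite (bstarE Xw (XB Xu Xu') Xv) (bstarE Xw Xu Xv) (bstarE Xw Xu' Xv).
rewrite (trilinBm Xw Xu Xu' Xv) (trilinBr Xw Xv Xu Xu').
move: (trilin w u v) (trilin w u' v) (trilin w v u) (trilin w v u') => a b c e; ring.
Qed.

Lemma bstar_diag w v : bstar Om w v v = 0.
Proof. exact: subrr. Qed.

(** The coefficient [w i] is paired with the test component [v j] in the product inequality, leaving
    the derivative of [u j] alone in L2; the factor [d%:R * d%:R] counts the summands. *)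
Lemma trilin_le : exists2 K, 0 < K & forall w u v, X w -> X u -> X v ->
  `|trilin w u v| <= K * Num.sqrt (vnorm Om w * gradnorm Om w) * gradnorm Om u * gradnorm Om v.
Proof.
have [K K0 HK] := L2norm_mul_gs oOm bOm hd.
have dp : (0 < d)%N by move: hd => /andP[]; case: (d).
exists (d%:R * d%:R * K); first by rewrite !mulr_gt0// ltr0n.
move=> w u v Xw Xu Xv.
pose Z := K * Num.sqrt (vnorm Om w * gradnorm Om w) * gradnorm Om u * gradnorm Om v.
have H j i : `|ip (w i * v j) (wD i (u j))| <= Z.
  have Lwv := H10M_L2 oOm bOm hd (Xw i) (Xv j).
  apply: le_trans (L2_CS oOm Lwv (X_wD_L2 i j Xu)) _.
  rewrite (_ : Z = K * gradnorm Om u * Num.sqrt (vnorm Om w * gradnorm Om w) * gradnorm Om v).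
    2: by rewrite /Z; move: (Num.sqrt _) (gradnorm Om u) (gradnorm Om v) => a b c; ring.
  apply: ler_pM_rot; [exact: L2norm_ge0|exact: L2norm_ge0| |].
    apply: le_trans (HK _ _ (Xw i) (Xv j)) _.
    apply: ler_pM; [by rewrite mulr_ge0 ?sqrtr_ge0// ltW|exact: gsnorm_ge0| |].
      rewrite ler_wpM2l ?(ltW K0)// ler_wsqrtr//.
      apply: ler_pM; [exact: L2norm_ge0|exact: gsnorm_ge0| |].
        exact: (L2norm_le_vnorm i (X_L2v Xw)).
      exact: (gsnorm_le_gradnorm i Xw).
    exact: (gsnorm_le_gradnorm j Xv).
  exact: (L2norm_wD_le_gradnorm i j Xu).
have -> : d%:R * d%:R * K * Num.sqrt (vnorm Om w * gradnorm Om w) * gradnorm Om u * gradnorm Om v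
  = \sum_(j < d) \sum_(i < d) Z.
  rewrite !sumr_const !card_ord -mulr_natl -[Z *+ d]mulr_natl /Z.
  move: (Num.sqrt _) (gradnorm Om u) (gradnorm Om v) => a b c; ring.
apply: le_trans (ler_norm_sum _ _ _) _; apply: ler_sum => j _.
by apply: le_trans (ler_norm_sum _ _ _) _; apply: ler_sum => i _; exact: H.
Qed.

Lemma bstar_le : exists2 K, 0 < K & forall w u v, X w -> X u -> X v ->
  `|bstar Om w u v| <= K * Num.sqrt (vnorm Om w * gradnorm Om w) * gradnorm Om u * gradnorm Om v.
Proof.
have [K K0 HK] := trilin_le; exists K => // w u v Xw Xu Xv.
have h1 := HK w u v Xw Xu Xv; have h2 := HK w v u Xw Xv Xu.
rewrite (bstarE Xw Xu Xv); move: h1 h2.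
move: (trilin w u v) (trilin w v u) (Num.sqrt _) (gradnorm Om u) (gradnorm Om v) => a b s x y.
rewrite !ler_norml => /andP[h1 h2] /andP[h3 h4].
have E : K * s * y * x = K * s * x * y by ring.
rewrite E in h3 h4; apply/andP; split; lra.
Qed.

Lemma divergE v : diverg Om v = \sum_(i < d) wD i (v i).
Proof. by apply/funext => x; rewrite fct_sumE. Qed.

Lemma diverg_L2 v : X v -> L2 (diverg Om v).
Proof. by move=> Xv; rewrite divergE; apply: L2_sum => i; exact: (X_wD_L2 i i Xv). Qed.

Lemma diverg_le v : X v -> nm (diverg Om v) <= d%:R * gradnorm Om v.
Proof.
move=> Xv; rewrite divergE.
apply: le_trans (L2norm_sum_le _ (fun i => X_wD_L2 i i Xv)) _.
have -> : d%:R * gradnorm Om v = \sum_(i < d) gradnorm Om v.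
  by rewrite sumr_const card_ord mulr_natl.
by apply: ler_sum => i _; exact: (L2norm_wD_le_gradnorm i i Xv).
Qed.

Lemma diverg_Qsp v : X v -> Qsp Om (diverg Om v).
Proof.
move=> Xv; split; first exact: diverg_L2.
rewrite -ip_cst1E divergE (ip_suml _ (fun i => X_wD_L2 i i Xv) (L2_cst1 oOm bOm)).
by apply: big1 => i _; exact: (ip_wD_cst1 oOm bOm i (Xv i)).
Qed.

(** The divergence has mean zero, so it is admissible as its own test function and its L2 norm
    vanishes. *)
Lemma diverg_free v : X v -> (forall q, Qsp Om q -> ip (diverg Om v) q = 0) ->
  aeq (diverg Om v) 0.
Proof.
move=> Xv H; apply: (aeq_ip0 mOm (diverg_L2 Xv)); exact: H (diverg_Qsp Xv).
Qed.

Lemma ip_divergB u v q : X u -> X v -> L2 q ->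
  ip (diverg Om (u - v)) q = ip (diverg Om u) q - ip (diverg Om v) q.
Proof.
move=> Xu Xv Lq; have Xuv := XB Xu Xv.
rewrite !divergE !ip_suml//; try by move=> i; exact: X_wD_L2.
rewrite -sumrB; apply: eq_bigr => i _.
rewrite !(ipC oOm _ Lq); [|exact: X_wD_L2..].
exact: (ip_wDB oOm i (Xu i) (Xv i) Lq).
Qed.

(** Summing [tri0] for [u_i], [u_j], [v_j] over the indices, the terms containing [d_i u_i] add up
    to a pairing with the divergence and vanish. Hence [trilin u] is skew in its last two arguments
    and the two halves of [bstar] agree. *)
Lemma bstar_convect u v : X u -> X v -> aeq (diverg Om u) 0 ->
  bstar Om u u v = vip Om (convect Om u u) v.
Proof.
move=> Xu Xv du.
have E : trilin u u v + trilin u v u = 0.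
  rewrite /trilin -big_split; apply: big1 => j _ /=; rewrite -big_split /=.
  have H i : ip (u i * v j) (wD i (u j)) + ip (u i * u j) (wD i (v j)) =
     - ip (u j * v j) (wD i (u i)).
    apply/eqP; rewrite -addr_eq0 addrC addrA; apply/eqP.
    exact: (tri0 oOm bOm hd i (Xu i) (Xu j) (Xv j)).
  rewrite (eq_bigr _ (fun i _ => H i)) sumrN.
  have Luv := H10M_L2 oOm bOm hd (Xu j) (Xv j).
  rewrite (eq_bigr (fun i => ip (wD i (u i)) (u j * v j))); last first.
    by move=> i _; rewrite (ipC oOm Luv (X_wD_L2 i i Xu)).
  rewrite -(ip_suml _ (fun i => X_wD_L2 i i Xu) Luv) -divergE.
  rewrite (ip_aeql mOm (diverg_L2 Xu) (L2_0 _) Luv du).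
  by rewrite (sip0l S Luv) oppr0.
rewrite (bstarE Xu Xu Xv) (vip_convect Xu Xu Xv) -/(trilin u u v).
have {}E : trilin u v u = - trilin u u v by apply/eqP; rewrite -addr_eq0 addrC E.
rewrite E; move: (trilin u u v) => a; by field.
Qed.

End vector_forms.

(** * Time increments as Bochner integrals *)

Section slice_integrals.
Context d1 d2 (T1 : measurableType d1) (T2 : measurableType d2) (R : realType).
Context (m1 : {sigma_finite_measure set T1 -> \bar R}) (m2 : {sigma_finite_measure set T2 -> \bar R}).
Context (E : T1 * T2 -> R) (mE : measurable_fun setT E).
Context (A : set T1) (mA : measurable A) (l c : R) (l0 : 0 < l).
Hypotheses (Al : m1 A = (l ^+ 2)%:E) (EA : forall z, ~ A z.1 -> E z = 0).
Hypothesis Ec : (\int[m1]_t \int[m2]_x (E (t, x) ^+ 2)%:E <= (c ^+ 2)%:E)%E.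

Let mE2 : measurable_fun setT (fun z => (E z ^+ 2)%:E).
Proof. by apply/measurable_EFinP; exact: measurable_funX. Qed.

Let mEl x : measurable_fun setT (fun t => E (t, x)).
Proof.
apply: (measurableT_comp mE); apply: measurable_fun_pair => //; exact: measurable_cst.
Qed.

(** The Bochner integral of [E] over [A], built pointwise in the second variable. Cauchy-Schwarz in
    the first variable bounds its L2 norm, and Fubini shows that it has the right pairing with every
    [v]. *)
Definition slice_integral (x : T2) : R := \int[m1]_t E (t, x).

Lemma measurable_slice_integral : measurable_fun setT slice_integral.
Proof.
have mEE : measurable_fun setT (EFin \o E) by exact/measurable_EFinP.
rewrite (_ : slice_integral = fine \o (fun x =>
   \int[m1]_t (EFin \o E)^\+ (t, x) - \int[m1]_t (EFin \o E)^\- (t, x))%E); last first.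
  apply/funext => x; rewrite /slice_integral /Rintegral integralE /=; congr (fine (_ - _)%E).
    by apply: eq_integral => t _; rewrite !funeposE.
  by apply: eq_integral => t _; rewrite !funenegE.
apply: (measurableT_comp (fine_measurable measurableT)).
apply: emeasurable_funB; apply: measurable_fun_fubini_tonelli_G => //.
  exact: measurable_funepos.
exact: measurable_funeneg.
Qed.

Let slice_le x : (\int[m1]_t (E (t, x) ^+ 2)%:E < +oo)%E ->
  ((slice_integral x ^+ 2)%:E <= (l ^+ 2)%:E * \int[m1]_t (E (t, x) ^+ 2)%:E)%E.
Proof.
move=> fin.
have I0 : (0 <= \int[m1]_t (E (t, x) ^+ 2)%:E)%E.
  by apply: integral_ge0 => t _; rewrite lee_fin sqr_ge0.
have If : (\int[m1]_t (E (t, x) ^+ 2)%:E)%E \is a fin_num by rewrite ge0_fin_numE.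
rewrite -(fineK If) -EFinM lee_fin.
set q := fine _; have q0 : 0 <= q by rewrite fine_ge0.
have H : (\int[m1]_t `|E (t, x) * \1_A t|%:E <= (Num.sqrt q * l)%:E)%E.
  apply: integral_mul_le; rewrite ?sqrtr_ge0 ?(ltW l0)//.
  - by rewrite sqr_sqrtr// /q fineK.
  - rewrite -Al -[X in m1 X]setIT -integral_indic//.
    by rewrite le_eqVlt; apply/orP; left; apply/eqP; apply: eq_integral => t _;
      rewrite indicE -natrX; case: (t \in A).
have E1 t : E (t, x) * \1_A t = E (t, x).
  rewrite indicE; case: (boolP (t \in A)) => [|/negP tA]; first by rewrite mulr1.
  by rewrite (EA (z := (t, x))) ?mul0r// => /= /mem_set.
have {}H : (\int[m1]_t `|E (t, x)|%:E <= (Num.sqrt q * l)%:E)%E.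
  by apply: le_trans H; apply: ge0_integral_mono => t; rewrite ?E1.
have mEx : measurable_fun setT (fun t => (E (t, x))%:E) by exact/measurable_EFinP.
have le1 := le_trans (le_abse_integral m1 measurableT mEx) H.
have fin1 : (\int[m1]_t (E (t, x))%:E)%E \is a fin_num.
  by rewrite fin_num_abs; apply: le_lt_trans le1 (ltry _).
have : `|slice_integral x| <= Num.sqrt q * l.
  by rewrite -lee_fin /slice_integral /Rintegral -abse_EFin fineK.
move=> h; rewrite -real_normK ?num_real// (_ : l ^+ 2 * q = (Num.sqrt q * l) ^+ 2).
  by rewrite ler_sqr ?nnegrE// (le_trans _ h).
by rewrite exprMn sqr_sqrtr// mulrC.
Qed.

Lemma slice_integral_sqr : (\int[m2]_x (slice_integral x ^+ 2)%:E <= ((l * c) ^+ 2)%:E)%E.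
Proof.
have mq : measurable_fun setT (fun x => \int[m1]_t (E (t, x) ^+ 2)%:E)%E.
  by apply: (measurable_fun_fubini_tonelli_G _ mE2) => z; rewrite lee_fin sqr_ge0.
have q0 x : (0 <= \int[m1]_t (E (t, x) ^+ 2)%:E)%E.
  by apply: integral_ge0 => t _; rewrite lee_fin sqr_ge0.
apply: (@le_trans _ _ (\int[m2]_x ((l ^+ 2)%:E * \int[m1]_t (E (t, x) ^+ 2)%:E))%E).
  apply: ge0_integral_mono => x; first by rewrite lee_fin sqr_ge0.
  have [fin|] := ltP (\int[m1]_t (E (t, x) ^+ 2)%:E)%E +oo%E; first exact: slice_le.
  by rewrite leye_eq => /eqP ->; rewrite gt0_muley ?leey// lte_fin exprn_gt0.
rewrite ge0_integralZl_EFin ?sqr_ge0//.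
rewrite -(fubini_tonelli (fun z => (E z ^+ 2)%:E))//; last by move=> z; rewrite lee_fin sqr_ge0.
rewrite exprMn [leRHS]EFinM; by apply: lee_wpmul2l; rewrite ?lee_fin ?sqr_ge0.
Qed.

Context (v : T2 -> R) (mv : measurable_fun setT v).
Hypothesis v2 : (\int[m2]_x (v x ^+ 2)%:E < +oo)%E.

Let Ev z : R := E z * v z.2.

Let mEv : measurable_fun setT Ev.
Proof.
by apply: measurable_funM => //; apply: (measurableT_comp mv); exact: measurable_snd.
Qed.

Let iEv : (m1 \x m2)%E.-integrable setT (EFin \o Ev).
Proof.
apply/integrable12ltyP; first exact/measurable_EFinP.
have mv2 : measurable_fun setT (fun x => (v x ^+ 2)%:E).
  by apply/measurable_EFinP; exact: measurable_funX.
have v20 : (0 <= \int[m2]_x (v x ^+ 2)%:E)%E.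
  by apply: integral_ge0 => x _; rewrite lee_fin sqr_ge0.
have mE2r t : measurable_fun setT (fun x => (E (t, x) ^+ 2)%:E).
  apply: (measurableT_comp mE2); apply: measurable_fun_pair => //; exact: measurable_cst.
have mq : measurable_fun setT (fun t => \int[m2]_x (E (t, x) ^+ 2)%:E)%E.
  by apply: (measurable_fun_fubini_tonelli_F _ mE2) => z; rewrite lee_fin sqr_ge0.
pose V := fine (\int[m2]_x (v x ^+ 2)%:E)%E.
have VE : (\int[m2]_x (v x ^+ 2)%:E)%E = V%:E by rewrite fineK// ge0_fin_numE.
have V0 : 0 <= V by rewrite fine_ge0.
(* On [A] the product is dominated by [E^2 + v^2], and off [A] it is zero; since [A] has finite
   measure both parts are integrable. *)
apply: (@le_lt_trans _ _ (\int[m1]_t (\int[m2]_x (E (t, x) ^+ 2)%:E + V%:E * (\1_A t)%:E))%E).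
  apply: ge0_integral_mono => t; first by apply: integral_ge0 => x _; rewrite lee_fin.
  have [At|nAt] := boolP (t \in A).
    rewrite indicE At mule1 -VE -ge0_integralD//; last 2 first.
    - by move=> x _; rewrite lee_fin sqr_ge0.
    - by move=> x _; rewrite lee_fin sqr_ge0.
    apply: ge0_integral_mono => x; first by rewrite lee_fin.
    rewrite /= -EFinD lee_fin /Ev /= ler_norml.
    move: (E (t, x)) (v x) => a b.
    have := sqr_ge0 (a + b); have := sqr_ge0 (a - b); have := sqr_ge0 a; have := sqr_ge0 b.
    by rewrite sqrrB sqrrD => h1 h2 h3 h4; apply/andP; split; lra.
  rewrite integral0_eq; last first.
    by move=> x _; rewrite /= /Ev (EA (z := (t, x))) ?mul0r ?normr0//= => /mem_set; exact/negP.
  by apply: adde_ge0; rewrite ?mule_ge0 ?lee_fin//; apply: integral_ge0 => x _; rewrite lee_fin sqr_ge0.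
rewrite ge0_integralD//; last 3 first.
- by move=> t _; apply: integral_ge0 => x _; rewrite lee_fin sqr_ge0.
- by move=> t _; rewrite mule_ge0// lee_fin.
- by apply: emeasurable_funM; [exact: measurable_cst|apply/measurable_EFinP; exact: measurable_indic].
apply: lte_add_pinfty; first exact: le_lt_trans Ec (ltry _).
rewrite ge0_integralZl_EFin//; last by apply/measurable_EFinP; exact: measurable_indic.
have -> : (\int[m1]_t (\1_A t)%:E = (l ^+ 2)%:E)%E by rewrite -Al -[X in m1 X]setIT -integral_indic.
by rewrite -EFinM ltry.
Qed.

Lemma integrable_slice_pairing :
  m1.-integrable setT (EFin \o (fun t => \int[m2]_x (E (t, x) * v x))).
Proof.
have iF := integrable_fubini_F iEv.
apply: le_integrable iF => //.
  apply/measurable_EFinP; apply: (measurableT_comp (fine_measurable measurableT)).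
  exact: (measurable_fubini_F iEv).
move=> t _ /=; rewrite /Rintegral.
by rewrite /fubini_F /Ev /=; case: (\int[m2]_y _)%E => [r| |] //=; rewrite ?normr0 ?leey.
Qed.

Lemma slice_integral_pairing :
  \int[m2]_x (slice_integral x * v x) = \int[m1]_t \int[m2]_x (E (t, x) * v x).
Proof.
have iF := integrable_fubini_F iEv.
rewrite /Rintegral; congr fine.
transitivity (\int[m1 \x m2]_z (EFin \o Ev) z)%E; last first.
  rewrite -(integral12_prod_meas1 iEv); apply: ae_eq_integral => //.
  - exact: (measurable_fubini_F iEv).
  - apply/measurable_EFinP; apply: (measurableT_comp (fine_measurable measurableT)).
    exact: (measurable_fubini_F iEv).
  - apply: filterS (integrable_ae measurableT iF) => t + _ => /(_ I) h.
    by rewrite fineK.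
rewrite -(integral21_prod_meas1 iEv); apply: ae_eq_integral => //.
- by apply/measurable_EFinP; apply: measurable_funM => //; exact: measurable_slice_integral.
- exact: (measurable_fubini_G iEv).
- apply: filterS (ae_integrable2 iEv) => x h _.
  have fG := integrable_fin_num measurableT h.
  (* Only the integrability of [E (t, x) * v x] in [t] is known. Where [v x] is nonzero it yields
     that of [E] itself; where it vanishes both sides are zero. *)
  have [v0|vn0] := eqVneq (v x) 0.
    rewrite v0 mulr0 /fubini_G integral0_eq// => t _.
    by rewrite /= /Ev /= v0 mulr0.
  rewrite /fubini_G -[RHS]fineK//; congr EFin.
  have iE : m1.-integrable setT (EFin \o (fun t => E (t, x))).
    have := integrableZr measurableT (v x)^-1 h.
    by apply: eq_integrable => // t _; rewrite /= /Ev /= -EFinM mulfK.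
  by rewrite -(RintegralZr (v x) measurableT iE).
Qed.

End slice_integrals.

(** * Measurable versions and Bochner integrals over time intervals *)

Section time_versions.
Context (R : realType) (d : nat) (Om : set 'rV[R]_d) (T : R).
Hypotheses (oOm : open Om).
Local Notation leb := (lebesgue_rV R d).
Local Notation mu := (@lebesgue_measure R).
Local Notation nm := (L2norm Om).
Local Notation L2 := (L2 Om).
Local Notation ip := (ip Om).

Let mOm : measurable Om := open_measurable_rV oOm.

Lemma ae_leb (P Q : R -> Prop) : (forall t, P t -> Q t) ->
  {ae mu, forall t, P t} -> {ae mu, forall t, Q t}.
Proof. by apply: filterS; exact: (ae_filter_ringOfSetsType mu). Qed.

Lemma ae_leb2 (P P' Q : R -> Prop) : (forall t, P t -> P' t -> Q t) ->
  {ae mu, forall t, P t} -> {ae mu, forall t, P' t} -> {ae mu, forall t, Q t}.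
Proof. by apply: filterS2; exact: (ae_filter_ringOfSetsType mu). Qed.

Lemma ge0_integral_mono_in (D : set R) (f g : R -> \bar R) :
  (forall x, D x -> 0 <= f x)%E -> (forall x, D x -> f x <= g x)%E ->
  (\int[mu]_(x in D) f x <= \int[mu]_(x in D) g x)%E.
Proof.
move=> f0 fg; rewrite integral_mkcond [leRHS]integral_mkcond.
apply: ge0_integral_mono => x; rewrite !patchE; case: ifPn => // /set_mem Dx; first exact: f0.
exact: fg.
Qed.

(** Extension by zero outside the space-time cylinder lets all product-measure arguments run on the
    full line and the full space. *)
Definition time_version (F : R -> 'rV[R]_d -> R) (D : measurableTypeR R * 'rV[R]_d -> R) : Prop :=
  [/\ measurable_fun setT D, forall z, ~ ((0 < z.1 < T) /\ Om z.2) -> D z = 0 &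
    {ae mu, forall t, 0 < t < T -> L2 (F t) /\ aeq Om (F t) (fun x => D (t, x))}].

(* [t |-> ip (F t) v] agrees only almost everywhere with a measurable function,
   whence [kp]. *)
Definition bochner_on (F : R -> 'rV[R]_d -> R) (a b : R) (h : 'rV[R]_d -> R) : Prop :=
  L2 h /\ forall v, L2 v -> ip h v = \int[mu]_(t in `[a, b]) ip (F t) v /\
    exists kp : R -> R, mu.-integrable `[a, b] (EFin \o kp) /\
      {ae mu, forall t, a <= t <= b -> ip (F t) v = kp t}.

Lemma bochner_version m w a : bochner_measurable Om T m w -> (size a <= m)%N ->
  (forall f, Hm Om m f -> L2 (wDs Om a f)) ->
  exists D, time_version (fun t => wDs Om a (w t)) D.
Proof.
move=> [D [mD HD]] am HL2.
have mS : measurable (`]0%R, T[ `*` Om : set (measurableTypeR R * 'rV[R]_d)) by exact: measurableX.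
exists ((D a) \_ (`]0, T[ `*` Om)); split.
- by apply/(measurable_restrictT _ mS); exact: mD.
- move=> z nz; rewrite patchE; case: ifPn => // /set_mem [/= z1 z2]; case: nz.
  by move: z1; rewrite in_itv.
- apply: (ae_leb _ HD) => t H t0; have [hm ae] := H t0; split; first exact: HL2.
  apply: filterS (ae a am) => x h Ox; rewrite patchE ifT; first exact: h.
  by apply/mem_set; split => //=; rewrite in_itv.
Qed.

Section one_field.
Context (F : R -> 'rV[R]_d -> R) (D : measurableTypeR R * 'rV[R]_d -> R).
Hypotheses (FD : time_version F D).
Hypothesis Ffin : (\int[mu]_(t in `]0%R, T[) (nm (F t) ^+ 2)%:E < +oo)%E.

Let mD : measurable_fun setT D. Proof. by case: FD. Qed.
Let D0 z : ~ ((0 < z.1 < T) /\ Om z.2) -> D z = 0. Proof. by case: FD => _ + _; apply. Qed.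

Let q (t : measurableTypeR R) : \bar R := (\int[leb]_x (D (t, x) ^+ 2)%:E)%E.

Let q0 t : (0 <= q t)%E.
Proof. by apply: integral_ge0 => x _; rewrite lee_fin sqr_ge0. Qed.

Let mq : measurable_fun setT q.
Proof.
have mD2 : measurable_fun setT (fun z => (D z ^+ 2)%:E).
  by apply/measurable_EFinP; exact: measurable_funX.
by apply: (measurable_fun_fubini_tonelli_F _ mD2) => z; rewrite lee_fin sqr_ge0.
Qed.

Let mDr t : measurable_fun setT (fun x => D (t, x)).
Proof.
apply: (measurableT_comp mD); apply: measurable_fun_pair => //; exact: measurable_cst.
Qed.

Let q_notin t : ~ (0 < t < T) -> q t = 0%E.
Proof.
by move=> nt; apply: integral0_eq => x _; rewrite D0 ?expr0n//= => -[].
Qed.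

Let q_norm : {ae mu, forall t, 0 < t < T -> q t = (nm (F t) ^+ 2)%:E}.
Proof.
have [_ _ H] := FD; apply: (ae_leb _ H) => t {}H t0; have [[mF L] ae] := H t0.
rewrite -L2_integral// integral_mkcond; apply: (@etrans _ _ (\int[leb]_(x in Om) (D (t, x) ^+ 2)%:E)%E).
  rewrite [RHS]integral_mkcond; apply: eq_integral => x _; rewrite !patchE.
  case: ifPn => // /negP xO; rewrite D0 ?expr0n//= => -[_ /mem_set]; exact: xO.
rewrite -integral_mkcond; apply: ae_eq_integral => //.
- by apply/measurable_EFinP; apply: measurable_funX; apply: measurable_funTS (mDr t).
- by apply/measurable_EFinP; exact: measurable_funX.
- by apply: filterS ae => x h Ox; rewrite h.
Qed.

Let itvT (t : R) : `]0, T[%classic t <-> 0 < t < T.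
Proof. by rewrite /= in_itv. Qed.

Let int_q : (\int[mu]_t q t = \int[mu]_(t in `]0%R, T[) (nm (F t) ^+ 2)%:E)%E.
Proof.
rewrite (@ge0_ae_eq_integralr _ _ R mu `]0, T[ _ q)//.
- rewrite [RHS]integral_mkcond; apply: eq_integral => t _; rewrite patchE.
  case: ifPn => // /negP tT; apply: q_notin => h; apply: tT; apply/mem_set; exact/itvT.
- exact: measurable_funTS mq.
- by move=> t; rewrite lee_fin sqr_ge0.
- by apply: (ae_leb _ q_norm) => t h /itvT/h.
Qed.

Let g (t : R) : R := fine (q t).

Let g0 t : 0 <= g t. Proof. exact: fine_ge0. Qed.

Let iq : mu.-integrable setT q.
Proof.
apply/integrableP; split; first exact: mq.
under eq_integral do rewrite gee0_abs//.
by rewrite int_q.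
Qed.

Let mg : measurable_fun setT g.
Proof. exact: (measurableT_comp (fine_measurable measurableT) mq). Qed.

Let gq : {ae mu, forall t, (g t)%:E = q t}.
Proof. by apply: (ae_leb _ (integrable_ae measurableT iq)) => t /(_ I) h; rewrite fineK. Qed.

Let ig : mu.-integrable setT (EFin \o g).
Proof.
apply: le_integrable iq => //; first exact/measurable_EFinP.
move=> t _ /=; rewrite /g; case: (q t) (q0 t) => [r| |] //= _; by rewrite ?normr0 ?leey.
Qed.

Section interval.
Context (a b : R) (a0 : 0 <= a) (ab : a < b) (bT : b <= T).

Let A : set (measurableTypeR R) := `[a, b]%classic.
Let mA : measurable A. Proof. exact: measurable_itv. Qed.
Let E (z : measurableTypeR R * 'rV[R]_d) : R := \1_A z.1 * D z.

Let mE : measurable_fun setT E.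
Proof.
have mi : measurable_fun setT (\1_A : measurableTypeR R -> R) by exact: measurable_indic.
by apply: measurable_funM => //; exact: (measurableT_comp mi measurable_fst).
Qed.

Let l : R := Num.sqrt (b - a).
Let l0 : 0 < l. Proof. by rewrite sqrtr_gt0 subr_gt0. Qed.

Let Al : mu A = (l ^+ 2)%:E.
Proof. by rewrite /A lebesgue_measure_itv/= lte_fin ab -EFinB sqr_sqrtr// subr_ge0 ltW. Qed.

Let EA z : ~ A z.1 -> E z = 0.
Proof. by move=> Az; rewrite /E indicE memNset// mul0r. Qed.

(** The half-open interval makes this quantity additive in the interval, so that bounds on
    consecutive time steps can be summed by telescoping. *)
Let G : R := \int[mu]_(t in `]a, b]) g t.
Let G0 : 0 <= G. Proof. by apply: Rintegral_ge0 => t _; exact: g0. Qed.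

Let intE2 : (\int[mu]_t \int[leb]_x (E (t, x) ^+ 2)%:E = G%:E)%E.
Proof.
transitivity (\int[mu]_(t in A) q t)%E.
  rewrite [RHS]integral_mkcond; apply: eq_integral => t _; rewrite patchE /E /=.
  case: ifPn => tA; rewrite indicE ?tA ?(negbTE tA).
    by apply: eq_integral => x _; rewrite mul1r.
  by apply: integral0_eq => x _; rewrite mul0r expr0n.
transitivity (\int[mu]_(t in A) (g t)%:E)%E.
  apply: ae_eq_integral => //.
  - exact: measurable_funTS mq.
  - by apply/measurable_EFinP; exact: measurable_funTS mg.
  - by apply: (ae_leb _ gq) => t h _; rewrite h.
rewrite /G /Rintegral fineK; last first.
  by apply: integrable_fin_num => //; exact: integrableS ig.
by rewrite /A -(@integral_itv_obnd_cbnd R a (BRight b) (EFin \o g))//; apply/measurable_EFinP; exact: measurable_funTS mg.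
Qed.

Let Ec : (\int[mu]_t \int[leb]_x (E (t, x) ^+ 2)%:E <= ((Num.sqrt G) ^+ 2)%:E)%E.
Proof. by rewrite intE2 sqr_sqrtr. Qed.

Lemma bochner_integral_itv : exists2 h, bochner_on F a b h &
  nm h ^+ 2 <= (b - a) * \int[mu]_(t in `]a, b]) g t.
Proof.
pose h := slice_integral mu E : 'rV[R]_d -> R.
have mh : measurable_fun setT h by exact: measurable_slice_integral.
have h2 := slice_integral_sqr mE mA l0 Al EA Ec.
have h2O : (\int[leb]_(x in Om) (h x ^+ 2)%:E <= ((l * Num.sqrt G) ^+ 2)%:E)%E.
  apply: le_trans h2; apply: ge0_subset_integral => //.
    by apply/measurable_EFinP; exact: measurable_funX.
  by move=> x _; rewrite lee_fin sqr_ge0.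
have Lh : L2 h.
  by split; [exact: measurable_funTS mh|apply: le_lt_trans h2O (ltry _)].
exists h; last first.
  have ba0 : 0 <= b - a by rewrite subr_ge0 ltW.
  by move: h2O; rewrite (L2_integral Lh) lee_fin exprMn (sqr_sqrtr G0) /l (sqr_sqrtr ba0).
split=> // v Lv; pose v' := v \_ Om.
have mv' : measurable_fun setT v' by apply/(measurable_restrictT _ mOm); case: Lv.
have v2 : (\int[leb]_x (v' x ^+ 2)%:E < +oo)%E.
  case: Lv => _; rewrite integral_mkcond (eq_integral (fun x => (v' x ^+ 2)%:E))// => x _.
  by rewrite /v' !patchE; case: ifP => //; rewrite expr0n.
have P1 := slice_integral_pairing mE mA Al EA Ec mv' v2.
have P2 := integrable_slice_pairing mE mA Al EA Ec mv' v2.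
pose kp (t : R) : R := \int[leb]_x (E (t, x) * v' x).
have kpE : {ae mu, forall t, a <= t <= b -> ip (F t) v = kp t}.
  have [_ _ H] := FD.
  have n0 : {ae mu, forall t, t != 0 /\ t != T}.
    have ne c : {ae mu, forall t, t != c}.
      exists [set c]; split => [//||t /= /negP]; first exact: lebesgue_measure_set1.
      by rewrite negbK => /eqP.
    by apply: (ae_leb2 _ (ne 0) (ne T)) => t.
  apply: (ae_leb2 _ n0 H) => t [tn0 tnT] + tab; case/andP: (tab) => at_ tb.
  have t0T : 0 < t < T.
    by rewrite lt_neqAle eq_sym tn0 (le_trans a0 at_) lt_neqAle tnT (le_trans tb bT).
  move=> /(_ t0T) [LF ae].
  have LD : L2 (fun x => D (t, x)).
    have [mF fF] := LF; split; first exact: measurable_funTS (mDr t).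
    rewrite (@ae_eq_integral _ _ _ leb Om (fun x => (F t x ^+ 2)%:E))//.
    - by apply/measurable_EFinP; apply: measurable_funX; exact: measurable_funTS (mDr t).
    - by apply/measurable_EFinP; exact: measurable_funX.
    - by apply: filterS ae => x e Ox; rewrite e.
  rewrite (ip_aeql mOm LF LD Lv ae) /kp [RHS](_ : _ = \int[leb]_x (((fun x => D (t, x) * v x) \_ Om) x)).
    by rewrite -Rintegral_mkcond.
  apply: eq_Rintegral => x _; rewrite /v' /E /= !patchE indicE mem_set; last by rewrite /A /= in_itv.
  by rewrite mul1r; case: ifP => _; rewrite ?mulr0.
split; last first.
  by exists kp; split => //; exact: integrableS P2.
have -> : ip h v = \int[leb]_x (h x * v' x).
  rewrite /Defs.ip Rintegral_mkcond; apply: eq_Rintegral => x _.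
  by rewrite /v' !patchE; case: ifP; rewrite ?mulr0.
rewrite P1 -/kp; congr fine.
have -> : (\int[mu]_(t in A) (ip (F t) v)%:E = \int[mu]_(t in A) (kp t)%:E)%E.
  apply: ae_eq_integralr => //.
    by apply: measurable_funTS (measurable_int _ P2).
  by apply: (ae_leb _ kpE) => t + At; rewrite /A /= in_itv in At => /(_ At) ->.
rewrite [RHS]integral_mkcond; apply: eq_integral => t _; rewrite patchE; case: ifPn => // tA.
rewrite /kp /Rintegral integral0_eq// => x _.
by rewrite EA ?mul0r// => /mem_set; exact/negP.
Qed.

End interval.

Lemma bochner_integral : exists gm : R -> R, [/\ mu.-integrable setT (EFin \o gm),
  forall t, 0 <= gm t, forall t, ~ (0 < t < T) -> gm t = 0,
  {ae mu, forall t, 0 < t < T -> nm (F t) ^+ 2 = gm t} &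
  forall a b, 0 <= a -> a < b -> b <= T ->
  exists2 h, bochner_on F a b h & nm h ^+ 2 <= (b - a) * \int[mu]_(t in `]a, b]) gm t].
Proof.
exists g; split => //.
- by move=> t nt; rewrite /g q_notin.
- by apply: (ae_leb _ q_norm) => t h t0; rewrite /g h.
- exact: bochner_integral_itv.
Qed.

End one_field.

End time_versions.

(** * Increments of functions of time *)

Section time_estimates.
Context (R : realType) (d : nat) (Om : set 'rV[R]_d) (T : R).
Hypotheses (oOm : open Om) (T0 : 0 < T).
Local Notation leb := (lebesgue_rV R d).
Local Notation mu := (@lebesgue_measure R).
Local Notation nm := (L2norm Om).
Local Notation L2 := (L2 Om).
Local Notation ip := (ip Om).
Local Notation wD := (wD Om).
Implicit Types (w wt : R -> 'rV[R]_d -> R).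

Let mOm : measurable Om := open_measurable_rV oOm.

(** [tnormoo] is the [fine] part of an essential supremum, which is informative only once that
    supremum is finite. The bound is assumed on the open interval and the norm is taken on the
    closed one, hence the two extra null points. *)
Lemma ess_bound (g : R -> R) : (forall t, 0 <= g t) ->
  (exists M, {ae mu, forall t, 0 < t < T -> g t <= M}) ->
  0 <= tnormoo T g /\ {ae mu, forall t, 0 < t < T -> g t <= tnormoo T g}.
Proof.
move=> g0 [M HM]; rewrite /tnormoo; set m := mrestr _ _; set e := ess_sup _ _.
have eM : (e <= M%:E)%E.
  apply/ess_supP; case: HM => N [mN N0 HN].
  have ne c : mu.-negligible [set c].
    by exists [set c]; split => //; exact: lebesgue_measure_set1.
  have [N' [mN' N'0 HN']] : mu.-negligible (N `|` ([set 0] `|` [set T])).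
    by apply: negligibleU; [exists N; split|exact: negligibleU].
  exists (N' `|` ~` `[0, T]%classic); split.
  - by apply: measurableU => //; apply: measurableC.
  - apply/eqP; rewrite -measure_le0 /m /mrestr -N'0; apply: le_measure; rewrite ?inE//.
      by apply: measurableI => //; apply: measurableU => //; exact: measurableC.
    by move=> t [[]].
  - move=> t /= H; have [t0T|] := pselect (`[0, T]%classic t); last by right.
    left; apply: HN'; move: t0T; rewrite /= in_itv /= => /andP[t0 tT].
    have [->|tn0] := eqVneq t 0; first by right; left.
    have [->|tnT] := eqVneq t T; first by right; right.
    left; apply: HN => /= H'; apply: H; rewrite lee_fin ger0_norm//; apply: H'.
    by rewrite !lt_neqAle eq_sym tn0 t0 tnT tT.
have e0 : (0 <= e)%E.
  apply: ess_sup_gee.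
    rewrite /m /= /mrestr setTI lebesgue_measure_itv /= lte_fin T0.
    by rewrite -EFinB subr0 lte_fin.
  by apply: nearW => t; rewrite lee_fin.
have ef : e \is a fin_num by rewrite ge0_fin_numE//; apply: le_lt_trans eM (ltry _).
split; first by rewrite fine_ge0.
have [N [mN N0 HN]] := ess_sup_ge m (fun t => `|g t|%:E).
exists (N `&` `[0, T]%classic); split; [exact: measurableI|exact: N0|].
move=> t /= /not_implyP[/andP[t0 tT] H]; split; last by rewrite /= in_itv /= !ltW.
apply: HN => /= H'; apply: H; rewrite -lee_fin fineK//; apply: le_trans H'.
by rewrite lee_fin ler_norm.
Qed.

Lemma Rintegral_le_cst (a b c : R) (k : R -> R) : a <= b -> 0 <= c ->
  mu.-integrable `[a, b] (EFin \o k) -> {ae mu, forall t, a <= t <= b -> `|k t| <= c} ->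
  `|\int[mu]_(t in `[a, b]) k t| <= c * (b - a).
Proof.
move=> ab c0 ik kc; have mk := measurable_int _ ik.
rewrite -lee_fin EFin_normr_Rintegral//.
apply: (le_trans (le_abse_integral _ _ mk)) => //.
apply: (@le_trans _ _ (\int[mu]_(t in `[a, b]) (c%:E))%E).
  apply: ae_ge0_le_integral => //.
  - exact: measurableT_comp.
rewrite integral_cst//= lebesgue_measure_itv/= lte_fin EFinM.
by case: ifPn => // _; rewrite ?mule0 ?lee_fin ?mulr_ge0 ?subr_ge0// EFinB.
Qed.

Lemma ae_itv (P : R -> Prop) (a b : R) : 0 <= a -> b <= T ->
  {ae mu, forall t, 0 < t < T -> P t} -> {ae mu, forall t, a <= t <= b -> P t}.
Proof.
move=> a0 bT HP.
have ne c : {ae mu, forall t, t != c}.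
  exists [set c]; split => [//||t /= /negP]; first exact: lebesgue_measure_set1.
  by rewrite negbK => /eqP.
have ne2 : {ae mu, forall t, t != 0 /\ t != T} by apply: (ae_leb2 _ (ne 0) (ne T)).
apply: (ae_leb2 _ ne2 HP) => t [tn0 tnT] + /andP[at_ tb]; apply.
by rewrite lt_neqAle eq_sym tn0 (le_trans a0 at_) lt_neqAle tnT (le_trans tb bT).
Qed.

Lemma integrable_itv_cst (a b c : R) : mu.-integrable `[a, b] (EFin \o cst c).
Proof.
apply/integrableP; split; first by apply/measurable_EFinP; exact: measurable_cst.
rewrite (eq_integral (cst `|c|%:E))// integral_cst//= lebesgue_measure_itv/= lte_fin.
by case: ifPn => _; rewrite ?mule0 ?ltry// -EFinB -EFinM ltry.
Qed.

Lemma L2norm0 : nm 0 = 0.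
Proof. by rewrite /L2norm (sip0l (ip_semi_ip mOm) (L2_0 _)) sqrtr0. Qed.

Lemma le_of_sqr_le_mul (x y : R) : 0 <= x -> 0 <= y -> x ^+ 2 <= y * x -> x <= y.
Proof.
move=> x0 y0; have [->//|xn0] := eqVneq x 0.
by rewrite expr2 ler_pM2r// lt_neqAle eq_sym xn0.
Qed.

(** [Th] is the primitive of the sum of the squared norms of the measurable versions. Its increments
    bound the individual steps, while its values at the end points recover the norm over the whole
    interval. A finite index type lets all components, or all first partial derivatives, share one
    [Th]. *)
Lemma time_family (K : finType) (F : K -> R -> 'rV[R]_d -> R) :
  (forall k, exists D, time_version Om T (F k) D) ->
  (forall k, (\int[mu]_(t in `]0%R, T[) (nm (F k t) ^+ 2)%:E < +oo)%E) ->
  exists Th : R -> R, [/\ Th 0 = 0,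
   Th T = tnorm2 T (fun t => Num.sqrt (\sum_k nm (F k t) ^+ 2)),
   forall a b, a <= b -> Th a <= Th b &
   forall k a b, 0 <= a -> a < b -> b <= T ->
     exists2 h, bochner_on Om (F k) a b h & nm h ^+ 2 <= (b - a) * (Th b - Th a)].
Proof.
move=> HD Hf.
have H k := let: ex_intro D FD := HD k in bochner_integral oOm FD (Hf k).
have [gm Hgm] := choice H.
pose g t := \sum_k gm k t.
have g0 t : 0 <= g t by apply: sumr_ge0 => k _; have [_ h _ _ _] := Hgm k.
have gz t : ~ (0 < t < T) -> g t = 0.
  by move=> h; apply: big1 => k _; have [_ _ z _ _] := Hgm k; exact: z.
have igk k : mu.-integrable setT (EFin \o gm k) by have [] := Hgm k.
have ig : mu.-integrable setT (EFin \o g).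
  have := @integrable_sum _ _ _ mu setT measurableT _ (index_enum K) xpredT
    (fun k => EFin \o gm k) (fun k _ => igk k).
  by apply: eq_integrable => // t _; rewrite /= /g sumEFin.
have igS A : measurable A -> mu.-integrable A (EFin \o g) by move=> mA; exact: integrableS ig.
pose Th b := \int[mu]_(t in `]-oo, b]) g t.
have ThB a b : a <= b -> Th b - Th a = \int[mu]_(t in `]a, b]) g t.
  by move=> ab; apply: Rintegral_itvB; rewrite ?bnd_simp//; exact: igS.
exists Th; split.
- rewrite /Th /Rintegral integral0_eq// => t; rewrite /= in_itv /= => t0.
  by rewrite gz// => /andP[]; rewrite ltNge t0.
- rewrite /Th /tnorm2 [LHS]Rintegral_mkcond.
  transitivity (\int[mu]_(t in `]0, T[) g t).
    rewrite [RHS]Rintegral_mkcond; apply: eq_Rintegral => t _; rewrite !patchE.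
    have [h|h] := pselect (0 < t < T).
      rewrite !ifT//; apply/mem_set; rewrite /= in_itv//=.
      by case/andP: h => _ /ltW.
    by rewrite (gz t h); do 2 case: ifP.
  rewrite /Rintegral; congr fine; symmetry; apply: ae_eq_integralr => //.
    by apply: measurable_int; exact: (igS _ (measurable_itv `]0, T[)).
  have : {ae mu, forall t, forall k, 0 < t < T -> nm (F k t) ^+ 2 = gm k t}.
    apply: (@filter_forall _ _ _ _ (ae_filter_ringOfSetsType mu)) => k.
    by have [] := Hgm k.
  apply: ae_leb => t Ht; rewrite /= in_itv /= => /Ht h; congr EFin.
  rewrite sqr_sqrtr ?sumr_ge0// => [|k _]; last exact: sqr_ge0.
  exact: eq_bigr.
- move=> a b ab; rewrite -subr_ge0 ThB//; exact: Rintegral_ge0.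
- move=> k a b a0 ab bT; have [_ _ _ _ /(_ a b a0 ab bT) [h Bh hle]] := Hgm k.
  exists h => //; apply: (le_trans hle); apply: ler_wpM2l; first by rewrite subr_ge0 ltW.
  rewrite (ThB _ _ (ltW ab)); apply: le_Rintegral => //.
  - by apply: integrableS (igk k).
  - exact: igS.
  - move=> t _; rewrite /g (bigD1 k)//= lerDl; apply: sumr_ge0 => j _.
    by have [_ hj _ _ _] := Hgm j.
Qed.

(** The increment is known only through its pairings, so it is paired with itself and one factor is
    cancelled. *)
Lemma time_increment w wt a b h : time_derivative Om T w wt -> 0 <= a -> a <= b -> b <= T ->
  bochner_on Om wt a b h -> nm (w b - w a) <= nm h.
Proof.
move=> [Lw _ Hw] a0 ab bT [Lh Hh].
have Lb : L2 (w b) by apply: Lw; rewrite (le_trans a0 ab).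
have La : L2 (w a) by apply: Lw; rewrite a0 (le_trans ab bT).
have Lba : L2 (w b - w a) := L2B oOm Lb La.
have E : nm (w b - w a) ^+ 2 = ip h (w b - w a).
  rewrite (L2norm2 oOm Lba) (ipBl oOm Lb La Lba) (Hw _ Lba a b a0 ab bT).
  by have [-> _] := Hh _ Lba.
have := le_trans (ler_norm _) (L2_CS oOm Lh Lba); rewrite -E.
exact: (le_of_sqr_le_mul (L2norm_ge0 _ _) (L2norm_ge0 _ _)).
Qed.

(** Space and time derivatives are interchanged by testing: against a test function, [h] acts as the
    weak derivative of the increment, and weak derivatives are unique up to null sets. *)
Lemma time_grad_increment w wt i a b h : time_derivative Om T w wt -> 0 <= a -> a <= b -> b <= T ->
  Hm Om 1 (w a) -> Hm Om 1 (w b) -> {ae mu, forall t, 0 < t < T -> Hm Om 1 (wt t)} ->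
  bochner_on Om (fun t => wD i (wt t)) a b h ->
  nm (wD i (w b - w a)) = nm h.
Proof.
move=> [Lw _ Hw] a0 ab bT Ha Hb Hwt [Lh Hh].
have Hba : Hm Om 1 (w b - w a) := Hm1B oOm Hb Ha.
have La := Hm1_L2 Ha; have Lb := Hm1_L2 Hb.
have W : weak_partial Om i (w b - w a) h.
  split=> // phi tphi; have Lphi := test_L2 oOm tphi.
  have Ldphi := test_L2 oOm (test_partial i tphi).
  rewrite (ipBl oOm Lb La Ldphi) (Hw _ Ldphi a b a0 ab bT).
  have [-> [kp [ikp kpE]]] := Hh _ Lphi.
  have mkp : measurable_fun `[a, b] (EFin \o kp) := measurable_int _ ikp.
  have -> : \int[mu]_(t in `[a, b]) ip (wD i (wt t)) phi = \int[mu]_(t in `[a, b]) kp t.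
    congr fine; apply: ae_eq_integralr => //.
    by apply: (ae_leb _ kpE) => t + /=; rewrite in_itv /= => + Ht => /(_ Ht) ->.
  rewrite -mulN1r -RintegralZl//; congr fine; apply: ae_eq_integralr => //.
    by apply: (measurable_funeM (-1)%:E mkp).
  apply: (ae_leb2 _ kpE (ae_itv a0 bT Hwt)) => t + + /=; rewrite in_itv /= => + + Ht.
  move=> /(_ Ht) <- /(_ Ht) Hm1; congr EFin.
  have [_ H] := Hm1_weak i Hm1.
  by rewrite (H _ tphi) mulN1r.
apply: (L2_aeq_norm oOm (Hm1_wD_L2 i Hba) Lh); exact: (wD_aeq oOm W).
Qed.

(** The consistency error is the integral over the step of [wt b - wt t], and each of these
    differences is an increment of [wt], bounded through [wtt] by [G]. *)
Lemma time_consistency w wt wtt a b h G : time_derivative Om T w wt -> time_derivative Om T wt wtt ->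
  0 <= a -> a < b -> b <= T -> 0 <= G ->
  (forall t, a <= t -> t < b -> exists2 g, bochner_on Om wtt t b g & nm g <= G) ->
  bochner_on Om wt a b h ->
  forall v, L2 v -> `|(b - a) * ip (wt b) v - (ip (w b) v - ip (w a) v)| <= (b - a) * G * nm v.
Proof.
move=> Dw Dwt a0 ab bT G0 HG [Lh Hh] v Lv.
have [Lw _ Hw] := Dw; have [Lwt _ Hwt] := Dwt.
have ab' := ltW ab.
have Lb : L2 (wt b) by apply: Lwt; rewrite (le_trans a0 ab').
have [_ [kp [ikp kpE]]] := Hh _ Lv.
rewrite (Hw _ Lv a b a0 ab' bT).
have -> : \int[mu]_(t in `[a, b]) ip (wt t) v = \int[mu]_(t in `[a, b]) kp t.
  congr fine; apply: ae_eq_integralr => //; first exact: measurable_int ikp.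
  by apply: (ae_leb _ kpE) => t + /=; rewrite in_itv /= => + Ht => /(_ Ht) ->.
have -> : (b - a) * ip (wt b) v = \int[mu]_(t in `[a, b]) cst (ip (wt b) v) t.
  by rewrite Rintegral_cst//= lebesgue_measure_itv/= lte_fin ab -EFinB mulrC.
have ic : mu.-integrable `[a, b] (EFin \o cst (ip (wt b) v)).
  exact: integrable_itv_cst.
rewrite -RintegralB// -mulrA [leRHS]mulrC.
apply: Rintegral_le_cst => //; first by rewrite mulr_ge0// L2norm_ge0.
  have := ikp; have := ic; set A := `[a, b]%classic => icA ikA.
  have hh : mu.-integrable A (fun t => ((EFin \o cst (ip (wt b) v)) t - (EFin \o kp) t)%E).
    by apply: integrableB => //; exact: measurable_itv.
  exact: hh.
apply: (ae_leb _ kpE) => t e /[dup] tab /e <-; case/andP: tab => at_ tb.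
have Lt : L2 (wt t) by apply: Lwt; rewrite (le_trans a0 at_) (le_trans tb bT).
rewrite -(ipBl oOm Lb Lt Lv); apply: (le_trans (L2_CS oOm (L2B oOm Lb Lt) Lv)).
apply: ler_wpM2r; first exact: L2norm_ge0.
have [->|tnb] := eqVneq t b.
  by rewrite subrr L2norm0.
have tltb : t < b by rewrite lt_neqAle tnb.
have [g Bg gG] := HG t at_ tltb; apply: le_trans gG.
exact: (time_increment Dwt (le_trans a0 at_) tb bT Bg).
Qed.

Lemma time_increment_bounded w wt a b c : time_derivative Om T w wt ->
  0 <= a -> a <= b -> b <= T -> 0 <= c ->
  {ae mu, forall t, 0 < t < T -> L2 (wt t) /\ nm (wt t) <= c} ->
  (exists h, bochner_on Om wt a b h) ->
  nm (w b - w a) <= (b - a) * c.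
Proof.
move=> [Lw _ Hw] a0 ab bT c0 Hc [h [Lh Hh]].
have Lb : L2 (w b) by apply: Lw; rewrite (le_trans a0 ab).
have La : L2 (w a) by apply: Lw; rewrite a0 (le_trans ab bT).
have Lba : L2 (w b - w a) := L2B oOm Lb La.
apply: le_of_sqr_le_mul; [exact: L2norm_ge0|by rewrite mulr_ge0// subr_ge0|].
rewrite (L2norm2 oOm Lba) (ipBl oOm Lb La Lba) (Hw _ Lba a b a0 ab bT).
have [_ [kp [ikp kpE]]] := Hh _ Lba.
have -> : \int[mu]_(t in `[a, b]) ip (wt t) (w b - w a) = \int[mu]_(t in `[a, b]) kp t.
  congr fine; apply: ae_eq_integralr => //; first exact: measurable_int ikp.
  by apply: (ae_leb _ kpE) => t + /=; rewrite in_itv /= => + Ht => /(_ Ht) ->.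
have N0 : 0 <= c * nm (w b - w a) by rewrite mulr_ge0// L2norm_ge0.
rewrite -mulrA mulrC; apply: (le_trans (ler_norm _)); apply: Rintegral_le_cst => //.
apply: (ae_leb2 _ kpE (ae_itv a0 bT Hc)) => t e1 e2 tab; rewrite -(e1 tab).
have [Lt nt] := e2 tab.
by apply: (le_trans (L2_CS oOm Lt Lba)); apply: ler_wpM2r => //; exact: L2norm_ge0.
Qed.

End time_estimates.

(** * Discrete energy estimates *)

Section discrete_estimates.
Context (R : realType).
Implicit Types (x y z a b c : R) (f g : nat -> R).

Lemma sum_semi_ip K : semi_ip setT (fun f g : nat -> R => \sum_(0 <= n < K) f n * g n).
Proof.
split=> //.
- by move=> u v _ _; apply: eq_bigr => n _; rewrite mulrC.
- by move=> u v w _ _ _; rewrite -big_split; apply: eq_bigr => n _; rewrite !fctE mulrDl.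
- by move=> a u v _ _; rewrite mulr_sumr; apply: eq_bigr => n _; rewrite mulrA.
- by move=> u _; apply: sumr_ge0 => n _; rewrite -expr2 sqr_ge0.
Qed.

Lemma sum_mul_le f g K : \sum_(0 <= n < K) f n * g n <=
  Num.sqrt (\sum_(0 <= n < K) f n ^+ 2) * Num.sqrt (\sum_(0 <= n < K) g n ^+ 2).
Proof.
have := sip_CS (sum_semi_ip K) (u := f) (v := g) I I.
by move=> /(le_trans (ler_norm _)).
Qed.

Lemma expR_ge1_ge0 a : 0 <= a -> 1 <= expR a.
Proof. by move=> a0; apply: le_trans (expR_ge1Dx a); rewrite lerDl. Qed.

Lemma discrete_gronwall (lam dt : R) (E D F : nat -> R) K : 0 <= lam -> 0 <= dt ->
  (forall n, 0 <= D n) -> (forall n, 0 <= E n) -> (forall n, 0 <= F n) ->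
  (forall n, (n < K)%N -> E n.+1 + D n <= (1 + lam * dt) * E n + F n) ->
  E K + \sum_(0 <= n < K) D n <=
  expR (lam * dt * K%:R) * (E 0%N + \sum_(0 <= n < K) F n).
Proof.
move=> l0 dt0 D0 E0 F0; elim: K => [|K ih] H.
  by rewrite !big_geq// mulr0 expR0 mul1r.
rewrite !big_nat_recr//= -natr1 [_ * (K%:R + 1)]mulrDr mulr1 expRD.
have {}ih := ih (fun n nK => H n (ltnW nK)).
have SD : 0 <= \sum_(0 <= n < K) D n by apply: sumr_ge0 => n _.
have SF : 0 <= \sum_(0 <= n < K) F n by apply: sumr_ge0 => n _.
have h := H K (ltnSn K).
have e1 : 1 + lam * dt <= expR (lam * dt) by exact: expR_ge1Dx.
have ld : 0 <= lam * dt by exact: mulr_ge0.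
have e2 : 1 <= expR (lam * dt * K%:R) by rewrite expR_ge1_ge0// mulr_ge0.
move: ih h e1 e2 SD SF (F0 K) (E0 K) (E0 0%N) ld.
move: (\sum_(0 <= n < K) D n) (\sum_(0 <= n < K) F n) (E K) (E K.+1) (E 0%N) (D K) (F K).
move: (lam * dt) => m sd sf eK eK1 e0 dK fK.
move: (expR _) (expR _) => q p ih h e1 e2 SD SF F00 EK E00 ld.
have h1 : (1 + m) * (eK + sd) <= q * (p * (e0 + sf)).
  apply: ler_pM; lra.
have h2 : fK <= p * q * fK.
  rewrite -[leLHS]mul1r ler_wpM2r// -[1]mulr1 ler_pM//; lra.
have h3 : sd <= (1 + m) * sd by rewrite -[leLHS]mul1r ler_wpM2r//; lra.
have -> : p * q * (e0 + (sf + fK)) = q * (p * (e0 + sf)) + p * q * fK by ring.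
lra.
Qed.

Lemma young nu a b : 0 < nu -> 2 * a * b <= nu * a ^+ 2 + b ^+ 2 / nu.
Proof.
move=> n0; rewrite -subr_ge0.
have -> : nu * a ^+ 2 + b ^+ 2 / nu - 2 * a * b = nu * (a - b / nu) ^+ 2.
  by field; rewrite gt_eqF.
by rewrite mulr_ge0 ?sqr_ge0// ltW.
Qed.

Lemma sqr_sum7 (a1 a2 a3 a4 a5 a6 a7 : R) :
  (a1 + a2 + a3 + a4 + a5 + a6 + a7) ^+ 2 <=
  7 * (a1 ^+ 2 + a2 ^+ 2 + a3 ^+ 2 + a4 ^+ 2 + a5 ^+ 2 + a6 ^+ 2 + a7 ^+ 2).
Proof.
have H x y : 2 * x * y <= x ^+ 2 + y ^+ 2.
  by have := sqr_ge0 (x - y); rewrite sqrrB -mulr_natr; lra.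
have := H a1 a2; have := H a1 a3; have := H a1 a4; have := H a1 a5; have := H a1 a6.
have := H a1 a7; have := H a2 a3; have := H a2 a4; have := H a2 a5; have := H a2 a6.
have := H a2 a7; have := H a3 a4; have := H a3 a5; have := H a3 a6; have := H a3 a7.
have := H a4 a5; have := H a4 a6; have := H a4 a7; have := H a5 a6; have := H a5 a7.
have := H a6 a7; rewrite !expr2; lra.
Qed.

(** * The energy inequality of one time step *)

Section step.
Context (nu dt eps T Q P al c1 : R).
Hypotheses (nu_gt0 : 0 < nu) (dt_gt0 : 0 < dt) (eps_gt0 : 0 < eps) (T_gt0 : 0 < T)
  (dtT : dt <= T) (Q_gt0 : 0 < Q) (c1_gt0 : 0 < c1) (c1e : c1 * dt <= eps)
  (P0 : 0 <= P) (al0 : 0 <= al).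

(* The term [sqrt (x g)] of the convective error is split between the old
   dissipation [g ^+ 2] and the Gronwall term [x ^+ 2 / nu ^+ 3]. *)
Lemma energy_step (x x' dx pp pp' dpi g g' ge ge' k' tt tg r gr : R) :
  0 <= x -> 0 <= pp -> 0 <= dpi -> pp' <= pp + dpi -> 0 <= g -> 0 <= tt -> 0 <= tg ->
  0 <= r -> 0 <= gr -> 0 <= ge' ->
  x' ^+ 2 - x ^+ 2 + dx ^+ 2 + eps * (pp' ^+ 2 - pp ^+ 2 + dpi ^+ 2) + 2 * nu * dt * g' ^+ 2
  <= 2 * dt * g' * (Q * (Num.sqrt (dt * tt) + ge' + k' + Num.sqrt (dt * tg) + ge
       + Num.sqrt (x * g) + Num.sqrt (r * gr) * ge'))
     + 2 * dt * (eps * P + al * Q * ge') * pp' ->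
  (x' ^+ 2 + eps * pp' ^+ 2 + nu * dt * g' ^+ 2)
  + (nu * dt / 2 * g ^+ 2 + dx ^+ 2 + eps / 2 * dpi ^+ 2)
  <= (1 + (49 * Q ^+ 4 / 2 / nu ^+ 3 + T^-1) * dt) * (x ^+ 2 + eps * pp ^+ 2 + nu * dt * g ^+ 2)
   + (7 * Q ^+ 2 / nu * dt * (dt * tt + ge' ^+ 2 + k' ^+ 2 + dt * tg + ge ^+ 2 + r * gr * ge' ^+ 2)
      + 6 * T / c1 * (eps ^+ 2 * P ^+ 2 + al ^+ 2 * Q ^+ 2 * ge' ^+ 2)).
Proof.
move=> x0 pp0 dpi0 ppd g0 tt0 tg0 r0 gr0 ge0.
set S := Num.sqrt (dt * tt) + _ + _ + _ + _ + _ + _.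
set Y := eps * P + _ => H.
have Y0 : 0 <= Y by rewrite addr_ge0// ?mulr_ge0// ltW.
(* This spends half of the new dissipation [2 nu dt g'^2]. The other half enters the energy carried
   to the next step, where it pays for the convective term. *)
have yg : 2 * g' * (Q * S) <= nu * g' ^+ 2 + (Q * S) ^+ 2 / nu by exact: young.
have S2 : S ^+ 2 <= 7 * (dt * tt + ge' ^+ 2 + k' ^+ 2 + dt * tg + ge ^+ 2 + x * g + r * gr * ge' ^+ 2).
  apply: (le_trans (sqr_sum7 _ _ _ _ _ _ _)).
  by rewrite [(_ * ge') ^+ 2]exprMn !sqr_sqrtr ?mulr_ge0// ltW.
(* The weight leaves exactly [nu / 2 * g^2], half of the old dissipation; the remaining coefficient
   of [x^2] is the origin of [49 Q^4 / 2] in the exponential rate. *)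
have xg : 7 * Q ^+ 2 / nu * (x * g) <= nu / 2 * g ^+ 2 + 49 * Q ^+ 4 / 2 / nu ^+ 3 * x ^+ 2.
  rewrite -subr_ge0.
  have -> : nu / 2 * g ^+ 2 + 49 * Q ^+ 4 / 2 / nu ^+ 3 * x ^+ 2 - 7 * Q ^+ 2 / nu * (x * g)
    = nu / 2 * (g - 7 * Q ^+ 2 / nu ^+ 2 * x) ^+ 2 by field; rewrite gt_eqF.
  by rewrite mulr_ge0 ?sqr_ge0// divr_ge0// ltW.
(* The old pressure error is charged to the Gronwall factor with rate [1 / T], the pressure
   increment to half of its own dissipation [eps * dpi^2]. No multiple of the new pressure error
   remains on the right. *)
have y1 : 2 * pp * Y <= eps / T * pp ^+ 2 + Y ^+ 2 / (eps / T) by apply: young; rewrite divr_gt0.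
have y2 : 2 * dpi * (dt * Y) <= eps / 2 * dpi ^+ 2 + (dt * Y) ^+ 2 / (eps / 2).
  by apply: young; rewrite divr_gt0.
have y3 : Y * pp' <= Y * (pp + dpi) by rewrite ler_wpM2l.
have Y2 : Y ^+ 2 <= 2 * (eps ^+ 2 * P ^+ 2 + al ^+ 2 * Q ^+ 2 * ge' ^+ 2).
  have := sqr_ge0 (eps * P - al * Q * ge'); rewrite /Y sqrrB sqrrD !exprMn; lra.
have de : dt / eps <= c1^-1 by rewrite ler_pdivrMr// mulrC ler_pdivlMr// mulrC.
(* The constant is [(dt / eps) (T + 2 dt) <= 3 T / c1], doubled by [Y2]. The lower bound
   [c1 dt <= eps] is what compensates the division by [eps]. *)
have yy : dt * (Y ^+ 2 / (eps / T)) + (dt * Y) ^+ 2 / (eps / 2)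
    <= 6 * T / c1 * (eps ^+ 2 * P ^+ 2 + al ^+ 2 * Q ^+ 2 * ge' ^+ 2).
  have -> : dt * (Y ^+ 2 / (eps / T)) + (dt * Y) ^+ 2 / (eps / 2)
    = (dt / eps) * (T + 2 * dt) * Y ^+ 2 by field; rewrite !gt_eqF.
  apply: (@le_trans _ _ (c1^-1 * (3 * T) * Y ^+ 2)).
    apply: ler_wpM2r; first exact: sqr_ge0.
    apply: ler_pM => //; first by rewrite divr_ge0// ltW.
      by rewrite addr_ge0 ?mulr_ge0// ltW.
    have -> : 3 * T = T + 2 * T by ring.
    by rewrite lerD2l ler_pM2l.
  have -> : 6 * T / c1 * (eps ^+ 2 * P ^+ 2 + al ^+ 2 * Q ^+ 2 * ge' ^+ 2) =
    c1^-1 * (3 * T) * (2 * (eps ^+ 2 * P ^+ 2 + al ^+ 2 * Q ^+ 2 * ge' ^+ 2)) by ring.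
  by rewrite ler_wpM2l// mulr_ge0 ?invr_ge0 ?mulr_ge0 ?(ltW c1_gt0) ?(ltW T_gt0).
have QS : dt * ((Q * S) ^+ 2 / nu) <= 7 * Q ^+ 2 / nu * dt *
    (dt * tt + ge' ^+ 2 + k' ^+ 2 + dt * tg + ge ^+ 2 + r * gr * ge' ^+ 2)
    + dt * (7 * Q ^+ 2 / nu * (x * g)).
  have -> : dt * ((Q * S) ^+ 2 / nu) = dt * Q ^+ 2 / nu * S ^+ 2 by ring.
  have -> : 7 * Q ^+ 2 / nu * dt *
    (dt * tt + ge' ^+ 2 + k' ^+ 2 + dt * tg + ge ^+ 2 + r * gr * ge' ^+ 2)
    + dt * (7 * Q ^+ 2 / nu * (x * g)) = dt * Q ^+ 2 / nu * (7 * (dt * tt + ge' ^+ 2 + k' ^+ 2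
     + dt * tg + ge ^+ 2 + x * g + r * gr * ge' ^+ 2)) by ring.
  by rewrite ler_wpM2l// divr_ge0 ?mulr_ge0 ?sqr_ge0 ?ltW.
have yg' : dt * (2 * g' * (Q * S)) <= dt * (nu * g' ^+ 2 + (Q * S) ^+ 2 / nu).
  by rewrite ler_wpM2l// ltW.
have xg' : dt * (7 * Q ^+ 2 / nu * (x * g)) <=
   dt * (nu / 2 * g ^+ 2 + 49 * Q ^+ 4 / 2 / nu ^+ 3 * x ^+ 2) by rewrite ler_wpM2l// ltW.
have y1' : dt * (2 * pp * Y) <= dt * (eps / T * pp ^+ 2 + Y ^+ 2 / (eps / T)).
  by rewrite ler_wpM2l// ltW.
have y3' : dt * (Y * pp') <= dt * (Y * (pp + dpi)) by rewrite ler_wpM2l// ltW.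
have r1 : 0 <= 49 * Q ^+ 4 / 2 / nu ^+ 3 * dt * (eps * pp ^+ 2 + nu * dt * g ^+ 2).
  by rewrite !mulr_ge0 ?invr_ge0 ?exprn_ge0 ?addr_ge0 ?mulr_ge0 ?sqr_ge0// ltW.
have r2 : 0 <= T^-1 * dt * (x ^+ 2 + nu * dt * g ^+ 2).
  by rewrite !mulr_ge0 ?invr_ge0 ?exprn_ge0 ?addr_ge0 ?mulr_ge0 ?sqr_ge0// ltW.
have E1 : 2 * dt * g' * (Q * S) = dt * (2 * g' * (Q * S)) by ring.
have E2 : 2 * dt * Y * pp' = 2 * (dt * (Y * pp')) by ring.
rewrite E1 E2 in H.
have E3 : 2 * (dt * (Y * (pp + dpi))) = dt * (2 * pp * Y) + 2 * dpi * (dt * Y) by ring.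
move: H yg' QS xg' y1' y2 y3' yy r1 r2 E3.
move: (7 * Q ^+ 2 / nu * dt * _) (6 * T / c1 * _) (49 * Q ^+ 4 / 2 / nu ^+ 3) (7 * Q ^+ 2 / nu * (x * g)).
move: (Q * S) => s w1 w2 w3 w4.
have -> : eps / T * pp ^+ 2 = T^-1 * (eps * pp ^+ 2) by ring.
move: (T^-1) (Y ^+ 2 / _) ((dt * Y) ^+ 2 / _) => ti w5 w6.
move: (s ^+ 2 / nu) (dt * (2 * g' * s)) (dt * (2 * pp * Y)) => w7 w8 w9.
move: (2 * dpi * (dt * Y)) (dt * (Y * (pp + dpi))) (dt * (Y * pp')) => w10 w11 w12.
lra.
Qed.

End step.

(** How a surplus power of [1/nu] is paid for: [1/nu = (nu^2 / T) (T / nu^3)], where the first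
    factor is bounded by [nu0^2 / T] and the second by its exponential. *)
Lemma inv_le_expR (nu nu0 T : R) : 0 < T -> 0 < nu -> nu <= nu0 ->
  nu^-1 <= nu0 ^+ 2 / T * expR (T / nu ^+ 3).
Proof.
move=> T0 n0 nn.
apply: (@le_trans _ _ (nu0 ^+ 2 / T * (T / nu ^+ 3))).
  have -> : nu0 ^+ 2 / T * (T / nu ^+ 3) = (nu0 / nu) ^+ 2 * nu^-1.
    by field; rewrite !gt_eqF.
  rewrite ler_peMl ?invr_ge0 ?(ltW n0)// expr_ge1 ?divr_ge0 ?(ltW n0)//.
    by rewrite ler_pdivlMr// mul1r.
  exact: le_trans (ltW n0) nn.
apply: ler_wpM2l; first by rewrite divr_ge0 ?sqr_ge0// ltW.
by apply: (le_trans _ (expR_ge1Dx _)); rewrite lerDr.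
Qed.

Lemma terms_le_sum (s a1 a2 a3 a4 a5 a6 a7 a8 a9 a10 : R) :
  s = a1 + a2 + a3 + (a4 + a5) + a6 + a7 + a8 + a9 + a10 ->
  0 <= a1 -> 0 <= a2 -> 0 <= a3 -> 0 <= a4 -> 0 <= a5 -> 0 <= a6 -> 0 <= a7 -> 0 <= a8 ->
  0 <= a9 -> 0 <= a10 ->
  [/\ a4 <= s, a6 <= s, a5 <= s & a7 <= s] /\ [/\ a8 <= s, a10 <= s, a9 <= s & a1 + a2 + a3 <= s].
Proof. by move=> -> *; do 2 split; lra. Qed.

(** * Summation over the time steps and the dichotomy on the stability quantity *)

Section total.
Context (T nu0 c1 c2 Q Cs : R).
Hypotheses (T_gt0 : 0 < T) (c1_gt0 : 0 < c1) (c2_gt0 : 0 < c2)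
  (Q_gt0 : 0 < Q) (Cs_gt0 : 0 < Cs).
Context (nu dt eps P al TT TG : R) (K : nat).
Context (x dx pp dpi g ge k tt tg r gr : nat -> R).
Hypotheses (nu_gt0 : 0 < nu) (nu_le : nu <= nu0) (dt_gt0 : 0 < dt) (dtK : dt * K%:R <= T)
  (K_gt0 : (0 < K)%N) (c1e : c1 * dt <= eps) (c2e : eps <= c2 * dt) (P0 : 0 <= P) (al0 : 0 <= al).
Hypotheses (x0 : forall n, 0 <= x n) (pp0 : forall n, 0 <= pp n) (dpi0 : forall n, 0 <= dpi n)
  (g0 : forall n, 0 <= g n) (ge0 : forall n, 0 <= ge n) (tt0 : forall n, 0 <= tt n)
  (tg0 : forall n, 0 <= tg n) (r0 : forall n, 0 <= r n) (gr0 : forall n, 0 <= gr n).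
Hypotheses (sum_tt : \sum_(0 <= n < K) tt n <= TT) (sum_tg : \sum_(0 <= n < K) tg n <= TG).
Hypothesis ppS : forall n, (n < K)%N -> pp n.+1 <= pp n + dpi n.
Hypothesis err : forall n, (n < K)%N ->
  x n.+1 ^+ 2 - x n ^+ 2 + dx n ^+ 2 + eps * (pp n.+1 ^+ 2 - pp n ^+ 2 + dpi n ^+ 2)
    + 2 * nu * dt * g n.+1 ^+ 2
  <= 2 * dt * g n.+1 * (Q * (Num.sqrt (dt * tt n) + ge n.+1 + k n.+1 + Num.sqrt (dt * tg n) + ge n
       + Num.sqrt (x n * g n) + Num.sqrt (r n * gr n) * ge n.+1))
     + 2 * dt * (eps * P + al * Q * ge n.+1) * pp n.+1.

Let G : R := dt * \sum_(0 <= n < K.+1) ge n ^+ 2.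
Let Kp : R := dt * \sum_(0 <= n < K.+1) k n ^+ 2.
Let X7 : R := Num.sqrt dt / (nu * Num.sqrt nu) * Num.sqrt (\sum_(0 <= n < K) ge n.+1 ^+ 4).
Let A : R := x 0%N ^+ 2 + eps * pp 0%N ^+ 2 + dt * nu * g 0%N ^+ 2 + nu^-1 * G.
Let L : R := x K ^+ 2 + eps * pp K ^+ 2 + nu * dt * g K ^+ 2
  + \sum_(0 <= n < K) (dx n ^+ 2 + eps / 2 * dpi n ^+ 2)
  + nu * dt * \sum_(0 <= n < K.+1) g n ^+ 2.
Let rhs : R := x 0%N ^+ 2 + eps * pp 0%N ^+ 2 + dt * nu * g 0%N ^+ 2
  + (nu^-1 + al ^+ 2 * dt^-1) * G + nu^-1 * Kp + dt ^+ 2 / nu * TT + dt ^+ 2 / nu * TG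
  + X7 + dt * P ^+ 2.

(* [stab] alone gives the conclusion when [1 <= A]; otherwise the three bounds are
   constants, up to powers of [nu]. *)
Hypothesis stab : L <= Cs / nu * (1 + A).
Hypothesis stab_r : forall n, (n < K)%N -> r n ^+ 2 <= Cs / nu * (1 + A).
Hypothesis stab_gr : dt * \sum_(0 <= n < K) gr n ^+ 2 <= Cs / nu ^+ 2 * (1 + A).

Let e_gt0 : 0 < eps. Proof. by apply: lt_le_trans c1e; rewrite mulr_gt0. Qed.
Let dtT : dt <= T.
Proof. by apply: le_trans dtK; rewrite ler_peMr ?(ltW dt_gt0)// ler1n. Qed.
Let sum_sqr_ge0 (f : nat -> R) m : 0 <= \sum_(0 <= n < m) f n ^+ 2.
Proof. by apply: sumr_ge0 => n _; exact: sqr_ge0. Qed.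
Let G0 : 0 <= G. Proof. by rewrite mulr_ge0 ?(ltW dt_gt0). Qed.
Let Kp0 : 0 <= Kp. Proof. by rewrite mulr_ge0 ?(ltW dt_gt0). Qed.
Let TT0 : 0 <= TT. Proof. by apply: le_trans sum_tt; apply: sumr_ge0. Qed.
Let TG0 : 0 <= TG. Proof. by apply: le_trans sum_tg; apply: sumr_ge0. Qed.
Let n0 := ltW nu_gt0.
Let d0 := ltW dt_gt0.
Let e0 := ltW e_gt0.
Let X70 : 0 <= X7. Proof. by rewrite mulr_ge0 ?divr_ge0 ?mulr_ge0 ?sqrtr_ge0. Qed.

Let parts : [/\ 0 <= x 0%N ^+ 2, 0 <= eps * pp 0%N ^+ 2 & 0 <= dt * nu * g 0%N ^+ 2].
Proof. by split; rewrite ?mulr_ge0 ?sqr_ge0. Qed.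
Let parts2 : [/\ 0 <= nu^-1 * G, 0 <= al ^+ 2 * dt^-1 * G & 0 <= nu^-1 * Kp].
Proof. by split; rewrite ?mulr_ge0 ?sqr_ge0 ?invr_ge0. Qed.
Let parts3 : [/\ 0 <= dt ^+ 2 / nu * TT, 0 <= dt ^+ 2 / nu * TG & 0 <= dt * P ^+ 2].
Proof. by split; rewrite ?mulr_ge0 ?sqr_ge0 ?invr_ge0. Qed.

Let A_le : 0 <= A <= rhs.
Proof.
have [h1 h2 h3] := parts; have [h4 h5 h6] := parts2; have [h7 h8 h9] := parts3.
have E : rhs = A + (al ^+ 2 * dt^-1 * G + nu^-1 * Kp + dt ^+ 2 / nu * TT + dt ^+ 2 / nu * TG
  + X7 + dt * P ^+ 2) by rewrite /rhs /A; ring.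
by rewrite E !addr_ge0//= lerDl !addr_ge0.
Qed.

Let F n : R := 7 * Q ^+ 2 / nu * dt * (dt * tt n + ge n.+1 ^+ 2 + k n.+1 ^+ 2 + dt * tg n
     + ge n ^+ 2 + r n * gr n * ge n.+1 ^+ 2)
   + 6 * T / c1 * (eps ^+ 2 * P ^+ 2 + al ^+ 2 * Q ^+ 2 * ge n.+1 ^+ 2).

Let sum_shift (f : nat -> R) : \sum_(0 <= n < K) f n.+1 ^+ 2 <= \sum_(0 <= n < K.+1) f n ^+ 2.
Proof. by rewrite [leRHS]big_nat_recl//= lerDr sqr_ge0. Qed.
Let sum_noshift (f : nat -> R) : \sum_(0 <= n < K) f n ^+ 2 <= \sum_(0 <= n < K.+1) f n ^+ 2.
Proof. by rewrite [leRHS]big_nat_recr//= lerDl sqr_ge0. Qed.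

(** With [A < 1] the stability bounds give [r <= (2 Cs / nu)^(1/2)] and an L2-in-time norm of [gr]
    at most [(2 Cs)^(1/2) / nu]. Cauchy-Schwarz against [ge^2] then yields the fourth powers; the
    factor [dt] divided by the [dt^(1/2)] of the time norm leaves [dt^(1/2)]. *)
Let term7 : A < 1 -> dt * \sum_(0 <= n < K) r n * gr n * ge n.+1 ^+ 2 <= 2 * Cs * X7.
Proof.
move=> A1; have /andP[Ag0 _] := A_le.
have csn : Cs / nu * (1 + A) <= 2 * Cs / nu.
  rewrite [leRHS](_ : _ = Cs / nu * 2); last by ring.
  by rewrite ler_wpM2l ?divr_ge0 ?(ltW Cs_gt0)//; lra.
have csn2 : Cs / nu ^+ 2 * (1 + A) <= 2 * Cs / nu ^+ 2.
  rewrite [leRHS](_ : _ = Cs / nu ^+ 2 * 2); last by ring.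
  by rewrite ler_wpM2l ?divr_ge0 ?exprn_ge0 ?(ltW Cs_gt0)//; lra.
have rle n : (n < K)%N -> r n <= Num.sqrt (2 * Cs / nu).
  move=> nK; rewrite -[leLHS]ger0_norm// -sqrtr_sqr ler_wsqrtr//.
  exact: le_trans (stab_r nK) csn.
have s1 : \sum_(0 <= n < K) r n * gr n * ge n.+1 ^+ 2 <=
    Num.sqrt (2 * Cs / nu) * \sum_(0 <= n < K) gr n * ge n.+1 ^+ 2.
  rewrite mulr_sumr big_nat_cond [leRHS]big_nat_cond; apply: ler_sum => n /andP[/andP[_ nK] _].
  by rewrite -mulrA ler_wpM2r ?mulr_ge0 ?sqr_ge0// rle.
have s2 := sum_mul_le gr (fun n => ge n.+1 ^+ 2) K.
have e4 : \sum_(0 <= n < K) (ge n.+1 ^+ 2) ^+ 2 = \sum_(0 <= n < K) ge n.+1 ^+ 4.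
  by apply: eq_bigr => n _; rewrite -exprM.
rewrite e4 in s2; set W := Num.sqrt (\sum_(0 <= n < K) ge n.+1 ^+ 4) in s2.
have s3 : Num.sqrt (\sum_(0 <= n < K) gr n ^+ 2) <= Num.sqrt (2 * Cs / nu ^+ 2 / dt).
  by rewrite ler_wsqrtr// ler_pdivlMr// mulrC (le_trans stab_gr).
have W0 : 0 <= W by exact: sqrtr_ge0.
apply: (@le_trans _ _ (dt * (Num.sqrt (2 * Cs / nu) * (Num.sqrt (2 * Cs / nu ^+ 2 / dt) * W)))).
  rewrite ler_wpM2l//; apply: le_trans s1 _; rewrite ler_wpM2l ?sqrtr_ge0//.
  by apply: le_trans s2 _; rewrite ler_wpM2r.
have c20 : 0 <= 2 * Cs by rewrite mulr_ge0// ltW.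
rewrite /X7 -/W (_ : 2 * Cs / nu ^+ 2 / dt = 2 * Cs * ((nu ^+ 2)^-1 * dt^-1)); last by rewrite !mulrA.
rewrite (sqrtrM (nu^-1) c20) (sqrtrM _ c20) [Num.sqrt (_^-1 * _)]sqrtrM ?invr_ge0 ?exprn_ge0//.
rewrite !sqrtrV ?exprn_ge0// sqrtr_sqr (ger0_norm n0).
have sC : Num.sqrt (2 * Cs) ^+ 2 = 2 * Cs by rewrite sqr_sqrtr.
have sd : Num.sqrt dt ^+ 2 = dt by rewrite sqr_sqrtr.
have sd0 : Num.sqrt dt != 0 by rewrite gt_eqF// sqrtr_gt0.
have sn0 : Num.sqrt nu != 0 by rewrite gt_eqF// sqrtr_gt0.
move: (Num.sqrt (2 * Cs)) (Num.sqrt dt) (Num.sqrt nu) sC sd sd0 sn0 => p q w <- <- q0 w0.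
rewrite le_eqVlt; apply/orP; left; apply/eqP; field.
by rewrite q0 w0 gt_eqF.
Qed.

(** Every summand is a multiple of a term of [rhs]. The number 35 counts five such terms with
    coefficient [7 Q^2], the norm of [ge] occurring at both the old and the new level;
    [14 Q^2 Cs / nu] is [7 Q^2 / nu] times the constant of [term7]. *)
Let sumF : A < 1 -> x 0%N ^+ 2 + eps * pp 0%N ^+ 2 + nu * dt * g 0%N ^+ 2 + \sum_(0 <= n < K) F n <=
  (1 + 35 * Q ^+ 2 + 6 * T ^+ 2 * c2 ^+ 2 / c1 + 6 * T * Q ^+ 2 / c1 + 14 * Q ^+ 2 * Cs / nu) * rhs.
Proof.
move=> A1; have t7 := term7 A1.
have [h1 h2 h3] := parts; have [h4 h5 h6] := parts2; have [h7 h8 h9] := parts3.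
have Q2 : 0 <= Q ^+ 2 by exact: sqr_ge0.
have E : \sum_(0 <= n < K) F n = 7 * Q ^+ 2 / nu * (dt * dt * (\sum_(0 <= n < K) tt n)
   + dt * (\sum_(0 <= n < K) ge n.+1 ^+ 2) + dt * (\sum_(0 <= n < K) k n.+1 ^+ 2)
   + dt * dt * (\sum_(0 <= n < K) tg n) + dt * (\sum_(0 <= n < K) ge n ^+ 2)
   + dt * (\sum_(0 <= n < K) r n * gr n * ge n.+1 ^+ 2))
   + 6 * T / c1 * (eps ^+ 2 * P ^+ 2 * K%:R + al ^+ 2 * Q ^+ 2 * (\sum_(0 <= n < K) ge n.+1 ^+ 2)).
  rewrite -[K%:R](_ : \sum_(0 <= n < K) (1 : R) = _); last by rewrite sumr_const_nat subn0.
  rewrite !mulr_sumr -!big_split /= !mulr_sumr -!big_split /=.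
  by apply: eq_bigr => n _; rewrite /F; ring.
have k1 : dt * dt * (\sum_(0 <= n < K) tt n) <= dt ^+ 2 * TT.
  by rewrite -expr2 ler_wpM2l// sqr_ge0.
have k2 : dt * (\sum_(0 <= n < K) ge n.+1 ^+ 2) <= G by rewrite ler_wpM2l.
have k3 : dt * (\sum_(0 <= n < K) k n.+1 ^+ 2) <= Kp by rewrite ler_wpM2l.
have k4 : dt * dt * (\sum_(0 <= n < K) tg n) <= dt ^+ 2 * TG.
  by rewrite -expr2 ler_wpM2l// sqr_ge0.
have k5 : dt * (\sum_(0 <= n < K) ge n ^+ 2) <= G by rewrite ler_wpM2l.
have k6 : eps ^+ 2 * P ^+ 2 * K%:R <= T * c2 ^+ 2 * (dt * P ^+ 2).
  apply: (@le_trans _ _ ((c2 * dt) ^+ 2 * P ^+ 2 * K%:R)).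
    by rewrite !ler_wpM2r ?sqr_ge0// ler_sqr ?nnegrE// mulr_ge0// ltW.
  have -> : (c2 * dt) ^+ 2 * P ^+ 2 * K%:R = (dt * K%:R) * (c2 ^+ 2 * (dt * P ^+ 2)) by ring.
  rewrite -[leRHS]mulrA ler_wpM2r//; apply: mulr_ge0; [exact: sqr_ge0|by rewrite mulr_ge0 ?sqr_ge0].
(* [G] contains a factor [dt] that this sum lacks: the division by [eps] in the pressure estimate
   has used it up. This is where [alpha^2 dt^-1] comes from. *)
have k7 : al ^+ 2 * Q ^+ 2 * (\sum_(0 <= n < K) ge n.+1 ^+ 2) <= Q ^+ 2 * (al ^+ 2 * dt^-1 * G).
  have -> : Q ^+ 2 * (al ^+ 2 * dt^-1 * G) = al ^+ 2 * Q ^+ 2 * \sum_(0 <= n < K.+1) ge n ^+ 2.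
    by rewrite /G; field; rewrite gt_eqF.
  by rewrite ler_wpM2l// mulr_ge0 ?sqr_ge0.
rewrite E.
have w1 : 0 <= 7 * Q ^+ 2 / nu by rewrite divr_ge0// mulr_ge0.
have w2 : 0 <= 6 * T / c1 by rewrite divr_ge0 ?mulr_ge0// ltW.
have T1 := ler_wpM2l w1 (lerD (lerD (lerD (lerD (lerD k1 k2) k3) k4) k5) t7).
have T2 := ler_wpM2l w2 (lerD k6 k7).
have rh0 : 0 <= rhs by case/andP: A_le => /le_trans; apply.
have rhsE : rhs = x 0%N ^+ 2 + eps * pp 0%N ^+ 2 + dt * nu * g 0%N ^+ 2
  + (nu^-1 * G + al ^+ 2 * dt^-1 * G) + nu^-1 * Kp + dt ^+ 2 / nu * TT + dt ^+ 2 / nu * TG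
  + X7 + dt * P ^+ 2 by rewrite /rhs mulrDl.
have [[le1 le2 le3 le4] [le5 le6 le7 le8]] : [/\ nu^-1 * G <= rhs, nu^-1 * Kp <= rhs,
  al ^+ 2 * dt^-1 * G <= rhs & dt ^+ 2 / nu * TT <= rhs] /\ [/\ dt ^+ 2 / nu * TG <= rhs,
  dt * P ^+ 2 <= rhs, X7 <= rhs &
  x 0%N ^+ 2 + eps * pp 0%N ^+ 2 + nu * dt * g 0%N ^+ 2 <= rhs].
  by rewrite [nu * dt]mulrC; apply: (terms_le_sum rhsE).
have B1 : 7 * Q ^+ 2 / nu * (dt ^+ 2 * TT + G + Kp + dt ^+ 2 * TG + G + 2 * Cs * X7) <=
   (35 * Q ^+ 2 + 14 * Q ^+ 2 * Cs / nu) * rhs.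
  have -> : 7 * Q ^+ 2 / nu * (dt ^+ 2 * TT + G + Kp + dt ^+ 2 * TG + G + 2 * Cs * X7) =
    7 * Q ^+ 2 * (dt ^+ 2 / nu * TT + nu^-1 * G + nu^-1 * Kp + dt ^+ 2 / nu * TG + nu^-1 * G)
    + 14 * Q ^+ 2 * Cs / nu * X7 by ring.
  rewrite [leRHS]mulrDl; apply: lerD; last first.
    by rewrite ler_wpM2l// divr_ge0// mulr_ge0 ?(ltW Cs_gt0)// mulr_ge0.
  have -> : 35 * Q ^+ 2 * rhs = 7 * Q ^+ 2 * (5 * rhs) by ring.
  have five (y : R) : 5 * y = y + y + y + y + y by ring.
  rewrite five; apply: ler_wpM2l; first by rewrite mulr_ge0.
  exact: (lerD (lerD (lerD (lerD le4 le1) le2) le5) le1).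
have B2 : 6 * T / c1 * (T * c2 ^+ 2 * (dt * P ^+ 2) + Q ^+ 2 * (al ^+ 2 * dt^-1 * G)) <=
   (6 * T ^+ 2 * c2 ^+ 2 / c1 + 6 * T * Q ^+ 2 / c1) * rhs.
  have -> : (6 * T ^+ 2 * c2 ^+ 2 / c1 + 6 * T * Q ^+ 2 / c1) * rhs =
    6 * T / c1 * (T * c2 ^+ 2 * rhs + Q ^+ 2 * rhs) by ring.
  by rewrite ler_wpM2l// lerD// ler_wpM2l// mulr_ge0 ?sqr_ge0// ltW.
apply: (@le_trans _ _ (rhs + ((35 * Q ^+ 2 + 14 * Q ^+ 2 * Cs / nu) * rhs +
  (6 * T ^+ 2 * c2 ^+ 2 / c1 + 6 * T * Q ^+ 2 / c1) * rhs))).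
  by apply: lerD => //; apply: lerD; [exact: le_trans T1 B1|exact: le_trans T2 B2].
by rewrite le_eqVlt; apply/orP; left; apply/eqP; ring.
Qed.

(** In the constant, the factor 2 restores the full [nu dt] from the half kept in the Gronwall sum,
    [expR 1] is the contribution of the rate [1 / T], and each [nu0 ^+ 2 / T] stands for one [1/nu]
    absorbed by [inv_le_expR]. The last summand serves the case [1 <= A], where
    [1 + A <= 2 * rhs]. *)
Lemma discrete_error_bound :
  L <= (2 * expR 1 * (1 + 35 * Q ^+ 2 + 6 * T ^+ 2 * c2 ^+ 2 / c1 + 6 * T * Q ^+ 2 / c1
          + 14 * Q ^+ 2 * Cs * (nu0 ^+ 2 / T)) + 2 * Cs * (nu0 ^+ 2 / T))
       * expR ((49 * Q ^+ 4 / 2 + 1) * T / nu ^+ 3) * rhs.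
Proof.
have /andP[Ag0 Arhs] := A_le.
have rh0 : 0 <= rhs by exact: le_trans Arhs.
have Q2 : 0 <= Q ^+ 2 by exact: sqr_ge0.
have Q4 : 0 <= 49 * Q ^+ 4 / 2 by rewrite divr_ge0// mulr_ge0// exprn_ge0// ltW.
have C0 := ltW Cs_gt0; have t0 := ltW T_gt0.
pose M := 1 + 35 * Q ^+ 2 + 6 * T ^+ 2 * c2 ^+ 2 / c1 + 6 * T * Q ^+ 2 / c1.
have M1 : 1 <= M.
  have m1 : 0 <= 35 * Q ^+ 2 by rewrite mulr_ge0.
  have m2 : 0 <= 6 * T ^+ 2 * c2 ^+ 2 / c1.
    by rewrite divr_ge0 ?(ltW c1_gt0)// mulr_ge0 ?sqr_ge0// mulr_ge0 ?sqr_ge0.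
  have m3 : 0 <= 6 * T * Q ^+ 2 / c1.
    by rewrite divr_ge0 ?(ltW c1_gt0)// mulr_ge0// mulr_ge0.
  by rewrite /M; lra.
pose b := nu0 ^+ 2 / T; have b0 : 0 <= b by rewrite divr_ge0 ?sqr_ge0.
have M0 : 0 <= M by apply: le_trans M1.
have cb : 0 <= 14 * Q ^+ 2 * Cs * b by rewrite mulr_ge0// mulr_ge0// mulr_ge0.
have inv := inv_le_expR T_gt0 nu_gt0 nu_le; rewrite -/b in inv.
have Tn0 : 0 <= T / nu ^+ 3 by rewrite divr_ge0 ?exprn_ge0.
have ee : expR ((49 * Q ^+ 4 / 2 + 1) * T / nu ^+ 3) =
    expR (49 * Q ^+ 4 / 2 * (T / nu ^+ 3)) * expR (T / nu ^+ 3).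
  by rewrite -expRD; congr expR; ring.
rewrite ee -/M -/b.
have g1 : 1 <= expR (49 * Q ^+ 4 / 2 * (T / nu ^+ 3)) by rewrite expR_ge1_ge0// mulr_ge0.
have g2 : 1 <= expR (T / nu ^+ 3) by exact: expR_ge1_ge0.
have [A1|A1] := leP 1 A.
  apply: (le_trans stab); apply: (@le_trans _ _ (2 * Cs * nu^-1 * rhs)).
    have -> : 2 * Cs * nu^-1 * rhs = Cs / nu * (2 * rhs) by ring.
    by rewrite ler_wpM2l ?divr_ge0//; lra.
  rewrite ler_wpM2r//; move: inv g1 g2.
  move: (expR _) (expR _) => q p inv g1 g2.
  apply: (@le_trans _ _ (2 * Cs * (b * p))); first by rewrite ler_wpM2l ?mulr_ge0.
  have e1 : 0 <= 2 * expR 1 * (M + 14 * Q ^+ 2 * Cs * b).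
    by apply: mulr_ge0; [rewrite mulr_ge0 ?expR_ge0|exact: addr_ge0].
  have -> : 2 * Cs * (b * p) = 2 * Cs * b * p by ring.
  have p0 : 0 <= p by lra.
  apply: ler_pM => //; [by rewrite mulr_ge0// mulr_ge0|by rewrite lerDr|].
  by rewrite -[leLHS]mul1r ler_wpM2r.
have lam0 : 0 <= 49 * Q ^+ 4 / 2 / nu ^+ 3 + T^-1 by rewrite addr_ge0 ?invr_ge0// divr_ge0 ?exprn_ge0.
have F0 n : 0 <= F n.
  have rg : 0 <= r n * gr n * ge n.+1 ^+ 2 by rewrite mulr_ge0 ?sqr_ge0// mulr_ge0.
  have q2 : 0 <= al ^+ 2 * Q ^+ 2 * ge n.+1 ^+ 2 by rewrite mulr_ge0 ?sqr_ge0// mulr_ge0 ?sqr_ge0.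
  have q1 : 0 <= eps ^+ 2 * P ^+ 2 by rewrite mulr_ge0 ?sqr_ge0.
  have d1 : 0 <= dt * tt n by rewrite mulr_ge0.
  have d2 : 0 <= dt * tg n by rewrite mulr_ge0.
  rewrite /F; apply: addr_ge0; apply: mulr_ge0.
  - by rewrite mulr_ge0// divr_ge0// mulr_ge0.
  - by rewrite !addr_ge0 ?sqr_ge0.
  - by rewrite divr_ge0 ?(ltW c1_gt0)// mulr_ge0.
  - exact: addr_ge0.
pose E n := x n ^+ 2 + eps * pp n ^+ 2 + nu * dt * g n ^+ 2.
pose D n := nu * dt / 2 * g n ^+ 2 + dx n ^+ 2 + eps / 2 * dpi n ^+ 2.
have nd : 0 <= nu * dt by rewrite mulr_ge0.
have E0 n : 0 <= E n.
  have h1 : 0 <= eps * pp n ^+ 2 by rewrite mulr_ge0 ?sqr_ge0.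
  have h2 : 0 <= nu * dt * g n ^+ 2 by rewrite mulr_ge0 ?sqr_ge0.
  by rewrite !addr_ge0 ?sqr_ge0.
have D0 n : 0 <= D n.
  have h1 : 0 <= eps / 2 * dpi n ^+ 2 by rewrite mulr_ge0 ?sqr_ge0// divr_ge0.
  have h2 : 0 <= nu * dt / 2 * g n ^+ 2 by rewrite mulr_ge0 ?sqr_ge0// divr_ge0.
  by rewrite !addr_ge0 ?sqr_ge0.
have step n : (n < K)%N -> E n.+1 + D n <= (1 + (49 * Q ^+ 4 / 2 / nu ^+ 3 + T^-1) * dt) * E n + F n.
  move=> nK; apply: (energy_step nu_gt0 dt_gt0 e_gt0 T_gt0 dtT Q_gt0 c1_gt0 c1e P0 al0
    (x0 n) (pp0 n) (dpi0 n) (ppS nK) (g0 n) (tt0 n) (tg0 n) (r0 n) (gr0 n) (ge0 n.+1) (err nK)).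
have gron := discrete_gronwall lam0 d0 D0 E0 F0 step.
have LE : L <= 2 * (E K + \sum_(0 <= n < K) D n).
  have -> : \sum_(0 <= n < K) D n = nu * dt / 2 * (\sum_(0 <= n < K) g n ^+ 2) +
     \sum_(0 <= n < K) (dx n ^+ 2 + eps / 2 * dpi n ^+ 2).
    by rewrite mulr_sumr -big_split /=; apply: eq_bigr => n _; rewrite /D addrA.
  have S0 : 0 <= \sum_(0 <= n < K) (dx n ^+ 2 + eps / 2 * dpi n ^+ 2).
    by apply: sumr_ge0 => n _; rewrite addr_ge0 ?sqr_ge0// mulr_ge0 ?sqr_ge0// divr_ge0.
  rewrite /L /E big_nat_recr//=.
  have p1 : 0 <= x K ^+ 2 by exact: sqr_ge0.
  have p2 : 0 <= eps * pp K ^+ 2 by rewrite mulr_ge0 ?sqr_ge0.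
  lra.
apply: (le_trans LE).
have lamT : expR ((49 * Q ^+ 4 / 2 / nu ^+ 3 + T^-1) * dt * K%:R) <=
   expR 1 * expR (49 * Q ^+ 4 / 2 * (T / nu ^+ 3)).
  rewrite -expRD ler_expR -mulrA.
  apply: (@le_trans _ _ ((49 * Q ^+ 4 / 2 / nu ^+ 3 + T^-1) * T)); first by rewrite ler_wpM2l.
  by rewrite le_eqVlt; apply/orP; left; apply/eqP; field; rewrite !gt_eqF.
have sF := sumF A1; rewrite -/(E 0%N) -/M in sF.
have S00 : 0 <= E 0%N + \sum_(0 <= n < K) F n by rewrite addr_ge0// sumr_ge0.
have h1 : E K + \sum_(0 <= n < K) D n <=
  expR 1 * expR (49 * Q ^+ 4 / 2 * (T / nu ^+ 3)) * ((M + 14 * Q ^+ 2 * Cs / nu) * rhs).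
  by apply: (le_trans gron); apply: ler_pM; rewrite ?expR_ge0.
have h2 : M + 14 * Q ^+ 2 * Cs / nu <= (M + 14 * Q ^+ 2 * Cs * b) * expR (T / nu ^+ 3).
  rewrite [leRHS]mulrDl; apply: lerD; first by rewrite ler_peMr//; lra.
  by rewrite -[leRHS]mulrA ler_wpM2l// mulr_ge0// mulr_ge0.
apply: (@le_trans _ _ (2 * (expR 1 * expR (49 * Q ^+ 4 / 2 * (T / nu ^+ 3)) *
   ((M + 14 * Q ^+ 2 * Cs * b) * expR (T / nu ^+ 3) * rhs)))).
  rewrite ler_wpM2l//; apply: (le_trans h1); rewrite ler_wpM2l ?mulr_ge0 ?expR_ge0//.
  by rewrite ler_wpM2r.
have -> : 2 * (expR 1 * expR (49 * Q ^+ 4 / 2 * (T / nu ^+ 3)) *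
   ((M + 14 * Q ^+ 2 * Cs * b) * expR (T / nu ^+ 3) * rhs)) =
   2 * expR 1 * (M + 14 * Q ^+ 2 * Cs * b) * (expR (49 * Q ^+ 4 / 2 * (T / nu ^+ 3)) * expR (T / nu ^+ 3)) * rhs.
  by ring.
apply: ler_wpM2r => //; apply: ler_wpM2r; first by rewrite mulr_ge0 ?expR_ge0.
by rewrite lerDl mulr_ge0// mulr_ge0.
Qed.

End total.

End discrete_estimates.

(** * From the stability of the scheme to that of the discrete error *)

Section stability_consequences.
Context (R : realType).

Lemma sqrD2_le (x y z : R) : 0 <= x -> x <= y + z -> x ^+ 2 <= 2 * y ^+ 2 + 2 * z ^+ 2.
Proof.
move=> x0 h; have h2 : x ^+ 2 <= (y + z) ^+ 2 by rewrite ler_sqr ?nnegrE// (le_trans x0).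
by apply: (le_trans h2); have := sqr_ge0 (y - z); rewrite sqrrB sqrrD; lra.
Qed.

Lemma sqrD3_le (x y z w : R) : 0 <= x -> x <= y + z + w ->
  x ^+ 2 <= 3 * y ^+ 2 + 3 * z ^+ 2 + 3 * w ^+ 2.
Proof.
move=> x0 h; have h2 : x ^+ 2 <= (y + z + w) ^+ 2.
  by rewrite ler_sqr ?nnegrE// (le_trans x0).
apply: (le_trans h2); have := sqr_ge0 (y - z); have := sqr_ge0 (y - w); have := sqr_ge0 (z - w).
rewrite !expr2; lra.
Qed.

Lemma stab_comb (x1 r1 x2 r2 c S D Z q H be a A y U M be0 a0 W b : R) :
  x1 <= 2 * r1 + 2 * b -> x2 <= 2 * r2 + 2 * c -> S <= 2 * D + 2 * b + 4 * c ->
  Z <= 3 * q + 3 * H + 6 * be + 3 * a -> y <= Z -> q <= 3 * A + 3 * be + 3 * a ->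
  r1 + r2 + D + H <= U -> H <= U -> 8 * U <= 8 * M -> 0 <= U -> be <= be0 -> a <= a0 ->
  4 * b + 6 * c + 30 * be0 + 18 * A + 24 * a0 <= W ->
  x1 + x2 + y + S + Z <= 8 * M + W.
Proof. lra. Qed.

Context (T nu0 c2 b : R).
Hypotheses (T_gt0 : 0 < T) (nu0_gt0 : 0 < nu0) (c2_gt0 : 0 < c2) (b0 : 0 <= b).
Context (nu dt eps : R) (K : nat).
Context (x dx pp dpi g ge r gr dr rp drp du : nat -> R).
Hypotheses (nu_gt0 : 0 < nu) (nu_le : nu <= nu0) (dt_gt0 : 0 < dt) (dtK : dt * K%:R <= T)
  (K_gt0 : (0 < K)%N) (e0 : 0 <= eps) (c2e : eps <= c2 * dt).
Hypotheses (x0 : forall n, 0 <= x n) (pp0 : forall n, 0 <= pp n) (g0 : forall n, 0 <= g n)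
  (dx0 : forall n, 0 <= dx n) (dpi0 : forall n, 0 <= dpi n) (r0 : forall n, 0 <= r n)
  (gr0 : forall n, 0 <= gr n) (rp0 : forall n, 0 <= rp n).
Hypotheses (xr : forall n, (n <= K)%N -> x n <= r n + b) (rx : r 0%N <= x 0%N + b)
  (pr : forall n, (n <= K)%N -> pp n <= rp n + b) (rp_le : rp 0%N <= pp 0%N + b)
  (ggr : forall n, (n <= K)%N -> g n <= gr n + b + ge n) (grg : gr 0%N <= g 0%N + b + ge 0%N)
  (dxr : forall n, (n < K)%N -> dx n <= dr n + du n)
  (du_sum : \sum_(0 <= n < K) du n ^+ 2 <= b ^+ 2)
  (dpir : forall n, (n < K)%N -> dpi n <= drp n + 2 * b).

Let U0 : R := r 0%N ^+ 2 + eps * rp 0%N ^+ 2 + b ^+ 2 / nu.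
Hypothesis scheme_stab : forall m, (m <= K)%N ->
  r m ^+ 2 + eps * rp m ^+ 2 + \sum_(0 <= n < m) (dr n ^+ 2 + eps * drp n ^+ 2)
  + nu * dt * \sum_(0 <= n < m) gr n.+1 ^+ 2 <= U0.

Let G : R := dt * \sum_(0 <= n < K.+1) ge n ^+ 2.
Let A : R := x 0%N ^+ 2 + eps * pp 0%N ^+ 2 + dt * nu * g 0%N ^+ 2 + nu^-1 * G.
(** [m0] is for the a priori quantity [U0], [m1] for the initial gradient of the discrete velocity,
    [m2] for what the projected solution and the gradient of [eta] add in [stab_le]. Powers of [nu0]
    appear because each term is multiplied by a power of [nu0 / nu >= 1] to reach the common factor
    [nu^-1] or [nu^-2]. *)
Let m0 : R := 2 * nu0 + 2 * nu0 * b ^+ 2 * (1 + c2 * T) + b ^+ 2.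
Let m1 : R := 3 * nu0 + 3 * nu0 ^+ 2 * T * b ^+ 2 + 3 * nu0 ^+ 3.
Let m2 : R := nu0 * (4 * b ^+ 2 + 6 * c2 * T * b ^+ 2 + 30 * nu0 * T * b ^+ 2 + 18 + 24 * nu0 ^+ 2).

Definition stab_const : R := 8 * m0 + m1 + m2.

Let n0 := ltW nu_gt0.
Let d0 := ltW dt_gt0.
Let b2 : 0 <= b ^+ 2. Proof. exact: sqr_ge0. Qed.
Let nn0 := ltW nu0_gt0.
Let t0 := ltW T_gt0.
Let c0 := ltW c2_gt0.
Let dtT : dt <= T.
Proof. by apply: le_trans dtK; rewrite ler_peMr// ler1n. Qed.
Let sum0 (f : nat -> R) m : 0 <= \sum_(0 <= n < m) f n ^+ 2.
Proof. by apply: sumr_ge0 => n _; exact: sqr_ge0. Qed.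
Let G0 : 0 <= G. Proof. by rewrite mulr_ge0. Qed.
Let m00 : 0 <= m0.
Proof.
have h : 0 <= c2 * T by rewrite mulr_ge0.
have h1 : 0 <= nu0 * b ^+ 2 by rewrite mulr_ge0.
have h2 : 0 <= 2 * nu0 * b ^+ 2 * (1 + c2 * T) by rewrite -mulrA -mulrA mulrA mulr_ge0 ?mulr_ge0 ?addr_ge0.
rewrite /m0; move: nn0 b2; lra.
Qed.
Let m10 : 0 <= m1.
Proof.
have h1 : 0 <= nu0 ^+ 2 * T * b ^+ 2 by rewrite mulr_ge0// mulr_ge0// sqr_ge0.
have h2 : 0 <= nu0 ^+ 3 by rewrite exprn_ge0.
rewrite /m1; move: nn0; lra.
Qed.
Let m20 : 0 <= m2.
Proof.
have h1 : 0 <= nu0 * T * b ^+ 2 by rewrite mulr_ge0// mulr_ge0.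
have h2 : 0 <= nu0 ^+ 2 by exact: sqr_ge0.
have h3 : 0 <= c2 * T * b ^+ 2 by rewrite mulr_ge0// mulr_ge0.
by rewrite /m2 mulr_ge0//; move: b2; lra.
Qed.

Let Aparts : [/\ 0 <= x 0%N ^+ 2, 0 <= eps * pp 0%N ^+ 2, 0 <= dt * nu * g 0%N ^+ 2 & 0 <= nu^-1 * G].
Proof.
split; rewrite ?sqr_ge0//.
- by rewrite mulr_ge0 ?sqr_ge0.
- by rewrite mulr_ge0 ?sqr_ge0// mulr_ge0.
- by rewrite mulr_ge0// invr_ge0.
Qed.
Let A0 : 0 <= A. Proof. by have [h1 h2 h3 h4] := Aparts; rewrite /A; lra. Qed.

Let eb : eps * b ^+ 2 <= c2 * T * b ^+ 2.
Proof.
by rewrite ler_wpM2r//; apply: (le_trans c2e); rewrite ler_wpM2l.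
Qed.

Let one_le : 1 <= nu0 / nu. Proof. by rewrite ler_pdivlMr// mul1r. Qed.

Lemma U0_le : U0 <= m0 / nu * (1 + A).
Proof.
have h1 := sqrD2_le (r0 0%N) rx; have h2 := sqrD2_le (rp0 0%N) rp_le.
have h3 : eps * rp 0%N ^+ 2 <= eps * (2 * pp 0%N ^+ 2 + 2 * b ^+ 2) by rewrite ler_wpM2l.
have [p1 p2 p3 p4] := Aparts.
have U1 : U0 <= 2 * A + 2 * b ^+ 2 * (1 + c2 * T) + b ^+ 2 / nu.
  by rewrite /U0 /A; move: h1 h3 p3 p4 eb; rewrite mulrDr; lra.
apply: (le_trans U1).
have -> : m0 / nu * (1 + A) = nu0 / nu * (2 * A + 2 * b ^+ 2 * (1 + c2 * T)) + b ^+ 2 / nu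
  + (2 * (nu0 / nu) + nu0 / nu * (2 * b ^+ 2 * (1 + c2 * T)) * A + b ^+ 2 / nu * A).
  by rewrite /m0; field; rewrite gt_eqF.
have q : 0 <= 2 * b ^+ 2 * (1 + c2 * T) by rewrite mulr_ge0 ?mulr_ge0 ?addr_ge0 ?mulr_ge0.
have q1 : 0 <= nu0 / nu by rewrite divr_ge0.
apply: ler_wpDr.
  apply: addr_ge0; first apply: addr_ge0; first by rewrite mulr_ge0.
    by rewrite mulr_ge0// mulr_ge0.
  by rewrite mulr_ge0// divr_ge0.
rewrite lerD2r -[leLHS]mul1r ler_wpM2r// addr_ge0// mulr_ge0//.
Qed.

Let stab0 m : (m <= K)%N -> [/\ r m ^+ 2 <= U0, eps * rp m ^+ 2 <= U0,
  \sum_(0 <= n < m) (dr n ^+ 2 + eps * drp n ^+ 2) <= U0 &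
  nu * dt * \sum_(0 <= n < m) gr n.+1 ^+ 2 <= U0].
Proof.
move=> mK; have := scheme_stab mK.
have h1 : 0 <= r m ^+ 2 by exact: sqr_ge0.
have h2 : 0 <= eps * rp m ^+ 2 by rewrite mulr_ge0 ?sqr_ge0.
have h3 : 0 <= \sum_(0 <= n < m) (dr n ^+ 2 + eps * drp n ^+ 2).
  by apply: sumr_ge0 => n _; rewrite addr_ge0 ?sqr_ge0// mulr_ge0 ?sqr_ge0.
have h4 : 0 <= nu * dt * \sum_(0 <= n < m) gr n.+1 ^+ 2 by rewrite mulr_ge0 ?mulr_ge0//; exact: sum0.
by move: h1 h2 h3 h4; move: (r m ^+ 2) (eps * rp m ^+ 2) (\sum_(0 <= n < m) (_ + _)) (nu * dt * _) U0 => a1 a2 a3 a4 a5 h1 h2 h3 h4 h; split; lra.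
Qed.

Lemma stab_const_gt0 : 0 < stab_const.
Proof.
rewrite /stab_const; have h : 0 < nu0 ^+ 3 by rewrite exprn_gt0.
have h1 : 0 <= nu0 ^+ 2 * T * b ^+ 2 by rewrite mulr_ge0// mulr_ge0// sqr_ge0.
have : 0 < m1 by rewrite /m1; move: nu0_gt0; lra.
by move: m00 m20; lra.
Qed.

Let scale_le (c n : R) : 0 <= n -> c <= stab_const -> c * n * (1 + A) <= stab_const * n * (1 + A).
Proof. by move=> h1 h2; apply: ler_wpM2r; [exact: addr_ge0|exact: ler_wpM2r]. Qed.

Lemma stab_r_le n : (n < K)%N -> r n ^+ 2 <= stab_const / nu * (1 + A).
Proof.
move=> nK; have [h _ _ _] := stab0 (ltnW nK); apply: (le_trans h); apply: (le_trans U0_le).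
by apply: scale_le; rewrite ?invr_ge0//; move: m00 m10 m20; rewrite /stab_const; lra.
Qed.

(** The stability of the scheme controls gradients from level 1 on only. At level 0 the gradient is
    recovered from [xi^0] and [eta^0], and this is why [A] contains [dt nu |grad xi^0|^2]. *)
Let gr00 : dt * gr 0%N ^+ 2 <= 3 * (nu^-1 * A) + 3 * (T * b ^+ 2) + 3 * (nu * A).
Proof.
have h := sqrD3_le (gr0 0%N) grg.
have [p1 p2 p3 p4] := Aparts.
have h1 : dt * gr 0%N ^+ 2 <= dt * (3 * g 0%N ^+ 2 + 3 * b ^+ 2 + 3 * ge 0%N ^+ 2).
  by rewrite ler_wpM2l.
have h2 : dt * ge 0%N ^+ 2 <= nu * A.
  apply: (@le_trans _ _ G).
    rewrite ler_wpM2l// big_nat_recl//= lerDl; exact: (sum0 (fun n => ge n.+1)).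
  have -> : G = nu * (nu^-1 * G) by rewrite mulrA divff ?mul1r// gt_eqF.
  by rewrite ler_wpM2l// /A; lra.
have h3 : dt * g 0%N ^+ 2 <= nu^-1 * A.
  have -> : dt * g 0%N ^+ 2 = nu^-1 * (dt * nu * g 0%N ^+ 2) by field; rewrite gt_eqF.
  by rewrite ler_wpM2l ?invr_ge0// /A; lra.
have h4 : dt * b ^+ 2 <= T * b ^+ 2 by rewrite ler_wpM2r.
apply: (le_trans h1).
have -> : dt * (3 * g 0%N ^+ 2 + 3 * b ^+ 2 + 3 * ge 0%N ^+ 2) =
  3 * (dt * g 0%N ^+ 2) + 3 * (dt * b ^+ 2) + 3 * (dt * ge 0%N ^+ 2) by ring.
lra.
Qed.

Lemma stab_gr_le : dt * \sum_(0 <= n < K) gr n ^+ 2 <= stab_const / nu ^+ 2 * (1 + A).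
Proof.
have [_ _ _ h] := stab0 (leqnn K).
have h1 : dt * \sum_(0 <= n < K) gr n ^+ 2 <= dt * gr 0%N ^+ 2 + nu^-1 * U0.
  apply: (@le_trans _ _ (dt * \sum_(0 <= n < K.+1) gr n ^+ 2)).
    by rewrite ler_wpM2l// [leRHS]big_nat_recr//= lerDl sqr_ge0.
  rewrite big_nat_recl//= mulrDr lerD2l.
  have -> : dt * \sum_(0 <= n < K) gr n.+1 ^+ 2 = nu^-1 * (nu * dt * \sum_(0 <= n < K) gr n.+1 ^+ 2).
    by field; rewrite gt_eqF.
  by rewrite ler_wpM2l ?invr_ge0.
apply: (le_trans h1).
have -> : stab_const / nu ^+ 2 * (1 + A) = nu^-1 * (m0 / nu * (1 + A)) + m1 / nu ^+ 2 * (1 + A)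
   + (7 * m0 + m2) / nu ^+ 2 * (1 + A) by rewrite /stab_const; field; rewrite gt_eqF.
apply: ler_wpDr.
  apply: mulr_ge0; [apply: divr_ge0; [by apply: addr_ge0 => //; exact: mulr_ge0|exact: exprn_ge0]|exact: addr_ge0].
rewrite addrC; apply: lerD; first by rewrite ler_wpM2l ?invr_ge0// U0_le.
apply: (le_trans gr00).
have i0 : 0 <= nu^-1 by rewrite invr_ge0.
have nuv : 1 <= nu0 * nu^-1 by [].
have e1 : nu^-1 * A <= nu0 * nu^-1 ^+ 2 * A.
  rewrite ler_wpM2r// -[leLHS]mul1r expr2 mulrA ler_wpM2r//.
have e2 : T * b ^+ 2 <= nu0 ^+ 2 * nu^-1 ^+ 2 * (T * b ^+ 2).
  by rewrite -[leLHS]mul1r ler_wpM2r ?mulr_ge0// -exprMn expr_ge1// divr_ge0.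
have e3 : nu * A <= nu0 ^+ 3 * nu^-1 ^+ 2 * A.
  rewrite ler_wpM2r// (_ : nu0 ^+ 3 * nu^-1 ^+ 2 = nu0 * (nu0 / nu) ^+ 2); last by rewrite exprMn; ring.
  by apply: (le_trans nu_le); rewrite ler_peMr// expr_ge1// divr_ge0.
have -> : m1 / nu ^+ 2 * (1 + A) = 3 * (nu0 * nu^-1 ^+ 2 * A) + 3 * (nu0 ^+ 2 * nu^-1 ^+ 2 * (T * b ^+ 2))
  + 3 * (nu0 ^+ 3 * nu^-1 ^+ 2 * A) + (3 * nu0 * nu^-1 ^+ 2 + 3 * nu0 ^+ 2 * nu^-1 ^+ 2 * (T * b ^+ 2) * A
   + 3 * nu0 ^+ 3 * nu^-1 ^+ 2) by rewrite /m1; field; rewrite gt_eqF.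
apply: ler_wpDr.
  have i2 : 0 <= nu^-1 ^+ 2 by rewrite exprn_ge0.
  apply: addr_ge0; first apply: addr_ge0.
  - by rewrite mulr_ge0// mulr_ge0.
  - by rewrite mulr_ge0// mulr_ge0 ?mulr_ge0// mulr_ge0 ?sqr_ge0.
  - by rewrite mulr_ge0// mulr_ge0// exprn_ge0.
lra.
Qed.

Lemma stab_le :
  x K ^+ 2 + eps * pp K ^+ 2 + nu * dt * g K ^+ 2
  + \sum_(0 <= n < K) (dx n ^+ 2 + eps / 2 * dpi n ^+ 2)
  + nu * dt * \sum_(0 <= n < K.+1) g n ^+ 2 <= stab_const / nu * (1 + A).
Proof.
have KK := leqnn K; have b2' := b2; have A0' := A0.
have [_ _ _ s4] := stab0 KK; have sK := scheme_stab KK.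
have h1 := sqrD2_le (x0 K) (xr KK).
have h2 : eps * pp K ^+ 2 <= 2 * (eps * rp K ^+ 2) + 2 * (c2 * T * b ^+ 2).
  apply: (@le_trans _ _ (eps * (2 * rp K ^+ 2 + 2 * b ^+ 2))).
    by rewrite ler_wpM2l// (sqrD2_le (pp0 K) (pr KK)).
  by rewrite mulrDr; move: eb; lra.
have h3 : \sum_(0 <= n < K) (dx n ^+ 2 + eps / 2 * dpi n ^+ 2) <=
    2 * \sum_(0 <= n < K) (dr n ^+ 2 + eps * drp n ^+ 2) + 2 * b ^+ 2 + 4 * (c2 * T * b ^+ 2).
  have e8 : eps * K%:R * b ^+ 2 <= c2 * T * b ^+ 2.
    rewrite ler_wpM2r//; apply: (@le_trans _ _ (c2 * dt * K%:R)); first by rewrite ler_wpM2r.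
    by rewrite -mulrA ler_wpM2l.
  apply: (@le_trans _ _ (\sum_(0 <= n < K) (2 * (dr n ^+ 2 + eps * drp n ^+ 2) + 2 * du n ^+ 2
      + 4 * (eps * b ^+ 2)))).
    rewrite big_nat_cond [leRHS]big_nat_cond; apply: ler_sum => n /andP[/andP[_ nK] _].
    have q1 := sqrD2_le (dx0 n) (dxr nK); have q2 := sqrD2_le (dpi0 n) (dpir nK).
    have q3 : eps / 2 * dpi n ^+ 2 <= eps / 2 * (2 * drp n ^+ 2 + 2 * (2 * b) ^+ 2).
      by rewrite ler_wpM2l// divr_ge0.
    have q4 : 0 <= eps * drp n ^+ 2 by rewrite mulr_ge0 ?sqr_ge0.
    have E : eps / 2 * (2 * drp n ^+ 2 + 2 * (2 * b) ^+ 2) = eps * drp n ^+ 2 + 4 * (eps * b ^+ 2) by field.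
    rewrite E in q3; lra.
  have -> : \sum_(0 <= n < K) (2 * (dr n ^+ 2 + eps * drp n ^+ 2) + 2 * du n ^+ 2
      + 4 * (eps * b ^+ 2)) = 2 * \sum_(0 <= n < K) (dr n ^+ 2 + eps * drp n ^+ 2)
      + 2 * \sum_(0 <= n < K) du n ^+ 2 + 4 * (eps * K%:R * b ^+ 2).
    by rewrite !big_split /= -!mulr_sumr !big_split /= -!mulr_sumr sumr_const_nat subn0 -[_ *+ K]mulr_natr; ring.
  by apply: lerD; [rewrite lerD2l ler_wpM2l|rewrite ler_wpM2l].
have h5 : nu * dt * \sum_(0 <= n < K.+1) g n ^+ 2 <=
    3 * (nu * (dt * gr 0%N ^+ 2)) + 3 * (nu * dt * \sum_(0 <= n < K) gr n.+1 ^+ 2)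
    + 6 * (nu * T * b ^+ 2) + 3 * (nu ^+ 2 * A).
  have q1 : \sum_(0 <= n < K.+1) g n ^+ 2 <=
     \sum_(0 <= n < K.+1) (3 * gr n ^+ 2 + 3 * b ^+ 2 + 3 * ge n ^+ 2).
    rewrite big_nat_cond [leRHS]big_nat_cond; apply: ler_sum => n /andP[/andP[_ nK] _].
    exact: (sqrD3_le (g0 n) (ggr nK)).
  (* There are [K.+1] levels for [K] steps; the extra level costs one more [dt], itself at most
     [T]. *)
  have q2 : nu * dt * (K.+1)%:R * b ^+ 2 <= 2 * (nu * T * b ^+ 2).
    rewrite [leRHS]mulrA ler_wpM2r// [leRHS]mulrCA -mulrA ler_wpM2l//.
    by rewrite -natr1 mulrDr mulr1; move: dtK dtT; lra.
  have q3 : nu * G <= nu ^+ 2 * A.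
    have -> : nu * G = nu ^+ 2 * (nu^-1 * G) by field; rewrite gt_eqF.
    by rewrite ler_wpM2l ?sqr_ge0//; have [p1 p2 p3 p4] := Aparts; rewrite /A; lra.
  have nd : 0 <= nu * dt by rewrite mulr_ge0.
  apply: (le_trans (ler_wpM2l nd q1)).
  have -> : \sum_(0 <= n < K.+1) (3 * gr n ^+ 2 + 3 * b ^+ 2 + 3 * ge n ^+ 2) =
      3 * (gr 0%N ^+ 2 + \sum_(0 <= n < K) gr n.+1 ^+ 2) + 3 * (K.+1%:R * b ^+ 2)
      + 3 * \sum_(0 <= n < K.+1) ge n ^+ 2.
    rewrite !big_split /= -!mulr_sumr [\sum_(0 <= n < K.+1) gr n ^+ 2]big_nat_recl//=.
    by rewrite sumr_const_nat subn0 -[_ *+ K.+1]mulr_natr; ring.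
  have -> : nu * dt * (3 * (gr 0%N ^+ 2 + \sum_(0 <= n < K) gr n.+1 ^+ 2) + 3 * (K.+1%:R * b ^+ 2)
      + 3 * \sum_(0 <= n < K.+1) ge n ^+ 2) = 3 * (nu * (dt * gr 0%N ^+ 2)) +
    3 * (nu * dt * \sum_(0 <= n < K) gr n.+1 ^+ 2) + 3 * (nu * dt * (K.+1)%:R * b ^+ 2) + 3 * (nu * G).
    by rewrite /G; ring.
  lra.
have h6 : nu * dt * g K ^+ 2 <= nu * dt * \sum_(0 <= n < K.+1) g n ^+ 2.
  rewrite ler_wpM2l ?mulr_ge0// big_nat_recr//= lerDr; exact: sum0.
have h7 : nu * (dt * gr 0%N ^+ 2) <= 3 * A + 3 * (nu * T * b ^+ 2) + 3 * (nu ^+ 2 * A).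
  apply: (le_trans (ler_wpM2l n0 gr00)).
  by rewrite le_eqVlt; apply/orP; left; apply/eqP; field; rewrite gt_eqF.
have U00 : 0 <= U0.
  by rewrite /U0 addr_ge0// ?divr_ge0// addr_ge0 ?sqr_ge0// mulr_ge0 ?sqr_ge0.
have U : 8 * U0 <= 8 * (m0 / nu * (1 + A)) by rewrite ler_wpM2l// U0_le.
have -> : stab_const / nu * (1 + A) = 8 * (m0 / nu * (1 + A)) + m2 / nu * (1 + A)
   + m1 / nu * (1 + A) by rewrite /stab_const; field; rewrite gt_eqF.
apply: ler_wpDr; first by apply: mulr_ge0; [exact: divr_ge0|exact: addr_ge0].
have -> : m2 / nu * (1 + A) = nu0 / nu * (4 * b ^+ 2 + 6 * (c2 * T * b ^+ 2) + 30 * (nu0 * T * b ^+ 2)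
   + (18 + 24 * nu0 ^+ 2) * A + (18 + 24 * nu0 ^+ 2 + (4 * b ^+ 2 + 6 * c2 * T * b ^+ 2 + 30 * nu0 * T * b ^+ 2) * A)).
  by rewrite /m2; field; rewrite gt_eqF.
have w1 : nu * T * b ^+ 2 <= nu0 * T * b ^+ 2 by rewrite !ler_wpM2r.
have w2 : nu ^+ 2 * A <= nu0 ^+ 2 * A by rewrite ler_wpM2r// ler_sqr ?nnegrE.
have w3 : 0 <= nu0 * T * b ^+ 2 by rewrite mulr_ge0// mulr_ge0.
have w4 : 0 <= c2 * T * b ^+ 2 by rewrite mulr_ge0// mulr_ge0.
have w5 : 0 <= nu0 ^+ 2 * A by rewrite mulr_ge0 ?sqr_ge0.
have w6 : 0 <= (4 * b ^+ 2 + 6 * c2 * T * b ^+ 2 + 30 * nu0 * T * b ^+ 2) * A.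
  by rewrite mulr_ge0//; lra.
have w7 : 0 <= nu0 ^+ 2 by exact: sqr_ge0.
set W := 4 * b ^+ 2 + 6 * (c2 * T * b ^+ 2) + _ + _ + _.
have WW : 4 * b ^+ 2 + 6 * (c2 * T * b ^+ 2) + 30 * (nu0 * T * b ^+ 2) + 18 * A + 24 * (nu0 ^+ 2 * A) <= W.
  by rewrite /W; lra.
have W0 : 0 <= W by apply: le_trans WW; lra.
apply: (@le_trans _ _ (8 * (m0 / nu * (1 + A)) + W)); last by rewrite lerD2l ler_peMl.
exact: (stab_comb h1 h2 h3 h5 h6 h7 sK s4 U U00 w1 w2 WW).
Qed.

End stability_consequences.

(** * Energy inequalities for Galerkin schemes *)

Section galerkin.
Context (R : realType) (V W : lmodType R) (PV : set V) (PW : set W).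
Context (m gr : V -> V -> R) (q : W -> W -> R) (b : V -> V -> V -> R) (dv : V -> W -> R).
Context (sm : semi_ip PV m) (sg : semi_ip PV gr) (sq : semi_ip PW q).
Local Notation nV v := (Num.sqrt (m v v)).
Local Notation nG v := (Num.sqrt (gr v v)).
Local Notation nW p := (Num.sqrt (q p p)).
Hypotheses
  (bBl : forall w w' u v, PV w -> PV w' -> PV u -> PV v -> b (w - w') u v = b w u v - b w' u v)
  (bBm : forall w u u' v, PV w -> PV u -> PV u' -> PV v -> b w (u - u') v = b w u v - b w u' v)
  (b_diag : forall w v, b w v v = 0)
  (dvBl : forall u v p, PV u -> PV v -> PW p -> dv (u - v) p = dv u p - dv v p)
  (dvBr : forall u p p', PV u -> PW p -> PW p' -> dv u (p - p') = dv u p - dv u p').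
Context (CP Kb dd : R).
Hypotheses (CP0 : 0 <= CP) (Kb0 : 0 <= Kb) 
  (poin : forall v, PV v -> nV v <= CP * nG v)
  (b_le : forall w u v, PV w -> PV u -> PV v ->
     `|b w u v| <= Kb * Num.sqrt (nV w * nG w) * nG u * nG v)
  (dv_le : forall v p, PV v -> PW p -> `|dv v p| <= dd * nG v * nW p).
Context (XR : set V) (QM : set W).
Hypotheses (XRP : forall v, XR v -> PV v) (QMP : forall p, QM p -> PW p)
  (XRB : forall u v, XR u -> XR v -> XR (u - v)) (QMB : forall p p', QM p -> QM p' -> QM (p - p')).
Context (nu dt eps : R).
Hypotheses (nu_gt0 : 0 < nu) (dt_gt0 : 0 < dt) (eps_ge0 : 0 <= eps).

Section step.
Context (u0 u1 : V) (p0 p1 : W) (f : V -> R).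
Hypotheses (Xu0 : XR u0) (Xu1 : XR u1) (Qp0 : QM p0) (Qp1 : QM p1).
Hypothesis momentum : forall v, XR v ->
  m (dt^-1 *: (u1 - u0)) v + b u0 u1 v + nu * gr u1 v - dv v p1 = f v.
Hypothesis continuity : forall p, QM p -> eps * q (dt^-1 *: (p1 - p0)) p + dv u1 p = 0.

Let dtV : dt * dt^-1 = 1. Proof. by rewrite divff// gt_eqF. Qed.

Let mom v : XR v -> m (u1 - u0) v + dt * (b u0 u1 v + nu * gr u1 v - dv v p1) = dt * f v.
Proof.
move=> Xv; rewrite -(momentum Xv) (sipZl sm) //; last 2 first.
- by apply: XRP; exact: XRB.
- exact: XRP.
move: (m _ v) (b _ _ _) (gr _ _) (dv _ _) => a1 a2 a3 a4.
have -> : dt * (dt^-1 * a1 + a2 + nu * a3 - a4) = (dt * dt^-1) * a1 + dt * (a2 + nu * a3 - a4).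
  by ring.
by rewrite dtV mul1r.
Qed.

Let con p : QM p -> eps * q (p1 - p0) p + dt * dv u1 p = 0.
Proof.
move=> Qp; rewrite -[RHS](mulr0 dt) -(continuity Qp) (sipZl sq) //; last 2 first.
- by apply: QMP; exact: QMB.
- exact: QMP.
move: (q _ p) (dv _ _) => a1 a2.
have -> : dt * (eps * (dt^-1 * a1) + a2) = (dt * dt^-1) * (eps * a1) + dt * a2 by ring.
by rewrite dtV mul1r.
Qed.

(** Both equations are tested with the new solution: skew-symmetry removes convection, and the
    pressure terms of the two equations cancel. The force is estimated in L2 through the Poincare
    inequality and half of the dissipation pays for it. *)
Lemma stability_step (F : R) : 0 <= F -> (forall v, XR v -> f v <= F * nV v) ->
  nV u1 ^+ 2 - nV u0 ^+ 2 + nV (u1 - u0) ^+ 2 + eps * (nW p1 ^+ 2 - nW p0 ^+ 2 + nW (p1 - p0) ^+ 2)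
  + nu * dt * nG u1 ^+ 2 <= CP ^+ 2 / nu * dt * F ^+ 2.
Proof.
move=> F0 Hf; have H1 := mom Xu1; have H2 := con Qp1.
have B1 := sip_BG sm (XRP Xu1) (XRP Xu0); have B2 := sip_BG sq (QMP Qp1) (QMP Qp0).
rewrite b_diag add0r in H1; rewrite -B1 -B2.
have G2 := sip_norm2 sg (XRP Xu1); rewrite -G2 in H1.
have fle : f u1 <= F * (CP * nG u1).
  by apply: (le_trans (Hf _ Xu1)); rewrite ler_wpM2l//; exact: poin (XRP Xu1).
have Y := young (nG u1) (F * CP) nu_gt0.
have fle2 : dt * f u1 <= dt * (F * (CP * nG u1)) by rewrite ler_wpM2l// ltW.
have Y2 : dt * (2 * nG u1 * (F * CP)) <= dt * (nu * nG u1 ^+ 2 + (F * CP) ^+ 2 / nu).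
  by rewrite ler_wpM2l// ltW.
have E : CP ^+ 2 / nu * dt * F ^+ 2 = dt * ((F * CP) ^+ 2 / nu) by ring.
rewrite E; move: H1 H2 fle2 Y2.
move: (nG u1) (m (u1 - u0) u1) (q (p1 - p0) p1) (dv u1 p1) (f u1) ((F * CP) ^+ 2 / nu) => x a c e g h.
move=> H1 H2 fle2 Y2.
have -> : 2 * a + eps * (2 * c) + nu * dt * x ^+ 2 = 2 * (a + dt * (nu * x ^+ 2 - e)) +
  2 * (eps * c + dt * e) - dt * (nu * x ^+ 2) by ring.
rewrite H1 H2; move: fle2 Y2.
have -> : dt * (F * (CP * x)) = dt * (2 * x * (F * CP)) / 2 by field.
rewrite mulrDr; lra.
Qed.

Section error.
Context (U0 U1 R0 R1 : V) (P0 P1 S0 S1 : W) (Tf : V -> R) (cT Pt al B : R).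
Hypotheses (XU0 : PV U0) (XU1 : PV U1) (XR0 : XR R0) (XR1 : XR R1)
  (QP0 : PW P0) (QP1 : PW P1) (QS0 : QM S0) (QS1 : QM S1)
  (orth0 : forall v, XR v -> m (U0 - R0) v = 0) (orth1 : forall v, XR v -> m (U1 - R1) v = 0)
  (orthp0 : forall p, QM p -> q (P0 - S0) p = 0) (orthp1 : forall p, QM p -> q (P1 - S1) p = 0).
Hypotheses (nse : forall v, XR v -> Tf v + b U1 U1 v + nu * gr U1 v - dv v P1 = f v)
  (consist : forall v, XR v -> `|dt * Tf v - m (U1 - U0) v| <= dt * cT * nV v)
  (P_le : nW (P1 - P0) <= dt * Pt)
  (al_le : forall p, QM p -> `|dv R1 p| <= al * nG (U1 - R1) * nW p)
  (cT0 : 0 <= cT) (B_ge : nG U1 <= B).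

Let xi0 := u0 - R0.
Let xi1 := u1 - R1.
Let pi0 := p0 - S0.
Let pi1 := p1 - S1.
Let eta0 := U0 - R0.
Let eta1 := U1 - R1.
Let kap1 := P1 - S1.

Let Xxi0 : XR xi0. Proof. exact: XRB. Qed.
Let Xxi1 : XR xi1. Proof. exact: XRB. Qed.
Let Qpi0 : QM pi0. Proof. exact: QMB. Qed.
Let Qpi1 : QM pi1. Proof. exact: QMB. Qed.
Let Pxi0 := XRP Xxi0.
Let Pxi1 := XRP Xxi1.
Let Ppi0 := QMP Qpi0.
Let Ppi1 := QMP Qpi1.
Let Peta0 : PV eta0. Proof. by apply: (sipPB sm) => //; exact: XRP. Qed.
Let Peta1 : PV eta1. Proof. by apply: (sipPB sm) => //; exact: XRP. Qed.
Let Pkap1 : PW kap1. Proof. by apply: (sipPB sq) => //; exact: QMP. Qed.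

(** Inserting [b u0 U1] and [b U0 U1] splits the nonlinear error. The part [b u0 xi1 xi1] vanishes
    by skew-symmetry, and since the scheme takes its coefficient at the old level, it is [xi0] and
    not [xi1] that occurs as a coefficient. *)
Let conv_split : b U1 U1 xi1 - b u0 u1 xi1 =
  b (U1 - U0) U1 xi1 + b eta0 U1 xi1 - b xi0 U1 xi1 + b u0 eta1 xi1.
Proof.
have Pu0 := XRP Xu0; have Pu1 := XRP Xu1; have PR0 := XRP XR0; have PR1 := XRP XR1.
have z : b u0 xi1 xi1 = 0 by exact: b_diag.
rewrite {1}/xi1 (bBm Pu0 Pu1 PR1 Pxi1) in z.
rewrite (bBl XU1 XU0 XU1 Pxi1) (bBl XU0 PR0 XU1 Pxi1) (bBl Pu0 PR0 XU1 Pxi1) (bBm Pu0 XU1 PR1 Pxi1).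
move: z; move: (b U1 U1 xi1) (b u0 u1 xi1) (b U0 U1 xi1) (b R0 U1 xi1) (b u0 U1 xi1) (b u0 R1 xi1).
move=> a1 a2 a3 a4 a5 a6 z; have -> : a2 = a6 by move/eqP: z; rewrite subr_eq0 => /eqP.
by ring.
Qed.

(** The pressure coupling of [xi1] and [pi1] cancels between the two equations, leaving [kap1]
    against the divergence of [xi1] and [pi1] against that of [R1]. Orthogonality replaces the
    increments of the projections by those of the exact velocity and pressure. *)
Let error_identity :
  2 * m (xi1 - xi0) xi1 + eps * (2 * q (pi1 - pi0) pi1) + 2 * nu * dt * gr xi1 xi1 =
  2 * (dt * Tf xi1 - m (U1 - U0) xi1)
  + 2 * dt * (nu * gr eta1 xi1 - dv xi1 kap1 + (b U1 U1 xi1 - b u0 u1 xi1))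
  - 2 * eps * q (P1 - P0) pi1 - 2 * dt * dv R1 pi1.
Proof.
have Pu0 := XRP Xu0; have Pu1 := XRP Xu1; have PR0 := XRP XR0; have PR1 := XRP XR1.
have Pp0 := QMP Qp0; have Pp1 := QMP Qp1; have PS0 := QMP QS0; have PS1 := QMP QS1.
have H1 := mom Xxi1; have H2 := con Qpi1; have H3 := nse Xxi1.
have o0 := orth0 Xxi1; have o1 := orth1 Xxi1; have q0 := orthp0 Qpi1; have q1 := orthp1 Qpi1.
have PB := sipPB sm; have QB := sipPB sq.
rewrite (sipBl sm Pu1 Pu0 Pxi1) in H1.
rewrite (sipBl sm XU0 PR0 Pxi1) in o0; rewrite (sipBl sm XU1 PR1 Pxi1) in o1.
rewrite (sipBl sq QP0 PS0 Ppi1) in q0; rewrite (sipBl sq QP1 PS1 Ppi1) in q1.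
rewrite (sipBl sq Pp1 Pp0 Ppi1) in H2.
rewrite (sipBl sm Pxi1 Pxi0 Pxi1) {1}/xi1 (sipBl sm Pu1 PR1 Pxi1) {1}/xi0 (sipBl sm Pu0 PR0 Pxi1).
rewrite (sipBl sq Ppi1 Ppi0 Ppi1) {1}/pi1 (sipBl sq Pp1 PS1 Ppi1) {1}/pi0 (sipBl sq Pp0 PS0 Ppi1).
rewrite (sipBl sm XU1 XU0 Pxi1) (sipBl sq QP1 QP0 Ppi1).
rewrite {1}/xi1 (sipBl sg Pu1 PR1 Pxi1) /eta1 (sipBl sg XU1 PR1 Pxi1) /kap1 (dvBr Pxi1 QP1 PS1).
have D1 : dv u1 pi1 = dv xi1 pi1 + dv R1 pi1.
  by rewrite /xi1 (dvBl Pu1 PR1 Ppi1) subrK.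
have D2 : dv xi1 p1 = dv xi1 pi1 + dv xi1 S1 by rewrite /pi1 (dvBr Pxi1 Pp1 PS1) subrK.
rewrite D1 in H2; rewrite D2 in H1; move: H1 H2 H3 o0 o1 q0 q1.
move: (m u1 xi1) (m u0 xi1) (m R1 xi1) (m R0 xi1) (m U1 xi1) (m U0 xi1) => a1 a2 a3 a4 a5 a6.
move: (q p1 pi1) (q p0 pi1) (q S1 pi1) (q S0 pi1) (q P1 pi1) (q P0 pi1) => c1 c2 c3 c4 c5 c6.
move: (gr u1 xi1) (gr R1 xi1) (gr U1 xi1) (dv xi1 pi1) (dv R1 pi1) (dv xi1 S1) (dv xi1 P1).
move=> g1 g2 g3 v1 v2 v3 v4.
move: (b U1 U1 xi1) (b u0 u1 xi1) (Tf xi1) (f xi1) => b1 b2 t1 f1 H1 H2 H3 o0 o1 q0 q1.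
have {}o0 : a6 = a4 by move/eqP: o0; rewrite subr_eq0 => /eqP.
have {}o1 : a5 = a3 by move/eqP: o1; rewrite subr_eq0 => /eqP.
have {}q0 : c6 = c4 by move/eqP: q0; rewrite subr_eq0 => /eqP.
have {}q1 : c5 = c3 by move/eqP: q1; rewrite subr_eq0 => /eqP.
subst a6 a5 c6 c5.
have E1 : a1 - a2 = dt * (t1 + b1 + nu * g3 - v4) - dt * (b2 + nu * g1 - (v1 + v3)).
  by rewrite H3 -H1 addrK.
have E2 : eps * (c1 - c2) = - (dt * (v1 + v2)) by apply/eqP; rewrite -subr_eq0 opprK H2.
have -> : 2 * (a1 - a3 - (a2 - a4)) + eps * (2 * (c1 - c3 - (c2 - c4))) =
  2 * (a1 - a2) - 2 * (a3 - a4) + 2 * (eps * (c1 - c2)) - 2 * eps * (c3 - c4) by ring.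
rewrite E1 E2; ring.
Qed.

Let absle (x y : R) : `|x| <= y -> x <= y /\ - x <= y.
Proof. by rewrite ler_norml => /andP[h1 h2]; split=> //; rewrite lerNl. Qed.

Lemma error_step :
  nV xi1 ^+ 2 - nV xi0 ^+ 2 + nV (xi1 - xi0) ^+ 2
  + eps * (nW pi1 ^+ 2 - nW pi0 ^+ 2 + nW (pi1 - pi0) ^+ 2) + 2 * nu * dt * nG xi1 ^+ 2
  <= 2 * dt * nG xi1 * (CP * cT + nu * nG eta1 + dd * nW kap1
       + Kb * Num.sqrt CP * B * nG (U1 - U0) + Kb * Num.sqrt CP * B * nG eta0
       + Kb * B * Num.sqrt (nV xi0 * nG xi0) + Kb * Num.sqrt (nV u0 * nG u0) * nG eta1)
     + 2 * dt * (eps * Pt + al * nG eta1) * nW pi1.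
Proof.
have B1 := sip_BG sm Pxi1 Pxi0; have B2 := sip_BG sq Ppi1 Ppi0.
rewrite -B1 -B2 (sip_norm2 sg Pxi1) error_identity conv_split.
have g0 v : 0 <= nG v by exact: sqrtr_ge0.
have B0 : 0 <= B by apply: le_trans B_ge.
have PU : PV (U1 - U0) := sipPB sm XU1 XU0.
have low w : PV w -> Num.sqrt (nV w * nG w) <= Num.sqrt CP * nG w.
  move=> Pw; rewrite [leRHS](_ : _ = Num.sqrt (CP * nG w ^+ 2)).
    by rewrite ler_wsqrtr// expr2 mulrA ler_wpM2r//; exact: poin.
  by rewrite sqrtrM// sqrtr_sqr ger0_norm.
(* The same form is bounded in two ways: fully by gradients for the data-dependent coefficients, and
   in the sharper form with the square root for [xi0], whose L2 norm has to reach the Gronwall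
   term. *)
have conv w : PV w -> b w U1 xi1 <= Kb * Num.sqrt CP * B * nG w * nG xi1 /\
    - b w U1 xi1 <= Kb * B * Num.sqrt (nV w * nG w) * nG xi1.
  move=> Pw; have [h1 h2] := absle (b_le Pw XU1 Pxi1); split.
    apply: (le_trans h1); rewrite ler_wpM2r//.
    have -> : Kb * Num.sqrt CP * B * nG w = Kb * (Num.sqrt CP * nG w) * B by ring.
    apply: ler_pM => //; first by rewrite mulr_ge0 ?sqrtr_ge0.
    by rewrite ler_wpM2l// low.
  apply: (le_trans h2); rewrite ler_wpM2r// -[leRHS]mulrA [B * _]mulrC mulrA.
  by rewrite ler_wpM2l// mulr_ge0 ?sqrtr_ge0.
have [t1 _] := absle (consist Xxi1).
have t1' : dt * cT * nV xi1 <= dt * cT * (CP * nG xi1).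
  by rewrite ler_wpM2l ?mulr_ge0 ?(ltW dt_gt0)//; exact: poin.
have [t2 _] := absle (sip_CS sg Peta1 Pxi1).
have [_ t3] := absle (dv_le Pxi1 Pkap1).
have [t4 _] := conv _ PU; have [t5 _] := conv _ Peta0; have [_ t6] := conv _ Pxi0.
(* The square root is kept here as well: the gradient of the discrete velocity is bounded only in
   mean square over time. *)
have [t7 _] := absle (b_le (XRP Xu0) Peta1 Pxi1).
have [_ t8] := absle (sip_CS sq (sipPB sq QP1 QP0) Ppi1).
have w0 : 0 <= nW pi1 by exact: sqrtr_ge0.
have t8' : - q (P1 - P0) pi1 <= dt * Pt * nW pi1 by apply: (le_trans t8); rewrite ler_wpM2r.
have [_ t9] := absle (al_le Qpi1).
have d0 := ltW dt_gt0.
have e8 : eps * (- q (P1 - P0) pi1) <= eps * (dt * Pt * nW pi1) by rewrite ler_wpM2l.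
have e9 : dt * (- dv R1 pi1) <= dt * (al * nG eta1 * nW pi1) by rewrite ler_wpM2l.
have e2 : nu * gr eta1 xi1 <= nu * (nG eta1 * nG xi1) by rewrite ler_wpM2l// ltW.
have inner : nu * gr eta1 xi1 - dv xi1 kap1 +
   (b (U1 - U0) U1 xi1 + b eta0 U1 xi1 - b xi0 U1 xi1 + b u0 eta1 xi1) <=
   nG xi1 * (nu * nG eta1 + dd * nW kap1
       + Kb * Num.sqrt CP * B * nG (U1 - U0) + Kb * Num.sqrt CP * B * nG eta0
       + Kb * B * Num.sqrt (nV xi0 * nG xi0) + Kb * Num.sqrt (nV u0 * nG u0) * nG eta1).
  move: e2 t3 t4 t5 t6 t7.
  move: (gr eta1 xi1) (dv xi1 kap1) (b (U1 - U0) U1 xi1) (b eta0 U1 xi1) (b xi0 U1 xi1) (b u0 eta1 xi1).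
  move: (Num.sqrt (nV xi0 * nG xi0)) (Num.sqrt (nV u0 * nG u0)) (Num.sqrt CP).
  move: (nG xi1) (nG eta1) (nG eta0) (nG (U1 - U0)) (nW kap1).
  move=> x1 x2 x3 x4 x5 x6 x7 x8 y1 y2 y3 y4 y5 y6 z1 z2 z3 z4 z5 z6.
  have -> : x1 * (nu * x2 + dd * x5 + Kb * x8 * B * x4 + Kb * x8 * B * x3 + Kb * B * x6 + Kb * x7 * x2)
    = nu * (x2 * x1) + dd * x1 * x5 + Kb * x8 * B * x4 * x1 + Kb * x8 * B * x3 * x1 + Kb * B * x6 * x1
      + Kb * x7 * x2 * x1 by ring.
  lra.
have inner' := ler_wpM2l d0 inner; have t1'' := le_trans t1 t1'.
move: inner' t1'' e8 e9.
move: (Num.sqrt (nV xi0 * nG xi0)) (Num.sqrt (nV u0 * nG u0)) (Num.sqrt CP).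
move: (nG xi1) (nG eta1) (nG eta0) (nG (U1 - U0)) (nW kap1) (nW pi1).
move: (nu * gr eta1 xi1 - _ + _) (dt * Tf xi1 - _) (q (P1 - P0) pi1) (dv R1 pi1).
move=> a1 a2 a3 a4 x1 x2 x3 x4 x5 x9 x6 x7 x8 h1 h2 h3 h4.
have -> : 2 * a2 + 2 * dt * a1 - 2 * eps * a3 - 2 * dt * a4 =
  2 * a2 + 2 * (dt * a1) + 2 * (eps * - a3) + 2 * (dt * - a4) by ring.
have -> : 2 * dt * x1 * (CP * cT + nu * x2 + dd * x5 + Kb * x8 * B * x4 + Kb * x8 * B * x3
    + Kb * B * x6 + Kb * x7 * x2) + 2 * dt * (eps * Pt + al * x2) * x9 =
  2 * (dt * cT * (CP * x1)) + 2 * (dt * (x1 * (nu * x2 + dd * x5 + Kb * x8 * B * x4 +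
    Kb * x8 * B * x3 + Kb * B * x6 + Kb * x7 * x2)))
  + 2 * (eps * (dt * Pt * x9)) + 2 * (dt * (al * x2 * x9)) by ring.
by apply: lerD; [apply: lerD; [apply: lerD|]|]; rewrite ler_pM2l.
Qed.

End error.
End step.
End galerkin.

(** * Divergence, pressure spaces and the principal angle *)

Section rom_spaces.
Context (R : realType) (d : nat) (Om : set 'rV[R]_d).
Hypotheses (oOm : open Om) (bOm : bounded_set Om).
Local Notation leb := (lebesgue_rV R d).
Local Notation L2 := (L2 Om).
Local Notation ip := (ip Om).
Local Notation nm := (L2norm Om).
Local Notation wD := (wD Om).
Local Notation X := (Xsp Om).
Local Notation Q := (Qsp Om).
Local Notation dvg := (diverg Om).

Let mOm : measurable Om := open_measurable_rV oOm.

Lemma semi_ip_sub (V : lmodType R) (P P' : set V) (b : V -> V -> R) : semi_ip P b ->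
  (forall v, P' v -> P v) -> P' 0 -> (forall u v, P' u -> P' v -> P' (u + v)) ->
  (forall a u, P' u -> P' (a *: u)) -> semi_ip P' b.
Proof.
move=> [_ _ _ sC sD sZ s0] sub z D Z; split=> //.
- by move=> u v /sub Pu /sub Pv; exact: sC.
- by move=> u v w /sub Pu /sub Pv /sub Pw; exact: sD.
- by move=> a u v /sub Pu /sub Pv; exact: sZ.
- by move=> u /sub Pu; exact: s0.
Qed.

Lemma L2norm_sqr f : nm f ^+ 2 = ip f f.
Proof.
by rewrite sqr_sqrtr//; apply: Rintegral_ge0 => x _; rewrite -expr2 sqr_ge0.
Qed.

Local Opaque Hm Defs.L2 Defs.ip Defs.wD Defs.L2norm Defs.H10.

Lemma X_semi_ip : semi_ip X (vip Om).
Proof.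
have G := grad_semi_ip oOm.
by apply: (semi_ip_sub (vip_semi_ip oOm)) => [v Xv| | |];
  [exact: (X_L2v Xv)|exact: (sip0 G)|exact: (sipPD G)|exact: (sipPZ G)].
Qed.

Lemma QspE q : Q q <-> L2 q /\ ip q (cst 1) = 0.
Proof. by rewrite (ip_cst1E Om q). Qed.

Lemma Q_semi_ip : semi_ip Q ip.
Proof.
have S := ip_semi_ip mOm; have L1 := L2_cst1 oOm bOm.
apply: (semi_ip_sub S) => [q /QspE[]//| |p q /QspE[Lp p0] /QspE[Lq q0]|a q /QspE[Lq q0]].
- by apply/QspE; split; [exact: (sip0 S)|exact: (sip0l S L1)].
- apply/QspE; split; first exact: (sipPD S).
  by rewrite (sipDl S Lp Lq L1) p0 q0 addr0.
- apply/QspE; split; first exact: (sipPZ S).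
  by rewrite (sipZl S a Lq L1) q0 mulr0.
Qed.

Lemma Qsp_L2 q : Q q -> L2 q.
Proof. by case/QspE. Qed.

Definition divform (v : vfield R d) (p : sfield R d) : R := ip p (dvg v).

Lemma divformC v p : X v -> L2 p -> divform v p = ip (dvg v) p.
Proof. by move=> Xv Lp; exact: (ipC oOm Lp (diverg_L2 oOm Xv)). Qed.

Lemma divformBl u v p : X u -> X v -> Q p -> divform (u - v) p = divform u p - divform v p.
Proof.
move=> Xu Xv /Qsp_L2 Lp; have Xuv := sipPB X_semi_ip Xu Xv.
by rewrite (divformC Xuv Lp) (divformC Xu Lp) (divformC Xv Lp); exact: (ip_divergB oOm Xu Xv Lp).
Qed.

Lemma divformBr u p p' : X u -> Q p -> Q p' -> divform u (p - p') = divform u p - divform u p'.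
Proof.
by move=> Xu /Qsp_L2 Lp /Qsp_L2 Lp'; exact: (ipBl oOm Lp Lp' (diverg_L2 oOm Xu)).
Qed.

Lemma divform_le v p : X v -> Q p -> `|divform v p| <= d%:R * gradnorm Om v * nm p.
Proof.
move=> Xv /Qsp_L2 Lp; apply: (le_trans (L2_CS oOm Lp (diverg_L2 oOm Xv))).
by rewrite mulrC ler_wpM2r ?L2norm_ge0//; exact: (diverg_le oOm Xv).
Qed.

(** [div u] is orthogonal to [Q], which contains [div v]. Pairing [div (u - v)] with [div v]
    therefore gives minus the squared norm of [div v]. *)
Lemma L2norm_div_le u v : X u -> X v -> (forall q, Q q -> ip (dvg u) q = 0) ->
  nm (dvg v) <= d%:R * gradnorm Om (u - v).
Proof.
move=> Xu Xv du; have Xuv := sipPB X_semi_ip Xu Xv.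
apply: le_trans (diverg_le oOm Xuv).
have Ldv := diverg_L2 oOm Xv; have Lduv := diverg_L2 oOm Xuv.
have E : ip (dvg (u - v)) (dvg v) = - nm (dvg v) ^+ 2.
  rewrite (ip_divergB oOm Xu Xv Ldv) du; last exact: (diverg_Qsp oOm bOm Xv).
  by rewrite L2norm_sqr sub0r.
have H := L2_CS oOm Lduv Ldv; rewrite E in H.
move: H (L2norm_ge0 Om (dvg v)) (L2norm_ge0 Om (dvg (u - v))).
move: (nm (dvg v)) (nm (dvg (u - v))) => x y + x0 y0.
rewrite normrN ger0_norm ?sqr_ge0//; exact: le_of_sqr_le_mul.
Qed.

Section span.
Context (r : nat) (phi : 'I_r -> vfield R d) (Xphi : forall i, X (phi i)).

Lemma wD_sum (I : Type) (s : seq I) (c : I -> R) (F : I -> 'rV[R]_d -> R) i :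
  (forall k, H10 Om (F k)) ->
  aeq Om (wD i (\sum_(k <- s) c k *: F k)) (\sum_(k <- s) c k *: wD i (F k)).
Proof.
move=> HF.
have HS t : H10 Om (\sum_(k <- t) c k *: F k).
  elim: t => [|k t ih]; first by rewrite big_nil; exact: (H10_0 oOm).
  by rewrite big_cons; apply: (H10D oOm _ ih); exact: (H10Z oOm _ (HF k)).
elim: s => [|k s ih].
  rewrite !big_nil; have := wDZ oOm i 0 (H10_Hm1 (H10_0 oOm)).
  by rewrite !scale0r.
rewrite !big_cons.
have h1 := wDD oOm i (H10_Hm1 (H10Z oOm (c k) (HF k))) (H10_Hm1 (HS s)).
have h2 := wDZ oOm i (c k) (H10_Hm1 (HF k)).
exact: (aeq_trans h1 (aeqD h2 ih)).
Qed.

Lemma aeq_sum (I : Type) (s : seq I) (F F' : I -> 'rV[R]_d -> R) :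
  (forall k, aeq Om (F k) (F' k)) -> aeq Om (\sum_(k <- s) F k) (\sum_(k <- s) F' k).
Proof.
move=> HF; elim: s => [|k s ih]; first by rewrite !big_nil; apply: nearW => x _.
by rewrite !big_cons; exact: (aeqD (HF k) ih).
Qed.

(** The chosen weak derivatives are linear only almost everywhere, so the divergence of a
    combination need not belong literally to the span of the divergences; it has a representative
    there. *)
Lemma diverg_span v : lspan phi v ->
  exists z, [/\ lspan (fun i => dvg (phi i)) z, L2 z & aeq Om (dvg v) z].
Proof.
move=> [c ->]; exists (\sum_(k < r) c k *: dvg (phi k)); split.
- by exists c.
- apply: (L2_sum oOm) => k; exact: (L2Z mOm _ (diverg_L2 oOm (Xphi k))).
- rewrite divergE.
  have E : \sum_(k < r) c k *: dvg (phi k) = \sum_(i < d) \sum_(k < r) c k *: wD i (phi k i).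
    by rewrite exchange_big; apply: eq_bigr => k _; rewrite divergE scaler_sumr.
  rewrite E; apply: aeq_sum => i.
  have -> : (\sum_(k < r) c k *: phi k) i = \sum_(k < r) c k *: phi k i by rewrite fct_sumE.
  exact: (wD_sum _ _ i (fun k => Xphi k i)).
Qed.

Context (M : nat) (psi : 'I_M -> sfield R d) (Qpsi : forall i, Q (psi i)).

(** The cosine decreases on [[0, pi]], so the least angle gives the largest normalized pairing. The
    angle is attained by a pair, whose ratio is nonnegative, and hence so is its cosine. *)
Lemma principal_angle_le theta v p :
  principal_angle Om (lspan (fun i => dvg (phi i))) (lspan psi) theta ->
  lspan phi v -> lspan psi p ->
  0 <= cos theta /\ `|divform v p| <= cos theta * nm (dvg v) * nm p.
Proof.
move=> [[[z0 q0] /= [z0in q0in nz0 nq0] thE] lb] Sv Sp.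
have [z [Sz Lz vz]] := diverg_span Sv.
have Xv : X v := lspan_sub (grad_semi_ip oOm) Xphi Sv.
have Qp : Q p := lspan_sub Q_semi_ip Qpsi Sp.
have Lp := Qsp_L2 Qp; have Ldv := diverg_L2 oOm Xv.
have ratio f g : L2 f -> L2 g -> nm f != 0 -> nm g != 0 -> 0 <= `|ip f g| / (nm f * nm g) <= 1.
  move=> Lf Lg f0 g0; have fg0 : 0 < nm f * nm g.
    by rewrite mulr_gt0// lt_neqAle eq_sym ?f0 ?g0/=; exact: L2norm_ge0.
  rewrite divr_ge0 ?(ltW fg0)//= ler_pdivrMr// mul1r; exact: (L2_CS oOm Lf Lg).
have Lz0 : L2 z0.
  apply: (lspan_sub (ip_semi_ip mOm) _ z0in) => i; exact: (diverg_L2 oOm (Xphi i)).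
have Lq0 : L2 q0 := Qsp_L2 (lspan_sub Q_semi_ip Qpsi q0in).
have cosE (x : R) : 0 <= x <= 1 -> cos (acos x) = x.
  by move=> /andP[x0 x1]; apply: acosK; rewrite in_itv/= x1 (le_trans _ x0)// lerN10.
have r0 := ratio _ _ Lz0 Lq0 nz0 nq0.
have c0 : 0 <= cos theta by rewrite -thE cosE//; case/andP: r0.
split=> //; rewrite (divformC Xv Lp) (L2_aeq_norm oOm Ldv Lz vz) (ip_aeql mOm Ldv Lz Lp vz).
have CS := L2_CS oOm Lz Lp.
(* Elements of norm zero are excluded from the definition of the angle; for them Cauchy-Schwarz
   makes both sides vanish. *)
have [zn|zn] := eqVneq (nm z) 0.
  by move: CS; rewrite zn mulr0 !mul0r.
have [pn|pn] := eqVneq (nm p) 0.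
  by move: CS; rewrite pn !mulr0.
have rzp := ratio _ _ Lz Lp zn pn.
have le : theta <= acos (`|ip z p| / (nm z * nm p)).
  by apply: lb; exists (z, p).
have zp0 : 0 < nm z * nm p.
  by rewrite mulr_gt0// lt_neqAle eq_sym ?zn ?pn/=; exact: L2norm_ge0.
rewrite -mulrA -ler_pdivrMr// -[leLHS](cosE _ rzp).
have itv (x : R) : 0 <= x <= 1 -> acos x \in `[0, pi].
  move=> /andP[x0 x1]; have h : -1 <= x <= 1 by rewrite x1 (le_trans _ x0)// lerN10.
  by rewrite in_itv/= acos_ge0//= acos_lepi.
have thI : theta \in `[0, pi] by rewrite -thE; exact: itv.
by rewrite leNgt ltr_cos ?itv// -leNgt.
Qed.

End span.
End rom_spaces.

(** * Time increments of the Navier-Stokes solution *)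

Section nse_time.
Context (R : realType) (d : nat) (Om : set 'rV[R]_d) (T : R).
Hypotheses (oOm : open Om) (T0 : 0 < T).
Local Notation mu := (@lebesgue_measure R).
Local Notation L2 := (L2 Om).
Local Notation ip := (ip Om).
Local Notation nm := (L2norm Om).
Local Notation wD := (wD Om).
Local Notation X := (Xsp Om).
Local Notation vn := (vnorm Om).
Local Notation gn := (gradnorm Om).

Let mOm : measurable Om := open_measurable_rV oOm.

Lemma vnorm_sumE v : vn v = Num.sqrt (\sum_j nm (v j) ^+ 2).
Proof. by congr Num.sqrt; apply: eq_bigr => j _; rewrite L2norm_sqr. Qed.

Lemma gradnorm_sumE v :
  gn v = Num.sqrt (\sum_(z : 'I_d * 'I_d) nm (wD z.1 (v z.2)) ^+ 2).
Proof.
congr Num.sqrt; rewrite /gradip pair_big /=; apply: eq_bigr => z _.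
by rewrite L2norm_sqr.
Qed.

Lemma Hm_sub1 m f : Hm Om m.+1 f -> Hm Om 1 f.
Proof.
move=> /= [Lf H]; split=> // i; have [Hi Hm] := H i; split=> //; split=> //.
by case: m Hm {H} => [|m] [].
Qed.

Lemma Hm_L2 m f : Hm Om m f -> L2 f.
Proof. by case: m => [|m] []. Qed.

Local Opaque Hm Defs.L2 Defs.ip Defs.wD Defs.L2norm Defs.H10.

Lemma Lq_version m w a : Lq_Hm Om T 2 m w -> (size a <= m)%N ->
  (forall f, Hm Om m f -> L2 (wDs Om a f)) ->
  (exists D, time_version Om T (fun t => wDs Om a (w t)) D) /\
  (\int[mu]_(t in `]0%R, T[) (nm (wDs Om a (w t)) ^+ 2)%:E < +oo)%E.
Proof.
move=> [bm fin] am HL; split; first exact: (bochner_version oOm bm am HL).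
apply: le_lt_trans fin; apply: ge0_integral_mono_in => t _; first by rewrite lee_fin sqr_ge0.
rewrite lee_fin ler_sqr ?nnegrE ?L2norm_ge0 ?sqrtr_ge0//; exact: L2norm_wDs_le.
Qed.

Lemma time_derivative_version w wt : time_derivative Om T w wt ->
  (exists D, time_version Om T wt D) /\
  (\int[mu]_(t in `]0%R, T[) (nm (wt t) ^+ 2)%:E < +oo)%E.
Proof.
by move=> [_ Hwt _]; apply: (Lq_version (a := [::]) Hwt) => // f; exact: Hm_L2.
Qed.

Lemma ler_sqrt_sqr (x y : R) : 0 <= x -> x ^+ 2 <= y -> x <= Num.sqrt y.
Proof. by move=> x0 h; rewrite -[leLHS]ger0_norm// -sqrtr_sqr ler_wsqrtr. Qed.

Lemma velocity_family (w wt : R -> vfield R d) :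
  (forall j, time_derivative Om T (w ^~ j) (wt ^~ j)) ->
  exists Th : R -> R, [/\ Th 0 = 0, Th T = tnorm2 T (fun t => vn (wt t)),
    forall a b, a <= b -> Th a <= Th b &
    forall j a b, 0 <= a -> a < b -> b <= T ->
      exists2 h, bochner_on Om (wt ^~ j) a b h & nm h ^+ 2 <= (b - a) * (Th b - Th a)].
Proof.
move=> Dw; have [Th [h1 h2 h3 h4]] := time_family oOm (F := fun j t => wt t j)
  (fun j => (time_derivative_version (Dw j)).1) (fun j => (time_derivative_version (Dw j)).2).
exists Th; split=> //; rewrite h2; congr (tnorm2 T _); apply/funext => t.
by rewrite vnorm_sumE.
Qed.

Lemma velocity_increment (w wt : R -> vfield R d) :
  (forall j, time_derivative Om T (w ^~ j) (wt ^~ j)) ->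
  exists Th : R -> R, [/\ Th 0 = 0, Th T = tnorm2 T (fun t => vn (wt t)),
    forall a b, a <= b -> Th a <= Th b &
    forall a b, 0 <= a -> a < b -> b <= T ->
      vn (w b - w a) ^+ 2 <= d%:R * ((b - a) * (Th b - Th a))].
Proof.
move=> Dw; have [Th [h1 h2 h3 h4]] := velocity_family Dw.
exists Th; split=> // a b a0 ab bT.
rewrite vnorm_sumE sqr_sqrtr; last by apply: sumr_ge0 => j _; exact: sqr_ge0.
have -> : d%:R * ((b - a) * (Th b - Th a)) = \sum_(j < d) (b - a) * (Th b - Th a).
  by rewrite sumr_const card_ord mulr_natl.
apply: ler_sum => j _; have [h Bh hle] := h4 j a b a0 ab bT.
apply: le_trans hle; have := time_increment oOm (Dw j) a0 (ltW ab) bT Bh.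
move: (L2norm_ge0 Om (w b j - w a j)) (L2norm_ge0 Om h).
have -> : (w b - w a) j = w b j - w a j by [].
move: (nm (w b j - w a j)) (nm h) => x y x0 y0 xy.
by rewrite ler_sqr.
Qed.

(** Monotonicity of [Th] makes the bound on the increment of [wt] from [t] to [b] uniform in [t], as
    [time_consistency] requires. The components are then summed, which costs the factor [d%:R]. *)
Lemma velocity_consistency (w wt wtt : R -> vfield R d) :
  (forall j, time_derivative Om T (w ^~ j) (wt ^~ j)) ->
  (forall j, time_derivative Om T (wt ^~ j) (wtt ^~ j)) ->
  exists Th : R -> R, [/\ Th 0 = 0, Th T = tnorm2 T (fun t => vn (wtt t)),
    forall a b, a <= b -> Th a <= Th b &
    forall a b v, 0 <= a -> a < b -> b <= T -> L2v Om v ->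
      `|(b - a) * vip Om (wt b) v - vip Om (w b - w a) v| <=
      (b - a) * (d%:R * Num.sqrt ((b - a) * (Th b - Th a))) * vn v].
Proof.
move=> Dw Dwt; have [Th [h1 h2 h3 h4]] := velocity_family Dwt.
have [Tw [_ _ _ hw]] := velocity_family Dw.
exists Th; split=> // a b v a0 ab bT Lv.
have ab0 : 0 <= b - a by rewrite subr_ge0 ltW.
set G := Num.sqrt _; have G0 : 0 <= G by exact: sqrtr_ge0.
have Hj j : `|(b - a) * ip (wt b j) (v j) - (ip (w b j) (v j) - ip (w a j) (v j))| <=
    (b - a) * G * nm (v j).
  have [h Bh _] := hw j a b a0 ab bT.
  apply: (time_consistency oOm (Dw j) (Dwt j) a0 ab bT G0 _ Bh (Lv j)) => t at_ tb.
  have [g Bg gle] := h4 j t b (le_trans a0 at_) tb bT; exists g => //.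
  apply: ler_sqrt_sqr; first exact: L2norm_ge0.
  apply: (le_trans gle); apply: ler_pM; rewrite ?subr_ge0 ?(ltW tb) ?h3 ?(ltW tb)//.
    by rewrite lerB.
  by rewrite lerB// h3.
have E : (b - a) * vip Om (wt b) v - vip Om (w b - w a) v =
   \sum_(j < d) ((b - a) * ip (wt b j) (v j) - (ip (w b j) (v j) - ip (w a j) (v j))).
  rewrite /vip mulr_sumr -sumrB; apply: eq_bigr => j _; congr (_ - _).
  have [Lw _ _] := Dw j.
  have Lb : L2 (w b j) by apply: Lw; rewrite (le_trans a0 (ltW ab)).
  have La : L2 (w a j) by apply: Lw; rewrite a0 (le_trans (ltW ab) bT).
  exact: (ipBl oOm Lb La (Lv j)).
rewrite E; apply: (le_trans (ler_norm_sum _ _ _)).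
have -> : (b - a) * (d%:R * G) * vn v = \sum_(j < d) (b - a) * G * vn v.
  rewrite sumr_const card_ord -mulr_natl; move: (vn v) => y; ring.
apply: ler_sum => j _; apply: (le_trans (Hj j)).
by apply: ler_wpM2l; [exact: mulr_ge0|exact: (L2norm_le_vnorm oOm j Lv)].
Qed.

Lemma velocity_grad_increment m (w wt : R -> vfield R d) :
  (forall j, time_derivative Om T (w ^~ j) (wt ^~ j)) ->
  (forall j, Lq_Hm Om T 2 m.+1 (wt ^~ j)) -> (forall t, 0 <= t <= T -> X (w t)) ->
  exists Th : R -> R, [/\ Th 0 = 0, Th T = tnorm2 T (fun t => gn (wt t)),
    forall a b, a <= b -> Th a <= Th b &
    forall a b, 0 <= a -> a < b -> b <= T ->
      gn (w b - w a) ^+ 2 <= (d%:R * d%:R) * ((b - a) * (Th b - Th a))].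
Proof.
move=> Dw HL Xw.
have Hv (z : 'I_d * 'I_d) : (exists D, time_version Om T (fun t => wD z.1 (wt t z.2)) D) /\
   (\int[mu]_(t in `]0%R, T[) (nm (wD z.1 (wt t z.2)) ^+ 2)%:E < +oo)%E.
  apply: (Lq_version (a := [:: z.1]) (HL z.2)) => // f Hf.
  exact: (Hm1_wD_L2 z.1 (Hm_sub1 Hf)).
have [Th [h1 h2 h3 h4]] := time_family oOm (F := fun (z : 'I_d * 'I_d) t => wD z.1 (wt t z.2))
  (fun z => (Hv z).1) (fun z => (Hv z).2).
exists Th; split=> // [|a b a0 ab bT].
  by rewrite h2; congr (tnorm2 T _); apply/funext => t; rewrite gradnorm_sumE.
rewrite gradnorm_sumE sqr_sqrtr; last by apply: sumr_ge0 => z _; exact: sqr_ge0.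
have -> : (d%:R * d%:R) * ((b - a) * (Th b - Th a)) =
    \sum_(z : 'I_d * 'I_d) (b - a) * (Th b - Th a).
  by rewrite sumr_const card_prod !card_ord -[RHS]mulr_natl natrM.
apply: ler_sum => z _; have [h Bh hle] := h4 z a b a0 ab bT.
apply: le_trans hle.
have Xa : Hm Om 1 (w a z.2).
  by apply: H10_Hm1; apply: Xw; rewrite a0 (le_trans (ltW ab) bT).
have Xb : Hm Om 1 (w b z.2).
  by apply: H10_Hm1; apply: Xw; rewrite bT (le_trans a0 (ltW ab)).
have Hae : {ae mu, forall t, 0 < t < T -> Hm Om 1 (wt t z.2)}.
  have [[D [_ HD]] _] := HL z.2.
  by apply: (ae_leb _ HD) => t Ht t0; have [Hm _] := Ht t0; exact: (Hm_sub1 Hm).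
have E := time_grad_increment oOm (Dw z.2) a0 (ltW ab) bT Xa Xb Hae Bh.
have E' : nm (wD z.1 ((w b - w a) z.2)) = nm h := E.
by rewrite E' lexx.
Qed.

Lemma pressure_increment (p pt : R -> sfield R d) : time_derivative Om T p pt ->
  Linf_Hm Om T 0 pt ->
  0 <= tnormoo T (fun t => nm (pt t)) /\
  forall a b, 0 <= a -> a < b -> b <= T ->
    nm (p b - p a) <= (b - a) * tnormoo T (fun t => nm (pt t)).
Proof.
move=> Dp [[D [_ HD]] [M HM]].
have [P0 HP] : 0 <= tnormoo T (fun t => nm (pt t)) /\
  {ae mu, forall t, 0 < t < T -> nm (pt t) <= tnormoo T (fun t => nm (pt t))}.
  apply: (ess_bound T0 (fun t => L2norm_ge0 Om (pt t))); exists M.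
  apply: (ae_leb _ HM) => t h t0; apply: le_trans (h t0).
  exact: (@L2norm_wDs_le R d Om 0 (pt t) [::]).
split=> // a b a0 ab bT.
have [Th [_ _ _ h4]] := time_family oOm (F := fun (z : unit) t => pt t)
  (fun z => (time_derivative_version Dp).1) (fun z => (time_derivative_version Dp).2).
have [h Bh _] := h4 tt a b a0 ab bT.
apply: (time_increment_bounded oOm Dp a0 (ltW ab) bT P0 _ (ex_intro _ h Bh)).
apply: (ae_leb2 _ HP HD) => t h1 h2 t0; split; last exact: h1.
by have [Hm _] := h2 t0; exact: (Hm_L2 Hm).
Qed.

End nse_time.

(** * The reduced order model *)

Section projections.
Context (R : realType) (V : lmodType R) (P : set V) (b : V -> V -> R) (sb : semi_ip P b).
Local Notation nm u := (Num.sqrt (b u u)).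

Lemma sip_proj_le v w : P v -> P w -> b (v - w) w = 0 -> nm w <= nm v.
Proof.
move=> Pv Pw o; have E : nm w ^+ 2 = b v w.
  by move/eqP: o; rewrite (sipBl sb Pv Pw Pw) subr_eq0 (sip_norm2 sb Pw) => /eqP ->.
have := le_trans (ler_norm _) (sip_CS sb Pv Pw); rewrite -E.
exact: (le_of_sqr_le_mul (sqrtr_ge0 _) (sqrtr_ge0 _)).
Qed.

Lemma subrACA (x y z w : V) : (x - y) - (z - w) = (x - z) - (y - w).
Proof. by rewrite !opprB addrACA [RHS]addrACA [- z - y]addrC. Qed.

Lemma sip_norm_sub_le u v w : P u -> P v -> nm v <= w -> nm (u - v) <= nm u + w /\ nm u <= nm (u - v) + w.
Proof.
move=> Pu Pv vw; split; first by apply: (le_trans (sip_normB sb Pu Pv)); rewrite lerD2l.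
apply: (@le_trans _ _ (nm (u - v) + nm v)); last by rewrite lerD2l.
by have := sip_normD sb (sipPB sb Pu Pv) Pv; rewrite subrK.
Qed.

(** [S' - S] is the projection of [U' - U], and projections do not increase norms. *)
Lemma sip_incr_le u u' U U' S S' : P u -> P u' -> P U -> P U' -> P S -> P S' ->
  b (U - S) (S' - S) = 0 -> b (U' - S') (S' - S) = 0 ->
  nm ((u' - S') - (u - S)) <= nm (u' - u) + nm (U' - U).
Proof.
move=> Pu Pu' PU PU' PS PS' o o'; have PB := sipPB sb.
rewrite (subrACA u' S' u S).
apply: (le_trans (sip_normB sb (PB _ _ Pu' Pu) (PB _ _ PS' PS))); rewrite lerD2l.
apply: (sip_proj_le (PB _ _ PU' PU) (PB _ _ PS' PS)).
rewrite (subrACA U' U S' S).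
by rewrite (sipBl sb (PB _ _ PU' PS') (PB _ _ PU PS) (PB _ _ PS' PS)) o o' subrr.
Qed.

Lemma sip_split u U S : P u -> P U -> P S -> b (U - S) (u - S) = 0 ->
  nm (U - u) ^+ 2 = nm (U - S) ^+ 2 + nm (u - S) ^+ 2.
Proof.
move=> Pu PU PS o; have PB := sipPB sb.
rewrite -(sip_pythagoras sb (PB _ _ PU PS) (PB _ _ Pu PS) o).
by have -> : U - S - (u - S) = U - u by rewrite opprB addrA subrK.
Qed.

Lemma sip_split_incr u u' U U' S S' : P u -> P u' -> P U -> P U' -> P S -> P S' ->
  (forall z, z = u - S \/ z = u' - S' -> b (U - S) z = 0 /\ b (U' - S') z = 0) ->
  nm ((U' - u') - (U - u)) ^+ 2 =
  nm ((U' - S') - (U - S)) ^+ 2 + nm ((u' - S') - (u - S)) ^+ 2.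
Proof.
move=> Pu Pu' PU PU' PS PS' o; have PB := sipPB sb.
have E : (U' - u') - (U - u) = (U' - S' - (U - S)) - (u' - S' - (u - S)).
  have D (x y z : V) : x - y = (x - z) - (y - z) by rewrite opprB addrA subrK.
  by rewrite (D U' u' S') (D U u S) subrACA.
rewrite E; apply: (sip_pythagoras sb (PB _ _ (PB _ _ PU' PS') (PB _ _ PU PS)) (PB _ _ (PB _ _ Pu' PS') (PB _ _ Pu PS))).
have P1 := PB _ _ PU' PS'; have P2 := PB _ _ PU PS; have P3 := PB _ _ Pu' PS'; have P4 := PB _ _ Pu PS.
rewrite (sipBl sb P1 P2 (PB _ _ P3 P4)) (sipBr sb P3 P4 P1) (sipBr sb P3 P4 P2).
have [-> ->] := o _ (or_introl erefl); have [-> ->] := o _ (or_intror erefl).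
by rewrite !subrr.
Qed.

End projections.

Lemma err_coef_le (R : realType) (CP nu nu0 Kb s Bn D Q a1 e1 k1 a4 e0 a6 a7 z : R) :
  nu <= nu0 -> 0 <= a1 -> 0 <= e1 -> 0 <= k1 -> 0 <= a4 -> 0 <= e0 -> 0 <= a6 -> 0 <= a7 ->
  0 <= Kb * s * Bn -> z <= D * a4 -> CP * D <= Q -> nu0 <= Q -> D <= Q -> Kb * s * Bn * D <= Q ->
  Kb * s * Bn <= Q -> Kb * Bn <= Q -> Kb <= Q ->
  CP * (D * a1) + nu * e1 + D * k1 + Kb * s * Bn * z + Kb * s * Bn * e0 + Kb * Bn * a6
    + Kb * a7 * e1 <= Q * (a1 + e1 + k1 + a4 + e0 + a6 + a7 * e1).
Proof.
move=> nn p1 p2 p3 p4 p5 p6 p7 c0 hz q1 q2 q3 q4 q5 q6 q7; rewrite !mulrDr.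
have hz' : Kb * s * Bn * z <= Kb * s * Bn * D * a4 by rewrite -[leRHS]mulrA ler_wpM2l.
apply: lerD; last by rewrite -mulrA ler_wpM2r// mulr_ge0.
apply: lerD; last by rewrite ler_wpM2r.
apply: lerD; last by rewrite ler_wpM2r.
apply: lerD; last by apply: (le_trans hz'); rewrite ler_wpM2r.
apply: lerD; last by rewrite ler_wpM2r.
apply: lerD; last by rewrite ler_wpM2r// (le_trans nn).
by rewrite mulrA ler_wpM2r.
Qed.

Lemma dnorm2E (R : realType) (dt : R) (K : nat) (g : nat -> R) :
  dnorm2 dt K g = dt * \sum_(0 <= n < K.+1) g n ^+ 2.
Proof. by rewrite /dnorm2 big_mkord. Qed.

Lemma powR_half_three (R : realType) (x y : R) : 0 <= x -> 0 < y ->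
  x `^ (1 / 2) / y `^ (3 / 2) = Num.sqrt x / (y * Num.sqrt y).
Proof.
move=> x0 y0; rewrite div1r powR12_sqrt//.
have -> : 3 / 2 = 1 + 2^-1 :> R by field.
by rewrite powRD ?(gt_eqF y0) ?implybT// powRr1 ?powR12_sqrt// ltW.
Qed.

(** Only the gradients fail to split exactly. Doubling their squares leaves an excess of at most
    [nu * G], half of it from the sum and half from the last level. Since [nu * G = nu^2 (nu^-1 G)],
    the excess is [nu0 ^+ 2] times a term already present in the bound. *)
Lemma combine_errors (R : realType) (nu nu0 dt eps al C E Pt TT TG Tpt S : R) (K : nat)
    (e de ep dep ge eta deta geta kap dkap xi dxi gxi pp dpp : nat -> R) :
  0 < nu -> nu <= nu0 -> 0 <= dt -> 0 <= eps -> 0 <= C -> 1 <= E ->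
  0 <= TT -> 0 <= TG -> 0 <= Tpt -> 0 <= S ->
  (forall n, (n <= K)%N -> [/\ e n ^+ 2 = eta n ^+ 2 + xi n ^+ 2,
     ep n ^+ 2 = kap n ^+ 2 + pp n ^+ 2 & ge n ^+ 2 <= 2 * geta n ^+ 2 + 2 * gxi n ^+ 2]) ->
  (forall n, (n < K)%N -> de n ^+ 2 = deta n ^+ 2 + dxi n ^+ 2 /\
     dep n ^+ 2 = dkap n ^+ 2 + dpp n ^+ 2) ->
  xi K ^+ 2 + eps * pp K ^+ 2 + nu * dt * gxi K ^+ 2
    + \sum_(0 <= n < K) (dxi n ^+ 2 + eps / 2 * dpp n ^+ 2)
    + nu * dt * \sum_(0 <= n < K.+1) gxi n ^+ 2 <=
  C * E * (xi 0%N ^+ 2 + eps * pp 0%N ^+ 2 + dt * nu * gxi 0%N ^+ 2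
    + (nu^-1 + al ^+ 2 * dt^-1) * (dt * \sum_(0 <= n < K.+1) geta n ^+ 2)
    + nu^-1 * (dt * \sum_(0 <= n < K.+1) kap n ^+ 2)
    + dt ^+ 2 / nu * TT + dt ^+ 2 / nu * TG + Num.sqrt dt / (nu * Num.sqrt nu) * S
    + dt * Pt ^+ 2) ->
  e K ^+ 2 + eps * ep K ^+ 2 + nu * dt / 2 * ge K ^+ 2
    + nu / 2 * dnorm2 dt K ge
    + \sum_(0 <= n < K) (de n ^+ 2 + eps / 2 * dep n ^+ 2) <=
  eta K ^+ 2 + eps * kap K ^+ 2 + nu * dt / 2 * geta K ^+ 2
    + nu / 2 * dnorm2 dt K geta
    + \sum_(0 <= n < K) (deta n ^+ 2 + eps / 2 * dkap n ^+ 2)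
  + (C + nu0 ^+ 2) * E * (xi 0%N ^+ 2 + eps * pp 0%N ^+ 2 + dt * nu * gxi 0%N ^+ 2
    + (nu^-1 + al ^+ 2 * dt^-1) * dnorm2 dt K geta
    + nu^-1 * dnorm2 dt K kap
    + dt ^+ 2 / nu * TT + dt ^+ 2 / nu * TG + dt `^ (1 / 2) / nu `^ (3 / 2) * S + dt ^+ 3 * Tpt + dt * Pt ^+ 2).
Proof.
move=> nu_gt0 nu_le d0 e0 C0 E1 TT0 TG0 Tpt0 S_ge0 He Hd bound.
rewrite !dnorm2E (powR_half_three d0 nu_gt0).
have n0 := ltW nu_gt0.
set X7 := _ * S in bound *.
have X70 : 0 <= X7.
  by rewrite /X7 mulr_ge0// divr_ge0 ?sqrtr_ge0// mulr_ge0 ?sqrtr_ge0.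
have S0 (g : nat -> R) m : 0 <= \sum_(0 <= n < m) g n ^+ 2.
  by apply: sumr_ge0 => n _; exact: sqr_ge0.
set G := dt * \sum_(0 <= n < K.+1) geta n ^+ 2 in bound *.
set Kp := dt * \sum_(0 <= n < K.+1) kap n ^+ 2 in bound *.
have G0 : 0 <= G by rewrite mulr_ge0.
have Kp0 : 0 <= Kp by rewrite mulr_ge0.
have h1 : 0 <= xi 0%N ^+ 2 by exact: sqr_ge0.
have h2 : 0 <= eps * pp 0%N ^+ 2 by rewrite mulr_ge0 ?sqr_ge0.
have h3 : 0 <= dt * nu * gxi 0%N ^+ 2 by rewrite mulr_ge0 ?sqr_ge0// mulr_ge0.
have h4 : 0 <= al ^+ 2 * dt^-1 * G by rewrite mulr_ge0// mulr_ge0 ?sqr_ge0 ?invr_ge0.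
have h5 : 0 <= nu^-1 * Kp by rewrite mulr_ge0 ?invr_ge0.
have h6 : 0 <= dt ^+ 2 / nu * TT by rewrite mulr_ge0// divr_ge0 ?sqr_ge0.
have h7 : 0 <= dt ^+ 2 / nu * TG by rewrite mulr_ge0// divr_ge0 ?sqr_ge0.
have h9 : 0 <= dt * Pt ^+ 2 by rewrite mulr_ge0 ?sqr_ge0.
have h10 : 0 <= nu^-1 * G by rewrite mulr_ge0 ?invr_ge0.
have h11 : 0 <= dt ^+ 3 * Tpt by rewrite mulr_ge0 ?exprn_ge0.
set rhs := (X in _ <= C * E * X) in bound.
set par := (X in _ <= _ + (C + _) * E * X).
have parE : par = rhs + dt ^+ 3 * Tpt by rewrite /par /rhs; ring.
have rhsE : rhs = xi 0%N ^+ 2 + eps * pp 0%N ^+ 2 + dt * nu * gxi 0%N ^+ 2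
    + (nu^-1 * G + al ^+ 2 * dt^-1 * G) + nu^-1 * Kp
    + dt ^+ 2 / nu * TT + dt ^+ 2 / nu * TG + X7 + dt * Pt ^+ 2.
  by rewrite /rhs mulrDl.
have [[rhsG _ _ _] _] := terms_le_sum rhsE h1 h2 h3 h10 h4 h5 h6 h7 X70 h9.
have rhs0 : 0 <= rhs by apply: le_trans rhsG.
have nuG : nu * G <= nu0 ^+ 2 * rhs.
  have -> : nu * G = nu ^+ 2 * (nu^-1 * G).
    by rewrite expr2 -mulrA (mulrA nu nu^-1) mulfV ?mul1r// gt_eqF.
  apply: ler_pM => //; first exact: sqr_ge0.
  by rewrite ler_sqr ?nnegrE// (le_trans n0).
have key : C * E * rhs + nu * G <= (C + nu0 ^+ 2) * E * par.
  apply: (@le_trans _ _ ((C + nu0 ^+ 2) * E * rhs)).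
    rewrite mulrDl [leRHS]mulrDl lerD2l; apply: (le_trans nuG).
    by rewrite ler_wpM2r// ler_peMr// sqr_ge0.
  rewrite parE [leRHS]mulrDr lerDl; apply: mulr_ge0 => //.
  by apply: mulr_ge0; [rewrite addr_ge0// sqr_ge0|exact: le_trans ler01 E1].
have [eK pK gK] := He K (leqnn K).
have sumE : \sum_(0 <= n < K) (de n ^+ 2 + eps / 2 * dep n ^+ 2) =
    \sum_(0 <= n < K) (deta n ^+ 2 + eps / 2 * dkap n ^+ 2)
    + \sum_(0 <= n < K) (dxi n ^+ 2 + eps / 2 * dpp n ^+ 2).
  rewrite -big_split/=; apply: eq_big_nat => n /andP[_ nK].
  by have [-> ->] := Hd n nK; rewrite mulrDr addrACA.
have sumG : \sum_(0 <= n < K.+1) ge n ^+ 2 <=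
    2 * \sum_(0 <= n < K.+1) geta n ^+ 2 + 2 * \sum_(0 <= n < K.+1) gxi n ^+ 2.
  rewrite !mulr_sumr -big_split/=; apply: ler_sum_nat => n /andP[_ nK].
  by have [_ _ ?] := He n nK.
have lastG : dt * geta K ^+ 2 <= G.
  by rewrite /G ler_wpM2l// big_nat_recr//= lerDr.
have a1 : nu * dt / 2 * ge K ^+ 2 <= nu * dt / 2 * (2 * geta K ^+ 2 + 2 * gxi K ^+ 2).
  by rewrite ler_wpM2l// divr_ge0// mulr_ge0.
have a2 : nu / 2 * (dt * \sum_(0 <= n < K.+1) ge n ^+ 2) <=
    nu / 2 * (dt * (2 * \sum_(0 <= n < K.+1) geta n ^+ 2
      + 2 * \sum_(0 <= n < K.+1) gxi n ^+ 2)).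
  by rewrite ler_wpM2l ?divr_ge0// ler_wpM2l.
have a3 : nu * (dt * geta K ^+ 2) <= nu * G by rewrite ler_wpM2l.
rewrite sumE eK pK; move: a1 a2 a3 key bound; rewrite /G.
move: (C * E * rhs) ((C + nu0 ^+ 2) * E * par) => r1 r2.
move: (\sum_(0 <= n < K.+1) ge n ^+ 2) (\sum_(0 <= n < K.+1) geta n ^+ 2).
move: (\sum_(0 <= n < K.+1) gxi n ^+ 2) (\sum_(0 <= n < K) (dxi n ^+ 2 + _)).
move: (\sum_(0 <= n < K) _) (ge K ^+ 2) (geta K ^+ 2) (gxi K ^+ 2).
clear => *; lra.
Qed.

(** * The constants of the estimate *)

Section constants.
Context (R : realType) (d : nat) (CP Kb T nu0 c1 c2 B : R).

(** A sum so that each part is dominated by the whole: the L2 norm of the velocity and the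
    contribution of the force, the pressure and the gradient of the velocity, and the square root of
    the sum of squared velocity increments. The absolute value keeps it nonnegative for every real
    [B]. *)
Definition stab_bound : R := CP * `|B| + `|B| + Num.sqrt (d%:R * T) * `|B|.
(** The sum of all coefficients in [error_step], so that it may replace each of them. *)
Definition err_const : R := CP * d%:R + nu0 + d%:R + Kb * Num.sqrt CP * `|B| * d%:R
  + Kb * Num.sqrt CP * `|B| + Kb * `|B| + Kb.

Definition rom_const : R :=
  2 * expR 1 * (1 + 35 * err_const ^+ 2 + 6 * T ^+ 2 * c2 ^+ 2 / c1 + 6 * T * err_const ^+ 2 / c1
          + 14 * err_const ^+ 2 * stab_const T nu0 c2 stab_bound * (nu0 ^+ 2 / T))
      + 2 * stab_const T nu0 c2 stab_bound * (nu0 ^+ 2 / T).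

Definition rom_rate : R := 49 * err_const ^+ 4 / 2 + 1.

Lemma err_const_gt0 : 0 < CP -> 0 < Kb -> 0 < nu0 -> 0 < err_const.
Proof.
move=> CP_gt0 Kb_gt0 nu0_gt0; have aB := normr_ge0 B.
have h1 : 0 <= CP * d%:R by rewrite mulr_ge0// ltW.
have h2 : 0 <= Kb * Num.sqrt CP * `|B| by rewrite mulr_ge0// mulr_ge0 ?sqrtr_ge0// ltW.
have h3 : 0 <= Kb * Num.sqrt CP * `|B| * d%:R by rewrite mulr_ge0.
have h4 : 0 <= Kb * `|B| by rewrite mulr_ge0// ltW.
have h5 : 0 <= d%:R :> R by [].
rewrite /err_const; lra.
Qed.

Lemma rom_rate_gt0 : 0 < rom_rate.
Proof.
have Q4 : 0 <= err_const ^+ 4 by rewrite exprn_even_ge0.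
rewrite /rom_rate; lra.
Qed.

Lemma rom_const_ge0 : 0 < CP -> 0 < T -> 0 < nu0 -> 0 < c1 -> 0 < c2 -> 0 <= rom_const.
Proof.
move=> CP_gt0 T_gt0 nu0_gt0 c1_gt0 c2_gt0.
have b0 : 0 <= stab_bound.
  by rewrite /stab_bound !addr_ge0// mulr_ge0 ?sqrtr_ge0// ltW.
have C0 := ltW (stab_const_gt0 T_gt0 nu0_gt0 c2_gt0 b0).
have w1 : 0 <= nu0 ^+ 2 / T by rewrite divr_ge0 ?sqr_ge0// ltW.
have w2 : 0 <= 6 * T ^+ 2 * c2 ^+ 2 / c1.
  by rewrite divr_ge0 ?(ltW c1_gt0)// mulr_ge0 ?sqr_ge0// mulr_ge0 ?sqr_ge0.
have w3 : 0 <= 6 * T * err_const ^+ 2 / c1.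
  by rewrite divr_ge0 ?(ltW c1_gt0)// mulr_ge0 ?sqr_ge0// mulr_ge0 ?(ltW T_gt0).
have w4 : 0 <= 14 * err_const ^+ 2 * stab_const T nu0 c2 stab_bound * (nu0 ^+ 2 / T).
  by rewrite mulr_ge0// mulr_ge0// mulr_ge0 ?sqr_ge0.
have w5 : 0 <= 35 * err_const ^+ 2 by rewrite mulr_ge0 ?sqr_ge0.
apply: addr_ge0; last by rewrite mulr_ge0// mulr_ge0.
by apply: mulr_ge0; [rewrite mulr_ge0 ?expR_ge0|rewrite !addr_ge0].
Qed.

End constants.

Section rom.
Context (R : realType) (d : nat) (Om : set 'rV[R]_d).
Hypotheses (oOm : open Om) (bOm : bounded_set Om) (hd : (2 <= d <= 3)%N).
Local Notation ip := (ip Om).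
Local Notation nm := (L2norm Om).
Local Notation X := (Xsp Om).
Local Notation Q := (Qsp Om).
Local Notation vn := (vnorm Om).
Local Notation gn := (gradnorm Om).
Context (CP Kb : R) (CP_gt0 : 0 < CP) (Kb_gt0 : 0 < Kb).
Hypotheses (poin : forall v, X v -> vn v <= CP * gn v)
  (b_le : forall w u v, X w -> X u -> X v ->
    `|bstar Om w u v| <= Kb * Num.sqrt (vn w * gn w) * gn u * gn v).

Context (r M : nat) (phi : 'I_r -> vfield R d) (psi : 'I_M -> sfield R d).
Hypotheses (Xphi : forall i, X (phi i)) (Qpsi : forall i, Q (psi i))
  (ophi : orthonormal_family (vip Om) phi) (opsi : orthonormal_family ip psi).
Local Notation XR := (lspan phi).
Local Notation QM := (lspan psi).
Local Notation PR := (orth_proj (vip Om) XR).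
Local Notation chi := (orth_proj ip QM).

Context (T nu0 c1 c2 B : R).
Hypotheses (T_gt0 : 0 < T) (nu0_gt0 : 0 < nu0) (c1_gt0 : 0 < c1) (c2_gt0 : 0 < c2).

Local Notation stab_bound := (stab_bound d CP T B).
Local Notation err_const := (err_const d CP Kb nu0 B).
Local Notation rom_const := (rom_const d CP Kb T nu0 c1 c2 B).
Local Notation rom_rate := (rom_rate d CP Kb nu0 B).

Context (nu dt eps Pt theta TT TG : R) (Nt N : nat).
Context (un uR utn fn : nat -> vfield R d) (pn pM : nat -> sfield R d) (tt tg : nat -> R).
Hypotheses (nu_gt0 : 0 < nu) (nu_le : nu <= nu0) (dt_gt0 : 0 < dt) (NNt : (N.+1 <= Nt)%N)
  (dtNt : dt * Nt%:R <= T) (c1e : c1 * dt <= eps) (c2e : eps <= c2 * dt) (Pt0 : 0 <= Pt).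
Hypotheses (Xun : forall n, (n <= Nt)%N -> X (un n)) (Qpn : forall n, (n <= Nt)%N -> Q (pn n))
  (Lfn : forall n, (n < Nt)%N -> L2v Om (fn n.+1)).
Hypothesis scheme : ac_scheme Om XR QM nu dt eps Nt fn uR pM.
Hypothesis nse : forall n, (n < Nt)%N ->
  (forall v, X v -> vip Om (utn n.+1) v + vip Om (convect Om (un n.+1) (un n.+1)) v
     + nu * gradip Om (un n.+1) v - ip (pn n.+1) (diverg Om v) = vip Om (fn n.+1) v) /\
  (forall q, Q q -> ip (diverg Om (un n.+1)) q = 0).
Hypotheses (tt0 : forall n, 0 <= tt n) (tg0 : forall n, 0 <= tg n)
  (sum_tt : \sum_(0 <= n < N.+1) tt n <= TT) (sum_tg : \sum_(0 <= n < N.+1) tg n <= TG)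
  (consist : forall n v, (n < Nt)%N -> L2v Om v ->
    `|dt * vip Om (utn n.+1) v - vip Om (un n.+1 - un n) v| <=
    dt * (d%:R * Num.sqrt (dt * tt n)) * vn v)
  (grad_inc : forall n, (n < Nt)%N -> gn (un n.+1 - un n) <= d%:R * Num.sqrt (dt * tg n))
  (vel_inc : \sum_(0 <= n < N.+1) vn (un n.+1 - un n) ^+ 2 <= d%:R * T * B ^+ 2)
  (pres_inc : forall n, (n < Nt)%N -> nm (pn n.+1 - pn n) <= dt * Pt)
  (u_bound : forall n, (n <= Nt)%N -> gn (un n) <= `|B|)
  (p_bound : forall n, (n <= Nt)%N -> nm (pn n) <= `|B|)
  (f_bound : dt * \sum_(0 <= n < Nt) vn (fn n.+1) ^+ 2 <= B ^+ 2).
Hypothesis angle : principal_angle Om (lspan (fun i => diverg Om (phi i))) QM theta.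

Let eta n := un n - PR (un n).
Let kap n := pn n - chi (pn n).
Let xi n := uR n - PR (un n).
Let piM n := pM n - chi (pn n).

Let sX := X_semi_ip oOm.
Let sQ := Q_semi_ip oOm bOm.
Let sG := grad_semi_ip oOm.

Local Opaque Hm Defs.L2 Defs.ip Defs.wD Defs.H10 Defs.vip Defs.gradip Defs.diverg Defs.bstar.

Let XRX v : XR v -> X v. Proof. exact: (lspan_sub sX Xphi). Qed.
Let QMQ p : QM p -> Q p. Proof. exact: (lspan_sub sQ Qpsi). Qed.

Let PRin n : (n <= Nt)%N -> XR (PR (un n)).
Proof. by move=> nN; have [] := orth_projP sX Xphi ophi (Xun nN). Qed.
Let PRo n : (n <= Nt)%N -> forall z, XR z -> vip Om (un n - PR (un n)) z = 0.
Proof. by move=> nN; have [] := orth_projP sX Xphi ophi (Xun nN). Qed.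
Let chin n : (n <= Nt)%N -> QM (chi (pn n)).
Proof. by move=> nN; have [] := orth_projP sQ Qpsi opsi (Qpn nN). Qed.
Let chio n : (n <= Nt)%N -> forall z, QM z -> ip (pn n - chi (pn n)) z = 0.
Proof. by move=> nN; have [] := orth_projP sQ Qpsi opsi (Qpn nN). Qed.
Let XRu n : (n <= Nt)%N -> XR (uR n). Proof. by move=> nN; have [H _] := scheme; have [] := H n nN. Qed.
Let QMp n : (n <= Nt)%N -> QM (pM n). Proof. by move=> nN; have [H _] := scheme; have [] := H n nN. Qed.
Let XPR n (nN : (n <= Nt)%N) : X (PR (un n)) := XRX (PRin nN).
Let Qchi n (nN : (n <= Nt)%N) : Q (chi (pn n)) := QMQ (chin nN).
Let XuR n (nN : (n <= Nt)%N) : X (uR n) := XRX (XRu nN).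
Let QpM n (nN : (n <= Nt)%N) : Q (pM n) := QMQ (QMp nN).
Let e0 : 0 <= eps. Proof. by apply: le_trans c1e; rewrite mulr_ge0// ltW. Qed.
Let K_le n : (n <= N.+1)%N -> (n <= Nt)%N. Proof. by move=> h; exact: leq_trans NNt. Qed.
Let vn0 v : 0 <= vn v. Proof. exact: sqrtr_ge0. Qed.
Let gn0 v : 0 <= gn v. Proof. exact: sqrtr_ge0. Qed.
Let nm0 p : 0 <= nm p. Proof. exact: sqrtr_ge0. Qed.

Let Xxi n (nN : (n <= Nt)%N) : XR (xi n) := lspanB (XRu nN) (PRin nN).
Let Qpi n (nN : (n <= Nt)%N) : QM (piM n) := lspanB (QMp nN) (chin nN).
Let Xeta n (nN : (n <= Nt)%N) : X (eta n) := sipPB sX (Xun nN) (XPR nN).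

Let bBl w w' u v : X w -> X w' -> X u -> X v ->
  bstar Om (w - w') u v = bstar Om w u v - bstar Om w' u v.
Proof. exact: (bstarBl oOm bOm hd). Qed.
Let bBm w u u' v : X w -> X u -> X u' -> X v ->
  bstar Om w (u - u') v = bstar Om w u v - bstar Om w u' v.
Proof. exact: (bstarBm oOm bOm hd). Qed.

Let mom n : (n < Nt)%N -> forall v, XR v -> vip Om (dt^-1 *: (uR n.+1 - uR n)) v
  + bstar Om (uR n) (uR n.+1) v + nu * gradip Om (uR n.+1) v - divform Om v (pM n.+1) =
  vip Om (fn n.+1) v.
Proof. by move=> nN; have [_ H] := scheme; have [H1 _] := H n nN. Qed.

Let con n : (n < Nt)%N -> forall p, QM p ->
  eps * ip (dt^-1 *: (pM n.+1 - pM n)) p + divform Om (uR n.+1) p = 0.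
Proof.
move=> nN p Qp; have [_ H] := scheme; have [_ H2] := H n nN.
by rewrite (divformC oOm (XuR nN) (Qsp_L2 (QMQ Qp))); exact: (H2 p Qp).
Qed.

Let stab_step n : (n < Nt)%N ->
  vn (uR n.+1) ^+ 2 - vn (uR n) ^+ 2 + vn (uR n.+1 - uR n) ^+ 2
  + eps * (nm (pM n.+1) ^+ 2 - nm (pM n) ^+ 2 + nm (pM n.+1 - pM n) ^+ 2)
  + nu * dt * gn (uR n.+1) ^+ 2 <= CP ^+ 2 / nu * dt * vn (fn n.+1) ^+ 2.
Proof.
move=> nN.
have hf v : XR v -> vip Om (fn n.+1) v <= vn (fn n.+1) * vn v.
  move=> Xv; apply: (le_trans (ler_norm _)).
  exact: (sip_CS (vip_semi_ip oOm) (Lfn nN) (X_L2v (XRX Xv))).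
exact (stability_step sX sG sQ (bstar_diag Om) poin XRX QMQ
  (@lspanB _ _ _ phi) (@lspanB _ _ _ psi) nu_gt0 dt_gt0 (XRu (ltnW nN)) (XRu nN)
  (QMp (ltnW nN)) (QMp nN) (mom nN) (con nN) (vn0 _) hf).
Qed.

Let err_step n : (n < Nt)%N ->
  vn (xi n.+1) ^+ 2 - vn (xi n) ^+ 2 + vn (xi n.+1 - xi n) ^+ 2
  + eps * (nm (piM n.+1) ^+ 2 - nm (piM n) ^+ 2 + nm (piM n.+1 - piM n) ^+ 2)
  + 2 * nu * dt * gn (xi n.+1) ^+ 2 <=
  2 * dt * gn (xi n.+1) * (CP * (d%:R * Num.sqrt (dt * tt n)) + nu * gn (eta n.+1)
       + d%:R * nm (kap n.+1)
       + Kb * Num.sqrt CP * `|B| * gn (un n.+1 - un n) + Kb * Num.sqrt CP * `|B| * gn (eta n)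
       + Kb * `|B| * Num.sqrt (vn (xi n) * gn (xi n))
       + Kb * Num.sqrt (vn (uR n) * gn (uR n)) * gn (eta n.+1))
     + 2 * dt * (eps * Pt + cos theta * d%:R * gn (eta n.+1)) * nm (piM n.+1).
Proof.
move=> nN; have nN' := ltnW nN; have [ns dvU] := nse nN.
(* The exact equation contains the plain convective term. The vanishing divergence allows it to be
   rewritten with the skew form used by the scheme. *)
have du0 : aeq Om (diverg Om (un n.+1)) 0 by exact: (diverg_free oOm bOm (Xun nN) dvU).
have ns' v : XR v -> vip Om (utn n.+1) v + bstar Om (un n.+1) (un n.+1) v
    + nu * gradip Om (un n.+1) v - divform Om v (pn n.+1) = vip Om (fn n.+1) v.
  move=> Xv; have XXv := XRX Xv.
  by rewrite (bstar_convect oOm bOm hd (Xun nN) XXv du0); exact: (ns v XXv).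
have cons' v : XR v -> `|dt * vip Om (utn n.+1) v - vip Om (un n.+1 - un n) v| <=
    dt * (d%:R * Num.sqrt (dt * tt n)) * vn v.
  by move=> Xv; exact: (consist nN (X_L2v (XRX Xv))).
have ang p : QM p -> `|divform Om (PR (un n.+1)) p| <=
    cos theta * d%:R * gn (un n.+1 - PR (un n.+1)) * nm p.
  move=> Qp; have [c0 h] := principal_angle_le oOm bOm Xphi Qpsi angle (PRin nN) Qp.
  apply: (le_trans h); apply: ler_wpM2r; first exact: nm0.
  rewrite -mulrA; apply: ler_wpM2l => //.
  exact: (L2norm_div_le oOm bOm (Xun nN) (XPR nN) dvU).
have cT0 : 0 <= d%:R * Num.sqrt (dt * tt n) by rewrite mulr_ge0// sqrtr_ge0.
exact (error_step sX sG sQ bBl bBm (bstar_diag Om) (divformBl oOm) (divformBr oOm)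
  (ltW CP_gt0) (ltW Kb_gt0) poin b_le (divform_le oOm) XRX QMQ
  (@lspanB _ _ _ phi) (@lspanB _ _ _ psi) nu_gt0 dt_gt0 e0 (XRu nN') (XRu nN)
  (QMp nN') (QMp nN) (mom nN) (con nN) (Xun nN') (Xun nN) (PRin nN') (PRin nN)
  (Qpn nN') (Qpn nN) (chin nN') (chin nN) (PRo nN') (PRo nN) (chio nN') (chio nN)
  ns' cons' (pres_inc nN) ang cT0 (u_bound nN)).
Qed.

Let dT0 : 0 <= d%:R * T. Proof. by rewrite mulr_ge0// ltW. Qed.
Let aB : 0 <= `|B|. Proof. exact: normr_ge0. Qed.
Let CPB0 : 0 <= CP * `|B|. Proof. by rewrite mulr_ge0// ltW. Qed.
Let sdB0 : 0 <= Num.sqrt (d%:R * T) * `|B|. Proof. by rewrite mulr_ge0// sqrtr_ge0. Qed.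
Let b_ge : [/\ 0 <= stab_bound, CP * `|B| <= stab_bound, `|B| <= stab_bound &
  Num.sqrt (d%:R * T) * `|B| <= stab_bound].
Proof. by rewrite /stab_bound; move: aB CPB0 sdB0; split; lra. Qed.

Let vn_u n : (n <= Nt)%N -> vn (un n) <= CP * `|B|.
Proof.
by move=> nN; apply: (le_trans (poin (Xun nN))); rewrite ler_wpM2l ?(ltW CP_gt0)// u_bound.
Qed.
Let vn_PR n : (n <= Nt)%N -> vn (PR (un n)) <= stab_bound.
Proof.
move=> nN; have [_ h _ _] := b_ge; apply: le_trans h; apply: le_trans (vn_u nN).
exact: (sip_proj_le sX (Xun nN) (XPR nN) (PRo nN (PRin nN))).
Qed.
Let nm_chi n : (n <= Nt)%N -> nm (chi (pn n)) <= stab_bound.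
Proof.
move=> nN; have [_ _ h _] := b_ge; apply: le_trans h; apply: le_trans (p_bound nN).
exact: (sip_proj_le sQ (Qpn nN) (Qchi nN) (chio nN (chin nN))).
Qed.
(** [PR] is orthogonal for the L2 product and not for gradients, so its gradient is bounded only up
    to that of [eta]. Through this bound the gradient of [eta] enters the stability quantity. *)
Let gn_PR n : (n <= Nt)%N -> gn (PR (un n)) <= stab_bound + gn (eta n).
Proof.
move=> nN; have [_ _ h _] := b_ge.
have h2 : gn (PR (un n)) <= gn (PR (un n) - un n) + gn (un n).
  by have [_ ?] := sip_norm_sub_le sG (XPR nN) (Xun nN) (lexx _).
apply: (le_trans h2); rewrite addrC; apply: lerD; first by apply: le_trans (u_bound nN) h.
have -> : gn (PR (un n) - un n) = gn (eta n) := sip_normBC sG (XPR nN) (Xun nN).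
exact: lexx.
Qed.

Let scheme_stab m : (m <= N.+1)%N ->
  vn (uR m) ^+ 2 + eps * nm (pM m) ^+ 2
  + \sum_(0 <= n < m) (vn (uR n.+1 - uR n) ^+ 2 + eps * nm (pM n.+1 - pM n) ^+ 2)
  + nu * dt * \sum_(0 <= n < m) gn (uR n.+1) ^+ 2
  <= vn (uR 0%N) ^+ 2 + eps * nm (pM 0%N) ^+ 2 + stab_bound ^+ 2 / nu.
Proof.
move=> mN.
have H : vn (uR m) ^+ 2 + eps * nm (pM m) ^+ 2
  + \sum_(0 <= n < m) (vn (uR n.+1 - uR n) ^+ 2 + eps * nm (pM n.+1 - pM n) ^+ 2)
  + nu * dt * \sum_(0 <= n < m) gn (uR n.+1) ^+ 2
  <= vn (uR 0%N) ^+ 2 + eps * nm (pM 0%N) ^+ 2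
     + CP ^+ 2 / nu * (dt * \sum_(0 <= n < m) vn (fn n.+1) ^+ 2).
  elim: m mN => [|m ih] mN; first by rewrite !big_geq// !mulr0 !addr0.
  have {}ih := ih (ltnW mN); have st := stab_step (leq_trans mN NNt).
  rewrite !big_nat_recr//=; move: ih st.
  move: (\sum_(0 <= n < m) (_ + _)) (\sum_(0 <= n < m) gn _ ^+ 2) (\sum_(0 <= n < m) vn (fn _) ^+ 2).
  move: (vn (uR m.+1 - uR m)) (vn (uR m.+1)) (vn (uR m)) (vn (uR 0%N)) (vn (fn m.+1)).
  move: (nm (pM m.+1 - pM m)) (nm (pM m.+1)) (nm (pM m)) (nm (pM 0%N)) (gn (uR m.+1)).
  by move: (CP ^+ 2 / nu) => *; lra.
apply: (le_trans H); rewrite lerD2l mulrAC ler_wpM2r ?invr_ge0 ?(ltW nu_gt0)//.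
have [h0 h1 _ _] := b_ge.
apply: (@le_trans _ _ ((CP * `|B|) ^+ 2)); last by rewrite ler_sqr ?nnegrE.
rewrite exprMn ler_wpM2l ?sqr_ge0// real_normK ?num_real//; apply: le_trans f_bound.
rewrite ler_wpM2l ?(ltW dt_gt0)// [leRHS](@big_cat_nat _ _ _ m)//=; last exact: K_le.
by rewrite lerDl; apply: sumr_ge0 => n _; exact: sqr_ge0.
Qed.

Let dtN : dt * N.+1%:R <= T.
Proof. by apply: le_trans dtNt; rewrite ler_wpM2l ?ler_nat// ltW. Qed.

Let Q_gt0 : 0 < err_const. Proof. exact: err_const_gt0. Qed.

Let cos_ge0 : 0 <= cos theta.
Proof.
have N0 : (0 <= Nt)%N by [].
by have [] := principal_angle_le oOm bOm Xphi Qpsi angle (PRin N0) (chin N0).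
Qed.

Let err n : (n < N.+1)%N ->
  vn (xi n.+1) ^+ 2 - vn (xi n) ^+ 2 + vn (xi n.+1 - xi n) ^+ 2
  + eps * (nm (piM n.+1) ^+ 2 - nm (piM n) ^+ 2 + nm (piM n.+1 - piM n) ^+ 2)
  + 2 * nu * dt * gn (xi n.+1) ^+ 2
  <= 2 * dt * gn (xi n.+1) * (err_const * (Num.sqrt (dt * tt n) + gn (eta n.+1) + nm (kap n.+1)
       + Num.sqrt (dt * tg n) + gn (eta n)
       + Num.sqrt (vn (xi n) * gn (xi n)) + Num.sqrt (vn (uR n) * gn (uR n)) * gn (eta n.+1)))
     + 2 * dt * (eps * Pt + cos theta * err_const * gn (eta n.+1)) * nm (piM n.+1).
Proof.
move=> nN; have nNt := leq_trans nN NNt; apply: (le_trans (err_step nNt)).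
have h1 : 0 <= CP * d%:R by rewrite mulr_ge0// ltW.
have h2 : 0 <= Kb * Num.sqrt CP * `|B| by rewrite mulr_ge0// mulr_ge0 ?sqrtr_ge0// ltW.
have h3 : 0 <= Kb * Num.sqrt CP * `|B| * d%:R by rewrite mulr_ge0.
have h4 : 0 <= Kb * `|B| by rewrite mulr_ge0// ltW.
have h5 : 0 <= d%:R :> R by [].
have h6 := ltW nu0_gt0; have h7 := ltW Kb_gt0; have d0 := ltW dt_gt0.
apply: lerD.
  apply: ler_wpM2l; first by rewrite mulr_ge0// mulr_ge0.
  have g := grad_inc nNt.
  have [q1 q2 q3 [q4 q5 q6 q7]] : [/\ CP * d%:R <= err_const, nu0 <= err_const, d%:R <= err_const &
     [/\ Kb * Num.sqrt CP * `|B| * d%:R <= err_const, Kb * Num.sqrt CP * `|B| <= err_const,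
       Kb * `|B| <= err_const & Kb <= err_const]].
    by rewrite /err_const; split; [lra..|split; lra].
  exact: (err_coef_le nu_le (sqrtr_ge0 _) (gn0 _) (nm0 _) (sqrtr_ge0 _) (gn0 _) (sqrtr_ge0 _) (sqrtr_ge0 _)
    h2 g q1 q2 q3 q4 q5 q6 q7).
apply: ler_wpM2r; first exact: nm0.
apply: ler_wpM2l; first by rewrite mulr_ge0.
rewrite lerD2l ler_wpM2r// ler_wpM2l// /err_const; lra.
Qed.

(** The three stability hypotheses of the summation result follow from the a priori estimate
    [scheme_stab] by the triangle inequality, since the projected solution is controlled by
    [stab_bound] and by the gradient of [eta]. *)
Lemma rom_discrete_bound :
  vn (xi N.+1) ^+ 2 + eps * nm (piM N.+1) ^+ 2 + nu * dt * gn (xi N.+1) ^+ 2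
  + \sum_(0 <= n < N.+1) (vn (xi n.+1 - xi n) ^+ 2 + eps / 2 * nm (piM n.+1 - piM n) ^+ 2)
  + nu * dt * \sum_(0 <= n < N.+2) gn (xi n) ^+ 2
  <= (2 * expR 1 * (1 + 35 * err_const ^+ 2 + 6 * T ^+ 2 * c2 ^+ 2 / c1 + 6 * T * err_const ^+ 2 / c1
          + 14 * err_const ^+ 2 * stab_const T nu0 c2 stab_bound * (nu0 ^+ 2 / T))
      + 2 * stab_const T nu0 c2 stab_bound * (nu0 ^+ 2 / T))
     * expR ((49 * err_const ^+ 4 / 2 + 1) * T / nu ^+ 3) *
  (vn (xi 0%N) ^+ 2 + eps * nm (piM 0%N) ^+ 2 + dt * nu * gn (xi 0%N) ^+ 2
  + (nu^-1 + cos theta ^+ 2 * dt^-1) * (dt * \sum_(0 <= n < N.+2) gn (eta n) ^+ 2)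
  + nu^-1 * (dt * \sum_(0 <= n < N.+2) nm (kap n) ^+ 2)
  + dt ^+ 2 / nu * TT + dt ^+ 2 / nu * TG
  + Num.sqrt dt / (nu * Num.sqrt nu) * Num.sqrt (\sum_(0 <= n < N.+1) gn (eta n.+1) ^+ 4)
  + dt * Pt ^+ 2).
Proof.
have N0 : (0 <= Nt)%N by [].
have [b0 bCP bB bd] := b_ge.
have xr n : (n <= N.+1)%N -> vn (xi n) <= vn (uR n) + stab_bound.
  by move=> /K_le nN; have [h _] := sip_norm_sub_le sX (XuR nN) (XPR nN) (vn_PR nN).
have rx : vn (uR 0%N) <= vn (xi 0%N) + stab_bound.
  by have [_ h] := sip_norm_sub_le sX (XuR N0) (XPR N0) (vn_PR N0).
have pr n : (n <= N.+1)%N -> nm (piM n) <= nm (pM n) + stab_bound.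
  by move=> /K_le nN; have [h _] := sip_norm_sub_le sQ (QpM nN) (Qchi nN) (nm_chi nN).
have rp : nm (pM 0%N) <= nm (piM 0%N) + stab_bound.
  by have [_ h] := sip_norm_sub_le sQ (QpM N0) (Qchi N0) (nm_chi N0).
have ggr n : (n <= N.+1)%N -> gn (xi n) <= gn (uR n) + stab_bound + gn (eta n).
  move=> /K_le nN; have [h _] := sip_norm_sub_le sG (XuR nN) (XPR nN) (gn_PR nN).
  by rewrite -addrA.
have grg : gn (uR 0%N) <= gn (xi 0%N) + stab_bound + gn (eta 0%N).
  have [_ h] := sip_norm_sub_le sG (XuR N0) (XPR N0) (gn_PR N0).
  by rewrite -addrA.
have dxr n : (n < N.+1)%N -> vn (xi n.+1 - xi n) <= vn (uR n.+1 - uR n) + vn (un n.+1 - un n).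
  move=> nN; have n1 := leq_trans nN NNt; have n0 := ltnW n1.
  have Wd := lspanB (PRin n1) (PRin n0).
  exact: (sip_incr_le sX (XuR n0) (XuR n1) (Xun n0) (Xun n1) (XPR n0) (XPR n1) (PRo n0 Wd) (PRo n1 Wd)).
have dpr n : (n < N.+1)%N -> nm (piM n.+1 - piM n) <= nm (pM n.+1 - pM n) + 2 * stab_bound.
  move=> nN; have n1 := leq_trans nN NNt; have n0 := ltnW n1.
  have Wd := lspanB (chin n1) (chin n0).
  have h := sip_incr_le sQ (QpM n0) (QpM n1) (Qpn n0) (Qpn n1) (Qchi n0) (Qchi n1) (chio n0 Wd) (chio n1 Wd).
  apply: (le_trans h); rewrite lerD2l; apply: (le_trans (sip_normB sQ (Qpn n1) (Qpn n0))).
  have -> : 2 * stab_bound = stab_bound + stab_bound by rewrite mulr_natl mulr2n.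
  by apply: lerD; [apply: le_trans (p_bound n1) bB|apply: le_trans (p_bound n0) bB].
have du : \sum_(0 <= n < N.+1) vn (un n.+1 - un n) ^+ 2 <= stab_bound ^+ 2.
  apply: (le_trans vel_inc); apply: (@le_trans _ _ ((Num.sqrt (d%:R * T) * `|B|) ^+ 2)).
    by rewrite exprMn sqr_sqrtr// real_normK ?num_real.
  by rewrite ler_sqr ?nnegrE.
have Cs0 := stab_const_gt0 T_gt0 nu0_gt0 c2_gt0 b0.
have ppS n : (n < N.+1)%N -> nm (piM n.+1) <= nm (piM n) + nm (piM n.+1 - piM n).
  move=> nN; have n1 := leq_trans nN NNt; have n0 := ltnW n1.
  have [_ h] := sip_norm_sub_le sQ (QMQ (Qpi n1)) (QMQ (Qpi n0)) (lexx (nm (piM n))).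
  by rewrite addrC.
pose x n := vn (xi n); pose dx n := vn (xi n.+1 - xi n).
pose pp n := nm (piM n); pose dpi n := nm (piM n.+1 - piM n); pose g n := gn (xi n).
pose ge n := gn (eta n); pose k n := nm (kap n); pose rr n := vn (uR n); pose gr n := gn (uR n).
pose dr n := vn (uR n.+1 - uR n); pose rpp n := nm (pM n); pose drp n := nm (pM n.+1 - pM n).
pose dun n := vn (un n.+1 - un n).
have S1 := @stab_le R T nu0 c2 stab_bound T_gt0 nu0_gt0 c2_gt0 b0 nu dt eps N.+1
  x dx pp dpi g ge rr gr dr rpp drp dun nu_gt0 nu_le dt_gt0 dtN (ltn0Sn N) e0 c2e
  (fun=> vn0 _) (fun=> nm0 _) (fun=> gn0 _) (fun=> vn0 _) (fun=> nm0 _) (fun=> vn0 _)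
  (fun=> gn0 _) (fun=> nm0 _) xr rx pr rp ggr grg dxr du dpr scheme_stab.
have S2 := @stab_r_le R T nu0 c2 stab_bound T_gt0 nu0_gt0 c2_gt0 b0 nu dt eps N.+1
  x pp g ge rr gr dr rpp drp nu_gt0 nu_le dt_gt0 dtN (ltn0Sn N) e0 c2e
  (fun=> vn0 _) (fun=> nm0 _) rx rp scheme_stab.
have S3 := @stab_gr_le R T nu0 c2 stab_bound T_gt0 nu0_gt0 c2_gt0 b0 nu dt eps N.+1
  x pp g ge rr gr dr rpp drp nu_gt0 nu_le dt_gt0 dtN (ltn0Sn N) e0 c2e
  (fun=> vn0 _) (fun=> gn0 _) (fun=> nm0 _) rx rp grg scheme_stab.
exact (@discrete_error_bound R T nu0 c1 c2 err_const (stab_const T nu0 c2 stab_bound) T_gt0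
  c1_gt0 c2_gt0 Q_gt0 Cs0 nu dt eps Pt (cos theta) TT TG N.+1 x dx pp dpi g ge k tt tg rr gr
  nu_gt0 nu_le dt_gt0 dtN (ltn0Sn N) c1e c2e Pt0 cos_ge0 (fun=> vn0 _) (fun=> nm0 _) (fun=> nm0 _)
  (fun=> gn0 _) (fun=> gn0 _) tt0 tg0 (fun=> vn0 _) (fun=> gn0 _) sum_tt sum_tg ppS err S1 S2 S3).
Qed.

Let err_split n : (n <= Nt)%N -> [/\
  vn (un n - uR n) ^+ 2 = vn (eta n) ^+ 2 + vn (xi n) ^+ 2,
  nm (pn n - pM n) ^+ 2 = nm (kap n) ^+ 2 + nm (piM n) ^+ 2 &
  gn (un n - uR n) ^+ 2 <= 2 * gn (eta n) ^+ 2 + 2 * gn (xi n) ^+ 2].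
Proof.
move=> nN; split.
- exact (sip_split sX (XuR nN) (Xun nN) (XPR nN) (PRo nN (Xxi nN))).
- exact (sip_split sQ (QpM nN) (Qpn nN) (Qchi nN) (chio nN (Qpi nN))).
- have E : un n - uR n = eta n - xi n by rewrite /eta /xi opprB addrA subrK.
  rewrite E; exact (sip_normB2 sG (Xeta nN) (XRX (Xxi nN))).
Qed.

Let incr_split n : (n < Nt)%N ->
  vn (un n.+1 - uR n.+1 - (un n - uR n)) ^+ 2 =
    vn (eta n.+1 - eta n) ^+ 2 + vn (xi n.+1 - xi n) ^+ 2 /\
  nm (pn n.+1 - pM n.+1 - (pn n - pM n)) ^+ 2 =
    nm (kap n.+1 - kap n) ^+ 2 + nm (piM n.+1 - piM n) ^+ 2.
Proof.
move=> n1; have n0 := ltnW n1; split.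
- refine (sip_split_incr sX (XuR n0) (XuR n1) (Xun n0) (Xun n1) (XPR n0) (XPR n1) _) => z hz.
  have Wz : XR z by case: hz => ->; [exact: (Xxi n0)|exact: (Xxi n1)].
  exact (conj (PRo n0 Wz) (PRo n1 Wz)).
- refine (sip_split_incr sQ (QpM n0) (QpM n1) (Qpn n0) (Qpn n1) (Qchi n0) (Qchi n1) _) => z hz.
  have Wz : QM z by case: hz => ->; [exact: (Qpi n0)|exact: (Qpi n1)].
  exact (conj (chio n0 Wz) (chio n1 Wz)).
Qed.

Lemma rom_error_bound (Tpt : R) : 0 <= Tpt ->
  vn (un N.+1 - uR N.+1) ^+ 2 + eps * nm (pn N.+1 - pM N.+1) ^+ 2
  + nu * dt / 2 * gn (un N.+1 - uR N.+1) ^+ 2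
  + nu / 2 * dnorm2 dt N.+1 (fun n => gn (un n - uR n))
  + \sum_(0 <= n < N.+1) (vn (un n.+1 - uR n.+1 - (un n - uR n)) ^+ 2
      + eps / 2 * nm (pn n.+1 - pM n.+1 - (pn n - pM n)) ^+ 2)
  <=
  vn (eta N.+1) ^+ 2 + eps * nm (kap N.+1) ^+ 2
  + nu * dt / 2 * gn (eta N.+1) ^+ 2
  + nu / 2 * dnorm2 dt N.+1 (fun n => gn (eta n))
  + \sum_(0 <= n < N.+1) (vn (eta n.+1 - eta n) ^+ 2 + eps / 2 * nm (kap n.+1 - kap n) ^+ 2)
  + (rom_const + nu0 ^+ 2) * expR (rom_rate * T / nu ^+ 3) *
    (vn (xi 0%N) ^+ 2 + eps * nm (piM 0%N) ^+ 2 + dt * nu * gn (xi 0%N) ^+ 2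
     + (nu^-1 + cos theta ^+ 2 * dt^-1) * dnorm2 dt N.+1 (fun n => gn (eta n))
     + nu^-1 * dnorm2 dt N.+1 (fun n => nm (kap n))
     + dt ^+ 2 / nu * TT + dt ^+ 2 / nu * TG
     + dt `^ (1 / 2) / nu `^ (3 / 2) * Num.sqrt (\sum_(0 <= n < N.+1) gn (eta n.+1) ^+ 4)
     + dt ^+ 3 * Tpt + dt * Pt ^+ 2).
Proof.
move=> Tpt0; have d0 := ltW dt_gt0; have n0 := ltW nu_gt0.
have TT0 : 0 <= TT by apply: le_trans sum_tt; apply: sumr_ge0.
have TG0 : 0 <= TG by apply: le_trans sum_tg; apply: sumr_ge0.
have ex1 : 1 <= expR (rom_rate * T / nu ^+ 3).
  apply: expR_ge1_ge0; apply: divr_ge0; last exact: exprn_ge0.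
  apply: mulr_ge0; last exact: (ltW T_gt0).
  exact: ltW (rom_rate_gt0 _ _ _ _ _).
have C0 : 0 <= rom_const by exact: rom_const_ge0.
exact (@combine_errors R nu nu0 dt eps (cos theta) rom_const (expR (rom_rate * T / nu ^+ 3))
  Pt TT TG Tpt _ N.+1
  (fun n => vn (un n - uR n)) (fun n => vn (un n.+1 - uR n.+1 - (un n - uR n)))
  (fun n => nm (pn n - pM n)) (fun n => nm (pn n.+1 - pM n.+1 - (pn n - pM n)))
  (fun n => gn (un n - uR n))
  (fun n => vn (eta n)) (fun n => vn (eta n.+1 - eta n)) (fun n => gn (eta n))
  (fun n => nm (kap n)) (fun n => nm (kap n.+1 - kap n))
  (fun n => vn (xi n)) (fun n => vn (xi n.+1 - xi n)) (fun n => gn (xi n))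
  (fun n => nm (piM n)) (fun n => nm (piM n.+1 - piM n))
  nu_gt0 nu_le d0 e0 C0 ex1 TT0 TG0 Tpt0 (sqrtr_ge0 _)
  (fun n nN => err_split (K_le nN)) (fun n nN => incr_split (leq_trans nN NNt))
  rom_discrete_bound).
Qed.

End rom.

Lemma telescope_le (R : realType) (Th : R -> R) (dt T : R) (K : nat) : Th 0 = 0 ->
  (forall a b, a <= b -> Th a <= Th b) -> K%:R * dt <= T ->
  \sum_(0 <= n < K) (Th (n.+1%:R * dt) - Th (n%:R * dt)) <= Th T.
Proof.
move=> Th0 mono KT; rewrite (telescope_sumr (fun n => Th (n%:R * dt)))// mul0r Th0 subr0.
exact: mono.
Qed.

Lemma le_mul_sqrt (R : realType) (x c y : R) : 0 <= c -> 0 <= x ->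
  x ^+ 2 <= c * c * y -> x <= c * Num.sqrt y.
Proof.
move=> c0 x0 h; rewrite -(sqr_sqrtr c0).
rewrite -(ger0_norm x0) -sqrtr_sqr; apply: (le_trans (ler_wsqrtr h)).
by rewrite -expr2 sqrtrM ?sqr_ge0// sqrtr_sqr ger0_norm// sqr_sqrtr.
Qed.

(** * The regularity of the solution read at the time levels *)

Section level_data.
Context (R : realType) (d : nat) (Om : set 'rV[R]_d) (T : R) (Nt N : nat) (dt : R).
Hypotheses (oOm : open Om) (T_gt0 : 0 < T) (NtT : Nt%:R * dt = T) (NNt : (N.+1 <= Nt)%N).
Local Notation vn := (vnorm Om).
Local Notation gn := (gradnorm Om).
Local Notation nm := (L2norm Om).

Local Opaque Hm Defs.L2 Defs.ip Defs.wD Defs.H10 Defs.vip Defs.gradip Defs.diverg Defs.bstar.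

Lemma step_gt0 : 0 < dt.
Proof.
have Nt0 : (0 < Nt)%N by apply: leq_trans NNt.
by move: T_gt0; rewrite -NtT pmulr_rgt0// ltr0n.
Qed.
Let dt0 := step_gt0.

Lemma level_itv n : (n <= Nt)%N -> 0 <= n%:R * dt <= T.
Proof.
move=> nN; rewrite mulr_ge0 ?(ltW dt0)//= -NtT ler_wpM2r ?ler_nat//.
exact: ltW.
Qed.

Lemma level_step n : n.+1%:R * dt - n%:R * dt = dt.
Proof. by rewrite -mulrBl -natrB// subSnn mul1r. Qed.

Lemma level_lt n : n%:R * dt < n.+1%:R * dt.
Proof. by rewrite -subr_gt0 level_step. Qed.

Let level_ge0 n : 0 <= n%:R * dt. Proof. by rewrite mulr_ge0// ltW. Qed.
Let level_le n : (n <= Nt)%N -> n%:R * dt <= T. Proof. by move=> /level_itv/andP[]. Qed.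

Lemma level_consistency (w wt wtt : R -> vfield R d) :
  (forall j, time_derivative Om T (w ^~ j) (wt ^~ j)) ->
  (forall j, time_derivative Om T (wt ^~ j) (wtt ^~ j)) ->
  exists tt : nat -> R, [/\ forall n, 0 <= tt n,
    \sum_(0 <= n < N.+1) tt n <= tnorm2 T (fun t => vn (wtt t)) &
    forall n v, (n < Nt)%N -> L2v Om v ->
    `|dt * vip Om (wt (n.+1%:R * dt)) v - vip Om (w (n.+1%:R * dt) - w (n%:R * dt)) v| <=
    dt * (d%:R * Num.sqrt (dt * tt n)) * vn v].
Proof.
move=> dw dwt; have [Th [Th0 ThT mono h]] := velocity_consistency oOm dw dwt.
exists (fun n => Th (n.+1%:R * dt) - Th (n%:R * dt)); split.
- by move=> n; rewrite subr_ge0; apply: mono; exact: ltW (level_lt n).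
- rewrite -ThT; apply: telescope_le => //; exact: level_le.
move=> n v nN Lv; have {h} := h _ _ v (level_ge0 n) (level_lt n) (level_le nN) Lv.
by rewrite (level_step n).
Qed.

Lemma level_grad_increment m (w wt : R -> vfield R d) :
  (forall j, time_derivative Om T (w ^~ j) (wt ^~ j)) ->
  (forall j, Lq_Hm Om T 2 m.+1 (wt ^~ j)) ->
  (forall t, 0 <= t <= T -> Xsp Om (w t)) ->
  exists tg : nat -> R, [/\ forall n, 0 <= tg n,
    \sum_(0 <= n < N.+1) tg n <= tnorm2 T (fun t => gn (wt t)) &
    forall n, (n < Nt)%N -> gn (w (n.+1%:R * dt) - w (n%:R * dt)) <= d%:R * Num.sqrt (dt * tg n)].
Proof.
move=> dw Hw Xw; have [Th [Th0 ThT mono h]] := velocity_grad_increment oOm dw Hw Xw.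
exists (fun n => Th (n.+1%:R * dt) - Th (n%:R * dt)); split.
- by move=> n; rewrite subr_ge0; apply: mono; exact: ltW (level_lt n).
- rewrite -ThT; apply: telescope_le => //; exact: level_le.
move=> n nN; have {h} := h _ _ (level_ge0 n) (level_lt n) (level_le nN).
rewrite (level_step n) => h.
by apply: le_mul_sqrt h; [exact: ler0n|exact: sqrtr_ge0].
Qed.

Lemma level_velocity_increment (w wt : R -> vfield R d) (B : R) :
  (forall j, time_derivative Om T (w ^~ j) (wt ^~ j)) ->
  tnorm2 T (fun t => vn (wt t)) <= B ^+ 2 ->
  \sum_(0 <= n < N.+1) vn (w (n.+1%:R * dt) - w (n%:R * dt)) ^+ 2 <= d%:R * T * B ^+ 2.
Proof.
move=> dw hB; have [Th [Th0 ThT mono h]] := velocity_increment oOm dw.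
apply: (@le_trans _ _ (d%:R * T * \sum_(0 <= n < N.+1) (Th (n.+1%:R * dt) - Th (n%:R * dt)))).
  rewrite mulr_sumr; apply: ler_sum_nat => n /andP[_ nN].
  have nNt := leq_trans nN NNt.
  apply: (le_trans (h _ _ (level_ge0 n) (level_lt n) (level_le nNt))).
  rewrite -mulrA (level_step n); apply: ler_wpM2l; first exact: ler0n.
  apply: ler_wpM2r; first by rewrite subr_ge0; apply: mono; exact: ltW (level_lt n).
  rewrite -NtT ler_peMl ?(ltW dt0)// ler1n; exact: leq_trans NNt.
apply: ler_wpM2l; first by rewrite mulr_ge0// ltW.
apply: le_trans hB; rewrite -ThT; apply: telescope_le => //; exact: level_le.
Qed.

End level_data.

Theorem theorem5p9 (R : realType) (d : nat) (hd : (2 <= d <= 3)%N)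
    (Om : set 'rV[R]_d) (hOm : flow_domain Om) (T : R) (hT : 0 < T)
    (s k l : nat) (hs : (2 <= s)%N)
    (sigma : R) (Cv : vfield R d -> R) (Cq : sfield R d -> R)
    (Cfe : R -> (R -> sfield R d) -> R)
    (nu0 B c1 c2 : R) (hnu0 : 0 < nu0) (hc1 : 0 < c1) (hc2 : 0 < c2) :
  exists C Ct : R, [/\ 0 < C, 0 < Ct &
  forall (nu : R) (u0 : vfield R d) (u ut utt f : R -> vfield R d)
    (p pt : R -> sfield R d),
  0 < nu <= nu0 ->
  nse_solution Om T nu s k u0 u ut utt p pt f ->
  forall (Nt N : nat) (dt eps : R),
  (0 < Nt)%N -> Nt%:R * dt = T ->
  (N.+1 <= Nt)%N ->
  c1 * dt <= eps <= c2 * dt ->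
  (forall n, (0 < n <= Nt)%N -> nse_at Om nu u ut p f (n%:R * dt)) ->
  data_bound Om T B dt Nt u ut f p ->
  let un n := u (n%:R * dt) in
  let pn n := p (n%:R * dt) in
  let fn n := f (n%:R * dt) in
  forall (h : R) (m : nat) (tau : 'I_m -> 'I_d.+1 -> 'rV[R]_d)
    (uh : nat -> vfield R d) (ph : nat -> sfield R d),
  regular_triangulation Om sigma h tau ->
  fe_approximation Om s Cv Cq h (Xh Om s tau) (Qh Om s tau) ->
  ac_scheme Om (Xh Om s tau) (Qh Om s tau) nu dt eps Nt fn uh ph ->
  fe_error Om s l (Cfe nu p) h dt Nt un uh pn ph ->
  forall (S : {set 'I_Nt.+1}) (r M : nat)
    (phi : 'I_r -> vfield R d) (psi : 'I_M -> sfield R d),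
  pod_basis (vip Om) (Xh Om s tau) S uh phi ->
  pod_basis (ip Om) (Qh Om s tau) S ph psi ->
  forall (theta1 : R) (uR : nat -> vfield R d) (pM : nat -> sfield R d),
  let XR := lspan phi in
  let QM := lspan psi in
  principal_angle Om (lspan (fun i => diverg Om (phi i))) QM theta1 ->
  ac_scheme Om XR QM nu dt eps Nt fn uR pM ->
  let PR := orth_proj (vip Om) XR in
  let chiM := orth_proj (ip Om) QM in
  let eu n := un n - uR n in
  let ep n := pn n - pM n in
  let eta n := un n - PR (un n) in
  let kappa n := pn n - chiM (pn n) in
  let xi n := uR n - PR (un n) in
  let piM n := pM n - chiM (pn n) in
  let alpha := cos theta1 in
  let nm := L2norm Om in
  let vn := vnorm Om in
  let gn := gradnorm Om in
  vn (eu N.+1) ^+ 2 + eps * nm (ep N.+1) ^+ 2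
  + nu * dt / 2 * gn (eu N.+1) ^+ 2
  + nu / 2 * dnorm2 dt N.+1 (fun n => gn (eu n))
  + \sum_(0 <= n < N.+1)
      (vn (eu n.+1 - eu n) ^+ 2 + eps / 2 * nm (ep n.+1 - ep n) ^+ 2)
  <=
  vn (eta N.+1) ^+ 2 + eps * nm (kappa N.+1) ^+ 2
  + nu * dt / 2 * gn (eta N.+1) ^+ 2
  + nu / 2 * dnorm2 dt N.+1 (fun n => gn (eta n))
  + \sum_(0 <= n < N.+1)
      (vn (eta n.+1 - eta n) ^+ 2 + eps / 2 * nm (kappa n.+1 - kappa n) ^+ 2)
  + C * expR (Ct * T / nu ^+ 3) *
    (vn (xi 0%N) ^+ 2 + eps * nm (piM 0%N) ^+ 2 + dt * nu * gn (xi 0%N) ^+ 2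
     + (nu^-1 + alpha ^+ 2 * dt^-1) * dnorm2 dt N.+1 (fun n => gn (eta n))
     + nu^-1 * dnorm2 dt N.+1 (fun n => nm (kappa n))
     + dt ^+ 2 / nu * tnorm2 T (fun t => vn (utt t))
     + dt ^+ 2 / nu * tnorm2 T (fun t => gn (ut t))
     + dt `^ (1 / 2) / nu `^ (3 / 2)
       * Num.sqrt (\sum_(0 <= n < N.+1) gn (eta n.+1) ^+ 4)
     + dt ^+ 3 * tnorm2 T (fun t => nm (pt t))
     + dt * tnormoo T (fun t => nm (pt t)) ^+ 2)].
Proof.
have [oOm bOm _ _] := hOm.
have [CP CP0 poin] := poincare_X oOm bOm hd.
have [Kb Kb0 b_le] := bstar_le oOm bOm hd.
(* Both constants are fixed here, before the viscosity, the time step, the mesh and the reduced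
   spaces are introduced. They depend on the domain through its Poincare and trilinear constants,
   and otherwise on [d], [T], [nu0], [c1], [c2] and [B]. *)
exists (rom_const d CP Kb T nu0 c1 c2 B + nu0 ^+ 2), (rom_rate d CP Kb nu0 B); split.
- by rewrite ltr_wpDl ?exprn_gt0//; exact: rom_const_ge0.
- exact: rom_rate_gt0.
move=> nu u0 u ut utt f p pt /andP[nu_gt0 nu_le] sol Nt N dt eps Nt0 NtT NNt.
move=> /andP[c1e c2e] nse dat un pn fn h m tau uh ph _ _ _ _ S r M phi psi.
move=> [Xhphi ophi _] [Qhpsi opsi _] theta1 uR pM XR QM angle scheme.
cbv zeta.
have dt0 := step_gt0 hT NtT NNt.
have itv n : (n <= Nt)%N -> 0 <= n%:R * dt <= T by exact: (level_itv hT NtT NNt).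
have Xphi i : Xsp Om (phi i) by have [] := Xhphi i.
have Qpsi i : Qsp Om (psi i) by have [] := Qhpsi i.
have Xun n (nN : (n <= Nt)%N) : Xsp Om (un n) := nse_uX sol (itv n nN).
have Qpn n (nN : (n <= Nt)%N) : Qsp Om (pn n) := nse_pQ sol (itv n nN).
have Lfn n : (n < Nt)%N -> L2v Om (fn n.+1).
  move=> nN; apply: (nse_fL2 sol); have /andP[_ ->] := itv _ nN.
  by rewrite andbT mulr_gt0.
have [tt [tt0 sum_tt consist]] := level_consistency oOm hT NtT NNt (nse_ut sol) (nse_utt sol).
have Hut j : Lq_Hm Om T 2 s.+1 (ut ^~ j) by have [] := nse_u_H1 sol j.
have [tg [tg0 sum_tg grad_inc]] :=
  level_grad_increment oOm hT NtT NNt (nse_ut sol) Hut (nse_uX sol).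
have vel_inc := level_velocity_increment oOm hT NtT NNt (nse_ut sol) (bound_ut dat).
have [Pt0 pinc] := pressure_increment oOm hT (nse_pt sol) (nse_pt_Loo sol).
have pres_inc n : (n < Nt)%N -> L2norm Om (pn n.+1 - pn n) <= dt * tnormoo T (fun t => L2norm Om (pt t)).
  move=> nN; rewrite -{1}(level_step dt n); apply: pinc.
  - by have /andP[] := itv n (ltnW nN).
  - exact: (level_lt hT NtT NNt n).
  - by have /andP[] := itv _ nN.
have u_bound n (nN : (n <= Nt)%N) : gradnorm Om (un n) <= `|B| :=
  le_trans (bound_u dat (itv n nN)) (ler_norm B).
have p_bound n (nN : (n <= Nt)%N) : L2norm Om (pn n) <= `|B| :=
  le_trans (bound_p dat (itv n nN)) (ler_norm B).
have f_bound : dt * \sum_(0 <= n < Nt) vnorm Om (fn n.+1) ^+ 2 <= B ^+ 2.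
  by have := bound_f dat; rewrite big_add1.
have nse' n : (n < Nt)%N -> nse_at Om nu u ut p f (n.+1%:R * dt) by move=> nN; exact: nse.
have dtNt : dt * Nt%:R <= T by rewrite mulrC NtT.
have Tpt0 : 0 <= tnorm2 T (fun t => L2norm Om (pt t)).
  by apply: Rintegral_ge0 => t _; exact: sqr_ge0.
exact (@rom_error_bound R d Om oOm bOm hd CP Kb CP0 Kb0 poin b_le r M phi psi Xphi Qpsi
  ophi opsi T nu0 c1 c2 B hT hnu0 hc1 hc2 nu dt eps (tnormoo T (fun t => L2norm Om (pt t))) theta1
  (tnorm2 T (fun t => vnorm Om (utt t))) (tnorm2 T (fun t => gradnorm Om (ut t))) Nt N
  un uR (fun n => ut (n%:R * dt)) fn pn pM tt tg nu_gt0 nu_le dt0 NNt dtNt c1e c2e Pt0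
  Xun Qpn Lfn scheme nse' tt0 tg0 sum_tt sum_tg consist grad_inc vel_inc pres_inc
  u_bound p_bound f_bound angle _ Tpt0).
Qed.
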